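(* Let $K\in\mathcal W_{\mathcal Q}$. There is $b_0=b_0(K)$ such that for every fixed real $b\ge b_0$ and every analytic function $g$ on $\mathbb D$, the following are equivalent: (i) the multiplication operator $M_gf=gf$ is bounded on $Q_K$ (that is, $g$ is a pointwise multiplier of $Q_K$); (ii) $g\in H^\infty\cap Q_K$ and $\sup_{a\in\mathbb D}D^{(b)}_{K,\mathcal R}(\mu_{g,a,K})<\infty$; (iii) $g\in H^\infty\cap Q_K$ and $\sup_{a\in\mathbb D}C^{(b)}_{K,\mathcal R}(\mu_{g,a,K})<\infty$.
   Context: Notation: $\mathbb D$ is the open unit disc, $\mathbb T=\partial\mathbb D$, $dA=\frac1\pi dx\,dy$, $\varphi_a(z)=\frac{a-z}{1-\bar a z}$ for $a\in\mathbb D$. $H^\infty$ is the space of bounded analytic functions on $\mathbb D$. Class $\mathcal W_{\mathcal Q}$: all non-decreasing, right-continuous $K:[0,\infty)\to[0,\infty)$ such that (K1) $K(0)=0$ and $K(t)>0$ for $t>0$; (K2) $\int_0^1K(\log\frac1r)\,2r\,dr<\infty$; (K3) there is $\sigma>0$ with $\int_0^1\frac{\varphi_K(s)}{s}ds<\infty$ and $\int_1^\infty\frac{\varphi_K(s)}{s^{1+\sigma}}ds<\infty$, where $\varphi_K(s)=\sup_{0<t\le1}\frac{K(st)}{K(t)}$; (K4) there is $C_K\ge1$ with $K(2t)\le C_KK(t)$ for all $t\in[0,1/2]$. Space $Q_K$: analytic $f$ on $\mathbb D$ with $\|f\|_{Q_K}=|f(0)|+\|f\|_{Q_K,*}<\infty$,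 where $\|f\|_{Q_K,*}^2=\sup_{a\in\mathbb D}\int_{\mathbb D}|f'(z)|^2K(1-|\varphi_a(z)|^2)\,dA(z)$. Measures: for $a\in\mathbb D$, $d\mu_{g,a,K}(z)=|g'(z)|^2K(1-|\varphi_a(z)|^2)\,dA(z)$ (a finite measure when $g\in Q_K$). Carleson boxes: for an arc $I\subseteq\mathbb T$, $|I|$ is its normalized arclength ($|\mathbb T|=1$) and $Q_I=\{re^{i\theta}\in\mathbb D:e^{i\theta}\in I,\ 1-|I|\le r<1\}$, $Q_{\mathbb T}=\mathbb D$. Polar dyadic resolution $\mathcal R=\{\mathcal R_N\}_{N\ge0}$: $\mathcal R_N=\{R_{N,j,k}:0\le j,k\le2^N-1\}$, $R_{N,j,k}=\{re^{i\theta}:\frac j{2^N}\le r^2<\frac{j+1}{2^N},\ \frac{2\pi k}{2^N}\le\theta<\frac{2\pi(k+1)}{2^N}\}$. Packets: $dA_b(w)=(b+1)(1-|w|^2)^b\,dA(w)$, $L_b(z,w)=\int_0^z\frac{d\xi}{(1-\xi\bar w)^{b+2}}$ (principal branch), and $\Psi^{(b)}_R(z)=\int_RL_b(z,w)\,dA_b(w)$ for $R\in\mathcal R_N$. Packet matrix of a finite measure $\mu$: $\Gamma^{(b)}_{\mu,N}(R_1,R_2)=\int_{\mathbb D}\Psi^{(b)}_{R_1}\overline{\Psi^{(b)}_{R_2}}\,d\mu$, $R_1,R_2\in\mathcal R_N$. Diagonal matrices: $A^{(K)}_{I,N}=\operatorname{diag}\bigl(\int_{R\cap Q_I}K(\frac{1-|z|}{|I|})dA(z):R\in\mathcal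 R_N\bigr)$. Discrete norm: for $c=\{c_R\}_{R\in\mathcal R_N}\subset\mathbb C$, $\|c\|_{X_{K,N}}^2=\sup_{I\subseteq\mathbb T}\sum_{R\in\mathcal R_N}|c_R|^2\int_{R\cap Q_I}K(\frac{1-|z|}{|I|})dA(z)$ (supremum over all arcs $I$). Capacities, for a finite positive Borel measure $\mu$: $C^{(b)}_{K,\mathcal R}(\mu)=\sup_{N\ge0}\sup_{\|c\|_{X_{K,N}}\le1}\int_{\mathbb D}\bigl|\sum_{R\in\mathcal R_N}c_R\Psi^{(b)}_R\bigr|^2d\mu$, and $$D^{(b)}_{K,\mathcal R}(\mu)=\sup_{N\ge0}\inf\Bigl\{\sum_{m=1}^M\lambda_m: M\in\mathbb N,\ \lambda_m\ge0,\ I_m\subseteq\mathbb T\text{ arcs},\ \Gamma^{(b)}_{\mu,N}\le\sum_{m=1}^M\lambda_mA^{(K)}_{I_m,N}\Bigr\},$$ where $\le$ between Hermitian matrices means that the difference (right minus left) is positive semidefinite. *)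

(* Defs.v *)
From HB Require Import structures.
From mathcomp Require Import all_boot all_order all_algebra.
From mathcomp Require Import complex.
From mathcomp Require Import all_classical all_reals all_analysis.

Set Implicit Arguments.
Unset Strict Implicit.
Unset Printing Implicit Defensive.

Import Order.TTheory GRing.Theory Num.Theory.
Import numFieldNormedType.Exports Normc.

Local Open Scope classical_set_scope.
Local Open Scope ring_scope.

(* [R[i]] carries the norm and topology of [R[i]^o], so that [derivable f z 1]
   and [derive1 f z] are complex differentiability and the complex derivative. *)
HB.instance Definition _ (R : realType) := NormedModule.copy R[i] R[i]^o.

Definition complex_of_pair (R : realType) (p : R * R) : R[i] := (p.1 +i* p.2)%C.

(* The Borel sets of the plane: [complex_of_pair] is a homeomorphism and the
   product sigma-algebra on [R * R] is the Borel one. *)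
Definition complex_display : measure_display.
Proof. exact: default_measure_display. Qed.

Section complex_measurable.
Variable R : realType.

Let measurableC_def : set (set R[i]) :=
  [set B | measurable (@complex_of_pair R @^-1` B)].

Let measurableC_set0 : measurableC_def set0.
Proof. by rewrite /measurableC_def /= preimage_set0. Qed.

Let measurableC_setC A : measurableC_def A -> measurableC_def (~` A).
Proof. by move=> mA; rewrite /measurableC_def /= preimage_setC; exact: measurableC. Qed.

Let measurableC_bigcup (F : (set R[i])^nat) :
  (forall i, measurableC_def (F i)) -> measurableC_def (\bigcup_i F i).
Proof.
move=> mF; rewrite /measurableC_def /= preimage_bigcup.
exact: bigcupT_measurable.
Qed.

HB.instance Definition _ := isMeasurable.Build complex_display R[i]
  measurableC_set0 measurableC_setC measurableC_bigcup.

Lemma measurable_complex_of_pair :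
  measurable_fun [set: R * R] (@complex_of_pair R).
Proof. by move=> _ B mB; rewrite setTI. Qed.

End complex_measurable.

Section definitions.
Variable R : realType.
Local Notation C := R[i].
Implicit Types (K : R -> R) (f g : C -> C) (a z w : C) (b : R) (N : nat).
Implicit Type mu : set C -> \bar R.

Let invpi_ge0 : 0 <= (pi : R)^-1.
Proof. by rewrite invr_ge0 pi_ge0. Qed.

(* Area measure on the plane, normalized so that the unit disc has mass 1. *)
Definition area : set C -> \bar R :=
  pushforward (mscale (NngNum invpi_ge0)
                 (@lebesgue_measure R \x @lebesgue_measure R)%E)
              (@complex_of_pair R).

Let area0 : area set0 = 0.
Proof. by rewrite /area /pushforward preimage_set0 measure0. Qed.

Let area_ge0 A : (0 <= area A)%E.
Proof. by rewrite /area /pushforward /mscale mule_ge0 ?lee_fin. Qed.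

Let area_semi_sigma_additive : semi_sigma_additive area.
Proof.
move=> F mF tF mUF; rewrite /area /pushforward preimage_bigcup.
apply: measure_semi_sigma_additive => //.
apply/trivIsetP => /= i j _ _ ij; rewrite -preimage_setI.
by move/trivIsetP : tF => /(_ _ _ _ _ ij) ->//; rewrite preimage_set0.
Qed.

HB.instance Definition _ := isMeasure.Build _ _ _ area
  area0 area_ge0 area_semi_sigma_additive.

Definition disc : set C := [set z | normc z < 1].

Definition analytic f : Prop := forall z, disc z -> derivable f z 1.

Definition mobius a z : C := (a - z) / (1 - a^* * z).

(* [d nu = rho dA] on the unit disc, as a set function on the whole plane; a
   measure as soon as [rho] is measurable and nonnegative on the disc. *)
Definition density (rho : C -> R) : set C -> \bar R :=
  fun A => (\int[area]_(z in A `&` disc) (rho z)%:E)%E.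

Definition cintegral d (T : measurableType d) (mu : set T -> \bar R)
    (D : set T) (h : T -> C) : C :=
  (fine (\int[mu]_(x in D) (complex.Re (h x))%:E)%E
    +i* fine (\int[mu]_(x in D) (complex.Im (h x))%:E)%E)%C.

Definition cis (t : R) : C := (cos t +i* sin t)%C.

(* The principal argument, in ]-pi, pi], of [z != 0]. *)
Definition carg z : R :=
  let t := acos (complex.Re z / normc z) in
  if 0 <= complex.Im z then t else - t.

(* The principal branch of the power of exponent [s]. *)
Definition cpow z (s : R) : C := ((normc z `^ s)%:C)%C * cis (s * carg z).

(* Only the values of [K] on [0, +oo[ matter. *)
Definition dilation K (s : R) : \bar R :=
  ereal_sup [set (K (s * t) / K t)%:E | t in `]0, 1]].

Record weightWQ K : Prop := WeightWQ {
  weight_ge0 : forall t, 0 <= t -> 0 <= K t;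
  weight_nondecreasing : forall s t, 0 <= s -> s <= t -> K s <= K t;
  weight_right_continuous : forall t, 0 <= t -> K x @[x --> t^'+] --> K t;
  weight_at0 : K 0 = 0;
  weight_gt0 : forall t, 0 < t -> 0 < K t;
  weight_log_integrable :
    (\int[@lebesgue_measure R]_(r in `]0%R, 1%R[)
       (K (ln r^-1) * (2 * r))%:E < +oo)%E;
  weight_dilation : exists2 sigma : R, 0 < sigma &
    (\int[@lebesgue_measure R]_(s in `]0%R, 1%R[)
        (dilation K s * (s^-1)%:E) < +oo)%E /\
    (\int[@lebesgue_measure R]_(s in `[1%R, +oo[)
        (dilation K s * ((s `^ (1 + sigma))^-1)%:E) < +oo)%E;
  weight_doubling : exists2 CK : R, 1 <= CK &
    forall t, 0 <= t <= 2^-1 -> K (2 * t) <= CK * K t }.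

(* The density of [mu_{g,a,K}] with respect to [area]. *)
Definition QK_density K g a z : R :=
  normc (derive1 g z) ^+ 2 * K (1 - normc (mobius a z) ^+ 2).

Definition QK_seminorm K f : \bar R :=
  sqrte (ereal_sup
    [set (\int[area]_(z in disc) (QK_density K f a z)%:E)%E | a in disc]).

Definition QK_norm K f : \bar R := ((normc (f 0))%:E + QK_seminorm K f)%E.

Definition in_QK K f : Prop := analytic f /\ (QK_norm K f < +oo)%E.

Definition in_Hinfty f : Prop :=
  analytic f /\ exists M : R, forall z, disc z -> normc (f z) <= M.

Definition bounded_multiplier K g : Prop :=
  exists M : R, forall f, in_QK K f ->
    in_QK K (fun z => g z * f z) /\
    (QK_norm K (fun z => g z * f z)%R <= M%:E * QK_norm K f)%E.

Definition mu_QK K g a : set C -> \bar R := density (QK_density K g a).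

(* A nondegenerate arc of the unit circle, of normalized length [arc_len]; the
   two booleans tell whether the endpoints belong to it. *)
Record arc := Arc {
  arc_start : R;
  arc_len : R;
  arc_closed_left : bool;
  arc_closed_right : bool;
  arc_len_bounds : 0 < arc_len <= 1 }.

Definition arc_set (I : arc) : set C :=
  cis @` [set` Interval
    (BSide (arc_closed_left I) (arc_start I))
    (BSide (~~ arc_closed_right I) (arc_start I + 2 * pi * arc_len I))].

Definition carleson_box (I : arc) : set C :=
  [set z | exists r t, [/\ z = (r%:C)%C * cis t, arc_set I (cis t),
                           1 - arc_len I <= r & r < 1]].

Definition cell_index N : finType := ('I_(2 ^ N) * 'I_(2 ^ N))%type.

Definition cell N (Q : cell_index N) : set C :=
  [set z | exists r t, [/\ 0 <= r, z = (r%:C)%C * cis t,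
    Q.1%:R / 2 ^+ N <= r ^+ 2 < Q.1.+1%:R / 2 ^+ N &
    2 * pi * Q.2%:R / 2 ^+ N <= t < 2 * pi * Q.2.+1%:R / 2 ^+ N]].

Definition dA_ b : set C -> \bar R :=
  density (fun w => (b + 1) * (1 - normc w ^+ 2) `^ b).

(* [int_0^z dxi / (1 - xi w^* )^(b+2)], along the segment [xi = t z]. *)
Definition Lkernel b z w : C :=
  cintegral (@lebesgue_measure R) `[0, 1]
    (fun t => z / cpow (1 - (t%:C)%C * z * w^*) (b + 2)).

Definition packet b N (Q : cell_index N) z : C :=
  cintegral (dA_ b) (cell Q) (Lkernel b z).

(* Rows and columns of the matrices are numbered by the enumeration of the
   cells. *)
Definition packet_matrix b mu N : 'M[C]_#|cell_index N| :=
  \matrix_(i, j) cintegral mu disc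
    (fun z => packet b (enum_val i) z * (packet b (enum_val j) z)^*).

Definition cell_mass K (I : arc) N (Q : cell_index N) : R :=
  fine (\int[area]_(z in cell Q `&` carleson_box I)
          (K ((1 - normc z) / arc_len I))%:E)%E.

Definition diag_matrix K (I : arc) N : 'M[C]_#|cell_index N| :=
  diag_mx (\row_i ((cell_mass K I (enum_val i))%:C)%C).

Definition psdmx n (A : 'M[C]_n) : Prop :=
  A \is hermsymmx /\
  forall v : 'cV[C]_n, 0 <= ((map_mx Num.conj v)^T *m A *m v) 0 0.

Definition loewner_le n (A B : 'M[C]_n) : Prop := psdmx (B - A).

Definition X_norm K N (c : cell_index N -> C) : \bar R :=
  sqrte (ereal_sup
    [set (\sum_Q normc (c Q) ^+ 2 * cell_mass K I Q)%:E | I in [set: arc]]).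

Definition C_capacity K b mu : \bar R :=
  ereal_sup [set ereal_sup
    [set (\int[mu]_(z in disc) (normc (\sum_Q c Q * packet b Q z) ^+ 2)%:E)%E
      | c in [set c : cell_index N -> C | (X_norm K c <= 1)%E]]
    | N in [set: nat]].

Definition D_capacity K b mu : \bar R :=
  ereal_sup [set ereal_inf
    [set x : \bar R | exists M (lambda : 'I_M -> R) (I : 'I_M -> arc),
      [/\ x = (\sum_m lambda m)%:E,
          forall m, 0 <= lambda m &
          loewner_le (packet_matrix b mu N)
            (\sum_m ((lambda m)%:C)%C *: diag_matrix K (I m) N)]]
    | N in [set: nat]].

End definitions.

(* Main.v *)
(** Every [f] in [Q_K] with [f 0 = 0] is the Bergman potential
    [f z = int L_b(z,w) f'(w) dA_b(w)], and [sum_R c_R Psi_R] is the potential of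
    the step function with values [c_R].  Since [|f'|^2 K(1 - |phi_a|^2)] and
    [|f'|^2 K((1 - |z|)/|I|)] have comparable suprema over [a] and over [I], a
    Schur test based on the Dini condition on [K] shows that the potential is
    bounded on the densities that are Carleson for [K].  Approximating [f'] by
    step functions, the capacities [C] are thus bounded uniformly in [a] exactly
    when [Q_K] embeds in [L^2(mu_{g,a,K})] uniformly in [a]; for bounded [g] this
    is the multiplier property, because [(g f)' = g f' + g' f].
    The inequality [C <= D] is immediate.  Conversely, separating [Gamma] from
    the cone generated by the [A_I] among Hermitian matrices bounds [D] by the
    supremum of [sum_v <Gamma v, v>] over finite families of vectors [v] such
    that [sum_v |v|^2], taken coordinatewise, is admissible for every [I]; the
    little Grothendieck inequality, proved with random signs, bounds this
    supremum by [48 C]. *)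

Require Import Defs.
From HB Require Import structures.
From mathcomp Require Import all_boot all_order all_algebra.
From mathcomp Require Import complex.
From mathcomp Require Import all_classical all_reals all_analysis.
From mathcomp Require Import sesquilinear spectral measurable_realfun ring lra.

Set Implicit Arguments.
Unset Strict Implicit.
Unset Printing Implicit Defensive.

Import Order.TTheory GRing.Theory Num.Theory.
Import numFieldNormedType.Exports Normc.

Local Open Scope classical_set_scope.
Local Open Scope ring_scope.

(** * Complex differentiation *)

Section complex_basics.
Variable R : realType.
Local Notation C := R[i].
Implicit Types (x y z w : C) (f g : C -> C).
Local Notation Re := complex.Re.
Local Notation Im := complex.Im.

(** Two properties of the weight drive the estimates: doubling, which makes [K t / t ^ p] almost
    decreasing once [CK <= 2 ^ p], and summability of the dilation function along [2 ^- n]. The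
    first fixes [b0 = p]: for [b >= p] the factor [(1 - |w| ^ 2) ^ b] is dominated by [K], so that
    potentials of derivatives of [Q_K] functions converge, and all kernels with [b >= p] share a
    majorant of exponent [p]. Analyticity is mere differentiability at each point, so continuity of
    the derivative has to be produced: Goursat on rectangles gives local primitives, and Stokes for
    a slope times a cut-off gives the reproducing formula, in the role of Cauchy's formula. A
    multiplier is bounded because point evaluation, applied to all powers of [g], allows only
    geometric growth. For [D], the arcs form an infinite family and the cone need not be closed, so
    an almost minimal residual replaces a minimizer; the positive mass of every cell in the full box
    absorbs the error, which costs the [+ 1] in [D <= 48 C + 1]. Packets are uniformly bounded, so
    the entries of [Gamma] are genuine integrals and not default values. *)

Lemma normc_ge0 z : 0 <= normc z. Proof. by case: z => a b; rewrite sqrtr_ge0. Qed.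
Lemma normcE z : `|z| = (normc z)%:C%C. Proof. by case: z. Qed.
Lemma normcD x y : normc (x + y) <= normc x + normc y.
Proof. exact: (@le_normcD R). Qed.
Lemma normcN z : normc (- z) = normc z. Proof. exact: (@complex.normcN R). Qed.
Lemma normcB x y : normc (x - y) <= normc x + normc y.
Proof. by rewrite -(normcN y) normcD. Qed.
Lemma normcBC x y : normc (x - y) = normc (y - x).
Proof. by rewrite -normcN opprB. Qed.
Lemma normc_sub_ge x y : normc x - normc y <= normc (x - y).
Proof. by rewrite lerBlDr (le_trans _ (normcD _ _)) // subrK. Qed.
Lemma normc_eq0 z : (normc z == 0) = (z == 0).
Proof. by apply/eqP/eqP => [/eq0_normc|->] //; rewrite normc0. Qed.
Lemma normc_gt0 z : (0 < normc z) = (z != 0).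
Proof. by rewrite lt_def normc_ge0 andbT normc_eq0. Qed.
Lemma normcX z n : normc (z ^+ n) = normc z ^+ n.
Proof. by elim: n => [|n IH]; rewrite ?normc1 // !exprS normcM IH. Qed.
Lemma normcR (a : R) : normc a%:C%C = `|a|.
Proof. by rewrite /= expr0n addr0 sqrtr_sqr. Qed.
Lemma normc_sqr z : normc z ^+ 2 = Re z ^+ 2 + Im z ^+ 2.
Proof. by case: z => a b /=; rewrite sqr_sqrtr // addr_ge0 ?sqr_ge0. Qed.
Lemma normcJ z : normc (z^*)%C = normc z.
Proof. by case: z => a b /=; rewrite sqrrN. Qed.
Lemma Re_le_normc z : `|Re z| <= normc z.
Proof. by rewrite -sqrtr_sqr; case: z => a b /=; rewrite ler_wsqrtr // lerDl sqr_ge0. Qed.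
Lemma Im_le_normc z : `|Im z| <= normc z.
Proof. by rewrite -sqrtr_sqr; case: z => a b /=; rewrite ler_wsqrtr // lerDr sqr_ge0. Qed.
Lemma normc_le_ReIm z : normc z <= `|Re z| + `|Im z|.
Proof.
rewrite -(ler_pXn2r (n := 2)) ?nnegrE ?normc_ge0 ?addr_ge0 //.
rewrite normc_sqr; have := mulr_ge0 (normr_ge0 (Re z)) (normr_ge0 (Im z)).
rewrite -[Re z ^+ 2]real_normK ?num_real // -[Im z ^+ 2]real_normK ?num_real //; nra.
Qed.
Lemma cReD x y : Re (x + y) = Re x + Re y. Proof. by case: x; case: y. Qed.
Lemma cImD x y : Im (x + y) = Im x + Im y. Proof. by case: x; case: y. Qed.
Lemma cReN x : Re (- x) = - Re x. Proof. by case: x. Qed.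
Lemma cImN x : Im (- x) = - Im x. Proof. by case: x. Qed.
Lemma cReM x y : Re (x * y) = Re x * Re y - Im x * Im y. Proof. by case: x; case: y. Qed.
Lemma cImM x y : Im (x * y) = Re x * Im y + Im x * Re y. Proof. by case: x; case: y. Qed.
Lemma complexP x y : Re x = Re y -> Im x = Im y -> x = y.
Proof. by case: x; case: y => a b c d /= -> ->. Qed.
Definition ReImE := (cReD, cImD, cReN, cImN, cReM, cImM).
Lemma realcM : {morph (fun b : R => b%:C%C) : u v / u * v >-> u * v}.
Proof. by move=> u v; apply: complexP; rewrite ?ReImE /=; ring. Qed.
Lemma sqr_normcE z : ((normc z ^+ 2)%:C)%C = z * (z^*)%C.
Proof. by apply: complexP; rewrite ?normc_sqr; case: z => a b /=; ring. Qed.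

End complex_basics.

Section cderiv.
Variable R : realType.
Local Notation C := R[i].
Implicit Types (x y z w : C) (f g : C -> C).
Local Notation Re := complex.Re.
Local Notation Im := complex.Im.

Definition ccont f z := forall e : R, 0 < e -> exists2 d : R, 0 < d &
  forall w, normc (w - z) < d -> normc (f w - f z) < e.

(** Real epsilons and no quotient: [h = 0] is harmless and the rules of calculus become norm
    estimates. The next two lemmas translate to and from [derivable], whose filters use the
    complex-valued norm. *)
Definition has_cderiv f z (l : C) := forall e : R, 0 < e -> exists2 d : R, 0 < d &
  forall h, normc h < d -> normc (f (z + h) - f z - l * h) <= e * normc h.

Lemma derivable_has_cderiv f z : derivable f z 1 -> has_cderiv f z (derive1 f z).
Proof.
move=> df; rewrite derive1E => e e0.
have e0' : 0 < e%:C%C :> C by rewrite ltcR.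
have /cvgrPdist_le /(_ _ e0') := df.
rewrite -nbhs_nearE => /nbhs_ballP [d /= d0 H].
(* The radius supplied by the topology of [R[i]] is a complex number; being positive, it is real. *)
have dr : d = (Re d)%:C%C by move: d0; rewrite ltcE => /andP[/eqP d0 _]; apply: complexP.
exists (Re d); first by move: d0; rewrite ltcE => /andP[].
move=> h hd; have [->|h0] := eqVneq h 0.
  by rewrite addr0 subrr mulr0 subr0 normc0 mulr0.
have /H /= : ball (0 : C) d h by rewrite -ball_normE /= sub0r normrN normcE dr ltcR.
move=> /(_ h0); rewrite normcE lecR => H1.
rewrite -(mulVKf h0 (f _ - _ - _)) normcM mulrC ler_wpM2r ?normc_ge0 //.
apply: le_trans H1; rewrite normcBC le_eqVlt; apply/orP; left; apply/eqP; congr normc.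
by rewrite mulrBr mulrCA mulVf // mulr1 /GRing.scale /= mulr1 [h + z]addrC.
Qed.

Lemma has_cderiv_derivable f z l : has_cderiv f z l -> derivable f z 1 /\ derive1 f z = l.
Proof.
move=> H.
have K : h^-1 *: (f (h *: 1 + z) - f z) @[h --> (0 : C)^'] --> l.
  apply/cvgrPdist_le => e e0.
  have er : e = (Re e)%:C%C by move: e0; rewrite ltcE => /andP[/eqP e0 _]; apply: complexP.
  have e0' : 0 < Re e by move: e0; rewrite ltcE => /andP[].
  have [d d0 Hd] := H _ e0'.
  rewrite -nbhs_nearE; apply/nbhs_ballP; exists d%:C%C; first by rewrite /= ltcR.
  move=> h /=; rewrite -ball_normE /= sub0r normrN normcE ltcR => hd h0.
  rewrite normcE er lecR normcBC.
  have := Hd _ hd; rewrite -{1}(mulVKf h0 (f _ - _ - _)) normcM mulrC.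
  rewrite ler_pM2r ?normc_gt0 // => H1; apply: le_trans H1.
  rewrite le_eqVlt; apply/orP; left; apply/eqP; congr normc.
  by rewrite mulrBr mulrCA mulVf // mulr1 /GRing.scale /= mulr1 [h + z]addrC.
have c1 : derivable f z 1 by apply/cvg_ex; exists l.
split => //; rewrite derive1E.
exact: (cvg_lim (@norm_hausdorff _ _) K).
Qed.

Lemma has_cderiv_eq f z l l' : has_cderiv f z l -> has_cderiv f z l' -> l = l'.
Proof. by move=> /has_cderiv_derivable[_ <-] /has_cderiv_derivable[_ <-]. Qed.

Lemma has_cderiv_near f g z l (r : R) : 0 < r ->
  (forall w, normc (w - z) < r -> f w = g w) -> has_cderiv f z l -> has_cderiv g z l.
Proof.
move=> r0 fg H e e0; have [d d0 Hd] := H _ e0.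
exists (Num.min d r); first by rewrite lt_min d0 r0.
move=> h; rewrite lt_min => /andP[hd hr].
rewrite -fg; last by rewrite addrAC subrr add0r.
rewrite -fg; first exact: Hd.
by rewrite subrr normc0.
Qed.

Lemma has_cderiv_ext f g z l : f =1 g -> has_cderiv f z l -> has_cderiv g z l.
Proof. by move=> fg; apply: (@has_cderiv_near _ _ _ _ 1). Qed.

Lemma has_cderiv_ccont f z l : has_cderiv f z l -> ccont f z.
Proof.
move=> H e e0; have [d d0 Hd] := H _ ltr01.
have nl : 0 < 2 + normc l by rewrite ltr_wpDr ?normc_ge0.
exists (Num.min d (e / (2 + normc l))); first by rewrite lt_min d0 divr_gt0.
move=> w; rewrite lt_min => /andP[wd we].
have := Hd _ wd; rewrite mul1r [z + _]addrC subrK => H1.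
rewrite -(subrK (l * (w - z)) (f w - f z)).
apply: (le_lt_trans (normcD _ _)); rewrite normcM.
apply: (le_lt_trans (y := (2 + normc l) * normc (w - z))).
  by rewrite mulrDl lerD2r (le_trans H1) // ler_peMl ?normc_ge0 // ler1n.
by rewrite mulrC -ltr_pdivlMr.
Qed.

Lemma has_cderiv_cst c z : has_cderiv (fun=> c) z 0.
Proof. by move=> e e0; exists 1 => // h _; rewrite subrr mul0r subr0 normc0 mulr_ge0 ?normc_ge0 ?ltW. Qed.

Lemma has_cderiv_id z : has_cderiv id z 1.
Proof.
move=> e e0; exists 1 => // h _.
have -> : z + h - z - 1 * h = 0 by ring.
by rewrite normc0 mulr_ge0 ?normc_ge0 ?ltW.
Qed.

Lemma has_cderivD f g z l m : has_cderiv f z l -> has_cderiv g z m ->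
  has_cderiv (fun w => f w + g w) z (l + m).
Proof.
move=> Hf Hg e e0; have e2 : 0 < e / 2 by rewrite divr_gt0.
have [d d0 Hd] := Hf _ e2; have [d' d0' Hd'] := Hg _ e2.
exists (Num.min d d'); first by rewrite lt_min d0.
move=> h; rewrite lt_min => /andP[/Hd H1 /Hd' H2].
have -> : f (z + h) + g (z + h) - (f z + g z) - (l + m) * h =
  (f (z + h) - f z - l * h) + (g (z + h) - g z - m * h) by ring.
by apply: (le_trans (normcD _ _)); lra.
Qed.

Lemma has_cderivZ c f z l : has_cderiv f z l -> has_cderiv (fun w => c * f w) z (c * l).
Proof.
move=> Hf e e0; have nc : 0 < 1 + normc c by rewrite ltr_wpDr ?normc_ge0.
have [d d0 Hd] := Hf _ (divr_gt0 e0 nc); exists d => // h /Hd H1.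
have -> : c * f (z + h) - c * f z - c * l * h = c * (f (z + h) - f z - l * h) by ring.
rewrite normcM; apply: (le_trans (ler_wpM2l (normc_ge0 _) H1)).
rewrite mulrA ler_wpM2r ?normc_ge0 // mulrCA ler_piMr ?(ltW e0) //.
by rewrite ler_pdivrMr // mul1r lerDr.
Qed.

Lemma has_cderivN f z l : has_cderiv f z l -> has_cderiv (fun w => - f w) z (- l).
Proof.
move=> /(has_cderivZ (-1)); rewrite mulN1r; apply: has_cderiv_ext => w.
by rewrite mulN1r.
Qed.

Lemma has_cderivB f g z l m : has_cderiv f z l -> has_cderiv g z m ->
  has_cderiv (fun w => f w - g w) z (l - m).
Proof. by move=> Hf /has_cderivN; exact: has_cderivD. Qed.

Lemma has_cderiv_comp f g z l m : has_cderiv f z l -> has_cderiv g (f z) m ->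
  has_cderiv (fun w => g (f w)) z (m * l).
Proof.
move=> Hf Hg e e0.
pose A := 1 + normc l; pose B := 1 + normc m.
have A0 : 0 < A by rewrite ltr_wpDr ?normc_ge0.
have B0 : 0 < B by rewrite ltr_wpDr ?normc_ge0.
have [d1 d10 H1] := Hf _ ltr01.
have eA : 0 < e / 2 / A by rewrite !divr_gt0.
have eB : 0 < e / 2 / B by rewrite !divr_gt0.
have [d2 d20 H2] := Hg _ eA; have [d3 d30 H3] := Hf _ eB.
exists (Num.min d1 (Num.min d3 (d2 / A))).
  by rewrite !lt_min d10 d30 divr_gt0.
move=> h; rewrite !lt_min => /and3P[/H1 h1 /H3 h3 hd].
pose k := f (z + h) - f z.
have kA : normc k <= A * normc h.
  rewrite -(subrK (l * h) k); apply: (le_trans (normcD _ _)).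
  by rewrite normcM mulrDl lerD2r.
have /H2 : normc k < d2 by rewrite (le_lt_trans kA) // mulrC -ltr_pdivlMr.
have -> : f z + k = f (z + h) by rewrite /k addrC subrK.
move=> h2.
have -> : g (f (z + h)) - g (f z) - m * l * h =
  (g (f (z + h)) - g (f z) - m * k) + m * (k - l * h) by ring.
apply: (le_trans (normcD _ _)); rewrite normcM.
have b1 : e / 2 / A * normc k <= e / 2 * normc h.
  rewrite [leLHS](_ : _ = e / 2 * (normc k / A)); last by ring.
  by rewrite ler_pM2l ?divr_gt0 // ler_pdivrMr // mulrC.
have b2 : normc m * normc (k - l * h) <= e / 2 * normc h.
  apply: (le_trans (ler_wpM2l (normc_ge0 _) h3)).
  rewrite mulrA ler_wpM2r ?normc_ge0 // mulrCA ler_piMr ?divr_ge0 ?(ltW e0) //.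
  by rewrite ler_pdivrMr // mul1r lerDr.
by lra.
Qed.

Lemma has_cderivM f g z l m : has_cderiv f z l -> has_cderiv g z m ->
  has_cderiv (fun w => f w * g w) z (l * g z + f z * m).
Proof.
move=> Hf Hg e e0.
pose A := 1 + normc l; pose F := 1 + normc (f z); pose G := 1 + normc (g z).
have [A0 F0 G0] : [/\ 0 < A, 0 < F & 0 < G] by split; rewrite ltr_wpDr ?normc_ge0.
have e3 : 0 < e / 3 by rewrite divr_gt0.
have [d1 d10 H1] := Hf _ (divr_gt0 e3 G0).
have [d2 d20 H2] := Hg _ (divr_gt0 e3 F0).
have [d3 d30 H3] := Hf _ ltr01.
have [d4 d40 H4] := has_cderiv_ccont Hg (divr_gt0 e3 A0).
exists (Num.min (Num.min d1 d2) (Num.min d3 d4)).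
  by rewrite !lt_min d10 d20 d30.
move=> h; rewrite !lt_min => /andP[/andP[/H1 h1 /H2 h2] /andP[/H3 h3 hd4]].
have h4 : normc (g (z + h) - g z) < e / 3 / A by apply: H4; rewrite addrAC subrr add0r.
have -> : f (z + h) * g (z + h) - f z * g z - (l * g z + f z * m) * h =
  (f (z + h) - f z - l * h) * g z + f z * (g (z + h) - g z - m * h)
  + (f (z + h) - f z) * (g (z + h) - g z) by ring.
have kA : normc (f (z + h) - f z) <= A * normc h.
  rewrite -(subrK (l * h) (f _ - _)); apply: (le_trans (normcD _ _)).
  by rewrite normcM mulrDl lerD2r.
apply: (le_trans (normcD _ _)); apply: (le_trans (lerD (normcD _ _) (lexx _))).
rewrite !normcM.
have b1 : normc (f (z + h) - f z - l * h) * normc (g z) <= e / 3 * normc h.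
  apply: (le_trans (ler_wpM2r (normc_ge0 _) h1)).
  rewrite mulrAC ler_wpM2r ?normc_ge0 // -[_ / G]mulrC mulrAC ler_piMl ?ltW //.
  by rewrite mulrC ltr_pdivrMr // mul1r ltrDr.
have b2 : normc (f z) * normc (g (z + h) - g z - m * h) <= e / 3 * normc h.
  apply: (le_trans (ler_wpM2l (normc_ge0 _) h2)).
  rewrite mulrA ler_wpM2r ?normc_ge0 // mulrCA ler_piMr ?(ltW e3) //.
  by rewrite ler_pdivrMr // mul1r lerDr.
have b3 : normc (f (z + h) - f z) * normc (g (z + h) - g z) <= e / 3 * normc h.
  apply: (le_trans (ler_pM (normc_ge0 _) (normc_ge0 _) kA (ltW h4))).
  by rewrite mulrAC [A * _]mulrC mulfVK ?gt_eqF.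
by lra.
Qed.

Lemma has_cderivV z : z != 0 -> has_cderiv (fun w => w^-1) z (- (z ^- 2)).
Proof.
move=> z0 e e0; have nz : 0 < normc z by rewrite normc_gt0.
(* The first bound keeps [normc (z + h)] above [normc z / 2], so that the remainder
   [h ^ 2 / (z ^ 2 (z + h))] is at most [2 |h| ^ 2 / |z| ^ 3]; the second makes this at most
   [e |h|]. *)
exists (Num.min (normc z / 2) (e * normc z ^+ 3 / 2)).
  by rewrite lt_min !divr_gt0 // mulr_gt0 // exprn_gt0.
move=> h; rewrite lt_min => /andP[h1 h2].
have zh : normc z / 2 <= normc (z + h).
  by have := normc_sub_ge z (- h); rewrite opprK normcN; lra.
have zh0 : z + h != 0 by rewrite -normc_gt0; lra.
have -> : (z + h)^-1 - z^-1 - - z ^- 2 * h = h * h / (z ^+ 2 * (z + h)).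
  by field; rewrite z0 zh0.
rewrite normcM normcV !normcM ler_pdivrMr ?mulr_gt0 ?normc_gt0 ?normcX ?exprn_gt0 //.
have : normc h <= e * (normc z * normc z * normc (z + h)).
  apply: (le_trans (ltW h2)); rewrite -mulrA ler_pM2l //.
  have -> : normc z ^+ 3 / 2 = normc z * normc z * (normc z / 2) by ring.
  by rewrite ler_wpM2l // mulr_ge0 ?normc_ge0.
have := normc_ge0 h; nra.
Qed.

Lemma has_cderivX f z l n : has_cderiv f z l ->
  has_cderiv (fun w => f w ^+ n) z (n%:R * f z ^+ n.-1 * l).
Proof.
move=> Hf; elim: n => [|n IH].
  by rewrite !mul0r; apply: has_cderiv_ext (has_cderiv_cst 1 z) => w; rewrite expr0.
have := has_cderivM Hf IH; rewrite (_ : _ + _ = n.+1%:R * f z ^+ n.+1.-1 * l).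
  by apply: has_cderiv_ext => w; rewrite exprS.
case: n {IH} => [|n] /=; first by rewrite expr0; ring.
by rewrite -[n.+2%:R]natr1 exprS; ring.
Qed.

End cderiv.

Section cderiv_line.
Variable R : realType.
Local Notation C := R[i].
Implicit Types (z w : C) (f g : C -> C).
Local Notation Re := complex.Re.
Local Notation Im := complex.Im.

Lemma is_derive_eps (g : R -> R) (t l : R) :
  (forall e : R, 0 < e -> exists2 d : R, 0 < d &
    forall h, `|h| < d -> `|g (t + h) - g t - l * h| <= e * `|h|) ->
  is_derive t 1 g l.
Proof.
move=> H.
have K : h^-1 *: (g (h *: 1 + t) - g t) @[h --> (0 : R)^'] --> l.
  apply/cvgrPdist_le => e e0; have [d d0 Hd] := H _ e0.
  rewrite -nbhs_nearE; apply/nbhs_ballP; exists d; first by rewrite /=.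
  move=> h /=; rewrite -ball_normE /= sub0r normrN => hd h0.
  rewrite distrC.
  have := Hd _ hd; rewrite -{1}(mulVKf h0 (g _ - _ - _)) normrM mulrC.
  rewrite ler_pM2r ?normr_gt0 // => H1; apply: le_trans H1.
  rewrite le_eqVlt; apply/orP; left; apply/eqP; congr `| _ |.
  by rewrite mulrBr mulrCA mulVf // mulr1 /GRing.scale /= mulr1 [h + t]addrC.
have c1 : derivable g t 1 by apply/cvg_ex; exists l.
by apply: DeriveDef => //; exact: (cvg_lim (@norm_hausdorff _ _) K).
Qed.

Lemma normr_line (h : R) z : normc (h%:C%C * z) = `|h| * normc z.
Proof. by rewrite normcM normcR. Qed.

Lemma has_cderiv_line f z k l (t : R) : has_cderiv f (z + t%:C%C * k) l ->
  is_derive t 1 (fun s => Re (f (z + s%:C%C * k))) (Re (l * k)) /\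
  is_derive t 1 (fun s => Im (f (z + s%:C%C * k))) (Im (l * k)).
Proof.
move=> H.
have K : forall e : R, 0 < e -> exists2 d : R, 0 < d &
    forall h : R, `|h| < d -> normc (f (z + (t + h)%:C%C * k) - f (z + t%:C%C * k) - h%:C%C * (l * k)) <= e * `|h|.
  move=> e e0; have k1 : 0 < 1 + normc k by rewrite ltr_wpDr ?normc_ge0.
  have [d d0 Hd] := H _ (divr_gt0 e0 k1).
  exists (d / (1 + normc k)); first by rewrite divr_gt0.
  move=> h; rewrite ltr_pdivlMr // => hd.
  have hk : normc (h%:C%C * k) < d.
    by rewrite normr_line (le_lt_trans _ hd) // ler_wpM2l // lerDr.
  have := Hd _ hk.
  have -> : z + t%:C%C * k + h%:C%C * k = z + (t + h)%:C%C * k.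
    by rewrite -addrA -mulrDl -rmorphD.
  rewrite [l * _]mulrCA => H1.
  apply: (le_trans H1); rewrite normr_line.
  rewrite [leLHS](_ : _ = e * `|h| * (normc k / (1 + normc k))); last by ring.
  rewrite ler_piMr ?mulr_ge0 ?(ltW e0) //.
  by rewrite ler_pdivrMr // mul1r lerDr.
split; apply: is_derive_eps => e e0; have [d d0 Hd] := K e e0; exists d => // h /Hd.
- apply: le_trans; apply: le_trans (Re_le_normc _); rewrite !ReImE /=.
  by rewrite le_eqVlt; apply/orP; left; apply/eqP; congr `| _ |; ring.
- apply: le_trans; apply: le_trans (Im_le_normc _); rewrite !ReImE /=.
  by rewrite le_eqVlt; apply/orP; left; apply/eqP; congr `| _ |; ring.
Qed.

Lemma is_derive_within_continuous (g dg : R -> R) (a b : R) :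
  (forall t : R, a <= t <= b -> is_derive t 1 g (dg t)) -> {within `[a, b], continuous g}.
Proof.
move=> H; apply: derivable_within_continuous => t; rewrite in_itv /= => /H [].
by [].
Qed.

(** The mean value theorem leaves only the oscillation of [dg] around [l]. The cases are the sign of
    [h], because [MVT] wants an ordered interval. *)
Lemma MVT_lin (g dg : R -> R) (x h l M : R) :
  (forall t, `|t - x| <= `|h| -> is_derive t 1 g (dg t)) ->
  (forall t, `|t - x| <= `|h| -> `|dg t - l| <= M) ->
  `|g (x + h) - g x - l * h| <= M * `|h|.
Proof.
move=> H HM.
have key c : `|c - x| <= `|h| -> g (x + h) - g x = dg c * h ->
    `|g (x + h) - g x - l * h| <= M * `|h|.
  by move=> cx ->; rewrite -mulrBl normrM ler_wpM2r // HM.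
have [h0|h0|h0] := ltgtP h 0.
- have K : {within `[x + h, x], continuous g}.
    apply: (@is_derive_within_continuous _ dg) => t /andP[t0 t1].
    by apply: H; rewrite !ler0_norm; lra.
  have xh : x + h < x by lra.
  have [t|c] := @MVT _ g dg (x + h) x xh _ K.
    by rewrite in_itv /= => /andP[t0 t1]; apply: H; rewrite !ler0_norm; lra.
  rewrite in_itv /= => /andP[t0 t1] E.
  by apply: (key c); [rewrite !ler0_norm; lra|nra].
- have K : {within `[x, x + h], continuous g}.
    apply: (@is_derive_within_continuous _ dg) => t /andP[t0 t1].
    by apply: H; rewrite !ger0_norm; lra.
  have xh : x < x + h by lra.
  have [t|c] := @MVT _ g dg x (x + h) xh _ K.
    by rewrite in_itv /= => /andP[t0 t1]; apply: H; rewrite !ger0_norm; lra.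
  rewrite in_itv /= => /andP[t0 t1] E.
  by apply: (key c); [rewrite !ger0_norm; lra|nra].
- by rewrite h0 addr0 subrr mulr0 subr0 normr0 mulr0.
Qed.

Lemma MVT01 (g dg : R -> R) (M : R) :
  (forall t : R, 0 <= t <= 1 -> is_derive t 1 g (dg t)) ->
  (forall t : R, 0 <= t <= 1 -> `|dg t| <= M) -> `|g 1 - g 0| <= M.
Proof.
move=> H HM.
have [t|t] := @MVT _ g dg 0 1 ltr01 _ (is_derive_within_continuous H).
  by rewrite in_itv /= => /andP[t0 t1]; apply: H; rewrite !ltW.
rewrite in_itv /= => /andP[t0 t1] ->; rewrite subr0 mulr1.
by apply: HM; rewrite !ltW.
Qed.

(* the constant [2] comes from treating real and imaginary parts separately *)
Lemma cmean_value f (df : C -> C) z k (M : R) :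
  (forall t : R, 0 <= t <= 1 -> has_cderiv f (z + t%:C%C * k) (df (z + t%:C%C * k))) ->
  (forall t : R, 0 <= t <= 1 -> normc (df (z + t%:C%C * k)) <= M) ->
  normc (f (z + k) - f z) <= 2 * (M * normc k).
Proof.
move=> H HM.
have b t : 0 <= t <= 1 -> normc (df (z + t%:C%C * k) * k) <= M * normc k.
  by move=> t01; rewrite normcM ler_wpM2r ?normc_ge0 // HM.
have HR := MVT01 (fun t t01 => (has_cderiv_line (H t t01)).1)
  (fun t t01 => le_trans (Re_le_normc _) (b t t01)).
have HI := MVT01 (fun t t01 => (has_cderiv_line (H t t01)).2)
  (fun t t01 => le_trans (Im_le_normc _) (b t t01)).
apply: (le_trans (normc_le_ReIm _)); rewrite !ReImE mulr2n mulrDl mul1r.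
by move: HR HI; rewrite !mul1r !mul0r addr0 => HR HI; exact: lerD.
Qed.

(** The increment is split into a horizontal and a vertical move, and [MVT_lin] handles each;
    continuity of the partials is used at the base point only. *)
Lemma partials_differential (u P Q : R -> R -> R) (x0 y0 r : R) : 0 < r ->
  (forall x y : R, `|x - x0| < r -> `|y - y0| < r ->
     is_derive x 1 (fun s => u s y) (P x y) /\ is_derive y 1 (fun s => u x s) (Q x y)) ->
  (forall e : R, 0 < e -> exists2 d : R, 0 < d & forall x y : R,
     `|x - x0| < d -> `|y - y0| < d ->
       `|P x y - P x0 y0| <= e /\ `|Q x y - Q x0 y0| <= e) ->
  forall e : R, 0 < e -> exists2 d : R, 0 < d & forall h k : R,
     `|h| < d -> `|k| < d ->
     `|u (x0 + h) (y0 + k) - u x0 y0 - P x0 y0 * h - Q x0 y0 * k| <= e * (`|h| + `|k|).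
Proof.
move=> r0 du cPQ e e0; have [d d0 Hd] := cPQ e e0.
exists (Num.min d r); first by rewrite lt_min d0.
move=> h k; rewrite !lt_min => /andP[hd hr] /andP[kd kr].
have z0 : `|x0 - x0| < d /\ `|y0 - y0| < d by rewrite !subrr normr0.
have b1 : `|u (x0 + h) (y0 + k) - u x0 (y0 + k) - P x0 y0 * h| <= e * `|h|.
  have kk : y0 + k - y0 = k by ring.
  have := @MVT_lin (fun x => u x (y0 + k)) (fun x => P x (y0 + k)) x0 h (P x0 y0) e.
  rewrite /=; apply => t th.
    by apply: (du t (y0 + k) _ _).1; rewrite ?kk // (le_lt_trans th).
  by apply: (Hd t (y0 + k) _ _).1; rewrite ?kk // (le_lt_trans th).
have b2 : `|u x0 (y0 + k) - u x0 y0 - Q x0 y0 * k| <= e * `|k|.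
  have := @MVT_lin (u x0) (Q x0) y0 k (Q x0 y0) e; apply => t th.
    by apply: (du x0 t _ _).2; rewrite ?subrr ?normr0 // (le_lt_trans th).
  by apply: (Hd x0 t z0.1 _).2; rewrite (le_lt_trans th).
have -> : u (x0 + h) (y0 + k) - u x0 y0 - P x0 y0 * h - Q x0 y0 * k =
  (u (x0 + h) (y0 + k) - u x0 (y0 + k) - P x0 y0 * h) +
  (u x0 (y0 + k) - u x0 y0 - Q x0 y0 * k) by ring.
by rewrite mulrDr (le_trans (ler_normD _ _)) // lerD.
Qed.

(** With the Cauchy-Riemann signs the two real differentials combine into multiplication by
    [p + i q]. This is how primitives, [cexp] and [clog] are differentiated. *)
Lemma CR_has_cderiv (u v p q : R -> R -> R) (z : C) (r : R) : 0 < r ->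
  (forall x y : R, `|x - Re z| < r -> `|y - Im z| < r ->
     [/\ is_derive x 1 (fun s => u s y) (p x y), is_derive y 1 (fun s => u x s) (- q x y),
         is_derive x 1 (fun s => v s y) (q x y) & is_derive y 1 (fun s => v x s) (p x y)]) ->
  (forall e : R, 0 < e -> exists2 d : R, 0 < d & forall x y : R,
     `|x - Re z| < d -> `|y - Im z| < d ->
       `|p x y - p (Re z) (Im z)| <= e /\ `|q x y - q (Re z) (Im z)| <= e) ->
  has_cderiv (fun w => (u (Re w) (Im w) +i* v (Re w) (Im w))%C) z
    (p (Re z) (Im z) +i* q (Re z) (Im z))%C.
Proof.
move=> r0 du cpq e e0.
have e4 : 0 < e / 4 by rewrite divr_gt0.
(* Each component costs [e / 4 * (|Re h| + |Im h|)], which is at most [e / 2 * normc h]. *)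
have [||d1 d10 H1] := @partials_differential u p (fun x y => - q x y) (Re z) (Im z) r r0 _ _ _ e4.
- by move=> x y hx hy; have [] := du x y hx hy.
- move=> e' /cpq[d d0 Hd]; exists d => // x y hx hy.
  by have [? ?] := Hd x y hx hy; rewrite -opprD normrN.
have [||d2 d20 H2] := @partials_differential v q p (Re z) (Im z) r r0 _ _ _ e4.
- by move=> x y hx hy; have [] := du x y hx hy.
- by move=> e' /cpq[d d0 Hd]; exists d => // x y hx hy; have [? ?] := Hd x y hx hy.
exists (Num.min d1 d2); first by rewrite lt_min d10.
move=> h; rewrite lt_min => /andP[hd1 hd2].
have hR := Re_le_normc h; have hI := Im_le_normc h.
have {H1} := H1 (Re h) (Im h) (le_lt_trans hR hd1) (le_lt_trans hI hd1).
have {H2} := H2 (Re h) (Im h) (le_lt_trans hR hd2) (le_lt_trans hI hd2).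
move=> H2 H1; apply: (le_trans (normc_le_ReIm _)); rewrite !ReImE /=.
set A := `|_|; set B := `|_|.
have -> : A = `|u (Re z + Re h) (Im z + Im h) - u (Re z) (Im z) -
     p (Re z) (Im z) * Re h - - q (Re z) (Im z) * Im h| by congr `|_|; ring.
have -> : B = `|v (Re z + Re h) (Im z + Im h) - v (Re z) (Im z) -
     q (Re z) (Im z) * Re h - p (Re z) (Im z) * Im h| by congr `|_|; ring.
apply: (le_trans (lerD H1 H2)); nra.
Qed.

End cderiv_line.

(** * Complex-valued integrals *)

Section complex_measurability.
Variable R : realType.
Local Notation C := R[i].
Local Notation Re := complex.Re.
Local Notation Im := complex.Im.

Lemma measurable_Re : measurable_fun setT (@complex.Re R).
Proof.
move=> _ B mB; rewrite setTI.
have := @measurable_fst _ _ R R measurableT _ mB; rewrite setTI.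
by [].
Qed.

Lemma measurable_Im : measurable_fun setT (@complex.Im R).
Proof.
move=> _ B mB; rewrite setTI.
have := @measurable_snd _ _ R R measurableT _ mB; rewrite setTI.
by [].
Qed.

Lemma measurable_funC d (T : measurableType d) (D : set T) (f : T -> C) :
  measurable_fun D (fun x => Re (f x)) -> measurable_fun D (fun x => Im (f x)) ->
  measurable_fun D f.
Proof.
move=> mR mI mD B mB.
have mR' := (measurable_restrictT _ mD).1 mR; have mI' := (measurable_restrictT _ mD).1 mI.
have := measurableI _ _ mD (measurable_fun_pair mR' mI' measurableT mB).
congr (measurable _); apply/seteqP; split => x; rewrite /preimage /= /complex_of_pair /=.
  by move=> [Dx [_]]; rewrite !patchE mem_set //; case: (f x).
by move=> [Dx Bx]; split => //; split => //; rewrite !patchE mem_set //; move: Bx; case: (f x).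
Qed.

Lemma measurable_funRe d (T : measurableType d) (D : set T) (f : T -> C) :
  measurable_fun D f -> measurable_fun D (fun x => Re (f x)).
Proof. by move=> mf; apply: measurableT_comp mf; exact: measurable_Re. Qed.

Lemma measurable_funIm d (T : measurableType d) (D : set T) (f : T -> C) :
  measurable_fun D f -> measurable_fun D (fun x => Im (f x)).
Proof. by move=> mf; apply: measurableT_comp mf; exact: measurable_Im. Qed.

Lemma measurable_funMC d (T : measurableType d) (D : set T) (f g : T -> C) :
  measurable_fun D f -> measurable_fun D g -> measurable_fun D (fun x => f x * g x).
Proof.
move=> mf mg; apply: measurable_funC.
- under eq_fun do rewrite cReM.
  by apply: measurable_funD; [|apply: measurableT_comp => //]; apply: measurable_funM;
    do ?[exact: measurable_funRe|exact: measurable_funIm].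
- under eq_fun do rewrite cImM.
  by apply: measurable_funD; apply: measurable_funM;
    do ?[exact: measurable_funRe|exact: measurable_funIm].
Qed.

Lemma measurable_funDC d (T : measurableType d) (D : set T) (f g : T -> C) :
  measurable_fun D f -> measurable_fun D g -> measurable_fun D (fun x => f x + g x).
Proof.
move=> mf mg; apply: measurable_funC.
- under eq_fun do rewrite cReD.
  by apply: measurable_funD; exact: measurable_funRe.
- under eq_fun do rewrite cImD.
  by apply: measurable_funD; exact: measurable_funIm.
Qed.

Lemma measurable_funNC d (T : measurableType d) (D : set T) (f : T -> C) :
  measurable_fun D f -> measurable_fun D (fun x => - f x).
Proof.
move=> mf; apply: measurable_funC.
- under eq_fun do rewrite cReN.
  by apply: measurableT_comp => //; exact: measurable_funRe.
- under eq_fun do rewrite cImN.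
  by apply: measurableT_comp => //; exact: measurable_funIm.
Qed.

Lemma measurable_funBC d (T : measurableType d) (D : set T) (f g : T -> C) :
  measurable_fun D f -> measurable_fun D g -> measurable_fun D (fun x => f x - g x).
Proof. by move=> mf mg; apply: measurable_funDC => //; exact: measurable_funNC. Qed.

Lemma measurable_funJ d (T : measurableType d) (D : set T) (f : T -> C) :
  measurable_fun D f -> measurable_fun D (fun x => (f x)^*%C).
Proof.
move=> mf; apply: measurable_funC.
- rewrite (_ : (fun _ => _) = fun x => Re (f x)); first exact: measurable_funRe.
  by apply/funext => x; case: (f x).
- rewrite (_ : (fun _ => _) = fun x => - Im (f x)).
    by apply: measurableT_comp => //; exact: measurable_funIm.
  by apply/funext => x; case: (f x).
Qed.

Lemma measurable_funR d (T : measurableType d) (D : set T) (f : T -> R) :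
  measurable_fun D f -> measurable_fun D (fun x => (f x)%:C%C).
Proof. by move=> mf; apply: measurable_funC. Qed.

Lemma measurable_normc d (T : measurableType d) (D : set T) (f : T -> C) :
  measurable_fun D f -> measurable_fun D (fun x => normc (f x)).
Proof.
move=> mf.
rewrite (_ : (fun _ => _) = fun x => Num.sqrt (Re (f x) ^+ 2 + Im (f x) ^+ 2)); last first.
  by apply/funext => x; case: (f x).
apply: (measurableT_comp (continuous_measurable_fun (@sqrt_continuous R))).
by apply: measurable_funD; apply: measurable_funX;
  do ?[exact: measurable_funRe|exact: measurable_funIm].
Qed.

(** Lower left corner of the dyadic square of side [2 ^- n] that contains [z]. It takes countably
    many values, so every function of [grid n z] is measurable. *)
Let grid (n : nat) (z : C) : C :=
  (((Num.floor (Re z * 2 ^+ n))%:~R / 2 ^+ n) +i* ((Num.floor (Im z * 2 ^+ n))%:~R / 2 ^+ n))%C.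

Let grid_close n z : normc (grid n z - z) <= 2 / 2 ^+ n.
Proof.
have p2 : 0 < 2 ^+ n :> R by rewrite exprn_gt0.
have fl (t : R) : `|(Num.floor (t * 2 ^+ n))%:~R / 2 ^+ n - t| <= (2 ^+ n)^-1.
  have /andP[a b] := floor_itv (t * 2 ^+ n); rewrite intrD in b.
  rewrite -(ler_pM2r p2) mulVf ?gt_eqF // -[X in _ * X](ger0_norm (ltW p2)) -normrM mulrBl.
  by rewrite mulfVK ?gt_eqF // ler_norml; apply/andP; split; lra.
apply: (le_trans (normc_le_ReIm _)); rewrite !ReImE /= mulr2n mulrDl mul1r.
by rewrite lerD.
Qed.

Let measurable_grid n (phi : C -> R) : measurable_fun setT (fun z => phi (grid n z)).
Proof.
move=> _ B mB; rewrite setTI.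
pose pt (i j : int) : C := ((i%:~R / 2 ^+ n) +i* (j%:~R / 2 ^+ n))%C.
rewrite [X in measurable X](_ : _ = \bigcup_i \bigcup_j
  (if `[< B (phi (pt i j)) >] then [set z : C | Num.floor (Re z * 2 ^+ n) = i] `&`
    [set z : C | Num.floor (Im z * 2 ^+ n) = j] else set0)); last first.
  apply/seteqP; split => z /=.
    move=> Bz; exists (Num.floor (Re z * 2 ^+ n)) => //; exists (Num.floor (Im z * 2 ^+ n)) => //.
    by case: asboolP.
  by move=> [i _ [j _]]; case: asboolP => // Bp [Ei Ej]; rewrite /grid Ei Ej.
have mfl (g : C -> R) (k : int) : measurable_fun setT g ->
    measurable [set z : C | Num.floor (g z * 2 ^+ n) = k].
  move=> mg.
  have mg2 : measurable_fun setT (fun z => g z * 2 ^+ n) by exact: measurable_funM.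
  have := mg2 measurableT [set` `[k%:~R : R, (k + 1)%:~R[] (measurable_itv _); rewrite setTI.
  congr measurable; apply/seteqP; split => z /=; rewrite in_itv /=.
    by move=> h; apply: floor_def.
  by move=> <-; exact: floor_itv.
apply: countable_bigcupT_measurable => [|i]; first exact: countableP.
apply: countable_bigcupT_measurable => [|j]; first exact: countableP.
case: asboolP => // _; apply: measurableI; apply: mfl.
  exact: measurable_Re.
exact: measurable_Im.
Qed.

(** On [D] the function is the pointwise limit of [f (grid n z)], which is measurable whatever [f]
    does elsewhere. *)
Lemma ccont_measurable (D : set C) (f : C -> C) : (forall z, D z -> ccont f z) ->
  measurable_fun D f.
Proof.
move=> cf.
have H z : D z -> forall e, 0 < e -> \forall n \near \oo, normc (f z - f (grid n z)) < e.
  move=> Dz e e0; have [d d0 Hd] := cf z Dz e e0.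
  have d2 : 0 < d / 2 by rewrite divr_gt0.
  near=> n; rewrite normcBC; apply: Hd; apply: (le_lt_trans (grid_close n z)).
  rewrite -ltr_pdivlMl // mulrC.
  have -> : (2 ^+ n)^-1 = (2^-1 : R) ^+ n by rewrite exprVn.
  near: n; have /cvgrPdist_lt /(_ _ d2) : (2^-1 : R) ^+ n @[n --> \oo] --> (0 : R).
    by apply: cvg_expr; rewrite ger0_norm ?invr_ge0 // invf_lt1 // ltr1n.
  by apply: filterS => n; rewrite sub0r normrN ger0_norm // exprn_ge0 // invr_ge0.
apply: measurable_funC.
- apply: (@measurable_fun_cvg _ _ _ D (fun n z => Re (f (grid n z)))).
    by move=> n; apply: measurable_funTS; exact: (measurable_grid n (fun z => Re (f z))).
  move=> z Dz; apply/cvgrPdist_lt => e e0; have := H z Dz e e0.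
  by apply: filterS => n; apply: le_lt_trans; rewrite -cReN -cReD Re_le_normc.
- apply: (@measurable_fun_cvg _ _ _ D (fun n z => Im (f (grid n z)))).
    by move=> n; apply: measurable_funTS; exact: (measurable_grid n (fun z => Im (f z))).
  move=> z Dz; apply/cvgrPdist_lt => e e0; have := H z Dz e e0.
  by apply: filterS => n; apply: le_lt_trans; rewrite -cImN -cImD Im_le_normc.
Unshelve. all: by end_near. Qed.

End complex_measurability.

Section complex_integral.
Context d (T : measurableType d) (R : realType).
Local Notation C := R[i].
Local Notation Re := complex.Re.
Local Notation Im := complex.Im.
Variable mu : {measure set T -> \bar R}.
Implicit Types (D : set T) (h : T -> C).

Definition cintegrable D h :=
  mu.-integrable D (EFin \o (fun x => Re (h x))) /\
  mu.-integrable D (EFin \o (fun x => Im (h x))).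

Lemma cintegrable_measurable D h : cintegrable D h -> measurable_fun D h.
Proof.
move=> [iR iI]; apply: measurable_funC; apply/measurable_EFinP.
  exact: measurable_int iR.
exact: measurable_int iI.
Qed.

Lemma cintegrableW D h (g : T -> R) : measurable D -> measurable_fun D h ->
  (forall x, D x -> normc (h x) <= g x) -> mu.-integrable D (EFin \o g) ->
  cintegrable D h.
Proof.
move=> mD mh hg ig; split; apply: le_integrable ig => //.
- by apply/measurable_EFinP; exact: measurable_funRe.
- move=> x Dx; rewrite /= lee_fin (le_trans (Re_le_normc _)) //.
  by rewrite (le_trans (hg _ Dx)) // ler_norm.
- by apply/measurable_EFinP; exact: measurable_funIm.
- move=> x Dx; rewrite /= lee_fin (le_trans (Im_le_normc _)) //.
  by rewrite (le_trans (hg _ Dx)) // ler_norm.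
Qed.

Lemma cintegrable_normc D h : measurable D -> cintegrable D h ->
  mu.-integrable D (EFin \o (fun x => normc (h x))).
Proof.
move=> mD ih; have mh := cintegrable_measurable ih; case: ih => iR iI.
have := integrableD mD (integrable_norm iR) (integrable_norm iI).
apply: le_integrable => //.
  by apply/measurable_EFinP; exact: measurable_normc.
move=> x Dx; rewrite /= lee_fin ger0_norm ?normc_ge0 //.
by rewrite (le_trans (normc_le_ReIm _)) // ler_norm.
Qed.

Lemma eq_cintegral D h h' : {in D, h =1 h'} -> cintegral mu D h = cintegral mu D h'.
Proof.
move=> hh; rewrite /cintegral; congr (fine _ +i* fine _)%C;
  by apply: eq_integral => x /hh ->.
Qed.

Lemma cintegralD D h h' : measurable D -> cintegrable D h -> cintegrable D h' ->
  cintegral mu D (fun x => h x + h' x) = cintegral mu D h + cintegral mu D h'.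
Proof.
move=> mD [hR hI] [hR' hI']; apply: complexP; rewrite !ReImE /=.
- by rewrite -[RHS]RintegralD //; congr fine; apply: eq_integral => x _; rewrite cReD.
- by rewrite -[RHS]RintegralD //; congr fine; apply: eq_integral => x _; rewrite cImD.
Qed.

Lemma cintegrableD D h h' : measurable D -> cintegrable D h -> cintegrable D h' ->
  cintegrable D (fun x => h x + h' x).
Proof.
move=> mD [hR hI] [hR' hI']; split.
- rewrite (_ : _ \o _ = (EFin \o (fun x => Re (h x))) \+ (EFin \o (fun x => Re (h' x))))%E.
    exact: integrableD.
  by apply/funext => x /=; rewrite cReD EFinD.
- rewrite (_ : _ \o _ = (EFin \o (fun x => Im (h x))) \+ (EFin \o (fun x => Im (h' x))))%E.
    exact: integrableD.
  by apply/funext => x /=; rewrite cImD EFinD.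
Qed.

Lemma cintegrableZ D (c : C) h : measurable D -> cintegrable D h ->
  cintegrable D (fun x => c * h x).
Proof.
move=> mD ih; apply: (@cintegrableW D _ (fun x => normc c * normc (h x))) => //.
- by apply: measurable_funMC => //; exact: cintegrable_measurable.
- by move=> x _; rewrite normcM.
rewrite (_ : _ \o _ = fun x => (normc c)%:E * (EFin \o (fun x => normc (h x))) x)%E //.
by apply: integrableZl => //; exact: cintegrable_normc.
Qed.

Lemma cintegralZ D (c : C) h : measurable D -> cintegrable D h ->
  cintegral mu D (fun x => c * h x) = c * cintegral mu D h.
Proof.
move=> mD [hR hI]; have Z (r : R) (f : T -> R) : mu.-integrable D (EFin \o f) ->
    mu.-integrable D (EFin \o (fun x => r * f x)).
  by move=> /(integrableZl mD r); apply: eq_integrable.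
apply: complexP; rewrite !ReImE /=.
- transitivity (fine (\int[mu]_(x in D) (Re c * Re (h x) - Im c * Im (h x))%:E)%E).
    by congr fine; apply: eq_integral => x _; rewrite cReM.
  rewrite -[LHS]/(Rintegral mu D _) RintegralB //; do ?exact: Z.
  by rewrite !RintegralZl.
- transitivity (fine (\int[mu]_(x in D) (Re c * Im (h x) + Im c * Re (h x))%:E)%E).
    by congr fine; apply: eq_integral => x _; rewrite cImM.
  rewrite -[LHS]/(Rintegral mu D _) RintegralD //; do ?exact: Z.
  by rewrite !RintegralZl.
Qed.

Lemma cintegralB D h h' : measurable D -> cintegrable D h -> cintegrable D h' ->
  cintegral mu D (fun x => h x - h' x) = cintegral mu D h - cintegral mu D h'.
Proof.
move=> mD ih ih'; have iN := cintegrableZ (-1) mD ih'.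
rewrite -mulN1r -cintegralZ // -cintegralD //.
by apply: eq_cintegral => x _; rewrite mulN1r.
Qed.

Lemma cintegrableB D h h' : measurable D -> cintegrable D h -> cintegrable D h' ->
  cintegrable D (fun x => h x - h' x).
Proof.
move=> mD ih ih'; have := cintegrableD mD ih (cintegrableZ (-1) mD ih').
by congr cintegrable; apply/funext => x; rewrite mulN1r.
Qed.

Lemma cintegrable0 D : cintegrable D (fun=> 0).
Proof. by split; exact: integrable0. Qed.

Lemma cintegral0 D : cintegral mu D (fun=> 0) = 0.
Proof. by apply: complexP => /=; rewrite integral0. Qed.

Lemma cintegrable_sum (I : Type) (s : seq I) D (h : I -> T -> C) : measurable D ->
  (forall i, cintegrable D (h i)) -> cintegrable D (fun x => \sum_(i <- s) h i x).
Proof.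
move=> mD ih; elim: s => [|i s IH].
  by have := cintegrable0 D; congr cintegrable; apply/funext => x; rewrite big_nil.
have := cintegrableD mD (ih i) IH; congr cintegrable; apply/funext => x.
by rewrite big_cons.
Qed.

Lemma cintegral_sum (I : Type) (s : seq I) D (h : I -> T -> C) : measurable D ->
  (forall i, cintegrable D (h i)) ->
  cintegral mu D (fun x => \sum_(i <- s) h i x) = \sum_(i <- s) cintegral mu D (h i).
Proof.
move=> mD ih; elim: s => [|i s IH].
  by rewrite big_nil -[RHS](cintegral0 D); apply: eq_cintegral => x _; rewrite big_nil.
rewrite big_cons -IH -cintegralD //; last exact: cintegrable_sum.
by apply: eq_cintegral => x _; rewrite big_cons.
Qed.

Lemma cintegrableJ D h : measurable D -> cintegrable D h -> cintegrable D (fun x => (h x)^*%C).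
Proof.
move=> mD [iR iI]; split.
- by apply: eq_integrable iR => // x _ /=; case: (h x).
- have := integrableN iI; apply: eq_integrable => // x _ /=.
  by case: (h x) => a b /=; rewrite EFinN.
Qed.

Lemma cintegralJ D h : measurable D -> cintegrable D h ->
  cintegral mu D (fun x => (h x)^*%C) = ((cintegral mu D h)^*)%C.
Proof.
move=> mD [iR iI]; apply: complexP => /=.
  by congr fine; apply: eq_integral => x _; case: (h x).
rewrite -[RHS]mulN1r -[X in -1 * X]/(Rintegral mu D _) -RintegralZl //.
by congr fine; apply: eq_integral => x _; rewrite mulN1r; case: (h x).
Qed.

(** The factor 2 is the price of estimating real and imaginary parts separately; it only inflates
    later constants. *)
Lemma cintegral_le D h : measurable D -> cintegrable D h ->
  ((normc (cintegral mu D h))%:E <= 2%:E * \int[mu]_(x in D) (normc (h x))%:E)%E.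
Proof.
move=> mD ih; have ihn := cintegrable_normc mD ih; case: (ih) => iR iI.
rewrite -(@fineK _ (\int[mu]_(x in D) _)%E); last exact: integrable_fin_num ihn.
rewrite -EFinM lee_fin (le_trans (normc_le_ReIm _)) // mulr2n mulrDl mul1r.
apply: lerD.
- apply: (le_trans (le_normr_Rintegral mD iR)).
  apply: le_Rintegral => //; first exact: integrable_norm.
  by move=> x Dx; exact: Re_le_normc.
- apply: (le_trans (le_normr_Rintegral mD iI)).
  apply: le_Rintegral => //; first exact: integrable_norm.
  by move=> x Dx; exact: Im_le_normc.
Qed.

Lemma cintegral_mkcond D h :
  cintegral mu D h = cintegral mu setT (fun x => if x \in D then h x else 0).
Proof.
apply: complexP => /=; congr fine; rewrite integral_mkcond; apply: eq_integral => x _;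
  by rewrite patchE; case: ifP.
Qed.

Lemma cintegrable_mkcond D h : measurable D ->
  cintegrable D h <-> cintegrable setT (fun x => if x \in D then h x else 0).
Proof.
move=> mD; split=> -[iR iI]; split.
- by have := (integrable_mkcond _ mD).1 iR; apply: eq_integrable => // x _;
    rewrite patchE /=; case: ifP.
- by have := (integrable_mkcond _ mD).1 iI; apply: eq_integrable => // x _;
    rewrite patchE /=; case: ifP.
- by apply/(integrable_mkcond _ mD); apply: eq_integrable iR => // x _;
    rewrite patchE /=; case: ifP.
- by apply/(integrable_mkcond _ mD); apply: eq_integrable iI => // x _;
    rewrite patchE /=; case: ifP.
Qed.

End complex_integral.

(** * Area measure: balls, points, sigma-finiteness *)

Section area_facts.
Variable R : realType.
Local Notation C := R[i].
Local Notation Re := complex.Re.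
Local Notation Im := complex.Im.
Local Notation area := (@area R).
Local Notation lambda := (@lebesgue_measure R).

(* The Lebesgue measure lives on this copy of [R]. *)
Local Notation RL := (g_sigma_algebraType R.-ocitv.-measurable).

Lemma measurable_complex_of_pairL :
  @measurable_fun _ _ (RL * RL)%type C setT (@complex_of_pair R).
Proof. exact: measurable_complex_of_pair. Qed.

Lemma area_ge0_integral (D : set C) (f : C -> \bar R) : measurable D ->
  measurable_fun D f -> (forall z, D z -> 0 <= f z)%E ->
  (\int[area]_(z in D) f z = (pi^-1)%:E *
    \int[lambda \x lambda]_(p in @complex_of_pair R @^-1` D) f (complex_of_pair p))%E.
Proof.
move=> mD mf f0.
have f0' : {in D, forall z, (0 <= f z)%E} by move=> z; rewrite inE; exact: f0.
have p0 : 0 <= (pi : R)^-1 by rewrite invr_ge0 pi_ge0.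
pose m : {measure set _ -> \bar R} := mscale (NngNum p0) (lambda \x lambda)%E.
transitivity (\int[pushforward m (@complex_of_pair R)]_(z in D) f z)%E.
  by congr integral; apply/funext.
rewrite (@ge0_integral_pushforward _ _ (RL * RL)%type _ R (@complex_of_pair R)
  measurable_complex_of_pairL m D f mD mf f0').
have mD' : measurable (@complex_of_pair R @^-1` D : set (RL * RL)).
  by rewrite -[X in measurable X]setTI; exact: measurable_complex_of_pairL.
by apply: ge0_integral_mscale => // p Dp; exact: f0.
Qed.

Lemma area_set (D : set C) : area D = ((pi^-1)%:E * (lambda \x lambda)%E (@complex_of_pair R @^-1` D))%E.
Proof. by []. Qed.

Definition cball (z : C) (r : R) : set C := [set w | normc (w - z) < r].

Lemma measurable_cball (z : C) (r : R) : measurable (cball z r).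
Proof.
have m : measurable_fun setT (fun w : C => normc (w - z)).
  by apply: measurable_normc; apply: measurable_funBC => //; exact: measurable_id.
have := m measurableT [set` `]-oo, r[] (measurable_itv _); rewrite setTI.
by congr measurable; apply/seteqP; split => w /=; rewrite in_itv.
Qed.

Lemma measurable_disc : measurable (@disc R).
Proof.
have := measurable_cball 0 1; congr measurable.
by apply/seteqP; split => w; rewrite /disc /cball /= subr0.
Qed.

(** The enclosing square has normalized area [4 r ^ 2 / pi], and [pi >= 2]. *)
Lemma le_area_cball (z : C) (r : R) : 0 <= r ->
  (area (cball z r) <= (2 * r ^+ 2)%:E)%E.
Proof.
move=> r0.
pose Q : set (R * R) := [set` `[Re z - r, Re z + r]] `*` [set` `[Im z - r, Im z + r]].
have mQ : measurable Q by apply: measurableX; exact: measurable_itv.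
have le1 : ((lambda \x lambda)%E (@complex_of_pair R @^-1` (cball z r)) <=
    (lambda \x lambda)%E Q)%E.
  apply: le_measure; rewrite ?inE //; first exact: measurable_cball.
  move=> [x y]; rewrite /preimage /complex_of_pair /cball /Q /= => h.
  have := le_lt_trans (Re_le_normc _) h; have := le_lt_trans (Im_le_normc _) h.
  rewrite !ReImE /= !in_itv /= !ltr_norml => /andP[a b] /andP[a' b'].
  by split; apply/andP; split; lra.
have w (a : R) : a + r - (a - r) = 2 * r by ring.
have itv (a : R) : lambda [set` `[a - r, a + r]] = (2 * r)%:E.
  rewrite lebesgue_measure_itv /= lte_fin; case: ltP => h; first by rewrite -EFinB w.
  have r00 : r = 0 by lra.
  by rewrite r00 mulr0.
have Qa : ((lambda \x lambda) Q = ((2 * r) * (2 * r))%:E)%E.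
  rewrite product_measure1E; try exact: measurable_itv.
  by rewrite EFinM; congr (_ * _)%E; exact: itv.
rewrite area_set; apply: (@le_trans _ _ ((pi^-1)%:E * ((2 * r) * (2 * r))%:E)%E).
  by rewrite lee_wpmul2l ?lee_fin ?invr_ge0 ?pi_ge0 // -Qa.
rewrite -EFinM lee_fin mulrC ler_pdivrMr ?pi_gt0 //.
have := pi_ge2 R; nra.
Qed.

Lemma measurable_set1C (z : C) : measurable [set z].
Proof.
have m : measurable_fun setT (fun w : C => normc (w - z)).
  by apply: measurable_normc; apply: measurable_funBC => //; exact: measurable_id.
have := m measurableT [set 0] (measurable_set1 _); rewrite setTI.
congr measurable; apply/seteqP; split => w /=; last by move=> ->; rewrite subrr normc0.
by move=> /eqP; rewrite normc_eq0 subr_eq0 => /eqP.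
Qed.

Lemma area_set1 (z : C) : area [set z] = 0.
Proof.
apply/eqP; rewrite eq_le measure_ge0 andbT; apply/lee_addgt0Pr => e e0; rewrite add0e.
have := @le_area_cball z (Num.sqrt (e / 2)) (sqrtr_ge0 _).
rewrite sqr_sqrtr ?divr_ge0 ?(ltW e0) // [X in X%:E](_ : _ = e); last by field.
apply: le_trans; apply: le_measure; rewrite ?inE.
- exact: measurable_set1C.
- exact: measurable_cball.
- by move=> w ->; rewrite /cball /= subrr normc0 sqrtr_gt0 divr_gt0.
Qed.

Lemma area_sigma_finite : sigma_finite setT area.
Proof.
exists (fun n => cball 0 n%:R).
  apply/seteqP; split => // z _; exists (Num.trunc (normc z)).+1 => //=.
  by rewrite /cball /= subr0 truncnS_gt.
move=> n; split; first exact: measurable_cball.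
by apply: le_lt_trans (le_area_cball _ _) _; rewrite ?ltry.
Qed.

HB.instance Definition _ := @Measure_isSigmaFinite.Build _ _ _ area area_sigma_finite.

Lemma disc_lty : (area (@disc R) < +oo)%E.
Proof.
have := @le_area_cball 0 1 ler01; rewrite (_ : cball 0 1 = @disc R).
  by move=> h; apply: le_lt_trans h _; rewrite ltry.
by apply/seteqP; split => w; rewrite /disc /cball /= subr0.
Qed.

End area_facts.

(** * Goursat's theorem and primitives *)

Section interval_integral.
Variable R : realType.
Local Notation mu := (@lebesgue_measure R).
Implicit Types (f g : R -> R) (a b c : R).

Definition itv_integral a b f : R := Rintegral mu [set` `[a, b]] f.

Lemma itv_integrable a b f : {within `[a, b], continuous f} ->
  mu.-integrable [set` `[a, b]] (EFin \o f).
Proof. by move=> cf; apply: continuous_compact_integrable => //; exact: segment_compact. Qed.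

Lemma itv_integralB a b f g : {within `[a, b], continuous f} -> {within `[a, b], continuous g} ->
  itv_integral a b (fun x => f x - g x) = itv_integral a b f - itv_integral a b g.
Proof. by move=> cf cg; apply: RintegralB => //; exact: itv_integrable. Qed.

Lemma itv_integral_cat a b c f : a <= b -> b <= c -> {within `[a, c], continuous f} ->
  itv_integral a c f = itv_integral a b f + itv_integral b c f.
Proof.
move=> ab bc cf; have iac := itv_integrable cf.
rewrite /itv_integral -(@Rintegral_itv_obnd_cbnd _ b).
  rewrite -Rintegral_setU //.
  - by congr Rintegral; rewrite -itv_bndbnd_setU // bnd_simp.
  - by rewrite -itv_bndbnd_setU // bnd_simp.
  - apply/disj_setPRL => x /= ; rewrite !in_itv /= => /andP[bx _] /andP[_ xb].
    by move: (lt_le_trans bx xb); rewrite ltxx.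
apply: integrableS iac => //.
by move=> x /=; rewrite !in_itv /= => /andP[bx ->]; rewrite andbT ltW // (le_lt_trans ab).
Qed.

Lemma itv_integral_cst_le a b f (k M : R) : a <= b -> {within `[a, b], continuous f} ->
  (forall x, a <= x <= b -> `|f x - k| <= M) ->
  `|itv_integral a b f - k * (b - a)| <= M * (b - a).
Proof.
move=> ab cf fM; have iab := itv_integrable cf.
have len : fine (mu [set` `[a, b]]) = b - a.
  rewrite lebesgue_measure_itv /= lte_fin; case: ltP => // ba.
  by rewrite (_ : a = b) ?subrr //; apply/eqP; rewrite eq_le ab.
have ik : mu.-integrable [set` `[a, b]] (EFin \o (fun=> k)).
  by apply: itv_integrable => x; exact: cvg_cst.
have -> : k * (b - a) = \int[mu]_(x in [set` `[a, b]]) k by rewrite Rintegral_cst // len.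
rewrite /itv_integral -RintegralB //.
apply: (le_trans (le_normr_Rintegral _ _)) => //.
  by apply: itv_integrable; apply: within_continuousB => // x; exact: cvg_cst.
have -> : M * (b - a) = \int[mu]_(x in [set` `[a, b]]) M by rewrite Rintegral_cst // len.
apply: le_Rintegral => //.
- have /itv_integrable/integrable_norm : {within `[a, b], continuous (fun x => f x - k)}.
    by apply: within_continuousB => // x; exact: cvg_cst.
  by [].
- by apply: itv_integrable => x; exact: cvg_cst.
Qed.

End interval_integral.

Section goursat.
Variable R : realType.
Local Notation I := (@itv_integral R).
Definition rdiff (u : R -> R -> R) (x y p q : R) := forall e : R, 0 < e ->
  exists2 d : R, 0 < d & forall h k : R, `|h| < d -> `|k| < d ->
  `|u (x + h) (y + k) - u x y - p * h - q * k| <= e * (`|h| + `|k|).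

Lemma dist_in_itv (A w x y : R) : A <= x <= A + w -> A <= y <= A + w -> `|y - x| <= w.
Proof. by rewrite ler_norml; lra. Qed.

Lemma rdiff_swap u x y p q : rdiff u x y p q -> rdiff (fun a b => u b a) y x q p.
Proof.
move=> H e e0; have [d d0 Hd] := H e e0; exists d => // h k hd kd.
by have := Hd k h kd hd; rewrite [`|k| + _]addrC; congr (`|_| <= _); ring.
Qed.

Lemma rdiff_continuous u x y p q : rdiff u x y p q -> {for x, continuous (u^~ y)}.
Proof.
move=> H; apply/cvgrPdist_le => e e0; have [d d0 Hd] := H _ ltr01.
have p0 : 0 < 1 + `|p| by rewrite ltr_wpDr.
rewrite -nbhs_nearE; apply/nbhs_ballP; exists (Num.min d (e / (1 + `|p|))).
  by rewrite /= lt_min d0 divr_gt0.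
move=> t; rewrite /= lt_min distrC => /andP[td te].
have zd : `|0 : R| < d by rewrite normr0.
have := Hd (t - x) 0 td zd.
rewrite addr0 normr0 addr0 mul1r mulr0 subr0 [x + _]addrC subrK distrC => B.
rewrite distrC -(subrK (p * (t - x)) (u t y - u x y)) (le_trans (ler_normD _ _)) //.
rewrite normrM; move: te; rewrite ltr_pdivlMr //; rewrite distrC in B; nra.
Qed.

Variables (P Q : R -> R -> R) (T : R).

(** The form [P dx + Q dy] is closed: the same [q] is the y-derivative of [P] and the x-derivative
    of [Q]. Only pointwise differentiability is known, which is why bisection is used and not
    Green's formula. *)
Hypothesis closed : forall x y : R, `|x| < T -> `|y| < T ->
  exists p q r, rdiff P x y p q /\ rdiff Q x y q r.

Let in_box (a b x : R) : - T < a -> b < T -> a <= x <= b -> `|x| < T.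
Proof. by move=> aT bT /andP[ax xb]; rewrite ltr_norml; lra. Qed.

Let contP y a b : `|y| < T -> - T < a -> b < T -> {within `[a, b], continuous (P^~ y)}.
Proof.
move=> yT aT bT; apply: continuous_in_subspaceT => x; rewrite inE /= in_itv /= => xab.
by have [p [q [r [/rdiff_continuous]]]] := closed (in_box aT bT xab) yT.
Qed.

Let contQ x a b : `|x| < T -> - T < a -> b < T -> {within `[a, b], continuous (Q x)}.
Proof.
move=> xT aT bT; apply: continuous_in_subspaceT => y; rewrite inE /= in_itv /= => yab.
by have [p [q [r [_ /rdiff_swap/rdiff_continuous]]]] := closed xT (in_box aT bT yab).
Qed.

(** Counterclockwise boundary integral of [P dx + Q dy] on the rectangle [[a, b] x [c, d]]. *)
Definition circulation (a b c d : R) : R :=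
  I a b (P^~ c) - I a b (P^~ d) + (I c d (Q b) - I c d (Q a)).
Local Notation W := circulation.

Let W_split a m b c k d : - T < a -> a <= m -> m <= b -> b < T ->
  - T < c -> c <= k -> k <= d -> d < T ->
  W a b c d = W a m c k + W m b c k + (W a m k d + W m b k d).
Proof.
move=> aT am mb bT cT ck kd dT; rewrite /circulation.
have yT y : c <= y -> y <= d -> `|y| < T by move=> ? ?; rewrite ltr_norml; lra.
have xT x : a <= x -> x <= b -> `|x| < T by move=> ? ?; rewrite ltr_norml; lra.
have cd := le_trans ck kd; have ab := le_trans am mb.
rewrite !(itv_integral_cat am mb); do ?[by apply: contP => //; apply: yT].
rewrite !(itv_integral_cat ck kd); do ?[by apply: contQ => //; apply: xT].
ring.
Qed.

(** Invariant of the bisection: the rectangle of generation [n] with lower left corner [z] still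
    carries the fraction [4 ^- n] of the initial circulation [om]. Circulations of the four quarters
    add up, so some quarter keeps its share. *)
Let step (w h om : R) (n : nat) (z : R * R) :=
  om / 4 ^+ n <= `|W z.1 (z.1 + w / 2 ^+ n) z.2 (z.2 + h / 2 ^+ n)|.

Let W_bisect w h om n (z : R * R) : 0 <= w -> 0 <= h ->
  - T < z.1 -> z.1 + w / 2 ^+ n < T -> - T < z.2 -> z.2 + h / 2 ^+ n < T ->
  step w h om n z -> exists z' : R * R,
  [/\ z.1 <= z'.1, z'.1 + w / 2 ^+ n.+1 <= z.1 + w / 2 ^+ n,
      z.2 <= z'.2, z'.2 + h / 2 ^+ n.+1 <= z.2 + h / 2 ^+ n & step w h om n.+1 z'].
Proof.
case: z => a c /= w0 h0 aT bT cT dT; rewrite /step /= => Wz.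
have p2 : 0 < 2 ^+ n :> R by rewrite exprn_gt0.
have wE : w / 2 ^+ n = w / 2 ^+ n.+1 + w / 2 ^+ n.+1.
  by rewrite exprS; field; rewrite gt_eqF.
have hE : h / 2 ^+ n = h / 2 ^+ n.+1 + h / 2 ^+ n.+1.
  by rewrite exprS; field; rewrite gt_eqF.
have w1 : 0 <= w / 2 ^+ n.+1 by rewrite divr_ge0 // exprn_ge0.
have h1 : 0 <= h / 2 ^+ n.+1 by rewrite divr_ge0 // exprn_ge0.
set w' := w / 2 ^+ n.+1 in wE w1 *; set h' := h / 2 ^+ n.+1 in hE h1 *.
rewrite wE hE in Wz bT dT *.
have omE : om / 4 ^+ n = om / 4 ^+ n.+1 *+ 4.
  by rewrite exprS -mulr_natl; field; rewrite gt_eqF // exprn_gt0.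
have : W a (a + (w' + w')) c (c + (h' + h')) =
    W a (a + w') c (c + h') + W (a + w') (a + (w' + w')) c (c + h') +
    (W a (a + w') (c + h') (c + (h' + h')) +
     W (a + w') (a + (w' + w')) (c + h') (c + (h' + h'))).
  by apply: W_split; rewrite ?lerDl ?lerD2l ?addr_ge0 //; rewrite lerDl.
set A := W a _ c (c + h'); set B := W (a + w') _ c _; set D := W a _ (c + h') _.
set G := W (a + w') _ (c + h') _ => E.
have : om / 4 ^+ n.+1 <= `|A| \/ om / 4 ^+ n.+1 <= `|B| \/
       om / 4 ^+ n.+1 <= `|D| \/ om / 4 ^+ n.+1 <= `|G|.
  apply: contrapT => /not_orP[/negP + /not_orP[/negP + /not_orP[/negP + /negP +]]].
  rewrite -!ltNge => A1 B1 C1 D1; move: Wz; rewrite E omE => Wz.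
  move: (A) (B) (D) (G) (om / _) A1 B1 C1 D1 Wz (ler_normD (A + B) (D + G)) (ler_normD A B) (ler_normD D G).
  clear => *; lra.
have aE : a + w' + w' = a + (w' + w') by rewrite addrA.
have cE : c + h' + h' = c + (h' + h') by rewrite addrA.
case=> [A1|[B1|[C1|D1]]].
- by exists (a, c); split => //=; move: w1 h1; clear => *; lra.
- by exists (a + w', c); rewrite /= aE; split => //=; move: w1 h1; clear => *; lra.
- by exists (a, c + h'); rewrite /= cE; split => //=; move: w1 h1; clear => *; lra.
- by exists (a + w', c + h'); rewrite /= aE cE; split => //=; move: w1 h1; clear => *; lra.
Qed.

Let nested (u : nat -> R) (w : R) : 0 <= w ->
  (forall n, u n <= u n.+1) -> (forall n, u n.+1 + w / 2 ^+ n.+1 <= u n + w / 2 ^+ n) ->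
  exists x, forall n, u n <= x <= u n + w / 2 ^+ n.
Proof.
move=> w0 ndu niu; have w1 n : 0 <= w / 2 ^+ n by rewrite divr_ge0 // exprn_ge0.
have ndu' : {homo u : n m / (n <= m)%N >-> n <= m} by apply/nondecreasing_seqP.
have niu' : {homo (fun n => u n + w / 2 ^+ n) : n m / (n <= m)%N >-> n >= m}.
  by apply/nonincreasing_seqP.
have bd n m : u n <= u m + w / 2 ^+ m.
  have := ndu' _ _ (leq_maxl n m); have := niu' _ _ (leq_maxr n m) => /=.
  by have := w1 (maxn n m); lra.
exists (sup (range u)) => n; apply/andP; split.
  apply: ub_le_sup; last by exists n.
  by exists (u 0 + w / 2 ^+ 0) => _ [m _ <-]; exact: bd.
by apply: ge_sup; [exists (u 0), 0|move=> _ [m _ <-]; exact: bd].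
Qed.

(** Opposite sides are paired. The linear parts contribute [- q h w] from the horizontal sides and
    [q w h] from the vertical ones; these cancel, and only the differentiability errors remain. *)
Let circulation_small A B w h x y p q r eps d : 0 <= w -> 0 <= h ->
  - T < A -> A + w < T -> - T < B -> B + h < T ->
  A <= x <= A + w -> B <= y <= B + h -> 0 < eps -> w + h < d ->
  (forall h0 k : R, `|h0| < d -> `|k| < d ->
    `|P (x + h0) (y + k) - P x y - p * h0 - q * k| <= eps * (`|h0| + `|k|)) ->
  (forall h0 k : R, `|h0| < d -> `|k| < d ->
    `|Q (x + h0) (y + k) - Q x y - q * h0 - r * k| <= eps * (`|h0| + `|k|)) ->
  `|W A (A + w) B (B + h)| <= 2 * (eps * (w + h)) * (w + h).
Proof.
move=> w0 h0 AT AwT BT BhT xP yP eps0 whd H1 H2.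
have Aw : A <= A + w by rewrite lerDl.
have Bh : B <= B + h by rewrite lerDl.
have Ain : A <= A <= A + w by rewrite lexx.
have Awin : A <= A + w <= A + w by rewrite lexx Aw.
have Bin : B <= B <= B + h by rewrite lexx.
have Bhin : B <= B + h <= B + h by rewrite lexx Bh.
have cP1 : {within `[A, A + w], continuous (P^~ B)}.
  by apply: contP => //; exact: in_box Bin.
have cP2 : {within `[A, A + w], continuous (P^~ (B + h))}.
  by apply: contP => //; exact: in_box Bhin.
have cQ1 : {within `[B, B + h], continuous (Q A)}.
  by apply: contQ => //; exact: in_box Ain.
have cQ2 : {within `[B, B + h], continuous (Q (A + w))}.
  by apply: contQ => //; exact: in_box Awin.
have est (u : R -> R -> R) p' q' x1 y1 : (forall h0 k : R, `|h0| < d -> `|k| < d ->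
    `|u (x + h0) (y + k) - u x y - p' * h0 - q' * k| <= eps * (`|h0| + `|k|)) ->
    A <= x1 <= A + w -> B <= y1 <= B + h ->
    `|u x1 y1 - u x y - p' * (x1 - x) - q' * (y1 - y)| <= eps * (w + h).
  move=> H x1P y1P.
  have hx : `|x1 - x| <= w by exact: dist_in_itv x1P.
  have hy : `|y1 - y| <= h by exact: dist_in_itv y1P.
  have := H (x1 - x) (y1 - y); rewrite ![_ + (_ - _)]addrC !subrK => H'.
  apply: (le_trans (H' _ _)); last by rewrite ler_pM2l // lerD.
    by rewrite (le_lt_trans hx) // (le_lt_trans _ whd) // lerDl.
  by rewrite (le_lt_trans hy) // (le_lt_trans _ whd) // lerDr.
have bP : `|I A (A + w) (fun t => P t B - P t (B + h)) - (- (q * h)) * (A + w - A)| <=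
    2 * (eps * (w + h)) * (A + w - A).
  apply: itv_integral_cst_le => //; [exact: within_continuousB|move=> t tP].
  rewrite (_ : _ - _ = (P t B - P x y - p * (t - x) - q * (B - y)) -
    (P t (B + h) - P x y - p * (t - x) - q * (B + h - y))); last by ring.
  by rewrite (le_trans (ler_normB _ _)) // mulr2n mulrDl mul1r lerD // est.
have bQ : `|I B (B + h) (fun t => Q (A + w) t - Q A t) - (q * w) * (B + h - B)| <=
    2 * (eps * (w + h)) * (B + h - B).
  apply: itv_integral_cst_le => //; [exact: within_continuousB|move=> t tP].
  rewrite (_ : _ - _ = (Q (A + w) t - Q x y - q * (A + w - x) - r * (t - y)) -
    (Q A t - Q x y - q * (A - x) - r * (t - y))); last by ring.
  by rewrite (le_trans (ler_normB _ _)) // mulr2n mulrDl mul1r lerD // est.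
rewrite /circulation -!itv_integralB //.
set X := I A _ _ in bP *; set Y := I B _ _ in bQ *.
rewrite -(subrK (- (q * h) * (A + w - A)) X) -(subrK (q * w * (B + h - B)) Y).
rewrite addrACA (_ : - (q * h) * _ + _ = 0) ?addr0; last by ring.
apply: (le_trans (ler_normD _ _)); apply: (le_trans (lerD bP bQ)).
by rewrite -mulrDr ![_ + _ - _]addrAC !subrr !add0r.
Qed.

Let inbox (a b c d w h : R) n (z : R * R) :=
  [/\ a <= z.1, z.1 + w / 2 ^+ n <= b, c <= z.2 & z.2 + h / 2 ^+ n <= d].

Let bisection a b c d om : - T < a -> a <= b -> b < T -> - T < c -> c <= d -> d < T ->
  om = `|W a b c d| -> exists s : nat -> R * R, exists x y, forall n,
    [/\ inbox a b c d (b - a) (d - c) n (s n), step (b - a) (d - c) om n (s n),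
     (s n).1 <= x <= (s n).1 + (b - a) / 2 ^+ n & (s n).2 <= y <= (s n).2 + (d - c) / 2 ^+ n].
Proof.
move=> aT ab bT cT cd dT omE.
have w0 : 0 <= b - a by rewrite subr_ge0. have h0 : 0 <= d - c by rewrite subr_ge0.
set w := b - a in w0 *; set h := d - c in h0 *.
(* [choice] wants a total successor function, so the invariant is a premise of the conclusion rather
   than of the existence claim. *)
have next (nz : nat * (R * R)) : exists z', inbox a b c d w h nz.1 nz.2 -> step w h om nz.1 nz.2 ->
  [/\ nz.2.1 <= z'.1, z'.1 + w / 2 ^+ nz.1.+1 <= nz.2.1 + w / 2 ^+ nz.1,
      nz.2.2 <= z'.2, z'.2 + h / 2 ^+ nz.1.+1 <= nz.2.2 + h / 2 ^+ nz.1 & step w h om nz.1.+1 z'].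
  have [[[i1 i2 i3 i4] st]|no] := pselect (inbox a b c d w h nz.1 nz.2 /\ step w h om nz.1 nz.2).
    have [||||z' ?] := W_bisect w0 h0 _ _ _ _ st; last by exists z'.
    - exact: lt_le_trans i1.
    - exact: le_lt_trans i2 _.
    - exact: lt_le_trans i3.
    - exact: le_lt_trans i4 _.
  by exists nz.2 => ib st; case: no.
have [F HF] := choice next.
pose s := fix s n := if n is m.+1 then F (m, s m) else (a, c).
have sP n : inbox a b c d w h n (s n) /\ step w h om n (s n).
  elim: n => [|n [ib st]].
    rewrite /inbox /step /= !expr0 !divr1 /w /h ![_ + (_ - _)]addrC !subrK omE.
    by split => //; split.
  have [F1 F2 F3 F4 F5] := HF (n, s n) ib st; case: ib => i1 i2 i3 i4.
  split => //; split => /=.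
  - exact: le_trans i1 F1.
  - exact: le_trans F2 i2.
  - exact: le_trans i3 F3.
  - exact: le_trans F4 i4.
have sM n := HF (n, s n) (sP n).1 (sP n).2.
have [x xP] : exists x, forall n, (s n).1 <= x <= (s n).1 + w / 2 ^+ n.
  by apply: (@nested (fun n => (s n).1)) => // n; have [] := sM n.
have [y yP] : exists y, forall n, (s n).2 <= y <= (s n).2 + h / 2 ^+ n.
  by apply: (@nested (fun n => (s n).2)) => // n; have [] := sM n.
by exists s, x, y => n; have [ib st] := sP n; split.
Qed.

(** With [L] the half-perimeter, the invariant and [circulation_small] give
    [om / 4 ^ n <= 2 eps (L / 2 ^ n) ^ 2]; the powers cancel and [eps = e / (1 + 2 L ^ 2)] leaves
    [om <= e]. *)
Theorem goursat a b c d : - T < a -> a <= b -> b < T -> - T < c -> c <= d -> d < T ->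
  W a b c d = 0.
Proof.
move=> aT ab bT cT cd dT; apply/eqP; rewrite -normr_le0; apply/ler_addgt0Pr => e e0; rewrite add0r.
have [s [x [y sP]]] := bisection aT ab bT cT cd dT erefl.
have w0 : 0 <= b - a by rewrite subr_ge0. have h0 : 0 <= d - c by rewrite subr_ge0.
move: (b - a) w0 (d - c) h0 `|W _ _ _ _| sP => w w0 h h0 om sP.
have xT : `|x| < T.
  have [[/= i1 i2 _ _] _ xin _] := sP 0%N.
  apply: (in_box _ _ xin); first exact: lt_le_trans i1.
  exact: le_lt_trans i2 bT.
have yT : `|y| < T.
  have [[/= _ _ i1 i2] _ _ xin] := sP 0%N.
  apply: (in_box _ _ xin); first exact: lt_le_trans i1.
  exact: le_lt_trans i2 dT.
have [p [q [r [dP dQ]]]] := closed xT yT.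
pose L := w + h.
have L0 : 0 <= L by rewrite addr_ge0.
have den : 0 < 1 + 2 * L ^+ 2 by rewrite ltr_wpDr // mulr_ge0 // sqr_ge0.
have eps0 : 0 < e / (1 + 2 * L ^+ 2) by rewrite divr_gt0.
have [d1 d10 H1] := dP _ eps0; have [d2 d20 H2] := dQ _ eps0.
have dd : 0 < Num.min d1 d2 by rewrite lt_min d10.
have [n Ln] : exists n, L / 2 ^+ n < Num.min d1 d2.
  exists (Num.trunc (L / Num.min d1 d2)).+1; rewrite ltr_pdivrMr ?exprn_gt0 //.
  rewrite mulrC -ltr_pdivrMr //; apply: (lt_trans (truncnS_gt _)).
  by rewrite -natrX ltr_nat ltn_expl.
have p2 : 0 < 2 ^+ n :> R by rewrite exprn_gt0.
have [[/= i1 i2 i3 i4] st xn yn] := sP n.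
have LE : L / 2 ^+ n = w / 2 ^+ n + h / 2 ^+ n by rewrite mulrDl.
rewrite LE in Ln.
have small := @circulation_small _ _ _ _ x y p q r _ (Num.min d1 d2) _ _ _ _ _ _ xn yn eps0 Ln.
have {}st := le_trans st (small _ _ _ _ _ _ _ _).
have : om / 4 ^+ n <= 2 * (e / (1 + 2 * L ^+ 2) * (L / 2 ^+ n)) * (L / 2 ^+ n).
  rewrite LE; apply: st.
  - by rewrite divr_ge0 // ltW.
  - by rewrite divr_ge0 // ltW.
  - exact: lt_le_trans i1.
  - exact: le_lt_trans i2 bT.
  - exact: lt_le_trans i3.
  - exact: le_lt_trans i4 dT.
  - by move=> k1 k2; rewrite !lt_min => /andP[a1 _] /andP[a2 _]; exact: H1.
  - by move=> k1 k2; rewrite !lt_min => /andP[_ a1] /andP[_ a2]; exact: H2.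
have -> : (4 : R) ^+ n = 2 ^+ n * 2 ^+ n by rewrite -exprMn -natrM.
rewrite [leRHS](_ : _ = 2 * L ^+ 2 * (e / (1 + 2 * L ^+ 2)) / (2 ^+ n * 2 ^+ n)); last first.
  by field; rewrite !gt_eqF.
rewrite ler_pM2r ?invr_gt0 ?mulr_gt0 // => om4; apply: (le_trans om4).
rewrite mulrCA ler_piMr ?(ltW e0) // ler_pdivrMr // mul1r lerDr //.
Qed.

End goursat.

Section primitive.
Variable R : realType.
Local Notation C := R[i].
Local Notation Re := complex.Re.
Local Notation Im := complex.Im.
Local Notation I := (@itv_integral R).

Lemma itv_integral_derive (f : R -> R) (a x u : R) : a < x -> x < u ->
  {within `[a, u], continuous f} -> is_derive x 1 (fun t => I a t f) (f x).
Proof.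
move=> ax xu cf.
have cx : {for x, continuous f}.
  by apply: (within_continuous_continuous (lt_trans ax xu) cf); rewrite in_itv /= ax.
have [d1 d2] := @continuous_FTC1_closed R f a x u xu (itv_integrable cf) ax cx.
by apply: DeriveDef; [exact: d1|rewrite -derive1E].
Qed.

Section potential.
Variables (P Q : R -> R -> R) (T a : R).
Hypotheses (a0 : 0 < a) (aT : a < T).
Hypothesis closed : forall x y : R, `|x| < T -> `|y| < T ->
  exists p q r, rdiff P x y p q /\ rdiff Q x y q r.

Let contP y : `|y| < T -> {within `[(- a), a], continuous (P^~ y)}.
Proof.
move=> yT; apply: continuous_in_subspaceT => x; rewrite inE /= in_itv /= => /andP[x1 x2].
have xT : `|x| < T by rewrite (le_lt_trans _ aT) // ler_norml x1.
by have [p [q [r [/rdiff_continuous]]]] := closed xT yT.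
Qed.

Let contQ x : `|x| < T -> {within `[(- a), a], continuous (Q x)}.
Proof.
move=> xT; apply: continuous_in_subspaceT => y; rewrite inE /= in_itv /= => /andP[x1 x2].
have yT : `|y| < T by rewrite (le_lt_trans _ aT) // ler_norml x1.
by have [p [q [r [_ /rdiff_swap/rdiff_continuous]]]] := closed xT yT.
Qed.

(** [U] integrates the form from the corner [(-a, -a)], first along the bottom and then upwards,
    which makes the y-derivative immediate. By [goursat] the path that goes up first gives the same
    value, and it shows the x-derivative. *)
Lemma potential : exists U : R -> R -> R, forall x y : R, `|x| < a -> `|y| < a ->
  is_derive x 1 (U^~ y) (P x y) /\ is_derive y 1 (U x) (Q x y).
Proof.
have aT' : `|- a| < T by rewrite normrN gtr0_norm.
exists (fun x y => I (- a) x (P^~ (- a)) + I (- a) y (Q x)) => x y xa ya.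
have xT := lt_trans xa aT; have yT := lt_trans ya aT.
move: (xa) (ya); rewrite !ltr_norml => /andP[x1 x2] /andP[y1 y2].
have g x' : - a < x' -> x' < a -> I (- a) x' (P^~ (- a)) + I (- a) y (Q x') =
    I (- a) y (Q (- a)) + I (- a) x' (P^~ y).
  move=> h1 h2; have := @goursat R P Q T closed (- a) x' (- a) y.
  rewrite /circulation => /(_ _ _ _ _ _ _) H; apply/eqP; rewrite -subr_eq0.
  have naT : - T < - a by rewrite ltrN2.
  rewrite -[X in _ == X]H ?(ltW h1) ?(ltW y1) ?(lt_trans h2) ?(lt_trans y2) //.
  by apply/eqP; ring.
split; last first.
  have d1 := itv_integral_derive y1 y2 (contQ xT).
  have d2 := @is_derive_cst R R R (I (- a) x (P^~ (- a))) y 1.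
  by have := is_deriveD d2 d1; rewrite add0r.
have d1 := itv_integral_derive x1 x2 (contP yT).
have d2 := @is_derive_cst R R R (I (- a) y (Q (- a))) x 1.
have := is_deriveD d2 d1; rewrite add0r; apply: near_eq_is_derive.
have : \forall t \near x, t \in `]- a, a[.
  by apply: near_in_itvoo; rewrite in_itv /= x1.
by apply: filterS => t; rewrite in_itv /= => /andP[t1 t2]; rewrite /= g.
Qed.

End potential.

Lemma has_cderiv_rdiff (f : C -> C) (x y : R) l : has_cderiv f (x +i* y)%C l ->
  rdiff (fun x y => Re (f (x +i* y)%C)) x y (Re l) (- Im l) /\
  rdiff (fun x y => Im (f (x +i* y)%C)) x y (Im l) (Re l).
Proof.
move=> H; suff K : forall e : R, 0 < e -> exists2 d : R, 0 < d & forall h k : R, `|h| < d -> `|k| < d ->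
    normc (f ((x + h) +i* (y + k))%C - f (x +i* y)%C - l * (h +i* k)%C) <= e * (`|h| + `|k|).
  split=> e /K[d d0 Hd]; exists d => // h k hd kd; apply: le_trans (Hd h k hd kd).
    apply: le_trans (Re_le_normc _); rewrite !ReImE /= le_eqVlt; apply/orP; left.
    by apply/eqP; congr `|_|; ring.
  apply: le_trans (Im_le_normc _); rewrite !ReImE /= le_eqVlt; apply/orP; left.
  by apply/eqP; congr `|_|; ring.
move=> e e0; have [d d0 Hd] := H e e0; exists (d / 2); first by rewrite divr_gt0.
move=> h k hd kd; have nhk : normc (h +i* k)%C <= `|h| + `|k| by exact: normc_le_ReIm.
have := Hd (h +i* k)%C; have -> : (x +i* y)%C + (h +i* k)%C = ((x + h) +i* (y + k))%C by [].
move=> H1; apply: (le_trans (H1 _)); last by rewrite ler_pM2l.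
by apply: (le_lt_trans nhk); lra.
Qed.

Lemma rdiffN (u : R -> R -> R) (x y p q : R) :
  rdiff u x y p q -> rdiff (fun x y => - u x y) x y (- p) (- q).
Proof.
move=> H e e0; have [d d0 Hd] := H e e0; exists d => // h k hd kd.
by apply: le_trans (Hd h k hd kd); rewrite -normrN le_eqVlt; apply/orP; left;
   apply/eqP; congr `|_|; ring.
Qed.

(** The real and imaginary parts of [f dz] are closed forms by Cauchy-Riemann. Their potentials [U]
    and [V] have the components of [f] as partials, and these are continuous because [f] is
    differentiable. *)
Lemma primitive_exists (f : C -> C) (T a : R) : 0 < a -> a < T ->
  (forall z, `|Re z| < T -> `|Im z| < T -> exists l, has_cderiv f z l) ->
  exists F : C -> C, forall z, `|Re z| < a -> `|Im z| < a -> has_cderiv F z (f z).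
Proof.
move=> a0 aT df.
have [|U HU] := @potential (fun x y => Re (f (x +i* y)%C)) (fun x y => - Im (f (x +i* y)%C)) T a a0 aT.
  move=> x y xT yT; have [l /has_cderiv_rdiff[H1 H2]] := df (x +i* y)%C xT yT.
  by exists (Re l), (- Im l), (- Re l); split => //; exact: rdiffN.
have [|V HV] := @potential (fun x y => Im (f (x +i* y)%C)) (fun x y => Re (f (x +i* y)%C)) T a a0 aT.
  move=> x y xT yT; have [l /has_cderiv_rdiff[H1 H2]] := df (x +i* y)%C xT yT.
  by exists (Im l), (Re l), (- Im l).
exists (fun w => (U (Re w) (Im w) +i* V (Re w) (Im w))%C) => z za zb.
have [l Hl] := df z (lt_trans za aT) (lt_trans zb aT).
pose r := Num.min (a - `|Re z|) (a - `|Im z|).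
have r0 : 0 < r by rewrite lt_min !subr_gt0 za.
have -> : f z = (Re (f (Re z +i* Im z)%C) +i* Im (f (Re z +i* Im z)%C))%C.
  by case: z {za zb Hl r r0} => x y /=; case: (f _).
apply: (@CR_has_cderiv R U V (fun x y => Re (f (x +i* y)%C)) (fun x y => Im (f (x +i* y)%C)) z r r0).
  move=> x y; rewrite !lt_min => /andP[x1 _] /andP[_ y1].
  have xa : `|x| < a by rewrite -(subrK (Re z) x) (le_lt_trans (ler_normD _ _)) // -ltrBrDr.
  have ya : `|y| < a by rewrite -(subrK (Im z) y) (le_lt_trans (ler_normD _ _)) // -ltrBrDr.
  by have [U1 U2] := HU x y xa ya; have [V1 V2] := HV x y xa ya; split.
move=> e e0; have [d d0 Hd] := has_cderiv_ccont Hl e0.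
exists (d / 2); first by rewrite divr_gt0.
move=> x y xd yd; have /Hd : normc ((x +i* y)%C - z) < d.
  by rewrite (le_lt_trans (normc_le_ReIm _)) // !ReImE /=; lra.
have -> : (Re z +i* Im z)%C = z by case: (z).
move=> H; rewrite -!cReN -!cReD -!cImN -!cImD.
by split; apply: ltW; apply: le_lt_trans H; [exact: Re_le_normc|exact: Im_le_normc].
Qed.

End primitive.

(** * Complex powers *)

Section complex_power.
Variable R : realType.
Local Notation C := R[i].
Local Notation Re := complex.Re.
Local Notation Im := complex.Im.
Implicit Types (z w : C) (s t : R).

Lemma normc_cis t : normc (cis t) = 1.
Proof. by rewrite /= cos2Dsin2 sqrtr1. Qed.

Lemma cisD t s : cis (t + s) = cis t * cis s.
Proof. by apply: complexP; rewrite ?ReImE /= ?cosD ?sinD; ring. Qed.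

Lemma normc_Re_gt0 z : 0 < Re z -> 0 < normc z.
Proof. by move=> h; apply: lt_le_trans h _; apply: le_trans (Re_le_normc z); exact: ler_norm. Qed.

Lemma normc_cpow z s : normc (cpow z s) = normc z `^ s.
Proof. by rewrite normcM normcR normc_cis mulr1 ger0_norm // powR_ge0. Qed.

Lemma atan_angle z : 0 < Re z ->
  cos (atan (Im z / Re z)) = Re z / normc z /\ sin (atan (Im z / Re z)) = Im z / normc z.
Proof.
move=> x0; have nz := normc_Re_gt0 x0.
have c : cos (atan (Im z / Re z)) = Re z / normc z.
  rewrite cos_atan.
  have -> : 1 + (Im z / Re z) ^+ 2 = (normc z / Re z) ^+ 2.
    by rewrite [in RHS]expr_div_n normc_sqr; field; rewrite gt_eqF.
  by rewrite sqrtr_sqr gtr0_norm ?divr_gt0 // invf_div.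
split => //.
have cn : cos (atan (Im z / Re z)) != 0 by rewrite c gt_eqF ?divr_gt0.
have : tan (atan (Im z / Re z)) = Im z / Re z by exact: atanK.
move=> /(congr1 (fun u => u * cos (atan (Im z / Re z)))); rewrite /tan divfK // => ->.
by rewrite c; field; rewrite !gt_eqF.
Qed.

(** On the right half-plane the principal argument is a smooth function. All bases of powers met
    below lie there, so the branch cut is never approached. *)
Lemma carg_atan z : 0 < Re z -> carg z = atan (Im z / Re z).
Proof.
move=> x0; have nz := normc_Re_gt0 x0; have [c s] := atan_angle x0.
have := atan_gtNpi2 (Im z / Re z); have := atan_ltpi2 (Im z / Re z).
rewrite /carg -c; move: (atan _) c s => phi c s p1 p2.
have pi0 := pi_gt0 R.
case: ifP => y0.
  have [phi0|phi0] := leP 0 phi; first by rewrite cosK // in_itv /=; apply/andP; split; lra.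
  have : 0 < sin (- phi) by apply: sin_gt0_pi; apply/andP; split; lra.
  by rewrite sinN oppr_gt0 s ltNge divr_ge0 // ltW.
have [phi0|phi0] := leP phi 0; first by rewrite cosKN ?opprK //; apply/andP; split; lra.
have : 0 < sin phi by apply: sin_gt0_pi; apply/andP; split; lra.
by rewrite s pmulr_lgt0 ?invr_gt0 // => /ltW; rewrite y0.
Qed.

Lemma cis_carg z : 0 < Re z -> (normc z)%:C%C * cis (carg z) = z.
Proof.
move=> x0; have nz := normc_Re_gt0 x0; have [c s] := atan_angle x0.
rewrite /cis carg_atan // c s; apply: complexP; rewrite ?ReImE /=; field; exact: lt0r_neq0.
Qed.

Lemma cpowS z s : 0 < Re z -> cpow z (s + 1) = cpow z s * z.
Proof.
move=> x0; have nz := normc_Re_gt0 x0; rewrite -[X in _ * X](cis_carg x0) /cpow.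
rewrite powRD; last by apply/implyP => _; rewrite gt_eqF.
by rewrite powRr1 ?normc_ge0 // mulrDl mul1r cisD realcM; ring.
Qed.

Lemma cpowJ z s : 0 < Re z -> cpow (z^*)%C s = ((cpow z s)^*)%C.
Proof.
move=> x0; have x0' : 0 < Re (z^*)%C by case: z x0.
rewrite /cpow normcJ !carg_atan //.
have -> : Im (z^*)%C / Re (z^*)%C = - (Im z / Re z) by case: (z) => a b /=; rewrite mulNr.
by rewrite atanN mulrN /cis cosN sinN; apply: complexP; rewrite ?ReImE /= ?ReImE /=; ring.
Qed.

Lemma cpow_real r s : 0 < r -> cpow r%:C%C s = (r `^ s)%:C%C.
Proof.
move=> r0; rewrite /cpow normcR gtr0_norm // carg_atan //= mul0r atan0 mulr0.
by rewrite /cis cos0 sin0 -[RHS]mulr1.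
Qed.

Lemma normc_eq_cpow z s : 0 < Re z -> cpow z s != 0.
Proof. by move=> z0; rewrite -normc_gt0 normc_cpow powR_gt0 // normc_Re_gt0. Qed.

Definition cexp z : C := (expR (Re z))%:C%C * cis (Im z).

Lemma cont2_mul (f g : R -> R) (x0 y0 : R) : {for x0, continuous f} -> {for y0, continuous g} ->
  forall e : R, 0 < e -> exists2 d : R, 0 < d & forall x y : R, `|x - x0| < d -> `|y - y0| < d ->
    `|f x * g y - f x0 * g y0| <= e.
Proof.
move=> cf cg e e0.
pose F := 1 + `|f x0|; pose G := 1 + `|g y0|.
have F0 : 0 < F by rewrite ltr_wpDr. have G0 : 0 < G by rewrite ltr_wpDr.
pose e1 := Num.min 1 (e / (F + G)).
have e10 : 0 < e1 by rewrite lt_min ltr01 divr_gt0 // addr_gt0.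
have e11 : e1 <= 1 by rewrite /e1 ge_min lexx.
have e1FG : e1 <= e / (F + G) by rewrite /e1 ge_min lexx orbT.
rewrite (ler_pdivlMr _ _ (addr_gt0 F0 G0)) in e1FG.
clearbody e1.
have /cvgrPdist_lt /(_ _ e10) := cf; rewrite -nbhs_nearE => /nbhs_ballP[d1 /= d10 H1].
have /cvgrPdist_lt /(_ _ e10) := cg; rewrite -nbhs_nearE => /nbhs_ballP[d2 /= d20 H2].
exists (Num.min d1 d2); first by rewrite lt_min d10.
move=> x y; rewrite !lt_min => /andP[xd _] /andP[_ yd].
have {}H1 : `|f x - f x0| < e1 by rewrite distrC; apply: (H1 x); rewrite -ball_normE /= distrC.
have {}H2 : `|g y - g y0| < e1 by rewrite distrC; apply: (H2 y); rewrite -ball_normE /= distrC.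
have -> : f x * g y - f x0 * g y0 = (f x - f x0) * (g y - g y0) + (f x - f x0) * g y0
  + f x0 * (g y - g y0) by ring.
apply: le_trans e1FG.
apply: (le_trans (ler_normD _ _)); apply: (le_trans (lerD (ler_normD _ _) (lexx _))).
rewrite !normrM.
have := normr_ge0 (f x0); have := normr_ge0 (g y0).
have := normr_ge0 (f x - f x0); have := normr_ge0 (g y - g y0); rewrite /F /G; nra.
Qed.

Lemma has_cderiv_cexp z : has_cderiv cexp z (cexp z).
Proof.
pose u (x y : R) := expR x * cos y; pose v (x y : R) := expR x * sin y.
have E w : cexp w = (u (Re w) (Im w) +i* v (Re w) (Im w))%C.
  by apply: complexP; rewrite /cexp ?ReImE /= /u /v; ring.
rewrite E; apply: (@has_cderiv_ext _ (fun w => (u (Re w) (Im w) +i* v (Re w) (Im w))%C)).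
  by move=> w; rewrite E.
apply: (@CR_has_cderiv R u v u v z 1 ltr01).
  move=> x y _ _; rewrite /u /v; split; apply: is_derive_eq;
    rewrite /GRing.scale /= ?mulr0 ?mulr1 ?addr0 ?add0r; ring.
move=> e e0.
have [d1 d10 H1] := @cont2_mul expR cos (Re z) (Im z) (@continuous_expR R (Re z)) (@continuous_cos R (Im z)) e e0.
have [d2 d20 H2] := @cont2_mul expR sin (Re z) (Im z) (@continuous_expR R (Re z)) (@continuous_sin R (Im z)) e e0.
exists (Num.min d1 d2); first by rewrite lt_min d10.
by move=> x y; rewrite !lt_min => /andP[a1 a2] /andP[b1 b2]; split; [exact: H1|exact: H2].
Qed.

Definition clog z : C := (ln (normc z) +i* atan (Im z / Re z))%C.

Lemma cpowE z s : 0 < Re z -> cpow z s = cexp (s%:C%C * clog z).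
Proof.
move=> z0; have nz := normc_Re_gt0 z0.
rewrite /cpow /cexp carg_atan // !ReImE /= !mul0r subr0 addr0.
by rewrite /powR gt_eqF.
Qed.

Lemma has_cderiv_clog z : 0 < Re z -> has_cderiv clog z z^-1.
Proof.
move=> z0; have nz := normc_Re_gt0 z0; have zn0 : z != 0 by rewrite -normc_gt0.
pose u (x y : R) := ln (x ^+ 2 + y ^+ 2) / 2; pose v (x y : R) := atan (y / x).
pose p (x y : R) := Re ((x +i* y)%C)^-1; pose q (x y : R) := Im ((x +i* y)%C)^-1.
have -> : z^-1 = (p (Re z) (Im z) +i* q (Re z) (Im z))%C.
  by rewrite /p /q; case: (z) => a b /=; rewrite -[LHS]/(_ +i* _)%C.
apply: (@has_cderiv_near _ (fun w => (u (Re w) (Im w) +i* v (Re w) (Im w))%C) _ _ _ (Re z)) => //.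
  move=> w wz; have w0 : 0 < Re w.
    have := le_lt_trans (Re_le_normc _) wz; rewrite !ReImE ltr_norml; lra.
  congr (_ +i* _)%C; rewrite /u -normc_sqr lnXn ?normc_Re_gt0 //.
  by rewrite -[_ *+ 2]mulr_natl; field.
apply: (@CR_has_cderiv R u v p q z (Re z)) => //.
  move=> x y xz _; have x0 : 0 < x by move: xz; rewrite ltr_norml; lra.
  have xy0 : 0 < x ^+ 2 + y ^+ 2 by rewrite ltr_pwDl ?exprn_gt0 ?sqr_ge0.
  have xn0 : x != 0 by rewrite gt_eqF.
  have D1 : is_derive (x ^+ 2 + y ^+ 2) (1 : R) (@ln R) (x ^+ 2 + y ^+ 2)^-1 by exact: is_derive1_ln.
  have I1 : is_derive x (1 : R) (fun s : R => s ^+ 2 + y ^+ 2) (2 * x).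
    by apply: is_derive_eq; rewrite /GRing.scale /=; ring.
  have I2 : is_derive y (1 : R) (fun s : R => x ^+ 2 + s ^+ 2) (2 * y).
    by apply: is_derive_eq; rewrite /GRing.scale /=; ring.
  have I3 : is_derive x (1 : R) (fun s : R => y / s) (- y / x ^+ 2).
    have := is_deriveV (f := id) xn0 (is_derive_id x 1) => DV.
    by apply: is_derive_eq; rewrite /GRing.scale /=; field.
  have I4 : is_derive y (1 : R) (fun s : R => s / x) (x^-1).
    by apply: is_derive_eq; rewrite /GRing.scale /=; ring.
  have C1 := @is_derive1_comp R (@ln R) (fun s : R => s ^+ 2 + y ^+ 2) x _ _ D1 I1.
  have C2 := @is_derive1_comp R (@ln R) (fun s : R => x ^+ 2 + s ^+ 2) y _ _ D1 I2.
  have C3 := @is_derive1_comp R (@atan R) (fun s : R => y / s) x _ _ (is_derive1_atan (y / x)) I3.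
  have C4 := @is_derive1_comp R (@atan R) (fun s : R => s / x) y _ _ (is_derive1_atan (y / x)) I4.
  have n1 : 1 + (y / x) ^+ 2 != 0 by rewrite gt_eqF // ltr_pwDl ?sqr_ge0.
  have n2 := lt0r_neq0 xy0.
  have n3 : (y / x) ^+ 2 + 1 != 0 by rewrite addrC.
  rewrite /u /v /p /q /=; split.
  - have C1' : is_derive x (1 : R) (fun s => ln (s ^+ 2 + y ^+ 2)) _ := C1.
    by apply: is_derive_eq; rewrite /GRing.scale /=; field.
  - have C2' : is_derive y (1 : R) (fun s => ln (x ^+ 2 + s ^+ 2)) _ := C2.
    by apply: is_derive_eq; rewrite /GRing.scale /=; field.
  - by apply: is_derive_eq C3 _; field; rewrite ?n2 ?xn0 // addrC.
  - by apply: is_derive_eq C4 _; field; rewrite ?n2 ?xn0 // addrC.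
move=> e e0; have [d d0 Hd] := has_cderiv_ccont (has_cderivV zn0) e0.
exists (d / 2); first by rewrite divr_gt0.
move=> x y xd yd; have /Hd : normc ((x +i* y)%C - z) < d.
  by rewrite (le_lt_trans (normc_le_ReIm _)) // !ReImE /=; lra.
rewrite /p /q; have -> : (Re z +i* Im z)%C = z by case: (z).
move=> H; rewrite -!cReN -!cReD -!cImN -!cImD.
by split; apply: ltW; apply: le_lt_trans H; [exact: Re_le_normc|exact: Im_le_normc].
Qed.

Lemma has_cderiv_cpow z s : 0 < Re z -> has_cderiv (fun w => cpow w s) z (s%:C%C * cpow z s / z).
Proof.
move=> z0; have H := has_cderiv_comp (has_cderivZ s%:C%C (has_cderiv_clog z0)) (has_cderiv_cexp _).
rewrite [X in has_cderiv _ _ X](_ : _ = cexp (s%:C%C * clog z) * (s%:C%C * z^-1)); last first.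
  by rewrite -cpowE //; ring.
apply: (has_cderiv_near z0) H => //.
move=> w wz; rewrite cpowE //.
have := le_lt_trans (Re_le_normc _) wz; rewrite !ReImE ltr_norml; lra.
Qed.

Lemma has_cderiv_cpowV z s : 0 < Re z ->
  has_cderiv (fun w => (cpow w s)^-1) z (- s%:C%C / (cpow z s * z)).
Proof.
move=> z0; have zn0 : z != 0 by rewrite -normc_gt0 normc_Re_gt0.
have c0 := normc_eq_cpow s z0.
have H := has_cderiv_comp (has_cderiv_cpow s z0) (has_cderivV c0).
rewrite [X in has_cderiv _ _ X](_ : _ = - cpow z s ^- 2 * (s%:C%C * cpow z s / z)); last first.
  by field; rewrite zn0 c0.
exact: H.
Qed.

End complex_power.

(** * The Cauchy-Pompeiu argument on the disc *)

Section stokes.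
Variable R : realType.
Local Notation C := R[i].
Local Notation Re := complex.Re.
Local Notation Im := complex.Im.
Local Notation area := (@area R).
Local Notation lambda := (@lebesgue_measure R).
Local Notation RL := (g_sigma_algebraType R.-ocitv.-measurable).

Lemma ccont_bounded (f : C -> C) (T : R) :
  (forall z, `|Re z| <= T -> `|Im z| <= T -> ccont f z) ->
  exists2 M : R, 0 < M & forall z, `|Re z| <= T -> `|Im z| <= T -> normc (f z) <= M.
Proof.
move=> cf.
pose A := ([set` `[(- T), T]] `*` [set` `[(- T), T]] : set (R * R)).
have cA : compact A by apply: compact_setX; exact: segment_compact.
pose g (p : R * R) : R := normc (f (p.1 +i* p.2)%C).
have cg : {within A, continuous g}.
  apply: continuous_in_subspaceT => p /set_mem [/=]; rewrite !in_itv /= => xT yT.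
  have := cf (p.1 +i* p.2)%C; rewrite /= !ler_norml => /(_ xT yT) H.
  apply/cvgrPdist_lt => e e0; have [d d0 Hd] := H e e0.
  rewrite -nbhs_nearE; exists (ball p.1 (d / 2), ball p.2 (d / 2)).
    by split; apply: nbhsx_ballx; rewrite divr_gt0.
  move=> q [/= xd yd]; rewrite -ball_normE /= in xd; rewrite -ball_normE /= in yd; rewrite /g /=.
  rewrite distrC; apply: le_lt_trans (Hd (q.1 +i* q.2)%C _).
    rewrite ler_norml normc_sub_ge andbT lerNl opprB normcBC; exact: normc_sub_ge.
  apply: (le_lt_trans (normc_le_ReIm _)); rewrite !ReImE /= [d]splitr ltrD //; by rewrite distrC.
have [M [_ HM]] := compact_bounded (continuous_compact cg cA).
exists (`|M| + 1); first by rewrite ltr_pwDr.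
move=> z zx zy; have := HM (`|M| + 1); rewrite (le_lt_trans (ler_norm M)) ?ltrDl // => /(_ isT).
move=> /(_ (g (Re z, Im z))); rewrite /g /= ger0_norm ?normc_ge0 //.
have -> : (Re z +i* Im z)%C = z by case: (z).
by apply; exists (Re z, Im z) => //=; [split; rewrite /= in_itv /= -ler_norml|case: (z)].
Qed.

Lemma FTC_zero (u h : R -> R) : (forall x : R, is_derive x 1 u (h x)) -> continuous h ->
  (forall x : R, 2 <= `|x| -> h x = 0) -> u 2 = u (- 2) ->
  (\int[lambda]_x (h x)%:E = 0)%E.
Proof.
move=> du ch h0 u2.
have -> : (\int[lambda]_x (h x)%:E = \int[lambda]_(x in [set` `[(- 2)%R : R, 2%R : R]]) (h x)%:E)%E.
  rewrite [RHS]integral_mkcond; apply: eq_integral => x _; rewrite patchE.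
  case: ifPn => //; rewrite notin_setE /= in_itv /= -ler_norml => /negP; rewrite -ltNge => /ltW.
  by move=> /h0 ->.
have cu : continuous u.
  by move=> x; apply/differentiable_continuous/derivable1_diffP; have [] := du x.
rewrite (@continuous_FTC2 _ _ u) //; first by rewrite -EFinB u2 subrr.
- by apply: (@lt_trans _ _ (0 : R)); rewrite ?oppr_lt0.
- exact: continuous_subspaceT.
- split; [by move=> x _; have [] := du x|by apply: cvg_at_right_filter; exact: cu|].
  by apply: cvg_at_left_filter; exact: cu.
- by move=> x _; rewrite derive1E; have [] := du x.
Qed.

Lemma bounded_integrable (f : RL * RL -> R) (M : R) : measurable_fun setT f ->
  (forall p, `|f p| <= M) -> (forall p, 2 <= `|p.1| \/ 2 <= `|p.2| -> f p = 0) ->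
  (lambda \x lambda)%E.-integrable setT (EFin \o f).
Proof.
move=> mf fM f0.
pose Q : set (RL * RL) := [set` `[(- 2)%R : R, 2%R : R]] `*` [set` `[(- 2)%R : R, 2%R : R]].
have mQ : measurable Q by apply: measurableX; exact: measurable_itv.
have LQ : ((lambda \x lambda) Q < +oo)%E.
  have L : lambda [set` `[(- 2)%R : R, 2%R : R]] = (2 - - 2)%:E.
    by rewrite lebesgue_measure_itv /= lte_fin ifT ?EFinB // (@lt_trans _ _ (0 : R)) ?oppr_lt0.
  rewrite product_measure1E; try exact: measurable_itv.
  by rewrite [X in (X < _)%E](_ : _ = ((2 - - 2) * (2 - - 2))%:E) ?ltry // EFinM; congr (_ * _)%E.
have iQ : (lambda \x lambda)%E.-integrable setT (EFin \o (fun p => M * \1_Q p)).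
  have h : (lambda \x lambda)%E.-integrable setT (fun p => (\1_Q p : R)%:E).
    apply/integrableP; split; first by apply/measurable_EFinP; exact: measurable_indic.
    under eq_integral do rewrite gee0_abs ?lee_fin //.
    by rewrite integral_indic // setIT; exact: LQ.
  by have := integrableZl measurableT M h; apply: eq_integrable.
apply: le_integrable iQ => //; first exact/measurable_EFinP.
move=> p _; rewrite /= lee_fin indicE; case: (boolP (p \in Q)) => pQ.
  by rewrite mulr1 (le_trans (fM p)) // ler_norm.
rewrite f0 ?normr0 //; apply: contrapT => /not_orP [/negP + /negP].
rewrite -!ltNge => a b; move/negP: pQ; apply; rewrite inE; split => /=.
  by rewrite in_itv /= -ler_norml ltW.
by rewrite in_itv /= -ler_norml ltW.
Qed.

(** Transfers a vanishing integral of a signed function: [area_ge0_integral] covers nonnegative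
    integrands only, but here the positive and negative parts have equal finite integrals. *)
Lemma area_integral_pair (f : C -> R) (M : R) : measurable_fun setT f ->
  (forall z, `|f z| <= M) -> (forall z, 2 <= `|Re z| \/ 2 <= `|Im z| -> f z = 0) ->
  (\int[lambda \x lambda]_p (f (complex_of_pair p))%:E = 0)%E ->
  (\int[area]_z (f z)%:E = 0)%E.
Proof.
move=> mf fM f0 int0.
have mf2 : measurable_fun setT (f \o @complex_of_pair R : RL * RL -> R).
  by apply: measurableT_comp => //; exact: measurable_complex_of_pairL.
have if2 : (lambda \x lambda)%E.-integrable setT (EFin \o (f \o @complex_of_pair R)).
  apply: (@bounded_integrable _ M) => // [p|p h]; first exact: fM.
  by rewrite /= f0 //; case: p h.
have mfE : measurable_fun setT (EFin \o f) by exact/measurable_EFinP.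
rewrite integralE !area_ge0_integral //; [|exact: measurable_funeneg|exact: measurable_funepos].
move: int0; rewrite integralE /= => h; rewrite preimage_setT.
have finB : (\int[lambda \x lambda]_x (EFin \o (f \o @complex_of_pair R))^\- x \is a fin_num)%E.
  exact: integrable_neg_fin_num.
have E : (\int[lambda \x lambda]_x (EFin \o (f \o @complex_of_pair R))^\+ x =
    \int[lambda \x lambda]_x (EFin \o (f \o @complex_of_pair R))^\- x)%E.
  by rewrite -[LHS](@subeK _ _ _ finB) [X in (X + _)%E]h add0e.
transitivity ((pi^-1)%:E * \int[lambda \x lambda]_x (EFin \o (f \o @complex_of_pair R))^\+ x
  - (pi^-1)%:E * \int[lambda \x lambda]_x (EFin \o (f \o @complex_of_pair R))^\- x)%E.
  by congr (_ * _ - _ * _)%E; apply: eq_integral => p _; rewrite ?funeposE ?funenegE.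
by rewrite E subee // fin_numM.
Qed.

Lemma area_FTC_x (u h : C -> R) (M : R) : measurable_fun setT h ->
  (forall z, `|h z| <= M) -> (forall z, 2 <= `|Re z| \/ 2 <= `|Im z| -> h z = 0) ->
  (forall y, u (2 +i* y)%C = u (- 2 +i* y)%C) ->
  (forall x y : R, is_derive x 1 (fun s => u (s +i* y)%C) (h (x +i* y)%C)) ->
  (forall y, continuous (fun x : R => h (x +i* y)%C)) ->
  (\int[area]_z (h z)%:E = 0)%E.
Proof.
move=> mh hM h0 u2 du ch; apply: (@area_integral_pair _ M) => //.
have ih : (lambda \x lambda)%E.-integrable setT (EFin \o (h \o @complex_of_pair R)).
  apply: (@bounded_integrable _ M) => [|p|[x y] hp]; [|exact: hM|exact: h0].
  by apply: measurableT_comp => //; exact: measurable_complex_of_pairL.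
rewrite -[LHS](integral21_prod_meas1 ih) /fubini_G.
under eq_integral => y _.
  rewrite (@FTC_zero (fun s => u (s +i* y)%C) (fun s => h (s +i* y)%C)) //.
    over.
  by move=> x x2; apply: h0; left.
by rewrite integral0.
Qed.

Lemma area_FTC_y (u h : C -> R) (M : R) : measurable_fun setT h ->
  (forall z, `|h z| <= M) -> (forall z, 2 <= `|Re z| \/ 2 <= `|Im z| -> h z = 0) ->
  (forall x, u (x +i* 2)%C = u (x +i* (- 2))%C) ->
  (forall x y : R, is_derive y 1 (fun s => u (x +i* s)%C) (h (x +i* y)%C)) ->
  (forall x, continuous (fun y : R => h (x +i* y)%C)) ->
  (\int[area]_z (h z)%:E = 0)%E.
Proof.
move=> mh hM h0 u2 du ch; apply: (@area_integral_pair _ M) => //.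
have ih : (lambda \x lambda)%E.-integrable setT (EFin \o (h \o @complex_of_pair R)).
  apply: (@bounded_integrable _ M) => [|p|[x y] hp]; [|exact: hM|exact: h0].
  by apply: measurableT_comp => //; exact: measurable_complex_of_pairL.
rewrite -[LHS](integral12_prod_meas1 ih) /fubini_F.
under eq_integral => x _.
  rewrite (@FTC_zero (fun s => u (x +i* s)%C) (fun s => h (x +i* s)%C)) //.
    over.
  by move=> y y2; apply: h0; right.
by rewrite integral0.
Qed.

(** Separate partials, since the integrands of the Stokes argument contain conjugates and cut-offs
    and have no complex derivative. *)
Definition has_dx (G : C -> C) (z l : C) : Prop :=
  is_derive (Re z) (1 : R) (fun s : R => Re (G (s +i* Im z)%C)) (Re l) /\
  is_derive (Re z) (1 : R) (fun s : R => Im (G (s +i* Im z)%C)) (Im l).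

Definition has_dy (G : C -> C) (z l : C) : Prop :=
  is_derive (Im z) (1 : R) (fun s : R => Re (G (Re z +i* s)%C)) (Re l) /\
  is_derive (Im z) (1 : R) (fun s : R => Im (G (Re z +i* s)%C)) (Im l).

Lemma has_cderiv_dx (G : C -> C) z l : has_cderiv G z l -> has_dx G z l.
Proof.
move=> H; have E (s : R) : (0 +i* Im z)%C + s%:C%C * 1 = (s +i* Im z)%C.
  by apply: complexP; rewrite ?ReImE /=; ring.
have H' : has_cderiv G ((0 +i* Im z)%C + (Re z)%:C%C * 1) l by rewrite E; case: (z) H.
have [d1 d2] := has_cderiv_line H'; rewrite mulr1 in d1 d2; split.
  by rewrite (_ : (fun s : R => _) = fun s : R => Re (G ((0 +i* Im z)%C + s%:C%C * 1))) //;
    apply/funext => s; rewrite E.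
by rewrite (_ : (fun s : R => _) = fun s : R => Im (G ((0 +i* Im z)%C + s%:C%C * 1))) //;
  apply/funext => s; rewrite E.
Qed.

Lemma has_cderiv_dy (G : C -> C) z l : has_cderiv G z l -> has_dy G z (l * 'i%C).
Proof.
move=> H; have E (s : R) : (Re z +i* 0)%C + s%:C%C * 'i%C = (Re z +i* s)%C.
  by apply: complexP; rewrite ?ReImE /=; ring.
have H' : has_cderiv G ((Re z +i* 0)%C + (Im z)%:C%C * 'i%C) l by rewrite E; case: (z) H.
have [d1 d2] := has_cderiv_line H'; split.
  by rewrite (_ : (fun s : R => _) = fun s : R => Re (G ((Re z +i* 0)%C + s%:C%C * 'i%C))) //;
    apply/funext => s; rewrite E.
by rewrite (_ : (fun s : R => _) = fun s : R => Im (G ((Re z +i* 0)%C + s%:C%C * 'i%C))) //;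
  apply/funext => s; rewrite E.
Qed.

Lemma has_dxM (F G : C -> C) z l m : has_dx F z l -> has_dx G z m ->
  has_dx (fun w => F w * G w) z (l * G z + F z * m).
Proof.
have Ez : (Re z +i* Im z)%C = z by case: (z).
move=> [F1 F2] [G1 G2]; split.
  under eq_fun do rewrite cReM.
  by apply: is_derive_eq; rewrite !ReImE !Ez /GRing.scale /=; ring.
under eq_fun do rewrite cImM.
by apply: is_derive_eq; rewrite !ReImE !Ez /GRing.scale /=; ring.
Qed.

Lemma has_dyM (F G : C -> C) z l m : has_dy F z l -> has_dy G z m ->
  has_dy (fun w => F w * G w) z (l * G z + F z * m).
Proof.
have Ez : (Re z +i* Im z)%C = z by case: (z).
move=> [F1 F2] [G1 G2]; split.
  under eq_fun do rewrite cReM.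
  by apply: is_derive_eq; rewrite !ReImE !Ez /GRing.scale /=; ring.
under eq_fun do rewrite cImM.
by apply: is_derive_eq; rewrite !ReImE !Ez /GRing.scale /=; ring.
Qed.

Lemma has_dxJ (F : C -> C) z l : has_dx F z l -> has_dx (fun w => (F w)^*%C) z (l^*)%C.
Proof.
move=> [F1 F2]; have RJ w : Re (w^*)%C = Re w by case: w.
have IJ w : Im (w^*)%C = - Im w by case: w.
split; first by under eq_fun do rewrite RJ; rewrite RJ.
by under eq_fun do rewrite IJ; rewrite IJ; exact: is_deriveN.
Qed.

Lemma has_dyJ (F : C -> C) z l : has_dy F z l -> has_dy (fun w => (F w)^*%C) z (l^*)%C.
Proof.
move=> [F1 F2]; have RJ w : Re (w^*)%C = Re w by case: w.
have IJ w : Im (w^*)%C = - Im w by case: w.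
split; first by under eq_fun do rewrite RJ; rewrite RJ.
by under eq_fun do rewrite IJ; rewrite IJ; exact: is_deriveN.
Qed.

Lemma ccont_line (G : C -> C) (z k : C) (t : R) : ccont G (z + t%:C%C * k) ->
  {for t, continuous (fun s : R => Re (G (z + s%:C%C * k)))} /\
  {for t, continuous (fun s : R => Im (G (z + s%:C%C * k)))}.
Proof.
move=> cG; suff K e : 0 < e -> exists2 d : R, 0 < d & forall s, `|t - s| < d ->
    normc (G (z + t%:C%C * k) - G (z + s%:C%C * k)) < e.
  split; apply/cvgrPdist_lt => e e0; have [d d0 Hd] := K e e0;
    rewrite -nbhs_nearE; apply/nbhs_ballP; exists d => // s /Hd.
    by apply: le_lt_trans; rewrite -cReN -cReD; exact: Re_le_normc.
  by apply: le_lt_trans; rewrite -cImN -cImD; exact: Im_le_normc.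
move=> e0; have [d d0 Hd] := cG e e0.
have k0 : 0 < 1 + normc k by rewrite ltr_wpDr ?normc_ge0.
exists (d / (1 + normc k)); first by rewrite divr_gt0.
move=> s ts; rewrite normcBC; apply: Hd.
have -> : z + s%:C%C * k - (z + t%:C%C * k) = (s - t)%:C%C * k.
  by apply: complexP; rewrite ?ReImE /=; ring.
rewrite normr_line distrC; move: ts; rewrite ltr_pdivlMr //; apply: le_lt_trans.
by rewrite ler_wpM2l // lerDr.
Qed.

Lemma cintegrable_bounded (D : set C) (h : C -> C) (M : R) : measurable D ->
  (area D < +oo)%E -> measurable_fun D h -> (forall z, D z -> normc (h z) <= M) ->
  cintegrable area D h.
Proof.
move=> mD aD mh hM; apply: (@cintegrableW _ _ _ _ _ _ (fun=> M)) => //.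
apply/integrableP; split; first exact: measurable_cst.
by rewrite integral_cst //= lte_mul_pinfty.
Qed.

(** Fubini reduces to lines, and on each line the fundamental theorem over [[-2, 2]] gives zero
    because [G] vanishes at both ends. *)
Lemma stokes (G Gx Gy : C -> C) : (forall z, has_dx G z (Gx z)) -> (forall z, has_dy G z (Gy z)) ->
  (forall z, ccont Gx z) -> (forall z, ccont Gy z) ->
  (forall z, 2 <= normc z -> [/\ G z = 0, Gx z = 0 & Gy z = 0]) ->
  [/\ cintegrable area setT Gx, cintegrable area setT Gy,
     cintegral area setT Gx = 0 & cintegral area setT Gy = 0].
Proof.
move=> dGx dGy cGx cGy G0.
have G0' z : 2 <= `|Re z| \/ 2 <= `|Im z| -> [/\ G z = 0, Gx z = 0 & Gy z = 0].
  by case=> h; apply: G0; [apply: le_trans h (Re_le_normc _)|apply: le_trans h (Im_le_normc _)].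
have bd (F : C -> C) : (forall z, ccont F z) -> (forall z, 2 <= normc z -> F z = 0) ->
    exists2 M : R, 0 <= M & forall z, normc (F z) <= M.
  move=> cF F0; have [M M0 HM] := @ccont_bounded F 2 (fun z _ _ => cF z).
  exists M; first exact: ltW.
  move=> z; have [h|h] := leP 2 (normc z); first by rewrite F0 // normc0 ltW.
  by apply: HM; apply: (le_trans _ (ltW h)); [exact: Re_le_normc|exact: Im_le_normc].
have [Mx Mx0 HMx] := bd Gx cGx (fun z h => let: And3 _ a _ := G0 z h in a).
have [My My0 HMy] := bd Gy cGy (fun z h => let: And3 _ _ a := G0 z h in a).
have ib (F : C -> C) M : (forall z, ccont F z) -> (forall z, 2 <= normc z -> F z = 0) ->
    (forall z, normc (F z) <= M) -> cintegrable area setT F.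
  move=> cF F0 FM.
  have mb := measurable_cball (0 : C) 3.
  have H : cintegrable area (cball 0 3) F.
    apply: (@cintegrable_bounded _ _ M) => //.
    - by apply: le_lt_trans (le_area_cball _ _) _; rewrite ?ltry.
    - by apply: ccont_measurable.
  have := (@cintegrable_mkcond _ _ _ area _ F mb).1 H; congr cintegrable; apply/funext => z.
  case: ifPn => //; rewrite notin_setE /cball /= subr0 => /negP; rewrite -leNgt => h.
  by rewrite F0 // (le_trans _ h) // ler_nat.
have mX := ccont_measurable (fun z (_ : setT z) => cGx z).
have mY := ccont_measurable (fun z (_ : setT z) => cGy z).
have Ez z : (Re z +i* Im z)%C = z by case: (z).
have far2 (t : R) (s : R) : 2 <= `|t| -> G (t +i* s)%C = 0 /\ G (s +i* t)%C = 0.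
  by move=> h; split; [have [|->] := G0' (t +i* s)%C; [left|]|have [|->] := G0' (s +i* t)%C; [right|]].
have n2 : 2 <= `|2 : R| /\ 2 <= `|- 2 : R| by rewrite normrN ger0_norm.
have cx (y : R) : continuous (fun x : R => Re (Gx (x +i* y)%C)) /\
    continuous (fun x : R => Im (Gx (x +i* y)%C)).
  have E (s : R) : (s +i* y)%C = (0 +i* y)%C + s%:C%C * 1 by apply: complexP; rewrite ?ReImE /=; ring.
  split; under eq_fun do rewrite E.
    by move=> x; have [] := @ccont_line Gx (0 +i* y)%C 1 x (cGx _).
  by move=> x; have [] := @ccont_line Gx (0 +i* y)%C 1 x (cGx _).
have cy (x : R) : continuous (fun y : R => Re (Gy (x +i* y)%C)) /\
    continuous (fun y : R => Im (Gy (x +i* y)%C)).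
  have E (s : R) : (x +i* s)%C = (x +i* 0)%C + s%:C%C * 'i%C by apply: complexP; rewrite ?ReImE /=; ring.
  split; under eq_fun do rewrite E.
    by move=> y; have [] := @ccont_line Gy (x +i* 0)%C 'i%C y (cGy _).
  by move=> y; have [] := @ccont_line Gy (x +i* 0)%C 'i%C y (cGy _).
split.
- by apply: ib HMx => // z /G0[].
- by apply: ib HMy => // z /G0[].
- apply: complexP => /=.
    rewrite [X in fine X](_ : _ = 0%E) //.
    refine (@area_FTC_x (fun z => Re (G z)) (fun z => Re (Gx z)) Mx (measurable_funRe mX) _ _ _ _ _).
    + by move=> z; rewrite (le_trans (Re_le_normc _)).
    + by move=> z /G0'[_ -> _].
    + by move=> y; rewrite (far2 2 y n2.1).1 (far2 (- 2) y n2.2).1.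
    + by move=> x y; exact: (dGx (x +i* y)%C).1.
    + by move=> y; exact: (cx y).1.
  rewrite [X in fine X](_ : _ = 0%E) //.
  refine (@area_FTC_x (fun z => Im (G z)) (fun z => Im (Gx z)) Mx (measurable_funIm mX) _ _ _ _ _).
  + by move=> z; rewrite (le_trans (Im_le_normc _)).
  + by move=> z /G0'[_ -> _].
  + by move=> y; rewrite (far2 2 y n2.1).1 (far2 (- 2) y n2.2).1.
  + by move=> x y; exact: (dGx (x +i* y)%C).2.
  + by move=> y; exact: (cx y).2.
- apply: complexP => /=.
    rewrite [X in fine X](_ : _ = 0%E) //.
    refine (@area_FTC_y (fun z => Re (G z)) (fun z => Re (Gy z)) My (measurable_funRe mY) _ _ _ _ _).
    + by move=> z; rewrite (le_trans (Re_le_normc _)).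
    + by move=> z /G0'[_ _ ->].
    + by move=> x; rewrite (far2 2 x n2.1).2 (far2 (- 2) x n2.2).2.
    + by move=> x y; exact: (dGy (x +i* y)%C).1.
    + by move=> x; exact: (cy x).1.
  rewrite [X in fine X](_ : _ = 0%E) //.
  refine (@area_FTC_y (fun z => Im (G z)) (fun z => Im (Gy z)) My (measurable_funIm mY) _ _ _ _ _).
  + by move=> z; rewrite (le_trans (Im_le_normc _)).
  + by move=> z /G0'[_ _ ->].
  + by move=> x; rewrite (far2 2 x n2.1).2 (far2 (- 2) x n2.2).2.
  + by move=> x y; exact: (dGy (x +i* y)%C).2.
  + by move=> x; exact: (cy x).2.
Qed.

End stokes.

Section reproducing.
Variable R : realType.
Local Notation C := R[i].
Local Notation Re := complex.Re.
Local Notation Im := complex.Im.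
Local Notation area := (@area R).
Implicit Types (z w : C) (f g : C -> C).

Lemma ccont_cst (c : C) z : ccont (fun=> c) z.
Proof. by move=> e e0; exists 1 => // w _; rewrite subrr normc0. Qed.

Lemma ccont_id z : ccont id z.
Proof. by move=> e e0; exists e. Qed.

Lemma ccontD f g z : ccont f z -> ccont g z -> ccont (fun w => f w + g w) z.
Proof.
move=> cf cg e e0; have e2 : 0 < e / 2 by rewrite divr_gt0.
have [d1 d10 H1] := cf _ e2; have [d2 d20 H2] := cg _ e2.
exists (Num.min d1 d2); first by rewrite lt_min d10.
move=> w; rewrite lt_min => /andP[/H1 h1 /H2 h2].
rewrite opprD addrACA (le_lt_trans (normcD _ _)) //; lra.
Qed.

Lemma ccontM f g z : ccont f z -> ccont g z -> ccont (fun w => f w * g w) z.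
Proof.
move=> cf cg e e0.
pose F := 1 + normc (f z); pose G := 1 + normc (g z).
have F0 : 0 < F by rewrite ltr_wpDr ?normc_ge0.
have G0 : 0 < G by rewrite ltr_wpDr ?normc_ge0.
have [d1 d10 H1] := cf _ (divr_gt0 (divr_gt0 e0 (ltr0Sn _ 1)) G0).
have [d2 d20 H2] := cg _ (divr_gt0 (divr_gt0 e0 (ltr0Sn _ 1)) F0).
have [d3 d30 H3] := cg _ ltr01.
exists (Num.min d1 (Num.min d2 d3)); first by rewrite !lt_min d10 d20.
move=> w; rewrite !lt_min => /and3P[/H1 h1 /H2 h2 /H3 h3].
have -> : f w * g w - f z * g z = (f w - f z) * g w + f z * (g w - g z) by ring.
rewrite (le_lt_trans (normcD _ _)) // !normcM.
have gw : normc (g w) <= G.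
  by rewrite -(subrK (g z) (g w)) (le_trans (normcD _ _)) // lerD2r ltW.
have b1 : normc (f w - f z) * normc (g w) <= e / 2.
  rewrite (le_trans (ler_pM _ _ (ltW h1) gw)) ?normc_ge0 //.
  by rewrite divfK ?gt_eqF.
have b2 : normc (f z) * normc (g w - g z) < e / 2.
  have [->|fz] := eqVneq (normc (f z)) 0; first by rewrite mul0r divr_gt0.
  have fz0 : 0 < normc (f z) by rewrite lt_def fz normc_ge0.
  rewrite -ltr_pdivlMl // (lt_le_trans h2) // mulrC ler_pM2r ?divr_gt0 //.
  by rewrite lef_pV2 ?posrE // lerDr.
lra.
Qed.

Lemma ccontJ f z : ccont f z -> ccont (fun w => (f w)^*%C) z.
Proof.
move=> cf e e0; have [d d0 H] := cf e e0; exists d => // w /H.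
by rewrite -[in X in X -> _]normcJ rmorphB.
Qed.

Lemma ccont_near f g z (r : R) : 0 < r ->
  (forall w, normc (w - z) < r -> f w = g w) -> ccont f z -> ccont g z.
Proof.
move=> r0 fg cf e e0; have [d d0 H] := cf e e0.
exists (Num.min d r); first by rewrite lt_min d0.
move=> w; rewrite lt_min => /andP[wd wr].
by rewrite -!fg ?subrr ?normc0 //; exact: H.
Qed.

Lemma ccont_Re z : ccont (fun w => (Re w)%:C%C) z.
Proof.
move=> e e0; exists e => // w; apply: le_lt_trans.
by rewrite -rmorphB normcR -cReN -cReD Re_le_normc.
Qed.

Lemma ccont_Im z : ccont (fun w => (Im w)%:C%C) z.
Proof.
move=> e e0; exists e => // w; apply: le_lt_trans.
by rewrite -rmorphB normcR -cImN -cImD Im_le_normc.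
Qed.

Lemma ccont_real (g : R -> R) (u : C -> R) z : {for u z, continuous g} ->
  ccont (fun w => (u w)%:C%C) z -> ccont (fun w => (g (u w))%:C%C) z.
Proof.
move=> /cvgrPdist_lt cg cu e e0; have := cg e e0.
rewrite -nbhs_nearE => /nbhs_ballP[d d0 Hd].
have [d' d0' H] := cu d d0; exists d' => // w /H.
have E (a b : R) : normc (a%:C%C - b%:C%C) = `|a - b| by rewrite -rmorphB normcR.
by rewrite !E distrC => h; rewrite distrC; exact: Hd.
Qed.

Lemma ccont_normc2 (c : R) z : ccont (fun w => (c - normc w ^+ 2)%:C%C) z.
Proof.
have H := ccontD (ccont_cst c%:C%C z) (ccontM (ccont_cst (-1) z)
  (ccontM (@ccont_id z) (ccontJ (@ccont_id z)))).
apply: (ccont_near ltr01) H => w _.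
by rewrite -sqr_normcE rmorphB mulN1r.
Qed.

(* [t_+ ^ b] *)
Definition pos_pow (b t : R) : R := Num.max 0 t `^ b.

Lemma pos_pow0 (b t : R) : b != 0 -> t <= 0 -> pos_pow b t = 0.
Proof. by move=> b0 t0; rewrite /pos_pow max_l // powR0. Qed.

Lemma pos_powE (b t : R) : 0 <= t -> pos_pow b t = t `^ b.
Proof. by move=> t0; rewrite /pos_pow max_r. Qed.

Lemma pos_pow_ge0 (b t : R) : 0 <= pos_pow b t. Proof. exact: powR_ge0. Qed.

Lemma is_derive_pos_pow (b t : R) : 1 <= b ->
  is_derive t 1 (pos_pow (b + 1)) ((b + 1) * pos_pow b t).
Proof.
move=> b1; have b0 : b != 0 by rewrite gt_eqF // (lt_le_trans ltr01).
have b10 : b + 1 != 0 by rewrite gt_eqF // addr_gt0 // (lt_le_trans ltr01).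
have [t0|t0|->] := ltgtP t 0.
- rewrite pos_pow0 ?(ltW t0) // mulr0.
  apply: (near_eq_is_derive (f := cst 0)).
  have : \forall s \near t, s \in `]t - 1, 0[.
    by apply: near_in_itvoo; rewrite in_itv /= t0 andbT ltrBlDr ltrDl.
  by apply: filterS => s; rewrite in_itv /= => /andP[_ s0]; rewrite pos_pow0 // ltW.
- rewrite pos_powE ?(ltW t0) //.
  apply: (near_eq_is_derive (f := fun s : R => s `^ (b + 1))).
    have : \forall s \near t, s \in `]0, t + 1[.
      by apply: near_in_itvoo; rewrite in_itv /= t0 ltrDl ltr01.
    by apply: filterS => s; rewrite in_itv /= => /andP[s0 _]; rewrite pos_powE // ltW.
  by have := is_derive1_powR (b + 1) t0; rewrite addrK.
(* At the corner, [h ^ (b + 1) = h ^ b * h] with [h ^ b <= h < e], because [b >= 1] and [h < 1]. *)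
- rewrite [pos_pow b 0]pos_pow0 // mulr0; apply: is_derive_eps => e e0.
  exists (Num.min 1 e); first by rewrite lt_min ltr01.
  move=> h; rewrite lt_min => /andP[h1 he]; rewrite add0r mul0r subr0.
  rewrite [pos_pow _ 0]pos_pow0 // subr0 ger0_norm ?pos_pow_ge0 //.
  have [h0|h0] := leP h 0; first by rewrite pos_pow0 // mulr_ge0 // ltW.
  rewrite pos_powE ?(ltW h0) // gtr0_norm // in h1 he *.
  rewrite powRD; last by apply/implyP => _; rewrite gt_eqF.
  rewrite powRr1 ?(ltW h0) // ler_pM2r // (le_trans _ (ltW he)) //.
  rewrite -[leRHS]powRr1 ?(ltW h0) //; apply: ger_powR => //; by rewrite h0 (ltW h1).
Qed.

Lemma continuous_pos_pow (b t : R) : 2 <= b -> {for t, continuous (pos_pow b)}.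
Proof.
move=> b2; have b1 : 1 <= b - 1 by lra.
have [d _] := is_derive_pos_pow t b1; rewrite subrK in d.
exact/differentiable_continuous/derivable1_diffP.
Qed.

Lemma pos_powS (b t : R) : 0 < b -> pos_pow (b + 1) t = pos_pow b t * t.
Proof.
move=> b0; have [t0|t0] := leP t 0.
  by rewrite !pos_pow0 ?mul0r // gt_eqF // ltr_wpDr // ltW.
rewrite !pos_powE ?(ltW t0) // powRD; last by apply/implyP => _; rewrite gt_eqF.
by rewrite powRr1 // ltW.
Qed.

Lemma has_dx_near (F G : C -> C) z l (r : R) : 0 < r ->
  (forall w, normc (w - z) < r -> F w = G w) -> has_dx F z l -> has_dx G z l.
Proof.
move=> r0 FG [d1 d2].
have N : \forall s \near Re z, F (s +i* Im z)%C = G (s +i* Im z)%C.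
  have : \forall s \near Re z, s \in `]Re z - r, Re z + r[.
    by apply: near_in_itvoo; rewrite in_itv /= ltrBlDr ltrDl r0.
  apply: filterS => s; rewrite in_itv /= => /andP[s1 s2]; apply: FG.
  apply: (le_lt_trans (normc_le_ReIm _)); rewrite !ReImE /= subrr normr0 addr0 ltr_norml.
  by rewrite ltrBrDl s1 ltrBlDl.
by split; [apply: near_eq_is_derive d1|apply: near_eq_is_derive d2];
   apply: filterS N => s ->.
Qed.

Lemma has_dy_near (F G : C -> C) z l (r : R) : 0 < r ->
  (forall w, normc (w - z) < r -> F w = G w) -> has_dy F z l -> has_dy G z l.
Proof.
move=> r0 FG [d1 d2].
have N : \forall s \near Im z, F (Re z +i* s)%C = G (Re z +i* s)%C.
  have : \forall s \near Im z, s \in `]Im z - r, Im z + r[.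
    by apply: near_in_itvoo; rewrite in_itv /= ltrBlDr ltrDl r0.
  apply: filterS => s; rewrite in_itv /= => /andP[s1 s2]; apply: FG.
  apply: (le_lt_trans (normc_le_ReIm _)); rewrite !ReImE /= subrr normr0 add0r ltr_norml.
  by rewrite ltrBrDl s1 ltrBlDl.
by split; [apply: near_eq_is_derive d1|apply: near_eq_is_derive d2];
   apply: filterS N => s ->.
Qed.

(* The cut-off [(rho^2 - |w|^2)_+ ^ b]. *)
Definition cutoff (rho b : R) (w : C) : C := (pos_pow b (rho ^+ 2 - normc w ^+ 2))%:C%C.

Lemma cutoff0 rho b w : 0 <= rho -> b != 0 -> rho <= normc w -> cutoff rho b w = 0.
Proof.
move=> r0 b0 rw; rewrite /cutoff pos_pow0 // subr_le0 ler_pXn2r ?nnegrE ?normc_ge0 //.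
Qed.

Lemma ccont_cutoff rho b w : 2 <= b -> ccont (cutoff rho b) w.
Proof.
move=> b2; apply: (ccont_real (g := pos_pow b)); first exact: continuous_pos_pow.
exact: ccont_normc2.
Qed.

Lemma has_dx_cutoff rho b w : 1 <= b ->
  has_dx (cutoff rho (b + 1)) w (- (2 * (b + 1))%:C%C * ((Re w)%:C%C * cutoff rho b w)).
Proof.
move=> b1.
have I : is_derive (Re w) (1 : R) (fun s : R => rho ^+ 2 - normc (s +i* Im w)%C ^+ 2) (- (2 * Re w)).
  under eq_fun do rewrite normc_sqr /=.
  by apply: is_derive_eq; rewrite /GRing.scale /=; ring.
have D := is_derive_pos_pow (rho ^+ 2 - normc (Re w +i* Im w)%C ^+ 2) b1.
have Ez : (Re w +i* Im w)%C = w by case: (w).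
split; last first.
  by rewrite !ReImE /=; apply: is_derive_eq; ring.
have := @is_derive1_comp R (pos_pow (b + 1)) (fun s : R => rho ^+ 2 - normc (s +i* Im w)%C ^+ 2)
  (Re w) _ _ D I.
move=> D'; rewrite [X in is_derive _ _ _ X](_ : _ = (b + 1) * pos_pow b (rho ^+ 2 - normc (Re w +i* Im w)%C ^+ 2) *
     - (2 * Re w)); first exact: D'.
by rewrite Ez /cutoff !ReImE /=; ring.
Qed.

Lemma has_dy_cutoff rho b w : 1 <= b ->
  has_dy (cutoff rho (b + 1)) w (- (2 * (b + 1))%:C%C * ((Im w)%:C%C * cutoff rho b w)).
Proof.
move=> b1.
have I : is_derive (Im w) (1 : R) (fun s : R => rho ^+ 2 - normc (Re w +i* s)%C ^+ 2) (- (2 * Im w)).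
  under eq_fun do rewrite normc_sqr /=.
  by apply: is_derive_eq; rewrite /GRing.scale /=; ring.
have D := is_derive_pos_pow (rho ^+ 2 - normc (Re w +i* Im w)%C ^+ 2) b1.
have Ez : (Re w +i* Im w)%C = w by case: (w).
split; last first.
  by rewrite !ReImE /=; apply: is_derive_eq; ring.
have := @is_derive1_comp R (pos_pow (b + 1)) (fun s : R => rho ^+ 2 - normc (Re w +i* s)%C ^+ 2)
  (Im w) _ _ D I.
move=> D'; rewrite [X in is_derive _ _ _ X](_ : _ = (b + 1) * pos_pow b (rho ^+ 2 - normc (Re w +i* Im w)%C ^+ 2) *
     - (2 * Im w)); first exact: D'.
by rewrite Ez /cutoff !ReImE /=; ring.
Qed.

(* The d-bar derivative of [cutoff * h] integrates to zero. *)
Lemma stokes_cutoff (rho r1 b : R) (h hx hy : C -> C) : 0 < rho -> rho < r1 -> rho <= 1 -> 2 <= b ->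
  (forall w, normc w < r1 -> [/\ has_dx h w (hx w), has_dy h w (hy w) & [/\ ccont h w, ccont hx w & ccont hy w]]) ->
  let g w := - (2 * (b + 1))%:C%C * (w * cutoff rho b w) * h w +
             cutoff rho (b + 1) w * (hx w + 'i%C * hy w) in
  cintegrable area setT g /\ cintegral area setT g = 0.
Proof.
move=> rho0 r1rho rho1 b2 H g.
have b1 : 1 <= b by lra. have bn0 : b != 0 by rewrite gt_eqF // (lt_le_trans ltr01).
have b1n0 : b + 1 != 0 by rewrite gt_eqF // addr_gt0 // (lt_le_trans ltr01).
have b12 : 2 <= b + 1 by lra.
pose kx w := - (2 * (b + 1))%:C%C * ((Re w)%:C%C * cutoff rho b w).
pose ky w := - (2 * (b + 1))%:C%C * ((Im w)%:C%C * cutoff rho b w).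
have c0 w : rho <= normc w -> [/\ cutoff rho (b + 1) w = 0, kx w = 0 & ky w = 0].
  by move=> rw; rewrite /kx /ky !cutoff0 ?(ltW rho0) // !mulr0.
(* [h] is controlled only on the disc of radius [r1 > rho]. Outside, all functions vanish on a whole
   neighbourhood because the cut-off does, so global hypotheses of [stokes] hold. *)
have far w : ~~ (normc w < r1) -> exists2 r : R, 0 < r & forall v, normc (v - w) < r -> rho <= normc v.
  rewrite -leNgt => rw; exists (r1 - rho); first by rewrite subr_gt0.
  move=> v vw; have := normc_sub_ge w v; rewrite normcBC; lra.
have cc (F : C -> C) : (forall w, normc w < r1 -> ccont F w) ->
    (forall w, rho <= normc w -> F w = 0) -> forall w, ccont F w.
  move=> cF F0 w; case: (boolP (normc w < r1)) => [/cF//|/far[r r0 Hr]].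
  by apply: (ccont_near r0) (ccont_cst 0 w) => v /Hr/F0 ->.
pose Gx w := kx w * h w + cutoff rho (b + 1) w * hx w.
pose Gy w := ky w * h w + cutoff rho (b + 1) w * hy w.
have ckx w : ccont kx w.
  by apply: ccontM (ccont_cst _ _) _; apply: ccontM (ccont_Re _) (ccont_cutoff _ _ _).
have cky w : ccont ky w.
  by apply: ccontM (ccont_cst _ _) _; apply: ccontM (ccont_Im _) (ccont_cutoff _ _ _).
have Gx0 w : rho <= normc w -> Gx w = 0 by move=> /c0[e1 e2 e3]; rewrite /Gx e1 e2 !mul0r addr0.
have Gy0 w : rho <= normc w -> Gy w = 0 by move=> /c0[e1 e2 e3]; rewrite /Gy e1 e3 !mul0r addr0.
have [|||||iX iY X0 Y0] := @stokes R (fun w => cutoff rho (b + 1) w * h w) Gx Gy.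
- move=> w; case: (boolP (normc w < r1)) => [wr|nw].
    by have [hdx _ _] := H w wr; exact: has_dxM (has_dx_cutoff _ _ _) hdx.
  rewrite Gx0; last by move: nw; rewrite -leNgt; apply: le_trans; exact: ltW.
  have [r r0 Hr] := far _ nw; apply: (has_dx_near r0 _ (has_cderiv_dx (has_cderiv_cst 0 w))).
  by move=> v /Hr/c0[-> _ _]; rewrite mul0r.
- move=> w; case: (boolP (normc w < r1)) => [wr|nw].
    by have [_ hdy _] := H w wr; exact: has_dyM (has_dy_cutoff _ _ _) hdy.
  rewrite Gy0; last by move: nw; rewrite -leNgt; apply: le_trans; exact: ltW.
  have [r r0 Hr] := far _ nw.
  have := has_cderiv_dy (has_cderiv_cst 0 w); rewrite mul0r; apply: (has_dy_near r0).
  by move=> v /Hr/c0[-> _ _]; rewrite mul0r.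
- apply: cc => // w /H[_ _ [ch chx chy]].
  by apply: ccontD; apply: ccontM => //; exact: ccont_cutoff.
- apply: cc => // w /H[_ _ [ch chx chy]].
  by apply: ccontD; apply: ccontM => //; exact: ccont_cutoff.
- move=> w w2; have rw : rho <= normc w by lra.
  by rewrite Gx0 // Gy0 //; have [-> _ _] := c0 w rw; rewrite mul0r.
(* Writing [w = Re w + i Im w] turns [Gx + i Gy], twice the d-bar derivative of the product, into
   [g]. *)
have gE : g = fun w => Gx w + 'i%C * Gy w.
  apply/funext => w; rewrite /g /Gx /Gy /kx /ky [in LHS](_ : w * _ = ((Re w)%:C%C + 'i%C * (Im w)%:C%C) * cutoff rho b w).
    by ring.
  by congr (_ * _); apply: complexP; rewrite !ReImE /=; ring.
rewrite gE; split.
  by apply: cintegrableD => //; exact: cintegrableZ.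
by rewrite cintegralD ?cintegralZ ?X0 ?Y0 ?mulr0 ?addr0 //; exact: cintegrableZ.
Qed.

End reproducing.

Section cauchy_bergman.
Variable R : realType.
Local Notation C := R[i].
Local Notation Re := complex.Re.
Local Notation Im := complex.Im.
Local Notation area := (@area R).
Implicit Types (z w : C) (F f g : C -> C).

Lemma conjM (x w : C) : (x * w)^*%C = x^*%C * w^*%C. Proof. exact: rmorphM. Qed.
Lemma conjB (x w : C) : (x - w)^*%C = x^*%C - w^*%C. Proof. exact: rmorphB. Qed.
Lemma conjV (x : C) : (x^-1)^*%C = (x^*%C)^-1. Proof. exact: fmorphV. Qed.
Lemma conjK (x : C) : (x^*)^*%C = x. Proof. by case: x => u v /=; rewrite opprK. Qed.
Lemma conjR (r : R) : (r%:C)^*%C = r%:C%C. Proof. by rewrite /= oppr0. Qed.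

Lemma ccont_ext f g z : f =1 g -> ccont f z -> ccont g z.
Proof. by move=> /funext ->. Qed.

(** The difference quotient of [F] at [z], completed by the derivative. Its own derivative [dslope1]
    has the value [l / 2] at [z]: the second Taylor coefficient. *)
Definition dslope F f z w : C := if w == z then f z else (F w - F z) / (w - z).
Definition dslope1 F f z (l : C) w : C :=
  if w == z then l / 2 else (f w * (w - z) - (F w - F z)) / (w - z) ^+ 2.

Lemma dslopeM F f z w : dslope F f z w * (w - z) = F w - F z.
Proof.
rewrite /dslope; case: eqVneq => [->|wz]; first by rewrite !subrr mulr0.
by rewrite divfK // subr_eq0.
Qed.

(** The mean value inequality is applied to [F] minus its quadratic Taylor polynomial, whose
    derivative is the first-order remainder of [f]; the factor 2 is that of [cmean_value]. *)
Lemma taylor2 F f z l (r : R) : 0 < r ->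
  (forall w, normc (w - z) < r -> has_cderiv F w (f w)) -> has_cderiv f z l ->
  forall e : R, 0 < e -> exists2 d : R, 0 < d & forall k, normc k < d ->
    normc (f (z + k) - f z - l * k) <= e * normc k /\
    normc (F (z + k) - F z - f z * k - l / 2 * k ^+ 2) <= 2 * (e * normc k ^+ 2).
Proof.
move=> r0 dF df e e0; have [d d0 Hd] := df _ e0.
exists (Num.min d r); first by rewrite lt_min d0.
move=> k; rewrite lt_min => /andP[kd kr].
have B k' : normc k' < d -> normc (f (z + k') - f z - l * k') <= e * normc k'.
  by move=> /Hd; apply.
split; first exact: B.
pose G w := F w - F z - f z * (w - z) - l / 2 * (w - z) ^+ 2.
pose G1 w := f w - f z - l * (w - z).
have nt (t : R) : 0 <= t <= 1 -> normc (t%:C%C * k) <= normc k.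
  by move=> /andP[t0 t1]; rewrite normr_line ger0_norm // ler_piMl ?normc_ge0.
have := @cmean_value R G G1 z k (e * normc k) _ _.
have -> : F (z + k) - F z - f z * k - l / 2 * k ^+ 2 = G (z + k) - G z by rewrite /G; ring.
have ek (t : R) : z + t%:C%C * k - z = t%:C%C * k by rewrite addrC addKr.
move=> H; rewrite expr2 [X in 2 * X]mulrA; apply: H => t t01.
  have -> : G1 (z + t%:C%C * k) = f (z + t%:C%C * k) - 0 - f z * (1 - 0)
     - l / 2 * (2%:R * (z + t%:C%C * k - z) ^+ 1 * (1 - 0)).
    by rewrite /G1; field.
  have dz : has_cderiv (fun w => w - z) (z + t%:C%C * k) (1 - 0).
    exact: has_cderivB (has_cderiv_id _) (has_cderiv_cst _ _).
  apply: has_cderivB; last by apply: has_cderivZ; exact: has_cderivX dz.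
  apply: has_cderivB; last exact: has_cderivZ dz.
  apply: has_cderivB; last exact: has_cderiv_cst.
  by apply: dF; rewrite ek (le_lt_trans (nt _ t01)).
rewrite /G1 ek (le_trans (B _ _)) //.
  exact: le_lt_trans (nt _ t01) kd.
by rewrite ler_pM2l // nt.
Qed.

(** Removable singularity without Cauchy's formula: at [z] both claims come from the second-order
    expansion, which is why a derivative [l] of [f] at [z] is assumed; away from [z] they come from
    the quotient rule. *)
Lemma has_cderiv_dslope F f z l (r : R) w : 0 < r ->
  (forall w, normc (w - z) < r -> has_cderiv F w (f w)) -> has_cderiv f z l ->
  has_cderiv F w (f w) -> ccont f w ->
  has_cderiv (dslope F f z) w (dslope1 F f z l w) /\ ccont (dslope1 F f z l) w.
Proof.
move=> r0 dF df dFw cfw.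
have [->|wz] := eqVneq w z.
  have T := taylor2 r0 dF df; split => e e0.
    have [d d0 H] := T _ (divr_gt0 e0 (ltr0Sn _ 1)); exists d => // k kd.
    have [->|k0] := eqVneq k 0.
      by rewrite addr0 subrr mulr0 subr0 !normc0 mulr0.
    have zk : (z + k == z) = false by rewrite -subr_eq0 [z + k]addrC addrK (negbTE k0).
    have ek : z + k - z = k by rewrite [z + k]addrC addrK.
    have [_ H2] := H k kd; rewrite /dslope1 /dslope eqxx zk ek.
    have nk : 0 < normc k by rewrite normc_gt0.
    rewrite -(ler_pM2r nk) -normcM.
    have -> : ((F (z + k) - F z) / k - f z - l / 2 * k) * k = F (z + k) - F z - f z * k - l / 2 * k ^+ 2.
      by field.
    by apply: (le_trans H2); suff -> : 2 * (e / 2 * normc k ^+ 2) = e * normc k * normc k by []; field.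
  have e8 : 0 < e / 8 by rewrite divr_gt0.
  have [d d0 H] := T _ e8; exists d => // v vd; rewrite /dslope1 eqxx.
  have [_|vz] := eqVneq v z; first by rewrite subrr normc0.
  have [] := H (v - z) vd; rewrite [z + (v - z)]addrC subrK => H1 H2.
  have k0 : v - z != 0 by rewrite subr_eq0.
  have nk : 0 < normc (v - z) by rewrite normc_gt0.
  have nk2 : 0 < normc (v - z) ^+ 2 by rewrite exprn_gt0.
  rewrite -(ltr_pM2r nk2) -normcX -normcM.
  have -> : ((f v * (v - z) - (F v - F z)) / (v - z) ^+ 2 - l / 2) * (v - z) ^+ 2 =
     (f v - f z - l * (v - z)) * (v - z) - (F v - F z - f z * (v - z) - l / 2 * (v - z) ^+ 2).
    by field.
  apply: (le_lt_trans (normcB _ _)); rewrite normcM normcX.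
  have : normc (f v - f z - l * (v - z)) * normc (v - z) <= e / 8 * normc (v - z) ^+ 2.
    by rewrite expr2 mulrA ler_pM2r.
  have : e / 8 * 3 * normc (v - z) ^+ 2 < e * normc (v - z) ^+ 2.
    by rewrite ltr_pM2r //; lra.
  lra.
have wz0 : w - z != 0 by rewrite subr_eq0.
have nk : 0 < normc (w - z) by rewrite normc_gt0.
have nez v : normc (v - w) < normc (w - z) -> (v == z) = false.
  by move=> h; apply/eqP => vz; move: h; rewrite vz normcBC ltxx.
have dz : has_cderiv (fun w => w - z) w (1 - 0).
  exact: has_cderivB (has_cderiv_id _) (has_cderiv_cst _ _).
have di := has_cderiv_comp dz (has_cderivV wz0).
have dFz := has_cderivB dFw (has_cderiv_cst (F z) w).
split.
  have -> : dslope1 F f z l w = (f w - 0) * (w - z)^-1 + (F w - F z) * (- (w - z) ^- 2 * (1 - 0)).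
    by rewrite /dslope1 (negbTE wz); field.
  apply: (has_cderiv_near nk) (has_cderivM dFz di) => v /nez vz.
  by rewrite /dslope vz.
have H : ccont (fun v => (f v * (v - z) + -1 * (F v - F z)) * ((v - z)^-1 * (v - z)^-1)) w.
  apply: ccontM.
    apply: ccontD; first exact: ccontM (has_cderiv_ccont dz).
    exact: ccontM (ccont_cst _ _) (has_cderiv_ccont dFz).
  by apply: ccontM; exact: has_cderiv_ccont di.
apply: (ccont_near nk) H => v /nez vz.
by rewrite /dslope1 vz mulN1r expr2 invfM.
Qed.

Lemma Re_kernel_gt0 (rho : R) z w : normc z * normc w < rho ^+ 2 ->
  0 < Re ((rho ^+ 2)%:C%C - z * (w^*)%C) /\ 0 < Re ((rho ^+ 2)%:C%C - (z^*)%C * w).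
Proof.
move=> H; split; rewrite cReD cReN subr_gt0 (le_lt_trans (ler_norm _)) //.
  by rewrite (le_lt_trans (Re_le_normc _)) // normcM normcJ.
by rewrite (le_lt_trans (Re_le_normc _)) // normcM normcJ.
Qed.

(* Stokes for [(rho^2-|w|^2)_+^(b+1) q(w) / (rho^2 - z w^* )^(b+1)] with the slope
   [q w = (F w - F z) / (w - z)]. *)
Lemma bergman_orthogonal F f z l (rho r1 b : R) : 0 < rho -> rho <= 1 -> rho < r1 -> normc z < rho ->
  2 <= b -> (forall w, normc w < r1 -> has_cderiv F w (f w) /\ ccont f w) -> has_cderiv f z l ->
  let g w := (F w - F z) * (cutoff rho b w / cpow ((rho ^+ 2)%:C%C - z * (w^*)%C) (b + 2)) in
  cintegrable area setT g /\ cintegral area setT g = 0.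
Proof.
move=> rho0 rho1 rr1 zr b2 dF df g.
have bn0 : b != 0 by rewrite gt_eqF // (lt_le_trans _ b2).
have b1n0 : b + 1 != 0 by rewrite gt_eqF // addr_gt0 // (lt_le_trans _ b2).
(* On this disc, strictly larger than that of radius [rho], one has [|z| |w| < rho ^ 2], so the base
   of the power stays in the right half-plane. *)
pose s := Num.min r1 (2 * rho ^+ 2 / (rho + normc z)).
have nz0 := normc_ge0 z.
have D0 : 0 < rho + normc z by rewrite ltr_wpDr.
have rs : rho < s.
  rewrite lt_min rr1 /= ltr_pdivlMr //; nra.
have sz w : normc w < s -> normc z * normc w < rho ^+ 2.
  rewrite lt_min => /andP[_]; rewrite ltr_pdivlMr // => h.
  have := normc_ge0 w; nra.
have zr1 : normc z < r1 by exact: lt_trans zr rr1.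
(* The conjugate of the kernel factor: the factor itself is antiholomorphic in [w], so the
   holomorphic calculus is run on [P] and conjugated at the end. *)
pose P w := (cpow ((rho ^+ 2)%:C%C - (z^*)%C * w) (b + 1))^-1.
pose y w := (rho ^+ 2)%:C%C - (z^*)%C * w.
pose P1 w := - (b + 1)%:C%C / (cpow (y w) (b + 1) * y w) * (0 - (z^*)%C * 1).
have dP w : normc w < s -> has_cderiv P w (P1 w).
  move=> /sz/Re_kernel_gt0[_ yw].
  have := @has_cderiv_comp R y (fun x => (cpow x (b + 1))^-1) w _ _ _ (has_cderiv_cpowV (b + 1) yw).
  apply; apply: has_cderivB; first exact: has_cderiv_cst.
  exact: has_cderivZ (has_cderiv_id _).
have cy w : ccont y w.
  apply: has_cderiv_ccont; apply: has_cderivB; first exact: has_cderiv_cst.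
  exact: has_cderivZ (has_cderiv_id _).
have cP1 w : normc w < s -> ccont P1 w.
  move=> ws; have [_ yw] := Re_kernel_gt0 (sz _ ws).
  have yn0 : y w != 0 by rewrite -normc_gt0 normc_Re_gt0.
  have cV : ccont (fun v => (y v)^-1) w.
    apply: has_cderiv_ccont; apply: has_cderiv_comp (has_cderivV yn0).
    apply: has_cderivB; first exact: has_cderiv_cst.
    exact: has_cderivZ (has_cderiv_id _).
  have := ccontM (ccontM (ccont_cst (- (b + 1)%:C%C) w) (ccontM (has_cderiv_ccont (dP _ ws)) cV))
     (ccont_cst (0 - (z^*)%C * 1) w).
  by apply: ccont_ext => v; rewrite /P1 /P [in RHS]invfM.
pose q := dslope F f z; pose q1 := dslope1 F f z l.
have dq w : normc w < s -> has_cderiv q w (q1 w) /\ ccont q1 w.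
  rewrite lt_min => /andP[ws _]; have [d1 d2] := dF w ws.
  apply: (@has_cderiv_dslope _ _ _ _ (r1 - normc z)) => //; first by rewrite subr_gt0.
  move=> v vz; have [] := dF v => //.
  by rewrite -(subrK z v) (le_lt_trans (normcD _ _)) // -ltrBrDr.
pose hx w := (P1 w)^*%C * q w + (P w)^*%C * q1 w.
pose hy w := (P1 w * 'i%C)^*%C * q w + (P w)^*%C * (q1 w * 'i%C).
have [||w ws|iG IG] := @stokes_cutoff R rho s b (fun w => (P w)^*%C * q w) hx hy rho0 rs => //.
  have [dqw cq1] := dq w ws; have dPw := dP w ws.
  have cP := has_cderiv_ccont dPw; have cq := has_cderiv_ccont dqw.
  have cP1w := cP1 w ws.
  split; first exact: has_dxM (has_dxJ (has_cderiv_dx dPw)) (has_cderiv_dx dqw).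
    exact: has_dyM (has_dyJ (has_cderiv_dy dPw)) (has_cderiv_dy dqw).
  split; first exact: ccontM (ccontJ cP) cq.
    by apply: ccontD; apply: ccontM => //; exact: ccontJ.
  apply: ccontD; apply: ccontM => //.
  - by apply: ccontJ; apply: ccontM => //; exact: ccont_cst.
  - exact: ccontJ.
  - by apply: ccontM => //; exact: ccont_cst.
set G := (fun w => _) in iG IG.
pose k : C := (2 * (b + 1) * rho ^+ 2)%:C%C.
have k0 : k != 0.
  rewrite -normc_gt0 normcR normr_gt0 !mulf_neq0 // ?expf_neq0 //; exact: lt0r_neq0.
(* The two terms share a factor, and the bracket [z (rho ^ 2 - |w| ^ 2) - w (rho ^ 2 - z conj w)]
   equals [rho ^ 2 (z - w)], which cancels the denominator of the slope. *)
have GE w : G w = - k * g w.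
  have [rw|wr] := leP rho (normc w).
    by rewrite /G /g !cutoff0 ?(ltW rho0) // !(mul0r, mulr0) addr0.
  have ws := lt_trans wr rs.
  have [y0 y0'] := Re_kernel_gt0 (sz _ ws).
  rewrite /G /g -(dslopeM F f z) -/q /hx /hy.
  set Y := (rho ^+ 2)%:C%C - z * (w^*)%C in y0 *.
  have YE : (y w)^*%C = Y by rewrite /Y /y conjB conjM conjK conjR.
  have PE : (P w)^*%C = (cpow Y (b + 1))^-1 by rewrite /P conjV -cpowJ // -/(y w) YE.
  have P1E : (P1 w)^*%C = (b + 1)%:C%C * z / (cpow Y (b + 1) * Y).
    rewrite /P1 sub0r mulr1 mulrN mulNr mulNr opprK 2!conjM conjV conjM -cpowJ // YE.
    by rewrite conjK conjR; ring.
  have Yn0 : Y != 0 by rewrite -normc_gt0 normc_Re_gt0.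
  have cYn0 := normc_eq_cpow (b + 1) y0.
  have E2 : cpow Y (b + 2) = cpow Y (b + 1) * Y by rewrite -cpowS // -addrA.
  have E3 : cutoff rho (b + 1) w = cutoff rho b w * ((rho ^+ 2)%:C%C - w * (w^*)%C).
    rewrite /cutoff pos_powS ?(lt_le_trans _ b2) //.
    by rewrite realcM rmorphB -sqr_normcE.
  have ii : 'i%C * 'i%C = -1 :> C by rewrite -expr2 sqr_i.
  have iJ : ('i%C : C)^*%C = - 'i%C by apply: complexP; rewrite /= ?oppr0.
  (* In the d-bar derivative the holomorphic factor [q] drops out and the antiholomorphic factor
     counts twice. *)
  rewrite (_ : _ + 'i%C * _ = 2 * ((P1 w)^*%C * q w)); last first.
    rewrite [(P1 w * 'i%C)^*%C]conjM iJ [RHS]mulr_natl mulr2n.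
    transitivity ((P1 w)^*%C * q w * (1 - 'i%C * 'i%C) + (P w)^*%C * q1 w * (1 + 'i%C * 'i%C)); first by ring.
    by rewrite ii opprK subrr mulr0 addr0 mulrDr mulr1.
  rewrite E3 PE P1E E2 /k.
  have -> : (2 * (b + 1) * rho ^+ 2)%:C%C = 2 * (b + 1)%:C%C * (rho ^+ 2)%:C%C :> C.
    by rewrite !realcM rmorph_nat.
  have -> : (2 * (b + 1))%:C%C = 2 * (b + 1)%:C%C :> C by rewrite realcM rmorph_nat.
  have zE : (rho ^+ 2)%:C%C = Y + z * (w^*)%C by rewrite subrK.
  move: (cpow Y (b + 1)) (cutoff rho b w) (q w) cYn0 => cY ct qw cYn0.
  rewrite zE; field; exact/andP.
have gE : g = fun w => - k^-1 * G w.
  by apply/funext => w; rewrite GE mulrA mulrNN mulVf // mul1r.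
rewrite gE; split; first exact: cintegrableZ.
by rewrite cintegralZ // IG mulr0.
Qed.

End cauchy_bergman.

(** * Bergman kernels and potentials *)

Section dominated.
Context d (T : measurableType d) (R : realType).
Local Notation C := R[i].
Variable mu : {measure set T -> \bar R}.

Lemma eq_cintegrable (D : set T) (f g : T -> C) : measurable D -> {in D, f =1 g} ->
  cintegrable mu D f -> cintegrable mu D g.
Proof.
move=> mD fg [iR iI]; split; [apply: eq_integrable iR|apply: eq_integrable iI] => // x Dx;
  by rewrite /= fg.
Qed.

Lemma cintegral_dct (D : set T) (f_ : nat -> T -> C) (f : T -> C) (g : T -> R) :
  measurable D -> (forall n, measurable_fun D (f_ n)) -> measurable_fun D f ->
  (forall x, D x -> forall e : R, 0 < e -> exists N, forall n, (N <= n)%N -> normc (f_ n x - f x) < e) ->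
  (forall n x, D x -> normc (f_ n x) <= g x) -> (forall x, D x -> normc (f x) <= g x) ->
  mu.-integrable D (EFin \o g) ->
  forall e : R, 0 < e -> exists N, forall n, (N <= n)%N ->
    normc (cintegral mu D (f_ n) - cintegral mu D f) < e.
Proof.
move=> mD mf_ mf cvf fg_ fg ig e e0.
have if_ n : cintegrable mu D (f_ n) := cintegrableW mD (mf_ n) (fg_ n) ig.
have if1 : cintegrable mu D f := cintegrableW mD mf fg ig.
have mh n : measurable_fun D (fun x => (normc (f_ n x - f x))%:E).
  by apply/measurable_EFinP; apply: measurable_normc; exact: measurable_funBC.
have [|||||] := @dominated_cvg _ _ _ mu D mD (fun n x => (normc (f_ n x - f x))%:E)
    (fun=> 0%E) (fun x => (2%:E * (EFin \o g) x)%E) mh _ _ _ _ [set y | (y < (e / 2)%:E)%E].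
- move=> x Dx; apply: cvg_EFin; first by near=> n.
  apply/cvgrPdist_lt => r r0; have [N HN] := cvf x Dx r r0; exists N => // n /= /HN.
  by rewrite sub0r normrN ger0_norm ?normc_ge0.
- by move=> x Dx.
- exact: integrableZl.
- move=> n x Dx; rewrite lee_fin ger0_norm ?normc_ge0 // (le_trans (normcB _ _)) //.
  by rewrite mulr2n mulrDl mul1r lerD ?fg_ ?fg.
- rewrite integral0; have := @nbhs_open_ereal_lt R 0 (fun=> e / 2); apply.
  by rewrite divr_gt0.
move=> N _ HN; exists N => n nN; have h := HN n nN; rewrite /= in h.
rewrite -cintegralB // -lte_fin.
apply: (le_lt_trans (cintegral_le mD (cintegrableB mD (if_ n) if1))).
rewrite (_ : e%:E = (2%:E * (e / 2)%:E)%E); last by rewrite -EFinM mulrC divfK.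
by rewrite lte_pmul2l.
Unshelve. all: by end_near. Qed.

(** Quantitative differentiation under the integral: the bound on the second derivative [k2] makes
    the first-order remainder at most [4 M |kk| ^ 2] for every [x], and this is integrated against
    [|h|]. The other bounds give integrability. *)
Lemma has_cderiv_cintegral (D : set T) (h : T -> C) (k k1 k2 : C -> T -> C) (z : C) (r M : R) :
  measurable D -> 0 < r -> 0 <= M -> cintegrable mu D h ->
  (forall v, normc (v - z) < r -> measurable_fun D (k v)) -> measurable_fun D (k1 z) ->
  (forall v x, D x -> normc (v - z) < r -> [/\ has_cderiv (k^~ x) v (k1 v x), has_cderiv (k1^~ x) v (k2 v x),
     normc (k v x) <= M & normc (k2 v x) <= M]) ->
  (forall x, D x -> normc (k1 z x) <= M) ->
  has_cderiv (fun v => cintegral mu D (fun x => h x * k v x)) z (cintegral mu D (fun x => h x * k1 z x)).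
Proof.
move=> mD r0 M0 ih mk mk1 dk k1M.
have mh := cintegrable_measurable ih.
have ihM : mu.-integrable D (EFin \o (fun x => normc (h x) * M)).
  have := integrableZl mD M (cintegrable_normc mD ih).
  by apply: eq_integrable => // x _ /=; rewrite -EFinM mulrC.
have ik v : normc (v - z) < r -> cintegrable mu D (fun x => h x * k v x).
  move=> vr; apply: cintegrableW ihM => //; first by apply: measurable_funMC => //; exact: mk.
  move=> x Dx; rewrite normcM ler_wpM2l ?normc_ge0 //.
  by have [] := dk v x Dx vr.
have ik1 : cintegrable mu D (fun x => h x * k1 z x).
  apply: cintegrableW ihM => //; first exact: measurable_funMC.
  by move=> x Dx; rewrite normcM ler_wpM2l ?normc_ge0 ?k1M.
have T2 kk x : D x -> normc kk < r ->
    normc (k (z + kk) x - k z x - kk * k1 z x) <= 4 * M * normc kk ^+ 2.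
  move=> Dx kr.
  have lt_r (t : R) : 0 <= t <= 1 -> normc (t%:C%C * kk) <= normc kk.
    by move=> /andP[t0 t1]; rewrite normr_line ger0_norm // ler_piMl ?normc_ge0.
  have near (t : R) : 0 <= t <= 1 -> normc (z + t%:C%C * kk - z) < r.
    by move=> t01; rewrite [z + _]addrC addrK (le_lt_trans (lt_r _ t01)).
  have B (t : R) : 0 <= t <= 1 -> normc (k1 (z + t%:C%C * kk) x - k1 z x) <= 2 * (M * normc kk).
    move=> t01; apply: (@le_trans _ _ (2 * (M * normc (t%:C%C * kk)))); last first.
      by rewrite ler_pM2l // ler_wpM2l ?lt_r.
    apply: (@cmean_value R (k1^~ x) (k2^~ x)) => s s01; rewrite mulrA -realcM.
      have st : 0 <= s * t <= 1.
        by case/andP: s01 => s0 s1; case/andP: t01 => t0 t1; rewrite mulr_ge0 // mulr_ile1.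
      by have [] := dk _ x Dx (near _ st).
    have st : 0 <= s * t <= 1.
      by case/andP: s01 => s0 s1; case/andP: t01 => t0 t1; rewrite mulr_ge0 // mulr_ile1.
    by have [] := dk _ x Dx (near _ st).
  pose G v := k v x - k1 z x * v.
  have -> : k (z + kk) x - k z x - kk * k1 z x = G (z + kk) - G z by rewrite /G; ring.
  have -> : 4 * M * normc kk ^+ 2 = 2 * ((2 * (M * normc kk)) * normc kk) by ring.
  apply: (@cmean_value R G (fun v => k1 v x - k1 z x * 1)) => t t01; last by rewrite mulr1 B.
  apply: has_cderivB; first by have [] := dk _ x Dx (near _ t01).
  exact: has_cderivZ (has_cderiv_id _).
move=> e e0; pose N := fine (\int[mu]_(x in D) (normc (h x))%:E)%E.
have NE : (\int[mu]_(x in D) (normc (h x))%:E)%E = N%:E.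
  by rewrite fineK //; exact: integrable_fin_num (cintegrable_normc mD ih).
have N0 : 0 <= N by rewrite /N fine_ge0 // integral_ge0 // => x _; rewrite lee_fin normc_ge0.
have B0 : 0 < 8 * M * N + 1 by rewrite ltr_wpDl // !mulr_ge0.
exists (Num.min r (e / (8 * M * N + 1))); first by rewrite lt_min r0 divr_gt0.
move=> kk; rewrite lt_min => /andP[kr ke].
have zr : normc (z - z) < r by rewrite subrr normc0.
have kr' : normc (z + kk - z) < r by rewrite [z + _]addrC addrK.
rewrite [_ * kk]mulrC -cintegralZ // -cintegralB //; [|exact: ik|exact: ik].
rewrite -cintegralB //; [|by apply: cintegrableB => //; exact: ik|exact: cintegrableZ].
rewrite -lee_fin; apply: (le_trans (cintegral_le mD _)).
  by apply: cintegrableB => //; [apply: cintegrableB => //; exact: ik|exact: cintegrableZ].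
apply: (@le_trans _ _ (2%:E * ((4 * M * normc kk ^+ 2)%:E * N%:E))%E); last first.
  rewrite -!EFinM lee_fin.
  have -> : 2 * (4 * M * normc kk ^+ 2 * N) = (8 * M * N) * normc kk * normc kk by ring.
  rewrite ler_wpM2r ?normc_ge0 //.
  have h1 : (8 * M * N + 1) * normc kk <= e by rewrite mulrC -ler_pdivlMr // ltW.
  by apply: (le_trans _ h1); rewrite [leRHS]mulrDl lerDl mul1r normc_ge0.
rewrite lee_pmul2l // -NE -integralZl //; last exact: cintegrable_normc.
apply: ge0_le_integral => //.
- by move=> x _; rewrite lee_fin normc_ge0.
- apply/measurable_EFinP; apply: measurable_normc.
  apply: measurable_funBC; first by apply: measurable_funBC; apply: measurable_funMC => //; exact: mk.
  by apply: measurable_funMC; [exact: measurable_cst|exact: measurable_funMC].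
- by apply/measurable_EFinP; apply: measurable_funM => //; exact: measurable_normc.
- move=> x Dx; rewrite lee_fin.
  have -> : h x * k (z + kk) x - h x * k z x - kk * (h x * k1 z x) =
     h x * (k (z + kk) x - k z x - kk * k1 z x) by ring.
  by rewrite normcM mulrC ler_wpM2r ?normc_ge0 // T2.
Qed.

End dominated.

Section bergman_kernel.
Variable R : realType.
Local Notation C := R[i].
Local Notation Re := complex.Re.
Local Notation Im := complex.Im.
Local Notation area := (@area R).
Local Notation disc := (@disc R).
Implicit Types (z w v : C) (F f g h : C -> C) (s b : R).

Definition bker s z w : C := (cpow (1 - z * w^*%C) s)^-1.

Lemma normcMJ_lt1 z w : disc z -> disc w -> normc (z * w^*%C) < 1.
Proof.
rewrite /Defs.disc /= => z1 w1; rewrite normcM normcJ.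
by rewrite (le_lt_trans _ w1) // ler_piMl ?normc_ge0 // ltW.
Qed.

Lemma Re_bker_gt0 z w : normc (z * w^*%C) < 1 -> 0 < Re (1 - z * w^*%C).
Proof.
by move=> h; rewrite cReD cReN subr_gt0 (le_lt_trans (ler_norm _)) // (le_lt_trans (Re_le_normc _)).
Qed.

Lemma conj_bker s z w : normc (z * w^*%C) < 1 -> (bker s z w)^*%C = bker s w z.
Proof.
move=> h; rewrite /bker conjV -cpowJ ?Re_bker_gt0 // conjB conjM conjK.
by rewrite (_ : 1^*%C = 1 :> C) ?[w * _]mulrC //; exact: rmorph1.
Qed.

Lemma has_cderiv_bker s z w : normc (z * w^*%C) < 1 ->
  has_cderiv (fun v => bker s v w) z (s%:C%C * w^*%C * bker (s + 1) z w).
Proof.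
move=> h; have x0 := Re_bker_gt0 h.
have dx : has_cderiv (fun v => 1 - v * w^*%C) z (0 - (1 * w^*%C + z * 0)).
  apply: has_cderivB; first exact: has_cderiv_cst.
  exact: has_cderivM (has_cderiv_id _) (has_cderiv_cst _ _).
have := has_cderiv_comp dx (has_cderiv_cpowV s x0).
congr has_cderiv; rewrite /bker cpowS //.
have n1 : 1 - z * w^*%C != 0 by rewrite -normc_gt0 normc_Re_gt0.
have n2 := normc_eq_cpow s x0.
by field; exact/andP.
Qed.

(** The kernel is holomorphic in its first argument and conjugate-symmetric, which gives continuity
    in the second. *)
Lemma ccont_bker s z w : normc (z * w^*%C) < 1 -> ccont (bker s z) w.
Proof.
move=> h; have h' : normc (w * z^*%C) < 1 by move: h; rewrite !normcM !normcJ mulrC.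
have [d d0 Hd] : exists2 d : R, 0 < d & forall v, normc (v - w) < d -> normc (v * z^*%C) < 1.
  have [z0|z0] := eqVneq (normc z) 0.
    by exists 1 => // v _; rewrite normcM normcJ z0 mulr0.
  have nz : 0 < normc z by rewrite lt_def z0 normc_ge0.
  exists (1 / normc z - normc w) => [|v vw].
    by rewrite subr_gt0 ltr_pdivlMr // -(normcJ z) -normcM.
  rewrite normcM normcJ -ltr_pdivlMr // -(subrK w v) (le_lt_trans (normcD _ _)) //.
  by rewrite -ltrBrDr.
apply: (ccont_near d0) (ccontJ (has_cderiv_ccont (has_cderiv_bker s h'))) => v /Hd hv.
exact: conj_bker.
Qed.

Lemma normc_bker s z w : normc (z * w^*%C) < 1 ->
  normc (bker s z w) = (normc (1 - z * w^*%C) `^ s)^-1.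
Proof.
move=> h; have c0 := normc_eq_cpow s (Re_bker_gt0 h).
have : normc (bker s z w) * normc (cpow (1 - z * w^*%C) s) = 1.
  by rewrite -normcM /bker mulVf // normc1.
rewrite normc_cpow => /(congr1 (fun x => x * (normc (1 - z * w^*%C) `^ s)^-1)).
rewrite mul1r mulfK //; apply/eqP => p0.
by move: c0; rewrite -normc_eq0 normc_cpow p0 eqxx.
Qed.

Lemma normc_ker_ge z w : disc w -> 1 - normc z <= normc (1 - z * w^*%C).
Proof.
rewrite /Defs.disc /= => w1; have := normc_sub_ge 1 (z * w^*%C).
rewrite normc1; apply: le_trans; rewrite lerB // normcM normcJ ler_piMr ?normc_ge0 //; exact: ltW.
Qed.

Lemma normc_bker_le s z w (x : R) : 0 <= s -> disc z -> disc w -> 0 < x -> x <= 1 - normc z ->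
  normc (bker s z w) <= (x `^ s)^-1.
Proof.
move=> s0 z1 w1 x0 xz; rewrite normc_bker; last exact: normcMJ_lt1.
rewrite lef_pV2 ?posrE ?powR_gt0 //; last first.
  by rewrite (lt_le_trans x0) // (le_trans xz) // normc_ker_ge.
by rewrite ge0_ler_powR ?nnegrE ?normc_ge0 ?(ltW x0) // (le_trans xz) // normc_ker_ge.
Qed.

Lemma measurable_bker s z : disc z -> measurable_fun disc (bker s z).
Proof. by move=> z1; apply: ccont_measurable => w w1; apply: ccont_bker; exact: normcMJ_lt1. Qed.

Lemma has_cderiv_potential h s z : 0 <= s -> disc z -> cintegrable area disc h ->
  has_cderiv (fun v => cintegral area disc (fun w => h w * bker s v w)) z
    (cintegral area disc (fun w => h w * (s%:C%C * w^*%C * bker (s + 1) z w))).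
Proof.
move=> s0 z1 ih; have z1' : normc z < 1 by [].
pose x := (1 - normc z) / 2; have x0 : 0 < x by rewrite divr_gt0 // subr_gt0.
pose M := Num.max (Num.max (x `^ s)^-1 (s * (x `^ (s + 1))^-1)) (s * (s + 1) * (x `^ (s + 2))^-1).
have near v : normc (v - z) < x -> disc v /\ x <= 1 - normc v.
  move=> vx; have vz : normc v < normc z + x.
    by rewrite -(subrK z v) (le_lt_trans (normcD _ _)) // addrC ltrD2l.
  by rewrite /Defs.disc /=; rewrite /x in vz *; split; lra.
have M0 : 0 <= M by rewrite !le_max invr_ge0 powR_ge0.
have mJ : measurable_fun disc (fun w : C => w^*%C).
  by apply: measurable_funJ; exact: measurable_id.
have w1 w : disc w -> normc w <= 1 by move=> /ltW.
have zx : x <= 1 - normc z by rewrite /x; lra.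
pose k1 v w := s%:C%C * w^*%C * bker (s + 1) v w.
pose k2 v w := s%:C%C * w^*%C * ((s + 1)%:C%C * w^*%C * bker (s + 1 + 1) v w).
have s1 : 0 <= s + 1 by rewrite addr_ge0.
have s2 : 0 <= s + 2 by rewrite addr_ge0.
have s12 : s + 1 + 1 = s + 2 by rewrite -addrA.
apply: (@has_cderiv_cintegral _ _ R area disc h (bker s) k1 k2 z x M (@measurable_disc R) x0 M0 ih).
- by move=> v /near[v1 _]; exact: measurable_bker.
- apply: measurable_funMC; last exact: measurable_bker.
  by apply: measurable_funMC mJ; exact: measurable_cst.
- move=> v w dw vx; have [dv xv] := near _ vx; have vw := normcMJ_lt1 dv dw.
  split.
  + exact: has_cderiv_bker.
  + exact: has_cderivZ (has_cderiv_bker _ vw).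
  + by rewrite (le_trans (normc_bker_le s0 dv dw x0 xv)) // !le_max lexx.
  + rewrite /k2 !normcM !normcR !normcJ !ger0_norm //.
    rewrite s12; apply: (@le_trans _ _ (s * (s + 1) * (x `^ (s + 2))^-1)); last first.
      by rewrite !le_max lexx orbT.
    rewrite -mulrA -[leRHS]mulrA ler_wpM2l //.
    rewrite (@le_trans _ _ ((s + 1) * normc w * normc (bker (s + 2) v w))) //.
      by rewrite ler_piMl ?w1 // !mulr_ge0 ?normc_ge0.
    rewrite -mulrA ler_wpM2l // (le_trans _ (normc_bker_le s2 dv dw x0 xv)) //.
    by rewrite ler_piMl ?w1 ?normc_ge0.
- move=> w dw; rewrite /k1 !normcM normcR normcJ ger0_norm //.
  apply: (@le_trans _ _ (s * (x `^ (s + 1))^-1)); last by rewrite !le_max lexx orbT.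
  rewrite -mulrA ler_wpM2l // (le_trans _ (normc_bker_le s1 z1 dw x0 zx)) //.
  by rewrite ler_piMl ?w1 ?normc_ge0.
Qed.

End bergman_kernel.

(** * The reproducing formula and the analyticity of derivatives *)

Section reproducing_formula.
Variable R : realType.
Local Notation C := R[i].
Local Notation Re := complex.Re.
Local Notation Im := complex.Im.
Local Notation area := (@area R).
Local Notation disc := (@disc R).
Implicit Types (z w v : C) (F f g h : C -> C) (s b : R).

Lemma cutoff_real (rho b : R) w : (cutoff rho b w)^*%C = cutoff rho b w.
Proof. exact: conjR. Qed.

Lemma cutoff_out b w : 2 <= b -> ~ disc w -> cutoff 1 b w = 0.
Proof.
move=> b2 /negP; rewrite -leNgt => w1.
by apply: cutoff0 => //; rewrite gt_eqF // (lt_le_trans _ b2).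
Qed.

Lemma cutoff_disc b h w : 2 <= b ->
  (if w \in disc then h w * cutoff 1 b w else 0) = h w * cutoff 1 b w.
Proof.
move=> b2; case: ifPn => //; rewrite notin_setE => w1.
by rewrite cutoff_out // mulr0.
Qed.

(** The value is [1 / (b + 1)], but it is never computed: knowing that it is nonzero suffices. *)
Definition bergman_mass b : C := cintegral area disc (cutoff 1 b).

Lemma cutoff_bounded b w : 2 <= b -> normc (cutoff 1 b w) <= 1.
Proof.
move=> b2; rewrite normcR ger0_norm ?pos_pow_ge0 // /pos_pow.
have b0 : 0 <= b by rewrite (le_trans _ b2).
rewrite (le_trans (ge0_ler_powR b0 _ _ (_ : _ <= 1))) ?powR1 ?nnegrE ?le_max ?lexx //.
by rewrite ge_max ler01 expr1n gerBl sqr_ge0.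
Qed.

Lemma cintegrable_cutoff b : 2 <= b -> cintegrable area disc (cutoff 1 b).
Proof.
move=> b2; apply: (@cintegrable_bounded R disc _ 1 (@measurable_disc R) (@disc_lty R)); last by move=> w _; exact: cutoff_bounded.
by apply: ccont_measurable => w _; exact: ccont_cutoff.
Qed.

Lemma kernel_orthogonal F f z l (r1 b : R) : 1 < r1 -> disc z -> 2 <= b ->
  (forall w, normc w < r1 -> has_cderiv F w (f w) /\ ccont f w) -> has_cderiv f z l ->
  let g w := (F w - F z) * (bker (b + 2) z w) * cutoff 1 b w in
  cintegrable area disc g /\ cintegral area disc g = 0.
Proof.
move=> r11 z1 b2 dF df g.
have [] := bergman_orthogonal ltr01 (lexx 1) r11 z1 b2 dF df.
set G := (fun w => _); have -> : G = fun w => if w \in disc then g w else 0.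
  apply/funext => w; rewrite (cutoff_disc (fun w => (F w - F z) * bker (b + 2) z w) w b2).
  rewrite /G /bker expr1n.
  by rewrite -mulrA [_^-1 * _]mulrC.
rewrite -cintegral_mkcond => iG; split => //.
exact/(@cintegrable_mkcond _ _ _ area _ _ (@measurable_disc R)).
Qed.

(** The orthogonality relation at the centre 0, where the kernel is 1, is applied to the holomorphic
    function [w |-> (1 - w conj z) ^ -(b + 2)]; conjugation then returns the kernel in the right
    variable. *)
Lemma bergman_mean b z : 2 <= b -> disc z ->
  cintegrable area disc (fun w => bker (b + 2) z w * cutoff 1 b w) /\
  cintegral area disc (fun w => bker (b + 2) z w * cutoff 1 b w) = bergman_mass b.
Proof.
move=> b2 z1; have mD := @measurable_disc R.
have d0 : disc 0 by rewrite /Defs.disc /mkset normc0.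
pose F w := bker (b + 2) w z; pose f w := (b + 2)%:C%C * z^*%C * bker (b + 2 + 1) w z.
have z0 := normc_ge0 z; have z1' : normc z < 1 := z1.
pose r1 := 2 / (1 + normc z).
have D0 : 0 < 1 + normc z by rewrite ltr_wpDr.
have r11 : 1 < r1 by rewrite /r1 ltr_pdivlMr // mul1r; lra.
have small w : normc w < r1 -> normc (w * z^*%C) < 1.
  rewrite /r1 ltr_pdivlMr // normcM normcJ => h; have := normc_ge0 w; nra.
have dF w : normc w < r1 -> has_cderiv F w (f w) /\ ccont f w.
  move=> /small h; split; first exact: has_cderiv_bker.
  by apply: ccontM (ccont_cst _ _) (has_cderiv_ccont (has_cderiv_bker _ h)).
have df : has_cderiv f 0 ((b + 2)%:C%C * z^*%C * ((b + 2 + 1)%:C%C * z^*%C * bker (b + 2 + 1 + 1) 0 z)).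
  by apply: has_cderivZ; apply: has_cderiv_bker; rewrite mul0r normc0.
have [] := kernel_orthogonal r11 d0 b2 dF df.
have b0 s w : bker s 0 w = 1 by rewrite /bker mul0r subr0 (_ : 1 = 1%:C%C) // cpow_real // powR1 invr1.
have F0 : F 0 = 1 by rewrite /F /bker mul0r subr0 (_ : 1 = 1%:C%C) // cpow_real // powR1 invr1.
under eq_fun do rewrite F0 b0 mulr1 mulrBl mul1r.
move=> i1 E1; have ic := cintegrable_cutoff b2.
have iF : cintegrable area disc (fun w => F w * cutoff 1 b w).
  rewrite (_ : (fun w => _) = fun w => (F w * cutoff 1 b w - cutoff 1 b w) + cutoff 1 b w).
    exact: cintegrableD.
  by apply/funext => w; rewrite subrK.
have EF : cintegral area disc (fun w => F w * cutoff 1 b w) = bergman_mass b.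
  by move: E1; rewrite cintegralB // => /eqP; rewrite subr_eq0 => /eqP.
have J w : disc w -> bker (b + 2) z w * cutoff 1 b w = (F w * cutoff 1 b w)^*%C.
  by move=> w1; rewrite conjM cutoff_real /F conj_bker // normcMJ_lt1.
have iJ := cintegrableJ mD iF; split.
  by apply: eq_cintegrable iJ => // w; rewrite inE => /J ->.
rewrite (@eq_cintegral _ _ _ area _ _ (fun w => (F w * cutoff 1 b w)^*%C)); last first.
  by move=> w; rewrite inE => /J.
rewrite cintegralJ // EF /bergman_mass -cintegralJ //.
by apply: eq_cintegral => w _; exact: cutoff_real.
Qed.

Lemma kernel_formula F f z l (r1 b : R) : 1 < r1 -> disc z -> 2 <= b ->
  (forall w, normc w < r1 -> has_cderiv F w (f w) /\ ccont f w) -> has_cderiv f z l ->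
  cintegral area disc (fun w => F w * cutoff 1 b w * bker (b + 2) z w) = bergman_mass b * F z.
Proof.
move=> r11 z1 b2 dF df; have mD := @measurable_disc R.
have [iG EG] := kernel_orthogonal r11 z1 b2 dF df.
have [iB EB] := bergman_mean b2 z1.
rewrite mulrC -EB -cintegralZ // -[RHS]add0r -EG -cintegralD //; last exact: cintegrableZ.
by apply: eq_cintegral => w _; ring.
Qed.

Lemma cutoffE b w : 2 <= b -> disc w -> cutoff 1 b w = ((1 - normc w ^+ 2) `^ b)%:C%C.
Proof.
move=> b2 w1; rewrite /cutoff expr1n pos_powE // subr_ge0 expr_le1 ?normc_ge0 //; exact: ltW.
Qed.

Lemma area_disc_gt0 : (0 < area disc)%E.
Proof.
pose a : R := 4^-1.
pose Q : set (R * R) := [set` `[- a, a]] `*` [set` `[- a, a]].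
have lQ : (0 < (@lebesgue_measure R \x @lebesgue_measure R)%E Q)%E.
  rewrite product_measure1E; try exact: measurable_itv.
  have I : (0 < @lebesgue_measure R [set` `[(- a)%R : R, a%R : R]])%E.
    by rewrite lebesgue_measure_itv /= lte_fin ifT /a; [rewrite lte_fin|]; lra.
  by apply: mule_gt0; exact: I.
rewrite area_set; apply: mule_gt0; first by rewrite lte_fin invr_gt0 pi_gt0.
apply: (lt_le_trans lQ); apply: le_measure; rewrite ?inE //.
- by apply: measurableX; exact: measurable_itv.
- exact: (@measurable_disc R).
- move=> [x y] []; rewrite /preimage /complex_of_pair /Defs.disc /= !in_itv /= => hx hy.
  apply: (@le_lt_trans _ _ (`|x| + `|y|)); first exact: (normc_le_ReIm (x +i* y)%C).
  have : `|x| <= a by rewrite ler_norml.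
  have : `|y| <= a by rewrite ler_norml.
  rewrite /a; lra.
Qed.

Lemma bergman_mass_neq0 b : 2 <= b -> bergman_mass b != 0.
Proof.
move=> b2; apply/eqP => E; have E0 : Re (bergman_mass b) = 0 by rewrite E.
have mD := @measurable_disc R; have [iR _] := cintegrable_cutoff b2.
have I0 : (\int[area]_(w in disc) `|(EFin \o (fun w => Re (cutoff 1 b w))) w| = 0)%E.
  rewrite -[RHS](congr1 EFin E0) /bergman_mass fineK ?(integrable_fin_num mD iR) //.
  by apply: eq_integral => w _; rewrite gee0_abs // lee_fin pos_pow_ge0.
have [N [mN N0 subN]] := (ae_eq_integral_abs area mD (measurable_int _ iR)).1 I0.
have := area_disc_gt0; rewrite lt_neqAle => /andP[/eqP + _]; apply.
apply/esym/eqP; rewrite eq_le measure_ge0 andbT -N0; apply: le_measure; rewrite ?inE //.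
move=> w w1; apply: subN => /(_ w1) [E1]; have E1' : Re (cutoff 1 b w) = 0 := E1.
have : 0 < Re (cutoff 1 b w).
  by rewrite (cutoffE b2 w1) powR_gt0 // subr_gt0 expr_lt1 ?normc_ge0.
by rewrite E1' ltxx.
Qed.

(* Solving the reproducing formula for a local primitive [F] makes [F] smooth. *)
Lemma analytic_derive1 f : analytic f -> analytic (derive1 f).
Proof.
move=> af z0 z01; have mD := @measurable_disc R.
have b2 : (2 : R) <= 2 by [].
have nz : normc z0 < 1 := z01.
(* A quarter of the distance to the circle, so that [m] maps the disc of radius 4 into the unit disc
   and there is room for a square of half-side 2. *)
pose r : R := (1 - normc z0) / 4; have r0 : 0 < r by rewrite divr_gt0 // subr_gt0.
pose m w := z0 + r%:C%C * w.
have mdisc w : normc w < 4 -> disc (m w).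
  move=> w4; rewrite /Defs.disc /mkset (le_lt_trans (normcD _ _)) // normr_line gtr0_norm //.
  have : r * normc w < r * 4 by rewrite ltr_pM2l.
  have : r * 4 = 1 - normc z0 by rewrite /r; field.
  lra.
have dm w : has_cderiv m w (0 + r%:C%C * 1).
  apply: has_cderivD; first exact: has_cderiv_cst.
  exact: has_cderivZ (has_cderiv_id _).
pose fm w := f (m w).
have dfm w : normc w < 4 -> has_cderiv fm w (derive1 f (m w) * r%:C%C).
  move=> w4; have := has_cderiv_comp (dm w) (derivable_has_cderiv (af _ (mdisc _ w4))).
  by rewrite add0r mulr1.
(* The half-side [3 / 2] exceeds 1: the reproducing formula needs [F] holomorphic beyond the closed
   unit disc. *)
have [F dF] : exists F : C -> C, forall z, `|Re z| < 3 / 2 -> `|Im z| < 3 / 2 -> has_cderiv F z (fm z).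
  apply: (@primitive_exists R fm 2 (3 / 2)); rewrite ?divr_gt0 //; first by lra.
  move=> w w1 w2; exists (derive1 f (m w) * r%:C%C); apply: dfm.
  by rewrite (le_lt_trans (normc_le_ReIm _)) //; lra.
have dF' w : normc w < 3 / 2 -> has_cderiv F w (fm w) /\ ccont fm w.
  move=> w1; split.
    by apply: dF; [apply: le_lt_trans (Re_le_normc _) w1|apply: le_lt_trans (Im_le_normc _) w1].
  by apply: (has_cderiv_ccont (dfm _ _)); lra.
pose h w := F w * cutoff 1 2 w.
have ih : cintegrable area disc h.
  have [M M0 HM] : exists2 M : R, 0 < M & forall w, `|Re w| <= 1 -> `|Im w| <= 1 -> normc (F w) <= M.
    by apply: ccont_bounded => w w1 w2; apply: (has_cderiv_ccont (dF w _ _)); lra.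
  apply: (@cintegrable_bounded R disc _ M mD (@disc_lty R)).
    apply: measurable_funMC; apply: ccont_measurable => w w1; last exact: ccont_cutoff.
    apply: (has_cderiv_ccont (dF' w _).1); apply: lt_trans w1 _; lra.
  move=> w w1; rewrite normcM -[M]mulr1 ler_pM ?normc_ge0 ?cutoff_bounded // HM //; apply: le_trans (ltW w1); [exact: Re_le_normc|exact: Im_le_normc].
have J0 := bergman_mass_neq0 b2; set J := bergman_mass 2 in J0.
have FE z : disc z -> F z = J^-1 * cintegral area disc (fun w => h w * bker (2 + 2) z w).
  move=> z1; have z1' : normc z < 3 / 2 by apply: lt_trans z1 _; lra.
  rewrite (kernel_formula _ z1 b2 dF' (dfm z _)) ?mulKf //; lra.
have near (P : C -> C -> Prop) z : disc z -> exists2 d : R, 0 < d & forall v, normc (v - z) < d -> disc v.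
  move=> z1; exists (1 - normc z); first by rewrite subr_gt0.
  move=> v vz; rewrite /Defs.disc /mkset -(subrK z v) (le_lt_trans (normcD _ _)) // -ltrBrDr //.
have pot (h1 : C -> C) s z : 0 <= s -> cintegrable area disc h1 -> disc z ->
    has_cderiv (fun v => J^-1 * cintegral area disc (fun w => h1 w * bker s v w)) z
      (J^-1 * cintegral area disc (fun w => (h1 w * (s%:C%C * w^*%C)) * bker (s + 1) z w)).
  move=> s0 ih1 z1; apply: has_cderivZ.
  have := has_cderiv_potential s0 z1 ih1; congr has_cderiv; apply: eq_cintegral => w _; ring.
have iJ (h1 : C -> C) s : cintegrable area disc h1 -> cintegrable area disc (fun w => h1 w * (s%:C%C * w^*%C)).
  move=> ih1; have mh1 := cintegrable_measurable ih1.
  have ig := integrableZl mD `|s| (cintegrable_normc mD ih1).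
  apply: cintegrableW ig => //.
    apply: measurable_funMC => //; apply: measurable_funMC; first exact: measurable_cst.
    by apply: measurable_funJ; exact: measurable_id.
  move=> w w1; rewrite /= !normcM normcR normcJ mulrC.
  rewrite ler_wpM2r ?normc_ge0 // ler_piMr //; exact: ltW.
(* Differentiating the potential formula for [F] once represents [fm], a second time represents the
   derivative of [fm], and the third time, at 0, gives the claim after undoing the change of
   variable [m]. *)
have fE z : disc z -> fm z = J^-1 * cintegral area disc (fun w => (h w * ((2 + 2)%:C%C * w^*%C)) * bker (2 + 2 + 1) z w).
  move=> z1; have [d d0 Hd] := near (fun _ _ => True) z z1.
  have z1' : normc z < 3 / 2 by apply: lt_trans z1 _; lra.
  apply: has_cderiv_eq (dF' _ z1').1 _.
  have s0 : 0 <= 2 + 2 :> R by [].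
  by apply: (has_cderiv_near d0 _ (pot _ _ _ s0 ih z1)) => v /Hd /FE ->.
have s5 : 0 <= 2 + 2 + 1 :> R by [].
have s6 : 0 <= 2 + 2 + 1 + 1 :> R by [].
have i1 := iJ _ (2 + 2) ih; have i2 := iJ _ (2 + 2 + 1) i1.
have gE z : disc z -> derive1 f (m z) * r%:C%C = J^-1 * cintegral area disc
    (fun w => (h w * ((2 + 2)%:C%C * w^*%C) * ((2 + 2 + 1)%:C%C * w^*%C)) * bker (2 + 2 + 1 + 1) z w).
  move=> z1; have [d d0 Hd] := near (fun _ _ => True) z z1.
  apply: has_cderiv_eq (dfm _ _) _; first by apply: lt_trans z1 _; lra.
  by apply: (has_cderiv_near d0 _ (pot _ _ _ s5 i1 z1)) => v /Hd /fE ->.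
have d0 : disc 0 by rewrite /Defs.disc /mkset normc0.
have rn0 : r%:C%C != 0 :> C by rewrite -normc_gt0 normcR normr_gt0 gt_eqF.
pose back z := (r%:C%C)^-1 * (z - z0).
have dback : has_cderiv back z0 ((r%:C%C)^-1 * (1 - 0)).
  by apply: has_cderivZ; apply: has_cderivB; [exact: has_cderiv_id|exact: has_cderiv_cst].
have b0 : back z0 = 0 by rewrite /back subrr mulr0.
have Dg := pot _ _ 0 s6 i2 d0; rewrite -b0 in Dg.
have := has_cderivZ (r%:C%C)^-1 (has_cderiv_comp dback Dg).
set G := (fun w => _); set l := (X in has_cderiv _ _ X) => DG.
suff : has_cderiv (derive1 f) z0 l by move=> /has_cderiv_derivable[].
apply: (has_cderiv_near r0 _ DG) => v vz; rewrite /G.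
have bv : disc (back v).
  rewrite /Defs.disc /mkset /back normcM normcV normcR gtr0_norm // mulrC ltr_pdivrMr // mul1r //.
have mb : m (back v) = v by rewrite /m /back mulrA mulfV // mul1r addrC subrK.
have E := gE _ bv; rewrite mb in E.
transitivity ((r%:C%C)^-1 * (derive1 f v * r%:C%C)); first by congr (_ * _); rewrite E.
by move: (derive1 f v) => l'; rewrite mulrC mulfK.
Qed.

End reproducing_formula.

Section segment.
Variable R : realType.
Local Notation C := R[i].
Local Notation Re := complex.Re.
Local Notation Im := complex.Im.
Local Notation lambda := (@lebesgue_measure R).

Lemma ccont_segment (G : C -> C) : (forall t : R, 0 <= t <= 1 -> ccont G t%:C%C) ->
  {within `[0, 1], continuous (fun t : R => Re (G t%:C%C))} /\
  {within `[0, 1], continuous (fun t : R => Im (G t%:C%C))}.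
Proof.
move=> cG; have E (t : R) : t%:C%C = 0 + t%:C%C * 1 by rewrite add0r mulr1.
have H (t : R) : 0 <= t <= 1 -> ccont G (0 + t%:C%C * 1) by move=> /cG; rewrite -E.
have RE : (fun t : R => Re (G t%:C%C)) = fun t : R => Re (G (0 + t%:C%C * 1)).
  by apply/funext => t; rewrite -E.
have IE : (fun t : R => Im (G t%:C%C)) = fun t : R => Im (G (0 + t%:C%C * 1)).
  by apply/funext => t; rewrite -E.
rewrite RE IE; split; apply: continuous_in_subspaceT => t; rewrite inE /= in_itv /= => /H/ccont_line[];
  by [].
Qed.

Lemma cintegrable_segment (G : C -> C) : (forall t : R, 0 <= t <= 1 -> ccont G t%:C%C) ->
  cintegrable lambda `[0, 1] (fun t => G t%:C%C).
Proof. by move=> /ccont_segment[cR cI]; split; exact: itv_integrable. Qed.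

Lemma FTC_segment (G G1 : C -> C) : (forall t : R, 0 <= t <= 1 -> has_cderiv G t%:C%C (G1 t%:C%C)) ->
  (forall t : R, 0 <= t <= 1 -> ccont G1 t%:C%C) ->
  cintegral lambda `[0, 1] (fun t => G1 t%:C%C) = G 1 - G 0.
Proof.
move=> dG cG1; have [cR cI] := ccont_segment cG1.
have E (t : R) : t%:C%C = 0 + t%:C%C * 1 by rewrite add0r mulr1.
have D (t : R) : 0 <= t <= 1 -> is_derive t 1 (fun s : R => Re (G s%:C%C)) (Re (G1 t%:C%C)) /\
    is_derive t 1 (fun s : R => Im (G s%:C%C)) (Im (G1 t%:C%C)).
  move=> /dG; rewrite {1}E => /has_cderiv_line; rewrite mulr1.
  have -> : (fun s : R => Re (G (0 + s%:C%C * 1))) = fun s : R => Re (G s%:C%C).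
    by apply/funext => s; rewrite -E.
  have -> : (fun s : R => Im (G (0 + s%:C%C * 1))) = fun s : R => Im (G s%:C%C).
    by apply/funext => s; rewrite -E.
  by [].
have K (u du : R -> R) : {within `[0, 1], continuous du} ->
    (forall t : R, 0 <= t <= 1 -> is_derive t 1 u (du t)) ->
    fine (\int[lambda]_(t in `[0%R, 1%R]) (du t)%:E)%E = u 1 - u 0.
  move=> cdu dudu; rewrite (continuous_FTC2 ltr01 cdu (F := u)) //.
    have cu : {within `[0, 1], continuous u}.
      by apply: (@is_derive_within_continuous R u du) => t t1 t2; apply: dudu; rewrite t1.
    have [c1 c2 c3] := (continuous_within_itvP u ltr01).1 cu.
    split=> //; move=> t; rewrite in_itv /= => /andP[t1 t2].
    by have [] : is_derive t 1 u (du t) by apply: dudu; rewrite !ltW.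
  move=> t; rewrite in_itv /= => /andP[t1 t2]; rewrite derive1E.
  by have [] : is_derive t 1 u (du t) by apply: dudu; rewrite !ltW.
have KR := K (fun s => Re (G s%:C%C)) (fun t => Re (G1 t%:C%C)) cR (fun t h => (D t h).1).
have KI := K (fun s => Im (G s%:C%C)) (fun t => Im (G1 t%:C%C)) cI (fun t h => (D t h).2).
by apply: complexP; [rewrite cReD cReN; exact: KR|rewrite cImD cImN; exact: KI].
Qed.

End segment.

Section primitive_kernel.
Variable R : realType.
Local Notation C := R[i].
Local Notation Re := complex.Re.
Local Notation Im := complex.Im.
Local Notation area := (@area R).
Local Notation disc := (@disc R).
Local Notation lambda := (@lebesgue_measure R).
Implicit Types (z w v : C) (F f g h : C -> C) (s b : R).

Lemma disc_scale (t : R) z : 0 <= t <= 1 -> disc z -> disc (t%:C%C * z).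
Proof.
move=> /andP[t0 t1] z1; rewrite /Defs.disc /mkset normr_line ger0_norm //.
by rewrite (le_lt_trans _ z1) // ler_piMl // normc_ge0.
Qed.

Lemma disc_near z : disc z -> exists2 x : R, 0 < x & forall v, normc (v - z) < x ->
  disc v /\ x <= 1 - normc v.
Proof.
move=> z1; have z1' : normc z < 1 by [].
exists ((1 - normc z) / 2); first by rewrite divr_gt0 // subr_gt0.
move=> v vx; have vz : normc v < normc z + (1 - normc z) / 2.
  by rewrite -(subrK z v) (le_lt_trans (normcD _ _)) // addrC ltrD2l.
by rewrite /Defs.disc /=; split; lra.
Qed.

Lemma has_cderiv_scale (t : R) v : has_cderiv (fun u => t%:C%C * u) v t%:C%C.
Proof. by have := has_cderivZ t%:C%C (@has_cderiv_id R v); rewrite mulr1. Qed.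

Lemma has_cderiv_bker_scale s (t : R) v w : normc (t%:C%C * v * w^*%C) < 1 ->
  has_cderiv (fun u => bker s (t%:C%C * u) w) v
    (s%:C%C * w^*%C * bker (s + 1) (t%:C%C * v) w * t%:C%C).
Proof. by move=> h; exact: has_cderiv_comp (has_cderiv_scale t v) (has_cderiv_bker s h). Qed.

Lemma ccont_bker_segment s v w (t : R) : disc v -> disc w -> 0 <= t <= 1 ->
  ccont (fun u => bker s (u * v) w) t%:C%C.
Proof.
move=> v1 w1 t01; have h := normcMJ_lt1 (disc_scale t01 v1) w1.
have := has_cderiv_comp (has_cderivM (has_cderiv_id t%:C%C) (has_cderiv_cst v _)) (has_cderiv_bker s h).
exact: has_cderiv_ccont.
Qed.

Local Notation RL := (g_sigma_algebraType R.-ocitv.-measurable).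

Lemma measurable_I01 : measurable ([set` `[0%R : R, 1%R : R]] : set RL).
Proof. exact: measurable_itv. Qed.

Lemma LkernelE b z w :
  Lkernel b z w = cintegral lambda `[0, 1] (fun t => z * bker (b + 2) (t%:C%C * z) w).
Proof. by []. Qed.

Lemma Lkernel0 b w : Lkernel b 0 w = 0.
Proof.
rewrite LkernelE -[RHS](cintegral0 lambda [set` `[0%R : R, 1%R : R]]).
by apply: eq_cintegral => t _; rewrite mul0r.
Qed.

Lemma cintegrable_Lkernel b z w : disc z -> disc w ->
  cintegrable lambda `[0, 1] (fun t => z * bker (b + 2) (t%:C%C * z) w).
Proof.
move=> z1 w1; apply: (@cintegrable_segment _ (fun u => z * bker (b + 2) (u * z) w)) => t t01.
by apply: ccontM (ccont_cst _ _) _; exact: ccont_bker_segment.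
Qed.

Lemma normc_Lkernel_le b z w (x : R) : 0 <= b -> disc z -> disc w -> 0 < x -> x <= 1 - normc z ->
  normc (Lkernel b z w) <= 2 * (x `^ (b + 2))^-1.
Proof.
move=> b0 z1 w1 x0 xz; have mI := measurable_I01.
have iL := cintegrable_Lkernel b z1 w1.
rewrite -lee_fin LkernelE; apply: (le_trans (cintegral_le mI iL)).
rewrite EFinM lee_pmul2l //.
apply: (@le_trans _ _ (\int[lambda]_(t in [set` `[0%R : R, 1%R : R]]) ((x `^ (b + 2))^-1)%:E)%E).
  apply: ge0_le_integral => //.
  - by move=> t _; rewrite lee_fin normc_ge0.
  - exact: measurable_int (cintegrable_normc mI iL).
  move=> t; rewrite /= in_itv /= => t01; rewrite lee_fin normcM.
  have tz := disc_scale t01 z1.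
  apply: (@le_trans _ _ (normc (bker (b + 2) (t%:C%C * z) w))).
    by rewrite ler_piMl ?normc_ge0 // ltW.
  apply: normc_bker_le => //; first by rewrite addr_ge0.
  rewrite (le_trans xz) // lerD2l lerN2 normr_line; case/andP: t01 => t0 t1.
  by rewrite ger0_norm // ler_piMl ?normc_ge0.
have l1 : lambda [set` `[0%R : R, 1%R : R]] = 1%E.
  by rewrite lebesgue_measure_itv /= lte_fin ltr01 oppr0 adde0.
by rewrite integral_cst // [X in (_ * X)%E](_ : _ = 1%E) ?mule1.
Qed.

(* [d/dv Lkernel] is the integral of [d/dt (t (1 - t v w^* )^(-b-2))]. *)
Lemma has_cderiv_Lkernel b z w : 0 <= b -> disc z -> disc w ->
  has_cderiv (Lkernel b ^~ w) z (bker (b + 2) z w).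
Proof.
move=> b0 z1 w1; set s := b + 2; have s0 : 0 <= s by rewrite addr_ge0.
have s10 : 0 <= s + 1 by rewrite addr_ge0. have s20 : 0 <= s + 1 + 1 by rewrite addr_ge0.
have mI := measurable_I01.
have [x x0 Hx] := disc_near z1.
pose k v (t : R) := v * bker s (t%:C%C * v) w.
pose k1 v (t : R) := 1 * bker s (t%:C%C * v) w + v * (s%:C%C * w^*%C * bker (s + 1) (t%:C%C * v) w * t%:C%C).
pose k2 v (t : R) := (0 * bker s (t%:C%C * v) w + 1 * (s%:C%C * w^*%C * bker (s + 1) (t%:C%C * v) w * t%:C%C)) +
  (1 * (s%:C%C * w^*%C * bker (s + 1) (t%:C%C * v) w * t%:C%C) +
   v * (s%:C%C * w^*%C * ((s + 1)%:C%C * w^*%C * bker (s + 1 + 1) (t%:C%C * v) w * t%:C%C) * t%:C%C)).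
pose B (u : R) := (x `^ u)^-1.
have Bge0 u : 0 <= B u by rewrite invr_ge0 powR_ge0.
pose M := B s + s * B (s + 1) + (s * B (s + 1) + s * B (s + 1) + s * ((s + 1) * B (s + 1 + 1))).
have Bk (u t : R) v : 0 <= u -> 0 <= t <= 1 -> disc v -> x <= 1 - normc v ->
    normc (bker u (t%:C%C * v) w) <= B u.
  move=> u0 t01 v1 xv; apply: normc_bker_le => //; first exact: disc_scale.
  rewrite (le_trans xv) // lerD2l lerN2 normr_line; case/andP: t01 => t0 t1.
  by rewrite ger0_norm // ler_piMl ?normc_ge0.
have w1' : normc (w^*%C) <= 1 by rewrite normcJ ltW.
have ml (p q : R) : 0 <= p <= 1 -> 0 <= q -> p * q <= q.
  by move=> /andP[p0 p1] q0; rewrite ler_piMl.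
have t1n (u t : R) y : 0 <= u -> 0 <= t <= 1 -> normc (u%:C%C * w^*%C * y * t%:C%C) <= u * normc y.
  move=> u0 /andP[t0 t1]; rewrite !normcM !normcR !ger0_norm //.
  rewrite -!mulrA ler_wpM2l // mulrCA ler_piMr ?normc_ge0 //.
  by rewrite mulr_ile1 ?normc_ge0.
have kk (t : R) v : 0 <= t <= 1 -> disc v -> x <= 1 - normc v ->
  [/\ normc (k v t) <= M, normc (k1 v t) <= M & normc (k2 v t) <= M].
  move=> t01 v1 xv; have b1 := Bk s t v s0 t01 v1 xv; have b2 := Bk (s + 1) t v s10 t01 v1 xv.
  have b3 := Bk (s + 1 + 1) t v s20 t01 v1 xv.
  have vle y : normc (v * y) <= normc y by rewrite normcM ler_piMl ?normc_ge0 // ltW.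
  have T1 : normc (s%:C%C * w^*%C * bker (s + 1) (t%:C%C * v) w * t%:C%C) <= s * B (s + 1).
    by rewrite (le_trans (t1n _ _ _ s0 t01)) // ler_wpM2l.
  have T2 : normc (v * (s%:C%C * w^*%C * ((s + 1)%:C%C * w^*%C * bker (s + 1 + 1) (t%:C%C * v) w * t%:C%C) * t%:C%C))
      <= s * ((s + 1) * B (s + 1 + 1)).
    rewrite (le_trans (vle _)) // (le_trans (t1n _ _ _ s0 t01)) // ler_wpM2l //.
    by rewrite (le_trans (t1n _ _ _ s10 t01)) // ler_wpM2l.
  have p1 : 0 <= s * B (s + 1) by rewrite mulr_ge0.
  have p2 : 0 <= s * ((s + 1) * B (s + 1 + 1)) by rewrite !mulr_ge0.
  have p3 := Bge0 s.
  rewrite /M; split.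
  - rewrite /k (le_trans (vle _)) //; lra.
  - rewrite /k1 mul1r (le_trans (normcD _ _)) //; have := vle (s%:C%C * w^*%C * bker (s + 1) (t%:C%C * v) w * t%:C%C).
    lra.
  - rewrite /k2 mul0r add0r mul1r (le_trans (normcD _ _)) //.
    have := normcD (s%:C%C * w^*%C * bker (s + 1) (t%:C%C * v) w * t%:C%C) (v * (s%:C%C * w^*%C * ((s + 1)%:C%C * w^*%C * bker (s + 1 + 1) (t%:C%C * v) w * t%:C%C) * t%:C%C)).
    lra.
have M0 : 0 <= M by rewrite /M !(addr_ge0, mulr_ge0).
have i1 : cintegrable lambda `[0, 1] (fun=> 1 : C).
  by apply: (@cintegrable_segment _ (fun=> 1)) => t _; exact: ccont_cst.
have zz : normc (z - z) < x by rewrite subrr normc0.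
pose G u := u * bker s (u * z) w.
pose G1 u := 1 * bker s (u * z) w + u * (s%:C%C * w^*%C * bker (s + 1) (u * z) w * (1 * z + u * 0)).
have dG (t : R) : 0 <= t <= 1 -> has_cderiv G t%:C%C (G1 t%:C%C).
  move=> t01; apply: has_cderivM (has_cderiv_id _) _.
  have h := normcMJ_lt1 (disc_scale t01 z1) w1.
  exact: has_cderiv_comp (has_cderivM (has_cderiv_id t%:C%C) (has_cderiv_cst z _)) (has_cderiv_bker s h).
have cG1 (t : R) : 0 <= t <= 1 -> ccont G1 t%:C%C.
  move=> t01; have c u := @ccont_bker_segment u z w t z1 w1 t01.
  apply: ccontD; first exact: ccontM (ccont_cst _ _) (c s).
  apply: ccontM (ccont_id _) _; apply: ccontM; first exact: ccontM (ccont_cst _ _) (c _).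
  by apply: ccontD; apply: ccontM (ccont_cst _ _) => //; [exact: ccont_cst|exact: ccont_id].
have GE : cintegral lambda `[0, 1] (fun t => 1 * k1 z t) = bker s z w.
  have <- : G 1 - G 0 = bker s z w by rewrite /G !mul1r mul0r subr0.
  rewrite -(FTC_segment dG cG1); apply: eq_cintegral => t _; rewrite /k1 /G1; ring.
have mk v (G2 : C -> C) : (forall t : R, 0 <= t <= 1 -> ccont G2 t%:C%C) ->
    measurable_fun ([set` `[0%R : R, 1%R : R]] : set RL) (fun t : R => G2 t%:C%C).
  by move=> /cintegrable_segment /cintegrable_measurable.
rewrite -GE.
have -> : (Lkernel b)^~ w = fun v => cintegral lambda `[0, 1] (fun t => 1 * k v t).
  by apply/funext => v; rewrite LkernelE; apply: eq_cintegral => t _; rewrite mul1r.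
apply: (@has_cderiv_cintegral _ _ R lambda _ (fun=> 1) k k1 k2 z x M mI x0 M0 i1).
- move=> v /Hx[v1 _]; apply: (mk v (fun u => v * bker s (u * v) w)) => t t01.
  by apply: ccontM (ccont_cst _ _) _; exact: ccont_bker_segment.
- apply: (mk z (fun u => 1 * bker s (u * z) w + z * (s%:C%C * w^*%C * bker (s + 1) (u * z) w * u))) => t t01.
  have c u := @ccont_bker_segment u z w t z1 w1 t01.
  apply: ccontD; first exact: ccontM (ccont_cst _ _) (c s).
  apply: ccontM (ccont_cst _ _) _; apply: ccontM (ccont_id _).
  exact: ccontM (ccont_cst _ _) (c _).
- move=> v t; rewrite /= in_itv /= => t01 /Hx[v1 xv].
  have h := normcMJ_lt1 (disc_scale t01 v1) w1.
  have [h1 h2 h3] := kk t v t01 v1 xv; split => //.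
    exact: has_cderivM (has_cderiv_id _) (has_cderiv_bker_scale _ h).
  apply: has_cderivD; first exact: has_cderivM (has_cderiv_cst 1 _) (has_cderiv_bker_scale _ h).
  have HZ := has_cderivZ (t%:C%C * (s%:C%C * w^*%C)) (has_cderiv_bker_scale (s + 1) h).
  apply: has_cderivM (has_cderiv_id _) _; move: HZ.
  rewrite [X in has_cderiv _ _ X -> _](_ : _ = s%:C%C * w^*%C *
    ((s + 1)%:C%C * w^*%C * bker (s + 1 + 1) (t%:C%C * v) w * t%:C%C) * t%:C%C); last by ring.
  by apply: has_cderiv_ext => u; rewrite -!mulrA mulrC !mulrA.
- move=> t; rewrite /= in_itv /= => t01; have [z1' xz] := Hx z zz.
  by have [] := kk t z t01 z1' xz.
Qed.

(** By conjugate symmetry [Lkernel b z w] is [z] times the conjugate of an integral that is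
    holomorphic in [w], hence continuous. *)
Lemma ccont_Lkernel b z w : 0 <= b -> disc z -> disc w -> ccont (Lkernel b z) w.
Proof.
move=> b0 z1 w1; set s := b + 2; have s0 : 0 <= s by rewrite addr_ge0.
have s10 : 0 <= s + 1 by rewrite addr_ge0. have s20 : 0 <= s + 1 + 1 by rewrite addr_ge0.
have mI := measurable_I01.
have [x x0 Hx] := disc_near w1.
pose tz (t : R) := t%:C%C * z.
pose k v (t : R) := bker s v (tz t).
pose k1 v (t : R) := s%:C%C * (tz t)^*%C * bker (s + 1) v (tz t).
pose k2 v (t : R) := s%:C%C * (tz t)^*%C * ((s + 1)%:C%C * (tz t)^*%C * bker (s + 1 + 1) v (tz t)).
pose B (u : R) := (x `^ u)^-1.
have Bge0 u : 0 <= B u by rewrite invr_ge0 powR_ge0.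
pose M := B s + s * B (s + 1) + s * ((s + 1) * B (s + 1 + 1)).
have M0 : 0 <= M by rewrite /M !(addr_ge0, mulr_ge0).
have i1 : cintegrable lambda `[0, 1] (fun=> 1 : C).
  by apply: (@cintegrable_segment _ (fun=> 1)) => t _; exact: ccont_cst.
have tz1 (t : R) : 0 <= t <= 1 -> disc (tz t) by move=> t01; exact: disc_scale.
have Bk (u t : R) v : 0 <= u -> 0 <= t <= 1 -> disc v -> x <= 1 - normc v ->
    normc (bker u v (tz t)) <= B u.
  by move=> u0 t01 v1 xv; apply: normc_bker_le => //; exact: tz1.
have t1n (u t : R) y : 0 <= u -> 0 <= t <= 1 -> normc (u%:C%C * (tz t)^*%C * y) <= u * normc y.
  move=> u0 t01; rewrite !normcM normcR normcJ ger0_norm // -mulrA ler_wpM2l //.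
  by rewrite ler_piMl ?normc_ge0 // ltW // tz1.
have cb u v (t : R) : disc v -> 0 <= t <= 1 -> ccont (fun y => bker u v (y * z)) t%:C%C.
  move=> v1 t01; have h := normcMJ_lt1 (tz1 t t01) v1.
  have [y0 y00 Hy] := disc_near (tz1 t t01).
  have cz : ccont (fun y => y * z) t%:C%C by exact: ccontM (ccont_id _) (ccont_cst _ _).
  have [d d0 Hd] := cz y0 y00.
  apply: (ccont_near d0) (ccontJ (ccont_bker_segment u z1 v1 t01)) => y /Hd/Hy[y1 _].
  by rewrite conj_bker // normcMJ_lt1.
have mk (G2 : C -> C) : (forall t : R, 0 <= t <= 1 -> ccont G2 t%:C%C) ->
    measurable_fun ([set` `[0%R : R, 1%R : R]] : set RL) (fun t : R => G2 t%:C%C).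
  by move=> /cintegrable_segment /cintegrable_measurable.
have ww : normc (w - w) < x by rewrite subrr normc0.
have [_ xw] := Hx _ ww.
have D : has_cderiv (fun v => cintegral lambda `[0, 1] (fun t => 1 * k v t)) w
    (cintegral lambda `[0, 1] (fun t => 1 * k1 w t)).
  apply: (@has_cderiv_cintegral _ _ R lambda _ (fun=> 1) k k1 k2 w x M mI x0 M0 i1).
  - by move=> v /Hx[v1 _]; apply: (mk (fun y => bker s v (y * z))) => t t01; exact: cb.
  - apply: (mk (fun y => s%:C%C * (y * z)^*%C * bker (s + 1) w (y * z))) => t t01.
    apply: ccontM; last exact: cb.
    apply: ccontM (ccont_cst _ _) (ccontJ _).
    exact: ccontM (ccont_id _) (ccont_cst _ _).
  - move=> v t; rewrite /= in_itv /= => t01 /Hx[v1 xv].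
    have h := normcMJ_lt1 v1 (tz1 t t01).
    have p1 : 0 <= s * B (s + 1) by rewrite mulr_ge0.
    have p2 : 0 <= s * ((s + 1) * B (s + 1 + 1)) by rewrite !mulr_ge0.
    have p3 := Bge0 s.
    split; first exact: has_cderiv_bker.
    + exact: has_cderivZ (has_cderiv_bker _ h).
    + rewrite (le_trans (Bk s t v s0 t01 v1 xv)) // /M; lra.
    + rewrite (le_trans (t1n s t _ s0 t01)) //.
      have : s * normc ((s + 1)%:C%C * (tz t)^*%C * bker (s + 1 + 1) v (tz t)) <= s * ((s + 1) * B (s + 1 + 1)).
        rewrite ler_wpM2l // (le_trans (t1n _ _ _ s10 t01)) // ler_wpM2l //.
        exact: Bk.
      rewrite /M; lra.
  - move=> t; rewrite /= in_itv /= => t01.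
    have p2 : 0 <= s * ((s + 1) * B (s + 1 + 1)) by rewrite !mulr_ge0.
    have p3 := Bge0 s.
    have : normc (k1 w t) <= s * B (s + 1).
      by rewrite (le_trans (t1n s t _ s0 t01)) // ler_wpM2l // Bk.
    rewrite /M; lra.
have cz := ccontM (ccont_cst z w) (ccontJ (has_cderiv_ccont D)).
apply: (ccont_near x0) cz => v /Hx[v1 _].
have iL := cintegrable_Lkernel b z1 v1.
have ik : cintegrable lambda `[0, 1] (fun t => 1 * k v t).
  apply: (@cintegrable_segment _ (fun y => 1 * bker s v (y * z))) => t t01.
  by apply: ccontM (ccont_cst _ _) _; exact: cb.
rewrite -cintegralJ // -cintegralZ //; last exact: cintegrableJ.
rewrite LkernelE; apply: eq_cintegral => t; rewrite inE => tI.
have t01 : 0 <= t <= 1 by move: tI; rewrite /= in_itv.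
by rewrite mul1r /k conj_bker //; apply: normcMJ_lt1 => //; exact: tz1.
Qed.

(** The weight [(1 - |w| ^ 2) ^ b] and the factor [b + 1] of [dA_b] are carried by [h], so that the
    same potential serves derivatives and step functions. *)
Definition bergman_potential b h z : C := cintegral area disc (fun w => h w * Lkernel b z w).

Lemma measurable_Lkernel b z : 0 <= b -> disc z -> measurable_fun disc (Lkernel b z).
Proof. by move=> b0 z1; apply: ccont_measurable => w w1; exact: ccont_Lkernel. Qed.

Lemma has_cderiv_bergman_potential b h z : 0 <= b -> disc z -> cintegrable area disc h ->
  has_cderiv (bergman_potential b h) z (cintegral area disc (fun w => h w * bker (b + 2) z w)).
Proof.
move=> b0 z1 ih; have mD := @measurable_disc R.
have [x x0 Hx] := disc_near z1; set s := b + 2; have s0 : 0 <= s by rewrite addr_ge0.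
have s10 : 0 <= s + 1 by rewrite addr_ge0.
pose B (u : R) := (x `^ u)^-1.
have Bge0 u : 0 <= B u by rewrite invr_ge0 powR_ge0.
pose M := 2 * B s + s * B (s + 1).
have zz : normc (z - z) < x by rewrite subrr normc0.
have [_ xz] := Hx _ zz.
have p1 : 0 <= s * B (s + 1) by rewrite mulr_ge0.
have M0 : 0 <= M by rewrite /M addr_ge0 // mulr_ge0.
apply: (@has_cderiv_cintegral _ _ R area disc h (Lkernel b) (bker s)
  (fun v w => s%:C%C * w^*%C * bker (s + 1) v w) z x M mD x0 M0 ih).
- by move=> v /Hx[v1 _]; exact: measurable_Lkernel.
- exact: measurable_bker.
- move=> v w w1 /Hx[v1 xv]; have h1 := normcMJ_lt1 v1 w1; split.
  + exact: has_cderiv_Lkernel.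
  + exact: has_cderiv_bker.
  + rewrite (le_trans (normc_Lkernel_le b0 v1 w1 x0 xv)) // /M; rewrite -/s -/(B s); lra.
  + have : normc (s%:C%C * w^*%C * bker (s + 1) v w) <= s * B (s + 1).
      rewrite !normcM normcR normcJ ger0_norm // -mulrA ler_wpM2l //.
      rewrite (le_trans _ (normc_bker_le s10 v1 w1 x0 xv)) // ler_piMl ?normc_ge0 // ltW //.
    have := Bge0 s; rewrite /M; lra.
- move=> w w1; rewrite (le_trans (normc_bker_le s0 z1 w1 x0 xz)) // -/(B s).
  have := Bge0 s; rewrite /M; lra.
Qed.

Lemma bergman_potential0 b h : bergman_potential b h 0 = 0.
Proof.
rewrite /bergman_potential -[RHS](cintegral0 area disc); apply: eq_cintegral => w _.
by rewrite Lkernel0 mulr0.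
Qed.

End primitive_kernel.

Section representation.
Variable R : realType.
Local Notation C := R[i].
Local Notation Re := complex.Re.
Local Notation Im := complex.Im.
Local Notation area := (@area R).
Local Notation disc := (@disc R).
Implicit Types (z w v : C) (F f g h : C -> C) (s b : R).

Lemma analytic_has_cderiv f z : analytic f -> disc z -> has_cderiv f z (derive1 f z).
Proof. by move=> af /af/derivable_has_cderiv. Qed.

Lemma analytic_ccont f z : analytic f -> disc z -> ccont f z.
Proof. by move=> af /(analytic_has_cderiv af)/has_cderiv_ccont. Qed.

Lemma analytic_measurable f : analytic f -> measurable_fun disc f.
Proof. by move=> af; apply: ccont_measurable => z; exact: analytic_ccont. Qed.

Lemma pos_pow_le (b s t : R) : 0 <= b -> s <= t -> pos_pow b s <= pos_pow b t.
Proof.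
move=> b0 st; have m0 u : 0 <= Num.max 0 u :> R by rewrite le_max lexx.
by apply: ge0_ler_powR; rewrite ?nnegrE // ge_max m0 /= le_max st orbT.
Qed.

(* [bergman_orthogonal] on the disc of radius [rho], letting [rho] tend to [1]. *)
Lemma reproducing f z b : 2 <= b -> analytic f -> disc z ->
  area.-integrable disc (fun w => (normc (f w) * (1 - normc w ^+ 2) `^ b)%:E) ->
  cintegrable area disc (fun w => f w * cutoff 1 b w) /\
  cintegral area disc (fun w => f w * cutoff 1 b w * bker (b + 2) z w) = bergman_mass b * f z.
Proof.
move=> b2 af z1 fi; have mD := @measurable_disc R.
have b0 : 0 <= b by rewrite (le_trans _ b2).
have nz : normc z < 1 := z1. have nz0 := normc_ge0 z.
have mc : measurable_fun disc (cutoff 1 b : C -> C).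
  by apply: ccont_measurable => w _; exact: ccont_cutoff.
have mf := analytic_measurable af.
have nf w : disc w -> normc (f w * cutoff 1 b w) = normc (f w) * (1 - normc w ^+ 2) `^ b.
  by move=> w1; rewrite normcM cutoffE // normcR ger0_norm ?powR_ge0.
have if1 : cintegrable area disc (fun w => f w * cutoff 1 b w).
  apply: cintegrableW fi => //; first exact: measurable_funMC.
  by move=> w /nf ->.
split => //.
(* For every radius [r >= r0] and [|w| < r], the base [r ^ 2 - z conj w] has modulus at least [e0];
   this makes the domination uniform in the radius. *)
pose r0 : R := (1 + normc z) / 2; pose e0 := r0 * (r0 - normc z).
have r01 : normc z < r0 by rewrite /r0; lra.
have r0lt : r0 < 1 by rewrite /r0; lra.
have r00 : 0 < r0 by rewrite (le_lt_trans _ r01).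
have e00 : 0 < e0 by rewrite mulr_gt0 // subr_gt0.
pose rho (n : nat) := 1 - (1 - r0) / n.+1%:R.
have rhoI n : r0 <= rho n /\ rho n < 1.
  have n1 : 0 < n.+1%:R :> R by [].
  split; last by rewrite /rho gtrBl divr_gt0 // subr_gt0.
  rewrite /rho lerBrDl -lerBrDr ler_pdivrMr // ler_peMr ?subr_ge0 ?(ltW r0lt) //.
  by rewrite ler1n.
pose g n w := (f w - f z) * (cutoff (rho n) b w / cpow ((rho n ^+ 2)%:C%C - z * w^*%C) (b + 2)).
pose g1 w := (f w - f z) * (cutoff 1 b w * bker (b + 2) z w).
have gP n : cintegrable area disc (g n) /\ cintegral area disc (g n) = 0.
  have [p1 p2] := rhoI n; have rp : 0 < rho n by rewrite (lt_le_trans r00).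
  have zr : normc z < rho n by rewrite (lt_le_trans r01).
  have [] := @bergman_orthogonal R f (derive1 f) z (derive1 (derive1 f) z) (rho n) 1 b rp (ltW p2) p2 zr b2.
  - move=> w w1; split; first exact: analytic_has_cderiv.
    exact: analytic_ccont (analytic_derive1 af) _.
  - exact: analytic_has_cderiv (analytic_derive1 af) z1.
  rewrite -/(g n) => iG EG; have gE : g n = fun w => if w \in disc then g n w else 0.
    apply/funext => w; case: ifPn => //; rewrite notin_setE => /negP; rewrite -leNgt => w1.
    rewrite /g cutoff0 ?mul0r ?mulr0 ?(ltW rp) //; first by rewrite gt_eqF // (lt_le_trans _ b2).
    exact: le_trans (ltW p2) w1.
  split; last by rewrite cintegral_mkcond -gE.
  by apply/(@cintegrable_mkcond _ _ _ area disc (g n) mD); rewrite -gE.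
have mg1 : measurable_fun disc g1.
  apply: measurable_funMC; first by apply: measurable_funBC => //; exact: measurable_cst.
  by apply: measurable_funMC => //; exact: measurable_bker.
pose M := (e0 `^ (b + 2))^-1.
have M0 : 0 <= M by rewrite invr_ge0 powR_ge0.
pose G w : R := (normc (f w) * (1 - normc w ^+ 2) `^ b + normc (f z)) * M.
have rle1 (r : R) : 0 <= r <= 1 -> r ^+ 2 <= 1 by move=> /andP[? ?]; rewrite expr_le1.
have dom (r : R) w : r0 <= r -> r <= 1 -> disc w ->
    normc ((f w - f z) * (cutoff r b w / cpow ((r ^+ 2)%:C%C - z * w^*%C) (b + 2))) <= G w.
  move=> rr r1 w1; have r_0 : 0 <= r by rewrite (le_trans (ltW r00)).
  have cb : normc (cutoff r b w) <= (1 - normc w ^+ 2) `^ b.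
    rewrite normcR ger0_norm ?pos_pow_ge0 // -[X in _ <= X]pos_powE.
      by apply: pos_pow_le => //; rewrite lerD2r rle1 // r_0.
    by rewrite subr_ge0 expr_le1 ?normc_ge0 // ltW.
  have pb1 : (1 - normc w ^+ 2) `^ b <= 1.
    by have := cutoff_bounded w b2; rewrite cutoffE // normcR ger0_norm ?powR_ge0.
  have pb0 : 0 <= (1 - normc w ^+ 2) `^ b by rewrite powR_ge0.
  have [rw|wr] := leP r (normc w).
    rewrite cutoff0 //; last by rewrite gt_eqF // (lt_le_trans _ b2).
    by rewrite mul0r mulr0 normc0 /G mulr_ge0 // addr_ge0 ?normc_ge0 // mulr_ge0 ?normc_ge0.
  have Xe : e0 <= normc ((r ^+ 2)%:C%C - z * w^*%C).
    apply: le_trans (normc_sub_ge _ _); rewrite normcR ger0_norm ?sqr_ge0 // normcM normcJ.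
    rewrite /e0; have := normc_ge0 w; nra.
  have cp : normc ((cpow ((r ^+ 2)%:C%C - z * w^*%C) (b + 2))^-1) <= M.
    have xn : normc z * normc w < r ^+ 2.
      rewrite expr2 (le_lt_trans (ler_wpM2l nz0 (ltW wr))) // ltr_pM2r ?(lt_le_trans r01) //.
      by rewrite (lt_le_trans r00).
    have [y0 _] := Re_kernel_gt0 xn.
    have cn0 := normc_eq_cpow (b + 2) y0.
    have : normc ((cpow ((r ^+ 2)%:C%C - z * w^*%C) (b + 2))^-1) * normc (cpow ((r ^+ 2)%:C%C - z * w^*%C) (b + 2)) = 1.
      by rewrite -normcM mulVf // normc1.
    have nb2 : 0 <= b + 2 by rewrite addr_ge0.
    have e0p : 0 < e0 `^ (b + 2) by rewrite powR_gt0.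
    have := ge0_ler_powR nb2 (ltW e00) (normc_ge0 _) Xe; rewrite normc_cpow.
    set N := normc _^-1; set P := _ `^ (b + 2) => Q NP.
    rewrite /M -[leRHS]mul1r ler_pdivlMr // -[leRHS]NP; apply: ler_wpM2l Q; exact: normc_ge0.
  rewrite normcM normcM mulrA; apply: ler_pM => //; rewrite ?mulr_ge0 ?normc_ge0 //.
  apply: (@le_trans _ _ ((normc (f w) + normc (f z)) * (1 - normc w ^+ 2) `^ b)).
    by apply: ler_pM => //; rewrite ?normc_ge0 ?normcB.
  by rewrite mulrDl lerD2l ler_piMr ?normc_ge0.
have iG : area.-integrable disc (EFin \o G).
  have ic : area.-integrable disc (EFin \o (fun=> normc (f z)) : C -> \bar R).
    apply: measurable_bounded_integrable => //; [exact: disc_lty|exact: bounded_cst].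
  have := integrableZl mD M (integrableD mD fi ic).
  by apply: eq_integrable => // w _ /=; rewrite -EFinD -EFinM mulrC.
have rE w : cutoff 1 b w * bker (b + 2) z w = cutoff 1 b w / cpow ((1 ^+ 2)%:C%C - z * w^*%C) (b + 2).
  by rewrite expr1n.
have mg n : measurable_fun disc (g n) by have [/cintegrable_measurable] := gP n.
have cvg w : disc w -> forall e : R, 0 < e -> exists N, forall n, (N <= n)%N -> normc (g n w - g1 w) < e.
  move=> w1 e e_0.
  (* The integrand as a function of the squared radius [t]; continuity at [t = 1] is the pointwise
     limit. *)
  pose P (t : C) := (pos_pow b (Re t - normc w ^+ 2))%:C%C * (cpow (t - z * w^*%C) (b + 2))^-1.
  have cP : ccont (fun t => (f w - f z) * P t) 1.
    apply: ccontM (ccont_cst _ _) _; apply: ccontM.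
      apply: (@ccont_real R (pos_pow b) (fun t : C => Re t - normc w ^+ 2)).
        exact: continuous_pos_pow.
      have := ccontD (@ccont_Re R 1) (ccont_cst (- (normc w ^+ 2)%:C%C) 1).
      by apply: ccont_ext => t; rewrite rmorphB.
    have zw := Re_bker_gt0 (normcMJ_lt1 z1 w1).
    apply: has_cderiv_ccont.
    apply: (@has_cderiv_comp R (fun t => t - z * w^*%C) (fun x => (cpow x (b + 2))^-1) 1 (1 - 0)).
      exact: has_cderivB (has_cderiv_id _) (has_cderiv_cst _ _).
    exact: has_cderiv_cpowV.
  have [d d0 Hd] := cP e e_0.
  have [N HN] : exists N : nat, 2 / d <= N%:R.
    by exists (Num.trunc (2 / d)).+1; rewrite ltW // truncnS_gt.
  exists N => n Nn.
  have gE : g n w = (f w - f z) * P ((rho n ^+ 2)%:C%C) by [].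
  have g1E : g1 w = (f w - f z) * P 1 by rewrite /g1 /P /cutoff /bker expr1n.
  rewrite gE g1E; apply: Hd; have -> : (rho n ^+ 2)%:C%C - 1 = (rho n ^+ 2 - 1)%:C%C :> C by rewrite rmorphB.
  rewrite normcR.
  have [p1 p2] := rhoI n; have rp : 0 <= rho n by rewrite (le_trans (ltW r00)).
  rewrite ler0_norm ?subr_le0 ?rle1 ?rp ?(ltW p2) // opprB.
  have -> : 1 - rho n ^+ 2 = (1 + rho n) * (1 - rho n) by ring.
  have n1 : 0 < n.+1%:R :> R by [].
  have : 1 - rho n < d / 2.
    rewrite /rho opprB addrC subrK (ltr_pdivrMr _ _ n1) mulrAC (ltr_pdivlMr _ _ (ltr0Sn R 1)).
    have : 2 <= d * N%:R by rewrite mulrC -ler_pdivrMr.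
    have : d * N%:R < d * n.+1%:R by rewrite (ltr_pM2l d0) ltr_nat.
    have : (1 - r0) * 2 <= 2 by move: r00; clear => ?; lra.
    clear => *; lra.
  have : 0 < 1 - rho n by rewrite subr_gt0.
  nra.
have [_ E0] : cintegrable area disc g1 /\ cintegral area disc g1 = 0.
  split.
    apply: (cintegrableW mD mg1 _ iG) => w w1; rewrite /g1 rE; apply: dom => //; exact: ltW.
  apply/eqP; rewrite -normc_eq0; apply/eqP; apply/le_anti; rewrite normc_ge0 andbT.
  apply/ler_addgt0Pr => e e_0; rewrite add0r.
  have := @cintegral_dct _ _ R area disc g g1 G mD mg mg1 cvg _ _ iG e e_0.
  case.
  - by move=> n w w1; have [p1 p2] := rhoI n; apply: dom => //; exact: ltW.
  - by move=> w w1; rewrite /g1 rE; apply: dom => //; exact: ltW.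
  move=> N /(_ N (leqnn N)); have [_ ->] := gP N; rewrite sub0r normcN; exact: ltW.
have [iB EB] := bergman_mean b2 z1.
have ig1 : cintegrable area disc g1.
  apply: (cintegrableW mD mg1 _ iG) => w w1; rewrite /g1 rE; apply: dom => //; exact: ltW.
rewrite mulrC -EB -cintegralZ // -[RHS]add0r -E0 -cintegralD //; last exact: cintegrableZ.
by apply: eq_cintegral => w _; rewrite /g1; ring.
Qed.

Lemma cderiv0_cst f z : (forall w, disc w -> has_cderiv f w 0) -> disc z -> f z = f 0.
Proof.
move=> df z1; have := @cmean_value R f (fun=> 0) 0 z 0; rewrite add0r mul0r mulr0.
move=> H; have : normc (f z - f 0) <= 0.
  by apply: H => t t01; rewrite ?normc0 // add0r; apply: df; exact: disc_scale.
by move=> h; apply/eqP; rewrite -subr_eq0 -normc_eq0 eq_le h normc_ge0.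
Qed.

(** Both sides have the same derivative, by [reproducing] applied to the derivative of [f], and both
    vanish at 0. *)
Lemma analytic_potential f z b : 2 <= b -> analytic f -> disc z ->
  area.-integrable disc (fun w => (normc (derive1 f w) * (1 - normc w ^+ 2) `^ b)%:E) ->
  bergman_potential b (fun w => derive1 f w * cutoff 1 b w) z = bergman_mass b * (f z - f 0).
Proof.
move=> b2 af z1 fi; have b0 : 0 <= b by rewrite (le_trans _ b2).
set h := (fun w => _); pose F v := bergman_potential b h v - bergman_mass b * f v.
have dF w : disc w -> has_cderiv F w 0.
  move=> w1; have [ih E] := reproducing b2 (analytic_derive1 af) w1 fi.
  have := has_cderivB (has_cderiv_bergman_potential b0 w1 ih) (has_cderivZ (bergman_mass b) (analytic_has_cderiv af w1)).
  by rewrite E subrr.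
have := cderiv0_cst dF z1; rewrite /F bergman_potential0 sub0r mulrBr => /eqP.
by rewrite subr_eq addrC => /eqP ->.
Qed.

End representation.

(** * Weights and Carleson densities *)

Section dyadic.
Variable R : realType.
Local Notation C := R[i].
Local Notation area := (@area R).
Implicit Types (z w p : C) (D : set C).

(** Take the least exponent: the previous one fails, which bounds [2 ^ n r] by [2 d]; for [n = 0]
    the bound is [r]. *)
Lemma dyadic_scale (d r : R) : 0 < r -> 0 <= d ->
  exists n, d < 2 ^+ n * r /\ 2 ^+ n * r <= Num.max r (2 * d).
Proof.
move=> r0 d0; have ex : exists n, d < 2 ^+ n * r.
  exists (Num.trunc (d / r)).+1; rewrite -ltr_pdivrMr // (lt_trans (truncnS_gt _)) //.
  by rewrite -natrX ltr_nat ltn_expl.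
exists (ex_minn ex); case: ex_minnP => -[|n] dn nmin; split => //.
  by rewrite expr0 mul1r le_max lexx.
rewrite le_max; apply/orP; right; rewrite exprS -mulrA ler_pM2l // leNgt.
by apply/negP => /nmin; rewrite ltnn.
Qed.

(** Annuli are replaced by overlapping balls: each point only has to be charged to one index at
    which [Gn] dominates. *)
Lemma dyadic_cover D (G : C -> \bar R) (B : nat -> set C) (Gn : nat -> C -> \bar R) :
  measurable D -> (forall n, measurable (B n)) -> measurable_fun D G ->
  (forall n, measurable_fun D (Gn n)) ->
  (forall w, D w -> 0 <= G w)%E -> (forall n w, D w -> 0 <= Gn n w)%E ->
  (forall w, D w -> exists n, B n w /\ (G w <= Gn n w)%E) ->
  (\int[area]_(w in D) G w <= \sum_(n <oo) \int[area]_(w in D `&` B n) Gn n w)%E.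
Proof.
move=> mD mB mG mGn G0 Gn0 H.
have E n : (\int[area]_(w in D `&` B n) Gn n w = \int[area]_(w in D) (Gn n \_ (B n)) w)%E.
  exact: integral_mkcondr.
have p0 n w : D w -> (0 <= (Gn n \_ (B n)) w)%E.
  by move=> Dw; rewrite patchE; case: ifPn => // _; exact: Gn0.
have mp n : measurable_fun D (Gn n \_ (B n)).
  apply/measurable_restrict => //; exact: (measurable_funS mD).
under eq_eseriesr do rewrite E.
rewrite -integral_nneseries //; apply: ge0_le_integral => //.
- by apply: (@ge0_emeasurable_sum _ _ _ _ _ xpredT) => // n w Dw _; exact: p0.
- move=> w Dw; have [n [Bn Gle]] := H w Dw.
  rewrite (@nneseriesD1 _ _ n) //; last by move=> k _; exact: p0.
  rewrite patchE ifT; last by rewrite inE.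
  by rewrite (le_trans Gle) // leeDl // nneseries_ge0 // => k _ _; exact: p0.
Qed.

Lemma dyadic_integral D (G : C -> \bar R) (M : nat -> R) p (r : R) : 0 < r ->
  measurable D -> measurable_fun D G -> (forall w, D w -> 0 <= G w)%E -> (forall n, 0 <= M n) ->
  (forall w, D w -> exists n, normc (w - p) < 2 ^+ n * r /\ (G w <= (M n)%:E)%E) ->
  (\int[area]_(w in D) G w <= \sum_(n <oo) (M n * (2 * (2 ^+ n * r) ^+ 2))%:E)%E.
Proof.
move=> r0 mD mG G0 M0 H.
have mB n := @measurable_cball R p (2 ^+ n * r).
apply: (le_trans (@dyadic_cover D G (fun n => cball p (2 ^+ n * r)) (fun n w => (M n)%:E) mD mB mG _ G0 _ H)).
- by move=> n; exact: measurable_cst.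
- by move=> n w _; rewrite lee_fin.
apply: lee_nneseries => [n _ _|n _].
  by apply: integral_ge0 => w _; rewrite lee_fin.
rewrite integral_cst; last exact: measurableI.
rewrite EFinM lee_wpmul2l ?lee_fin //.
have rn : 0 <= 2 ^+ n * r by rewrite mulr_ge0 ?exprn_ge0 // ltW.
apply: le_trans (le_area_cball p rn); apply: le_measure; rewrite ?inE //.
  exact: measurableI.
Qed.

Lemma sum_half_le (c : R) (M : nat -> R) : (forall n, 0 <= M n) -> (forall n, M n <= c * (2 ^+ n)^-1) ->
  (\sum_(n <oo) (M n)%:E <= (2 * c)%:E)%E.
Proof.
move=> M0 Mc.
have := @cvg_geometric_eseries_half R (2 * c) 0; rewrite expr0 divr1 => /cvg_lim <- //.
apply: lee_nneseries => [n _ _|n _]; rewrite lee_fin // addn1 natrX exprS.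
by rewrite invfM mulrA [2 * c]mulrC mulfK // -[c / _]natrX.
Qed.

End dyadic.

Section weight.
Variable R : realType.
Implicit Types (K : R -> R) (s t : R).

(* What the argument uses of a weight; [phi] bounds the dilation function. *)
Record admissible K (CK : R) (p : nat) (phi : nat -> R) : Prop := Admissible {
  adm_ge0 : forall t, 0 <= t -> 0 <= K t;
  adm_mono : forall s t, 0 <= s -> s <= t -> K s <= K t;
  adm_gt0 : forall t, 0 < t -> 0 < K t;
  adm_C1 : 1 <= CK;
  adm_double : forall t, 0 <= t <= 2^-1 -> K (2 * t) <= CK * K t;
  adm_p : CK <= 2 ^+ p;
  adm_p0 : (0 < p)%N;
  adm_phi : forall n t, 0 < t <= 1 -> K (2 ^- n * t) <= phi n * K t;
  adm_sum : (\sum_(n <oo) (phi n)%:E < +oo)%E }.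

Section facts.
Variables (K : R -> R) (CK : R) (p : nat) (phi : nat -> R).
Hypothesis KP : admissible K CK p phi.

Lemma phi_ge0 n : 0 <= phi n.
Proof.
have K1 := adm_gt0 KP ltr01.
have := adm_phi KP n (_ : 0 < 1 <= 1); rewrite ltr01 lexx => /(_ isT) H.
rewrite -(pmulr_lge0 _ K1) (le_trans _ H) // (adm_ge0 KP) // mulr_ge0 // invr_ge0 exprn_ge0 //.
Qed.

Lemma CK_ge0 : 0 <= CK. Proof. exact: le_trans ler01 (adm_C1 KP). Qed.

Lemma weight_double_iter n t : 0 <= t -> 2 ^+ n * t <= 1 -> K (2 ^+ n * t) <= CK ^+ n * K t.
Proof.
move=> t0; elim: n => [|n IH] h; first by rewrite !expr0 !mul1r.
have h2 : 2 ^+ n * t <= 2^-1 by rewrite -(ler_pM2l (ltr0Sn _ 1)) mulrA -exprS mulfV.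
have h1 : 2 ^+ n * t <= 1 by rewrite (le_trans h2) // invf_le1 // ler1n.
have q0 : 0 <= 2 ^+ n * t by rewrite mulr_ge0 ?exprn_ge0.
rewrite exprS -mulrA (le_trans (adm_double KP _)) ?q0 // exprS -mulrA ler_wpM2l ?CK_ge0 //.
exact: IH.
Qed.

(** [K t / t ^ p] is almost decreasing: going from [s] up to [t] by doublings multiplies [K] by at
    most [CK] each time, against [2 ^ p >= CK] for the power. One extra doubling accounts for the
    factor [CK]. *)
Lemma weight_power s t : 0 < s -> s <= t -> t <= 1 -> s ^+ p * K t <= CK * t ^+ p * K s.
Proof.
move=> s0 st t1; have t0 : 0 < t by exact: lt_le_trans s0 st.
have [n [h1 h2]] := @dyadic_scale R t s s0 (ltW t0).
case: n h1 h2 => [|n] h1 h2; first by move: h1; rewrite expr0 mul1r ltNge st.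
have h3 : 2 ^+ n * s <= t.
  move: h2; rewrite le_max => /orP[|]; rewrite exprS -mulrA; last by rewrite ler_pM2l.
  have : s <= 2 ^+ n * s by rewrite ler_peMl ?(ltW s0) // exprn_ege1 // ler1n.
  have : 0 < 2 ^+ n * s by rewrite mulr_gt0 ?exprn_gt0.
  lra.
pose q := t / 2 ^+ n.+1; have q0 : 0 <= q by rewrite divr_ge0 ?(ltW t0) ?exprn_ge0.
have tq : t = 2 ^+ n.+1 * q by rewrite /q mulrC divfK // expf_neq0.
have qs : q <= s by rewrite /q ler_pdivrMr ?exprn_gt0 // mulrC ltW.
have Kt : K t <= CK ^+ n.+1 * K s.
  rewrite {1}tq (le_trans (weight_double_iter q0 _)) -?tq // ler_wpM2l ?exprn_ge0 ?CK_ge0 //.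
  exact: (adm_mono KP).
have Cn : CK ^+ n * s ^+ p <= t ^+ p.
  apply: (@le_trans _ _ ((2 ^+ p) ^+ n * s ^+ p)).
    by rewrite ler_wpM2r ?exprn_ge0 ?(ltW s0) // lerXn2r ?nnegrE ?CK_ge0 ?exprn_ge0 ?(adm_p KP).
  rewrite -exprM mulnC exprM -exprMn lerXn2r ?nnegrE ?mulr_ge0 ?exprn_ge0 ?(ltW s0) ?(ltW t0) //.
rewrite (le_trans (ler_wpM2l _ Kt)) ?exprn_ge0 ?(ltW s0) //.
rewrite mulrA ler_wpM2r ?(adm_ge0 KP) ?(ltW s0) // mulrC exprS -mulrA ler_wpM2l ?CK_ge0 //.
Qed.

End facts.
End weight.

(** * Schur estimates for the Bergman kernel *)

Section kernel_estimates.
Variable R : realType.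
Local Notation C := R[i].
Local Notation Re := complex.Re.
Local Notation Im := complex.Im.
Local Notation area := (@area R).
Local Notation disc := (@disc R).
Implicit Types (z w a : C) (D : set C).

Lemma nneseries_shift (f : nat -> R) : (forall n, 0 <= f n) ->
  (\sum_(n <oo) (f n.+1)%:E < +oo)%E -> (\sum_(n <oo) (f n)%:E < +oo)%E.
Proof.
move=> f0 H; apply: (@le_lt_trans _ _ ((f 0%N)%:E + \sum_(n <oo) (f n.+1)%:E)%E); last first.
  by rewrite lte_add_pinfty // ltry.
apply: lime_le; first by apply: is_cvg_nneseries => n _ _; rewrite lee_fin.
near=> n; apply: (@le_trans _ _ (\sum_(0 <= k < n.+1) (f k)%:E)%E).
  by rewrite big_nat_recr //= leeDl // lee_fin.
rewrite big_nat_recl // leeD2l //; apply: nneseries_lim_ge => k _ _; by rewrite lee_fin.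
Unshelve. all: by end_near. Qed.

Lemma measurable_funV_ge0 d (T : measurableType d) (D : set T) (f : T -> R) :
  (forall x, 0 <= f x) -> measurable_fun D f -> measurable_fun D (fun x => (f x)^-1).
Proof.
move=> f0 mf; rewrite (_ : (fun x => _) = (fun t => t `^ -1) \o f); last first.
  by apply/funext => x; rewrite /= powR_inv1.
exact: measurableT_comp (measurable_powR _) mf.
Qed.

Lemma tonelli_on (D E : set C) (F : C * C -> \bar R) : measurable D -> measurable E ->
  measurable_fun setT F -> (forall q, (0 <= F q)%E) ->
  (\int[area]_(z in D) \int[area]_(w in E) F (z, w) =
   \int[area]_(w in E) \int[area]_(z in D) F (z, w))%E.
Proof.
move=> mD mE mF F0; pose G := F \_ (D `*` E).
have mDE : measurable (D `*` E) by exact: measurableX.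
have mG : measurable_fun setT G := (measurable_restrictT F mDE).1 (measurable_funTS mF).
have G0 q : (0 <= G q)%E by rewrite /G patchE; case: ifP.
have := @fubini_tonelli _ _ C C R area area G mG G0.
have E1 : (\int[area]_x \int[area]_y G (x, y) = \int[area]_(z in D) \int[area]_(w in E) F (z, w))%E.
  rewrite [RHS]integral_mkcond; apply: eq_integral => z _; rewrite patchE.
  case: ifPn => zD; last first.
    rewrite -[RHS](integral0 area setT); apply: eq_integral => w _; rewrite /G patchE ifF //.
    by apply/negP; rewrite inE => -[/= Dz _]; move: zD; rewrite notin_setE.
  rewrite [RHS]integral_mkcond; apply: eq_integral => w _; rewrite /G !patchE.
  by rewrite in_setX /= zD.
have E2 : (\int[area]_y \int[area]_x G (x, y) = \int[area]_(w in E) \int[area]_(z in D) F (z, w))%E.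
  rewrite [RHS]integral_mkcond; apply: eq_integral => w _; rewrite patchE.
  case: ifPn => wE; last first.
    rewrite -[RHS](integral0 area setT); apply: eq_integral => z _; rewrite /G patchE ifF //.
    by apply/negP; rewrite inE => -[/= _ Ew]; move: wE; rewrite notin_setE.
  rewrite [RHS]integral_mkcond; apply: eq_integral => z _; rewrite /G !patchE.
  by rewrite in_setX /= wE andbT.
by rewrite E1 E2.
Qed.

Lemma measurable_section (E : set C) (F : C * C -> \bar R) : measurable E ->
  measurable_fun setT F -> (forall q, (0 <= F q)%E) ->
  measurable_fun setT (fun z => \int[area]_(w in E) F (z, w))%E.
Proof.
move=> mE mF F0; pose G := F \_ (setT `*` E).
have mDE : measurable ([set: C] `*` E) by exact: measurableX.
have mG : measurable_fun setT G := (measurable_restrictT F mDE).1 (measurable_funTS mF).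
have G0 q : (0 <= G q)%E by rewrite /G patchE; case: ifP.
have := @measurable_fun_fubini_tonelli_F _ _ C C R area G mG G0.
congr measurable_fun; apply/funext => z; rewrite /fubini_F [RHS]integral_mkcond.
by apply: eq_integral => w _; rewrite /G !patchE in_setX /= in_setT.
Qed.

(** Truncated at 0 so that it is measurable and nonnegative on the whole plane. *)
Definition defect w : R := Num.max 0 (1 - normc w).

Lemma defect_ge0 w : 0 <= defect w. Proof. by rewrite le_max lexx. Qed.

Lemma defectE w : disc w -> defect w = 1 - normc w.
Proof. by move=> w1; rewrite /defect max_r // subr_ge0 ltW. Qed.

Lemma defect_gt0 w : disc w -> 0 < defect w.
Proof. by move=> w1; rewrite defectE // subr_gt0. Qed.

Lemma measurable_defect : measurable_fun setT (defect : C -> R).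
Proof.
apply: measurable_maxr; first exact: measurable_cst.
apply: measurable_funB; first exact: measurable_cst.
by apply: measurable_normc; exact: measurable_id.
Qed.

Lemma kernel_sym z w : normc (1 - z * w^*%C) = normc (1 - w * z^*%C).
Proof. by rewrite -normcJ conjB conjM conjK (_ : 1^*%C = 1) ?[w * _]mulrC //; exact: rmorph1. Qed.

Lemma kernel_identity z w :
  normc (1 - z * w^*%C) ^+ 2 = normc (z - w) ^+ 2 + (1 - normc z ^+ 2) * (1 - normc w ^+ 2).
Proof. by rewrite !normc_sqr; case: z => x y; case: w => u v /=; ring. Qed.

Lemma kernel_ge_dist z w : disc z -> disc w -> normc (z - w) <= normc (1 - z * w^*%C).
Proof.
move=> z1 w1; rewrite -(ler_pXn2r (n := 2)) ?nnegrE ?normc_ge0 // kernel_identity lerDl.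
by rewrite mulr_ge0 // subr_ge0 expr_le1 ?normc_ge0 // ltW.
Qed.

Lemma kernel_ge_defect z w : disc z -> disc w -> defect z <= normc (1 - z * w^*%C) /\
  defect w <= normc (1 - z * w^*%C).
Proof.
by move=> z1 w1; rewrite !defectE //; split; [|rewrite kernel_sym]; exact: normc_ker_ge.
Qed.

Lemma kernel_gt0 z w : disc z -> disc w -> 0 < normc (1 - z * w^*%C).
Proof. by move=> z1 w1; apply: lt_le_trans (kernel_ge_defect z1 w1).1; exact: defect_gt0. Qed.

Section kernel.
Variable p : nat.
Hypothesis p0 : (0 < p)%N.

Definition kern z w : R := defect w ^+ p / normc (1 - z * w^*%C) ^+ (p + 2).

Lemma kern_ge0 z w : 0 <= kern z w.
Proof. by rewrite divr_ge0 ?exprn_ge0 ?normc_ge0 ?defect_ge0. Qed.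

Lemma measurable_kern : measurable_fun setT (fun q : C * C => kern q.1 q.2).
Proof.
apply: measurable_funM.
  by apply: measurable_funX; exact: measurableT_comp measurable_defect measurable_snd.
apply: measurable_funV_ge0 => [q|]; first by rewrite exprn_ge0 // normc_ge0.
apply: measurable_funX; apply: measurable_normc; apply: measurable_funBC => //.
apply: measurable_funMC; first exact: measurable_fst.
by apply: measurable_funJ; exact: measurable_snd.
Qed.

Lemma measurable_kern1 w : measurable_fun setT (kern ^~ w).
Proof. exact: (measurableT_comp measurable_kern (measurable_pair2 w)). Qed.

Lemma measurable_kern2 z : measurable_fun setT (kern z).
Proof. exact: (measurableT_comp measurable_kern (measurable_pair1 z)). Qed.

(** [|1 - z conj w|] dominates both the distance [|w - z|] and the defect of [z], hence the dyadic
    radius that captures [w]. *)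
Lemma kernel_annulus z w : disc z -> disc w -> exists n,
  [/\ normc (w - z) < 2 ^+ n * defect z, 2 ^+ n * defect z <= Num.max (defect z) (2 * normc (w - z)) &
      2 ^+ n * defect z <= 2 * normc (1 - z * w^*%C)].
Proof.
move=> z1 w1; have [n [h1 h2]] := dyadic_scale (defect_gt0 z1) (normc_ge0 (w - z)).
exists n; split => //; apply: (le_trans h2); rewrite ge_max ler_pM2l // normcBC kernel_ge_dist // andbT.
by have [h _] := kernel_ge_defect z1 w1; rewrite (le_trans h) // ler_peMl ?normc_ge0 // ler1n.
Qed.

Lemma kern_le z w (x : R) : disc z -> disc w -> 0 < x -> x <= 2 * normc (1 - z * w^*%C) ->
  kern z w <= defect w ^+ p * (2 ^+ (p + 2) / x ^+ (p + 2)).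
Proof.
move=> z1 w1 x0 h; rewrite /kern ler_wpM2l ?exprn_ge0 ?defect_ge0 //.
rewrite -expr_div_n -exprVn lerXn2r ?nnegrE ?invr_ge0 ?normc_ge0 ?divr_ge0 ?(ltW x0) //.
rewrite -[leRHS]invrK lef_pV2 ?posrE ?invr_gt0 ?divr_gt0 ?kernel_gt0 //.
by rewrite invf_div ler_pdivrMr // mulrC.
Qed.

(** On the ball of radius [2 ^ n] times the defect of [w] the kernel contributes a multiple of
    [2 ^ (- n p)], at most [2 ^- n] since [p > 0]. *)
Lemma kernel_mass w : disc w -> (\int[area]_(z in disc) (kern z w)%:E <= (2 ^+ (p + 4))%:E)%E.
Proof.
move=> w1; have mD := @measurable_disc R; have r0 := defect_gt0 w1.
pose r := defect w; pose M n := r ^+ p * (2 ^+ (p + 2) / (2 ^+ n * r) ^+ (p + 2)).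
have M0 n : 0 <= M n by rewrite /M !(mulr_ge0, exprn_ge0, invr_ge0) // ltW.
apply: (le_trans (@dyadic_integral R disc (fun z => (kern z w)%:E) M w r r0 mD _ _ M0 _)).
- by apply/measurable_EFinP; apply: measurable_funTS; exact: measurable_kern1.
- by move=> z _; rewrite lee_fin kern_ge0.
- move=> z z1; have [n [h1 _ h2]] := kernel_annulus w1 z1.
  exists n; split => //; rewrite lee_fin; apply: kern_le => //; first by rewrite mulr_gt0 ?exprn_gt0.
  by rewrite kernel_sym.
have -> : 2 ^+ (p + 4) = 2 * 2 ^+ (p + 3) :> R by rewrite -exprS addnS.
apply: sum_half_le => n; first by rewrite mulr_ge0 // mulr_ge0 // sqr_ge0.
have x0 : 0 < 2 ^+ n :> R by rewrite exprn_gt0.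
have -> : M n * (2 * (2 ^+ n * r) ^+ 2) = 2 ^+ (p + 3) / (2 ^+ n) ^+ p.
  rewrite /M !exprD !exprMn.
  have a1 : (2 ^+ n) ^+ p != 0 :> R by rewrite expf_neq0 // gt_eqF.
  have a2 : r ^+ p != 0 by rewrite expf_neq0 // gt_eqF.
  have a3 : r != 0 by rewrite gt_eqF.
  have a4 : 2 ^+ n != 0 :> R by rewrite gt_eqF.
  move: (2 ^+ n) (r ^+ p) (2 ^+ p) ((2 ^+ n) ^+ p) a1 a2 a4 => A B D E *.
  by field; exact/and4P.
rewrite ler_wpM2l ?exprn_ge0 // lef_pV2 ?posrE ?exprn_gt0 //.
rewrite -[leLHS]expr1 -(subnKC p0) exprD ler_peMr ?expr1 ?(ltW x0) //.
by rewrite exprn_ege1 // exprn_ege1 // ler1n.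
Qed.

End kernel.

Section weighted.
Variables (K : R -> R) (CK : R) (p : nat) (phi : nat -> R).
Hypothesis KP : admissible K CK p phi.

Lemma weight_le_iter m (y t : R) : 0 <= y <= 1 -> 0 <= t -> y <= 2 ^+ m * t -> K y <= CK ^+ m * K t.
Proof.
move=> /andP[y0 y1] t0 h; have q0 : 0 <= y / 2 ^+ m by rewrite divr_ge0 // exprn_ge0.
have yE : y = 2 ^+ m * (y / 2 ^+ m) by rewrite mulrC divfK // expf_neq0.
rewrite {1}yE (le_trans (weight_double_iter KP q0 _)) -?yE // ler_wpM2l ?exprn_ge0 ?(CK_ge0 KP) //.
by apply: (adm_mono KP) => //; rewrite ler_pdivrMr ?exprn_gt0 // mulrC.
Qed.

Definition wt (l : R) w : R := K (defect w / l).

Lemma wt_ge0 l w : 0 < l -> 0 <= wt l w.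
Proof. by move=> l0; rewrite (adm_ge0 KP) // divr_ge0 ?defect_ge0 // ltW. Qed.

Lemma measurable_wt l : 0 < l -> measurable_fun setT (wt l).
Proof.
move=> l0; pose Kp t := K (Num.max 0 t).
have mK : measurable_fun setT Kp.
  apply: nondecreasing_measurable => // s t st; apply: (adm_mono KP).
    by rewrite le_max lexx.
  by rewrite ge_max le_max lexx /= le_max st orbT.
have -> : wt l = Kp \o (fun w => defect w * l^-1).
  by apply/funext => w; rewrite /wt /Kp /= max_r // divr_ge0 ?defect_ge0 // ltW.
apply: (measurableT_comp mK); apply: measurable_funM; [exact: measurable_defect|exact: measurable_cst].
Qed.

(** Shift by two: annulus [n] around [z] meets the ball of radius [2 l] only if [2 ^ n r <= 6 l],
    hence [2 ^ (n - 2) r / (2 l) <= 1], the range where [phi] controls [K]. Truncated subtraction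
    covers [n <= 2]. *)
Let psi n := phi (n - 2)%N.

Let psi_sum : exists2 P : R, 0 <= P & (\sum_(n <oo) (psi n)%:E <= P%:E)%E.
Proof.
have p0 n : 0 <= phi n := phi_ge0 KP n.
have H : (\sum_(n <oo) (psi n)%:E < +oo)%E.
  apply: nneseries_shift => [n|]; first exact: p0.
  apply: nneseries_shift => [n|]; first exact: p0.
  by under eq_eseriesr do rewrite /psi subn2 /=; exact: (adm_sum KP).
have S0 : (0 <= \sum_(n <oo) (psi n)%:E)%E by apply: nneseries_ge0 => n _ _; rewrite lee_fin p0.
exists (fine (\sum_(n <oo) (psi n)%:E)%E); first exact: fine_ge0.
by rewrite fineK // ge0_fin_numE.
Qed.

Lemma carleson_defect z (zeta : C) (l : R) : normc zeta = 1 -> disc z -> cball zeta l z -> defect z < l.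
Proof.
move=> z1 dz; rewrite /cball /= => h; rewrite defectE //.
by have := normc_sub_ge zeta z; rewrite z1 normcBC => /le_lt_trans; exact.
Qed.

(* Schur test function [1 / wt (2 l)]; the Dini condition sums the annuli. *)
Lemma schur_near : exists2 C1 : R, 0 < C1 & forall (zeta z : C) (l : R), normc zeta = 1 -> 0 < l ->
  disc z -> cball zeta l z ->
  (\int[area]_(w in disc `&` cball zeta (2 * l)%R) (kern p z w / wt (2 * l) w)%:E <= (C1 / wt (2 * l) z)%:E)%E.
Proof.
have [P P0 HP] := psi_sum; have C0 := CK_ge0 KP.
pose A : R := CK * 2 ^+ (2 * p + 3).
have A0 : 0 <= A by rewrite mulr_ge0 // exprn_ge0.
exists (A * P + 1); first by rewrite ltr_wpDl // mulr_ge0.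
move=> zeta z l zeta1 l0 z1 zl; have mD := @measurable_disc R.
have l20 : 0 < 2 * l by rewrite mulr_gt0.
pose r := defect z; have r0 : 0 < r := defect_gt0 z1.
have rl : r < l := carleson_defect zeta1 z1 zl.
pose x := r / (2 * l); have x0 : 0 < x by rewrite divr_gt0.
have Kx : 0 < wt (2 * l) z by exact: (adm_gt0 KP).
pose M n := CK * 2 ^+ (2 * p + 2) * psi n / (2 ^+ n * r) ^+ 2 / K x.
have psi0 n : 0 <= psi n := phi_ge0 KP _.
have M0 n : 0 <= M n.
  by rewrite /M !divr_ge0 ?mulr_ge0 ?exprn_ge0 ?(ltW r0) // ltW.
have mE : measurable (disc `&` cball zeta (2 * l)).
  by apply: measurableI => //; exact: measurable_cball.
apply: (le_trans (@dyadic_integral R _ (fun w => (kern p z w / wt (2 * l) w)%:E) M z r r0 mE _ _ M0 _)).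
- apply/measurable_EFinP; apply: measurable_funTS; apply: measurable_funM; first exact: measurable_kern2.
  by apply: measurable_funV_ge0 => [w|]; [exact: wt_ge0|exact: measurable_wt].
- by move=> w _; rewrite lee_fin divr_ge0 ?kern_ge0 ?wt_ge0.
- move=> w [w1 wl]; have [n [h1 h2 h3]] := kernel_annulus z1 w1.
  exists n; split => //; rewrite lee_fin.
  have dw : defect w < 2 * l := carleson_defect zeta1 w1 wl.
  pose s := defect w / (2 * l); have s0 : 0 < s by rewrite divr_gt0 ?defect_gt0.
  have s1 : s <= 1 by rewrite /s ler_pdivrMr // mul1r ltW.
  (* The largest normalized height of a point of annulus [n]: below 1 inside the ball, and at most
     twice the dyadic radius because the defect is 1-Lipschitz. *)
  pose S := Num.min 1 (2 ^+ n.+1 * x).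
  have S1 : S <= 1 by rewrite ge_min lexx.
  have Sx : S <= 2 ^+ n.+1 * x by rewrite ge_min lexx orbT.
  have n1 : 1 <= 2 ^+ n :> R by rewrite exprn_ege1 // ler1n.
  have dws : defect w <= 2 ^+ n.+1 * r.
    have : r <= 2 ^+ n * r by rewrite ler_peMl // ltW.
    have := normc_sub_ge z w; rewrite normcBC exprS -mulrA -/r in h1 *.
    rewrite /r !defectE // in h1 *; lra.
  have sS : s <= S by rewrite le_min s1 /= /s /x mulrA ler_pM2r ?invr_gt0.
  have S0 : 0 < S := lt_le_trans s0 sS.
  have W := weight_power KP s0 sS S1.
  have Ks : 0 < K s by exact: (adm_gt0 KP). have KS : 0 < K S by exact: (adm_gt0 KP).
  (* [2 ^ (n - 2) x] is at most 1, so the dilation bound compares [K] there with [K x]; it is also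
     at most [S]. *)
  have V : K x <= psi n * K S.
    have q1 : 2 ^+ (n - 2) * x <= 2 ^+ n.+1 * x.
      by rewrite ler_pM2r // ler_weXn2l ?ler1n // (leq_trans (leq_subr _ _)).
    have q2 : 2 ^+ (n - 2) * x <= 1.
      case: (leqP n 2) => n2.
        have -> : (n - 2 = 0)%N by apply/eqP; rewrite subn_eq0.
        rewrite expr0 mul1r /x ler_pdivrMr // mul1r; lra.
      have wz : normc (w - z) < 3 * l.
        have -> : w - z = (w - zeta) - (z - zeta) by ring.
        have := normcB (w - zeta) (z - zeta); rewrite /cball /= in zl wl; move: zl wl; clear => *; lra.
      have E : 2 ^+ n = 4 * 2 ^+ (n - 2) :> R.
        by rewrite -{1}(subnK (ltnW n2)) exprD mulrC; congr (_ * _); ring.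
      have : 2 ^+ n * r <= 6 * l.
        apply: (le_trans h2); rewrite ge_max -/r; have wz2 := wz; rewrite normcBC in wz2.
        by move: wz wz2 rl l0; clear => *; apply/andP; split; lra.
      by rewrite E /x mulrA ler_pdivrMr // mul1r; move: l0; clear => *; lra.
    have q0 : 0 < 2 ^+ (n - 2) * x by rewrite mulr_gt0 ?exprn_gt0.
    have := adm_phi KP (n - 2) (_ : 0 < 2 ^+ (n - 2) * x <= 1); rewrite q0 q2 => /(_ isT).
    rewrite mulKf ?expf_neq0 // => H; apply: (le_trans H); apply: (ler_wpM2l (psi0 n)).
    by apply: (adm_mono KP); rewrite ?(ltW q0) // le_min q2.
  have y0 : 0 < 2 ^+ n * r by rewrite mulr_gt0 ?exprn_gt0.
  apply: (@le_trans _ _ (defect w ^+ p * (2 ^+ (p + 2) / (2 ^+ n * r) ^+ (p + 2)) / K s)).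
    by rewrite ler_pM2r ?invr_gt0 //; exact: kern_le.
  have dE : defect w = s * (2 * l) by rewrite /s divfK // gt_eqF.
  have B1 : s ^+ p / K s <= CK * S ^+ p / K S.
    by rewrite ler_pdivrMr // mulrAC ler_pdivlMr // mulrAC.
  have B2 : S ^+ p <= (2 ^+ n.+1 * x) ^+ p.
    have X0 : 0 <= 2 ^+ n.+1 * x by apply: mulr_ge0; [rewrite exprn_ge0|exact: ltW].
    by rewrite lerXn2r ?nnegrE ?(ltW S0).
  have B3 : (K S)^-1 <= psi n / K x.
    by rewrite -[leLHS]mul1r ler_pdivrMr // mulrAC ler_pdivlMr // mul1r.
  apply: (@le_trans _ _ ((2 * l) ^+ p * (2 ^+ (p + 2) / (2 ^+ n * r) ^+ (p + 2)) * (CK * (2 ^+ n.+1 * x) ^+ p * (psi n / K x)))).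
    rewrite dE exprMn.
    have -> : s ^+ p * (2 * l) ^+ p * (2 ^+ (p + 2) / (2 ^+ n * r) ^+ (p + 2)) / K s =
      (2 * l) ^+ p * (2 ^+ (p + 2) / (2 ^+ n * r) ^+ (p + 2)) * (s ^+ p / K s) by ring.
    rewrite ler_wpM2l ?mulr_ge0 ?invr_ge0 ?exprn_ge0 ?(ltW l20) ?(ltW y0) //.
    apply: (le_trans B1); apply: ler_pM => //.
    - by rewrite mulr_ge0 // exprn_ge0 // ltW.
    - by rewrite invr_ge0 ltW.
    - by rewrite ler_wpM2l.
  rewrite le_eqVlt; apply/orP; left; apply/eqP; rewrite /M.
  have -> : (2 ^+ n.+1 * x) ^+ p = 2 ^+ p * (2 ^+ n * r) ^+ p / (2 * l) ^+ p.
    by rewrite /x exprS -exprMn -expr_div_n; congr (_ ^+ _); ring.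
  rewrite mul2n -addnn !exprD.
  have a1 : (2 * l) ^+ p != 0 by rewrite expf_neq0 // gt_eqF.
  have a2 : (2 ^+ n * r) ^+ p != 0 by rewrite expf_neq0 // gt_eqF.
  have a3 : 2 ^+ n * r != 0 by rewrite gt_eqF.
  have a4 : K x != 0 by rewrite gt_eqF.
  move: (2 ^+ n * r) (K x) (2 ^+ p) (psi n) ((2 * l) ^+ p) ((2 ^+ n * r) ^+ p) a1 a2 a3 a4 => ? ? ? ? ? ? *.
  by field; exact/and4P.
have E n : M n * (2 * (2 ^+ n * r) ^+ 2) = A / K x * psi n.
  have a3 : 2 ^+ n * r != 0 by rewrite gt_eqF // mulr_gt0 ?exprn_gt0.
  have a4 : K x != 0 by rewrite gt_eqF.
  rewrite /M /A !addnS !exprS; move: (2 ^+ n * r) (K x) (2 ^+ (2 * p + 0)) (psi n) a3 a4 => ? ? ? ? *.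
  by field; exact/andP.
under eq_eseriesr do rewrite E EFinM.
rewrite nneseriesZl ?lee_fin //; last by move=> n _; rewrite lee_fin.
have AK : 0 <= A / K x by rewrite divr_ge0 // ltW.
rewrite (le_trans (lee_wpmul2l _ HP)) ?lee_fin // -/(wt _ _).
by rewrite mulrAC ler_pM2r ?invr_gt0 // lerDl ler01.
Qed.

(** The Carleson condition for [h ^ 2] with balls centred on the circle instead of boxes; all radii
    are allowed, so large ones cover the whole disc. *)
Definition carleson (h : C -> R) (A : R) := forall (zeta : C) (l : R), normc zeta = 1 -> 0 < l ->
  (\int[area]_(w in disc `&` cball zeta l) (h w ^+ 2 * wt l w)%:E <= A%:E)%E.

(* AM-GM on each annulus [|w - zeta| ~ 2 ^ n l]. *)
Lemma schur_far : exists2 C3 : R, 0 <= C3 & forall (h : C -> R) (zeta z : C) (l : R),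
  measurable_fun setT h -> (forall w, 0 <= h w) -> carleson h 1 -> normc zeta = 1 -> 0 < l ->
  disc z -> cball zeta l z ->
  (\int[area]_(w in disc `\` cball zeta (2 * l)%R) (h w * kern p z w)%:E <= (C3 / l)%:E)%E.
Proof.
have C0 := CK_ge0 KP; have K1 := adm_gt0 KP ltr01.
pose B := CK / K 1; have B0 : 0 <= B by rewrite divr_ge0 // ltW.
pose A : R := 2 ^+ (2 * (p + 2)) * (1 + 2 * B).
have A0 : 0 <= A by rewrite mulr_ge0 ?exprn_ge0 // addr_ge0 // mulr_ge0.
exists A => // h zeta z l mh h0 ch zeta1 l0 z1 zl; have mD := @measurable_disc R.
pose L n := 2 ^+ n * (2 * l).
have L0 n : 0 < L n by rewrite !mulr_gt0 ?exprn_gt0.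
pose Q : R := 2 ^+ (2 * (p + 2)).
pose G n w : R := Q * (L n ^- 2) * (L n * (h w ^+ 2 * wt (L n) w) + B / L n).
have Q0 : 0 <= Q by rewrite exprn_ge0.
have g0 n w : 0 <= L n * (h w ^+ 2 * wt (L n) w) + B / L n.
  apply: addr_ge0; last by rewrite divr_ge0 // ltW.
  by apply: mulr_ge0 (ltW (L0 n)) _; apply: mulr_ge0 (sqr_ge0 _) (wt_ge0 _ (L0 n)).
have G0 n w : 0 <= G n w by rewrite mulr_ge0 // mulr_ge0 // invr_ge0 sqr_ge0.
have mE : measurable (disc `\` cball zeta (2 * l)).
  by apply: measurableD => //; exact: measurable_cball.
have mB n : measurable (cball zeta (L n)) by exact: measurable_cball.
have mhw n : measurable_fun setT (fun w => h w ^+ 2 * wt (L n) w).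
  by apply: measurable_funM; [exact: measurable_funX|exact: measurable_wt].
have mG n : measurable_fun setT (G n).
  apply: measurable_funM; first exact: measurable_cst.
  apply: measurable_funD; last exact: measurable_cst.
  by apply: measurable_funM => //; exact: measurable_cst.
apply: (le_trans (@dyadic_cover R _ (fun w => (h w * kern p z w)%:E) (fun n => cball zeta (L n))
   (fun n w => (G n w)%:E) mE mB _ _ _ _ _)).
- apply/measurable_EFinP; apply: measurable_funTS; apply: measurable_funM => //; exact: measurable_kern2.
- by move=> n; apply/measurable_EFinP; exact: measurable_funTS.
- by move=> w _; rewrite lee_fin mulr_ge0 ?kern_ge0.
- by move=> n w _; rewrite lee_fin.
- move=> w [w1 /negP wl]; rewrite -leNgt in wl.
  have l20 : 0 < 2 * l by rewrite mulr_gt0.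
  have [n [h1 h2]] := dyadic_scale l20 (normc_ge0 (w - zeta)).
  exists n; split => //; rewrite lee_fin.
  have dk : normc (w - zeta) <= 2 * normc (1 - z * w^*%C).
    have k1 := kernel_ge_dist z1 w1.
    have e : normc (w - zeta) = normc ((z - zeta) - (z - w)) by congr normc; ring.
    have := normcB (z - zeta) (z - w); rewrite -e; rewrite /cball /= in zl; lra.
  have Lk : L n / 2 <= 2 * normc (1 - z * w^*%C).
    rewrite ler_pdivrMr // (le_trans h2) // ge_max; apply/andP; split; lra.
  have dwL : defect w < L n by exact: carleson_defect zeta1 w1 h1.
  pose s := defect w / L n; have s0 : 0 < s by rewrite divr_gt0 ?defect_gt0.
  have s1 : s <= 1 by rewrite /s ler_pdivrMr // mul1r ltW.
  have Ks : 0 < K s by exact: (adm_gt0 KP).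
  have L20 : 0 < L n / 2 by rewrite divr_gt0.
  have kl := kern_le p z1 w1 L20 Lk.
  have dE : defect w = s * L n by rewrite /s divfK // gt_eqF.
  have kE : defect w ^+ p * (2 ^+ (p + 2) / (L n / 2) ^+ (p + 2)) = Q * L n ^- 2 * s ^+ p.
    rewrite dE; clearbody s; move: (L n) (L0 n) => X X0; rewrite /Q mul2n -addnn !exprMn !exprVn !exprD.
    have a1 : X ^+ p != 0 by rewrite expf_neq0 // gt_eqF.
    have a2 : X != 0 by rewrite gt_eqF.
    have a3 : 2 ^+ p != 0 :> R by rewrite expf_neq0.
    move: (2 ^+ p) (s ^+ p) (X ^+ p) a1 a2 a3 => ? ? ? *.
    by field; exact/and3P.
  rewrite kE in kl; apply: (le_trans (ler_wpM2l (h0 w) kl)).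
  have E : h w * (Q * L n ^- 2 * s ^+ p) = Q * L n ^- 2 * (h w * s ^+ p) by ring.
  rewrite E /G ler_wpM2l ?mulr_ge0 ?invr_ge0 ?sqr_ge0 // -[wt _ _]/(K s).
  have W := weight_power KP s0 s1 (lexx 1); rewrite expr1n mulr1 in W.
  have y0 : 0 <= s ^+ p by rewrite exprn_ge0 // ltW.
  have y1 : s ^+ p <= 1 by rewrite exprn_ile1 // ltW.
  have X0 : 0 < L n * K s by rewrite mulr_gt0.
  (* With [X = L n * K s] and [y = s ^ p], this is [(X h - y / 2) ^ 2 >= 0] combined with
     [y ^ 2 <= y]. The first term is then integrated by the Carleson hypothesis. *)
  have T1 : h w * s ^+ p <= (L n * K s) * h w ^+ 2 + s ^+ p / (L n * K s).
    rewrite -(ler_pM2r X0) mulrDl divfK ?gt_eqF //.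
    move: (L n * K s) (h w) (s ^+ p) X0 (h0 w) y0 y1 => X H y *.
    have : 0 <= (X * H - y / 2) ^+ 2 by exact: sqr_ge0.
    have : y ^+ 2 <= y by rewrite expr2 ler_piMr.
    nra.
  (* The second term becomes constant on the ball: [s ^ p] is at most a multiple of [K s] by
     [weight_power] between [s] and 1. *)
  have T2 : s ^+ p / (L n * K s) <= B / L n.
    have yB : s ^+ p <= B * K s by rewrite /B mulrAC ler_pdivlMr.
    rewrite ler_pdivrMr //; suff -> : B / L n * (L n * K s) = B * K s by [].
    by rewrite mulrA divfK // gt_eqF.
  rewrite (le_trans T1) // lerD // le_eqVlt; apply/orP; left; apply/eqP; ring.
have mD' n : measurable (disc `&` cball zeta (L n)) by apply: measurableI.
pose c := A / (2 * l).
have -> : A / l = 2 * c by rewrite /c; field; rewrite gt_eqF.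
have I n : (\int[area]_(w in (disc `\` cball zeta (2 * l)%R) `&` cball zeta (L n)) (G n w)%:E <=
    (c * (2 ^+ n)^-1)%:E)%E.
  apply: (@le_trans _ _ (\int[area]_(w in disc `&` cball zeta (L n)) (G n w)%:E)%E).
    apply: ge0_subset_integral => //.
    - exact: measurableI.
    - by apply/measurable_EFinP; exact: measurable_funTS.
    - by move=> w _; rewrite lee_fin.
    - by move=> w [[w1 _] w2].
  have mL : measurable_fun (disc `&` cball zeta (L n)) (fun w => (L n * (h w ^+ 2 * wt (L n) w))%:E).
    by apply/measurable_EFinP; apply: measurable_funM; [exact: measurable_cst|exact: measurable_funTS].
  rewrite (_ : (fun w => (G n w)%:E) = fun w => ((Q * L n ^- 2)%:E * ((L n * (h w ^+ 2 * wt (L n) w))%:E + (B / L n)%:E))%E); last first.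
    by apply/funext => w; rewrite -EFinD -EFinM.
  have p1 w : (0 <= (L n * (h w ^+ 2 * wt (L n) w))%:E)%E.
    by rewrite lee_fin; apply: mulr_ge0 (ltW (L0 n)) _; apply: mulr_ge0 (sqr_ge0 _) (wt_ge0 _ (L0 n)).
  have p2 : 0 <= B / L n by rewrite divr_ge0 // ltW.
  rewrite ge0_integralZl //; last 3 first.
  - by apply: emeasurable_funD => //; exact: measurable_cst.
  - by move=> w _; rewrite adde_ge0 // lee_fin.
  - by rewrite lee_fin mulr_ge0 // invr_ge0 sqr_ge0.
  rewrite ge0_integralD //.
  have i1 : (\int[area]_(w in disc `&` cball zeta (L n)) (L n * (h w ^+ 2 * wt (L n) w))%:E <= (L n)%:E)%E.
    under eq_integral do rewrite EFinM.
    rewrite ge0_integralZl ?lee_fin ?(ltW (L0 n)) //; last 2 first.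
    - by apply/measurable_EFinP; exact: measurable_funTS.
    - by move=> w _; rewrite lee_fin mulr_ge0 ?sqr_ge0 ?wt_ge0.
    by rewrite -[leRHS]mule1 lee_wpmul2l ?lee_fin ?(ltW (L0 n)) // ch.
  have i2 : (\int[area]_(w in disc `&` cball zeta (L n)) (B / L n)%:E <= (2 * B * L n)%:E)%E.
    rewrite integral_cst //.
    apply: (@le_trans _ _ ((B / L n)%:E * (2 * L n ^+ 2)%:E)%E).
      rewrite lee_wpmul2l ?lee_fin //; apply: le_trans (le_area_cball zeta (ltW (L0 n))).
      by apply: le_measure; rewrite ?inE.
    rewrite -EFinM lee_fin le_eqVlt; apply/orP; left; apply/eqP; field.
    by rewrite gt_eqF.
  apply: (@le_trans _ _ ((Q * L n ^- 2)%:E * ((L n)%:E + (2 * B * L n)%:E))%E).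
    by rewrite lee_wpmul2l ?lee_fin ?mulr_ge0 ?invr_ge0 ?sqr_ge0 // leeD.
  rewrite -EFinD -EFinM lee_fin le_eqVlt; apply/orP; left; apply/eqP.
  rewrite /c /A -/Q /L; field; rewrite expf_neq0 //= gt_eqF //.
apply: (@le_trans _ _ (\sum_(n <oo) (c * (2 ^+ n)^-1)%:E)%E).
  apply: lee_nneseries => [n _ _|n _]; last exact: I.
  by apply: integral_ge0 => w _; rewrite lee_fin.
have c0 : 0 <= c by rewrite divr_ge0 // mulr_ge0 // ltW.
by apply: sum_half_le => n //; apply: mulr_ge0.
Qed.

(** Stands in for Cauchy-Schwarz: the choice [lam = (u - c) / P] optimizes the family of bounds and
    gives [(u - c) ^ 2 <= P t]. *)
Lemma sqr_le_amgm (u P t c : R) : 0 <= u -> 0 < P -> 0 <= t -> 0 <= c ->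
  (forall lam, 0 < lam -> u <= (lam * P + t / lam) / 2 + c) -> u ^+ 2 <= 2 * (P * t) + 2 * c ^+ 2.
Proof.
move=> u0 P0 t0 c0 H; have [uc|cu] := leP u c.
  have : u ^+ 2 <= c ^+ 2 by rewrite lerXn2r.
  have : 0 <= P * t by rewrite mulr_ge0 // ltW.
  have := sqr_ge0 c; lra.
have v0 : 0 < u - c by rewrite subr_gt0.
have := H _ (divr_gt0 v0 P0); rewrite divfK ?gt_eqF // invf_div => h.
have h2 : u - c <= t * (P / (u - c)) by lra.
have h3 : (u - c) ^+ 2 <= P * t.
  by rewrite expr2 -ler_pdivlMr // [P * t]mulrC -mulrA.
have := sqr_ge0 (u - 2 * c); nra.
Qed.

(** Near part: [schur_near] and the kernel-weighted square of [h], integrated in [z] by Tonelli and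
    [kernel_mass]. Far part: the bound [C3 / l] of [schur_far], squared, times the area of a ball of
    radius [l]. *)
Lemma carleson_kernel : exists2 CS : R, 0 <= CS & forall (h u : C -> R),
  measurable_fun setT h -> (forall w, 0 <= h w) -> carleson h 1 ->
  measurable_fun disc u -> (forall z, disc z -> 0 <= u z) ->
  (forall z, disc z -> ((u z)%:E <= \int[area]_(w in disc) (h w * kern p z w)%:E)%E) ->
  carleson u CS.
Proof.
have [C1 C10 H1] := schur_near; have [C3 C30 H3] := schur_far.
have C0 := CK_ge0 KP; have K1 := adm_gt0 KP ltr01.
pose C2 : R := 2 ^+ (p + 4); have C20 : 0 <= C2 by rewrite exprn_ge0.
pose X : R := 2 * CK * C1; pose Y : R := 2 * CK * K 1 * C3 ^+ 2.
have X0 : 0 <= X by rewrite !mulr_ge0 // ltW.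
have Y0 : 0 <= Y by rewrite !mulr_ge0 ?sqr_ge0 // ltW.
exists (X * C2 + 2 * Y); first by apply: addr_ge0; apply: mulr_ge0.
move=> h u mh h0 ch mu u0 uk zeta l zeta1 l0; have mD := @measurable_disc R.
have l20 : 0 < 2 * l by rewrite mulr_gt0.
pose E := disc `&` cball zeta (2 * l)%R; pose A := disc `&` cball zeta l.
have mE : measurable E by apply: measurableI => //; exact: measurable_cball.
have mA : measurable A by apply: measurableI => //; exact: measurable_cball.
pose F (q : C * C) : \bar R := (kern p q.1 q.2 * (h q.2 ^+ 2 * wt (2 * l) q.2))%:E.
have hw0 w : 0 <= h w ^+ 2 * wt (2 * l) w by rewrite mulr_ge0 ?sqr_ge0 ?wt_ge0.
have mhw : measurable_fun setT (fun w => h w ^+ 2 * wt (2 * l) w).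
  by apply: measurable_funM; [exact: measurable_funX|exact: measurable_wt].
have F0 q : (0 <= F q)%E by rewrite lee_fin mulr_ge0 ?kern_ge0.
have mF : measurable_fun setT F.
  apply/measurable_EFinP; apply: measurable_funM; first exact: measurable_kern.
  exact: measurableT_comp mhw measurable_snd.
pose T z := (\int[area]_(w in E) F (z, w))%E.
have T0 z : (0 <= T z)%E by apply: integral_ge0.
have mT : measurable_fun setT T by exact: measurable_section.
have mk z : measurable_fun setT (kern p z) by exact: measurable_kern2.
have main z : A z -> ((u z ^+ 2 * wt l z)%:E <= X%:E * T z + (Y / l ^+ 2)%:E)%E.
  move=> [z1 zl]; have om : 0 < wt (2 * l) z.
    by apply: (adm_gt0 KP); rewrite divr_gt0 ?defect_gt0.
  have dl : defect z < l := carleson_defect zeta1 z1 zl.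
  have wtl : wt l z <= CK * wt (2 * l) z.
    rewrite /wt; have -> : defect z / l = 2 * (defect z / (2 * l)) by field; rewrite gt_eqF.
    apply: (adm_double KP); rewrite divr_ge0 ?defect_ge0 ?(ltW l20) //=.
    by rewrite ler_pdivrMr // mulrA mulVf // mul1r ltW.
  have [Tfin|] := boolP (T z \is a fin_num); last first.
    rewrite ge0_fin_numE // -leNgt leye_eq => /eqP ->.
    have X1 : 0 < X by rewrite !mulr_gt0 // (lt_le_trans ltr01 (adm_C1 KP)).
    by rewrite gt0_muley ?lte_fin // addye // leey.
  have tE : T z = (fine (T z))%:E by rewrite fineK.
  pose t := fine (T z); have t0 : 0 <= t by rewrite fine_ge0.
  have cl0 : 0 <= C3 / l by rewrite divr_ge0 // ltW.
  have S : u z ^+ 2 <= 2 * (C1 / wt (2 * l) z * t) + 2 * (C3 / l) ^+ 2.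
    apply: sqr_le_amgm => //; [exact: u0|by rewrite divr_gt0|move=> lam lam0].
    have near : (\int[area]_(w in E) (h w * kern p z w)%:E <= ((lam * (C1 / wt (2 * l) z) + t / lam) / 2)%:E)%E.
      apply: (@le_trans _ _ (\int[area]_(w in E) ((lam / 2)%:E * (kern p z w / wt (2 * l) w)%:E + (lam^-1 / 2)%:E * F (z, w))%E)%E).
        apply: ge0_le_integral => //.
        - by move=> w _; rewrite lee_fin mulr_ge0 ?kern_ge0.
        - by apply/measurable_EFinP; apply: measurable_funTS; exact: measurable_funM.
        - apply: emeasurable_funD; apply: measurable_funeM.
            apply/measurable_EFinP; apply: measurable_funTS; apply: measurable_funM => //.
            by apply: measurable_funV_ge0 => [w|]; [exact: wt_ge0|exact: measurable_wt].
          by apply: measurable_funTS; exact: (measurableT_comp mF (measurable_pair1 z)).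
        move=> w [w1 wl]; rewrite -!EFinM -EFinD lee_fin.
        have ow : 0 < wt (2 * l) w by apply: (adm_gt0 KP); rewrite divr_gt0 ?defect_gt0.
        (* The gap in the weighted arithmetic-geometric inequality is a square; [lam] stays free for
           [sqr_le_amgm]. *)
        have E1 : lam / 2 * (kern p z w / wt (2 * l) w) + lam^-1 / 2 * (kern p z w * (h w ^+ 2 * wt (2 * l) w)) - h w * kern p z w
           = kern p z w / (2 * lam * wt (2 * l) w) * (lam - h w * wt (2 * l) w) ^+ 2.
          field; rewrite ?gt_eqF //.
        rewrite -subr_ge0 E1 mulr_ge0 ?sqr_ge0 // divr_ge0 ?kern_ge0 // !mulr_ge0 // ltW //.
      rewrite ge0_integralD //; last 4 first.
      - move=> w _; apply: mule_ge0; rewrite lee_fin; first by rewrite divr_ge0 // ltW.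
        by rewrite divr_ge0 ?kern_ge0 ?wt_ge0.
      - apply: measurable_funeM; apply/measurable_EFinP; apply: measurable_funTS; apply: measurable_funM => //.
        by apply: measurable_funV_ge0 => [w|]; [exact: wt_ge0|exact: measurable_wt].
      - by move=> w _; rewrite mule_ge0 // lee_fin divr_ge0 // invr_ge0 ltW.
      - by apply: measurable_funeM; apply: measurable_funTS; exact: (measurableT_comp mF (measurable_pair1 z)).
      have -> : (lam * (C1 / wt (2 * l) z) + t / lam) / 2 = lam * (C1 / wt (2 * l) z) / 2 + t / lam / 2 by ring.
      rewrite EFinD; apply: leeD.
        rewrite ge0_integralZl //; last 3 first.
        - apply/measurable_EFinP; apply: measurable_funTS; apply: measurable_funM => //.
          by apply: measurable_funV_ge0 => [w|]; [exact: wt_ge0|exact: measurable_wt].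
        - by move=> w _; rewrite lee_fin divr_ge0 ?kern_ge0 ?wt_ge0.
        - by rewrite lee_fin divr_ge0 // ltW.
        apply: (le_trans (lee_wpmul2l _ (H1 zeta z l zeta1 l0 z1 zl))).
          by rewrite lee_fin divr_ge0 // ltW.
        rewrite -EFinM lee_fin le_eqVlt; apply/orP; left; apply/eqP; ring.
      rewrite ge0_integralZl //; last 2 first.
      - by apply: measurable_funTS; exact: (measurableT_comp mF (measurable_pair1 z)).
      - by rewrite lee_fin divr_ge0 // invr_ge0 ltW.
      rewrite -/(T z) tE -EFinM lee_fin le_eqVlt; apply/orP; left; apply/eqP; rewrite -/t; ring.
    rewrite -lee_fin; apply: (le_trans (uk z z1)).
    have DE : disc = E `|` (disc `\` cball zeta (2 * l)) by rewrite /E setUIDK.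
    rewrite {1}DE ge0_integral_setU //; last 4 first.
    - by apply: measurableD => //; exact: measurable_cball.
    - by apply/measurable_EFinP; apply: measurable_funTS; exact: measurable_funM.
    - by move=> w _; rewrite lee_fin mulr_ge0 ?kern_ge0.
    - apply/disj_setPS => w [[_ a1] [_ a2]]; exact: a2.
    by rewrite EFinD; apply: leeD => //; exact: H3.
  rewrite tE -/t -EFinM -EFinD lee_fin.
  apply: (le_trans (ler_wpM2l (sqr_ge0 _) wtl)).
  apply: (le_trans (ler_wpM2r _ S)); first by rewrite mulr_ge0 // ltW.
  rewrite [leLHS]mulrDl; apply: lerD.
    rewrite le_eqVlt; apply/orP; left; apply/eqP; rewrite /X; field; by rewrite gt_eqF.
  have -> : Y / l ^+ 2 = 2 * (C3 / l) ^+ 2 * (CK * K 1) by rewrite /Y; field; rewrite gt_eqF.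
  apply: ler_wpM2l; first by rewrite mulr_ge0 // sqr_ge0.
  apply: ler_wpM2l => //; apply: (adm_mono KP); first by rewrite divr_ge0 ?defect_ge0 // ltW.
  by rewrite ler_pdivrMr // mul1r; lra.
have Yl : 0 <= Y / l ^+ 2 by rewrite divr_ge0 // sqr_ge0.
have mTA : measurable_fun A T by exact: measurable_funTS.
apply: (@le_trans _ _ (\int[area]_(z in A) (X%:E * T z + (Y / l ^+ 2)%:E)%E)%E).
  apply: ge0_le_integral => //.
  - by move=> z [z1 zl]; rewrite lee_fin mulr_ge0 ?sqr_ge0 ?wt_ge0.
  - apply/measurable_EFinP; apply: measurable_funM; last by apply: measurable_funTS; exact: measurable_wt.
    by apply: measurable_funX; apply: measurable_funS mu => // z [].
  - by apply: emeasurable_funD; [exact: measurable_funeM|exact: measurable_cst].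
rewrite ge0_integralD //; last 2 first.
- by move=> z _; rewrite mule_ge0.
- exact: measurable_funeM.
rewrite EFinD; apply: leeD.
  rewrite ge0_integralZl // [X in (_ <= X)%E]EFinM; apply: lee_wpmul2l; first by rewrite lee_fin.
  rewrite /T tonelli_on //.
  apply: (@le_trans _ _ (\int[area]_(w in E) ((C2)%:E * (h w ^+ 2 * wt (2 * l) w)%:E)%E)%E).
    apply: ge0_le_integral => //.
    - by move=> w _; exact: integral_ge0.
    - have ms : measurable_fun setT (fun q : C * C => (q.2, q.1)) :=
        measurable_fun_pair measurable_snd measurable_fst.
      have mS : measurable_fun setT (F \o (fun q : C * C => (q.2, q.1))) := measurableT_comp mF ms.
      by apply: measurable_funTS; exact: (measurable_section mA mS (fun q => F0 _)).
    - by apply: measurable_funeM; apply/measurable_EFinP; exact: measurable_funTS.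
    move=> w [w1 wl]; rewrite /F /=.
    under eq_integral do rewrite EFinM muleC.
    rewrite ge0_integralZl ?lee_fin //; last 2 first.
    - by apply/measurable_EFinP; apply: measurable_funTS; exact: measurable_kern1.
    - by move=> z _; rewrite lee_fin kern_ge0.
    rewrite muleC lee_wpmul2r ?lee_fin //.
    apply: le_trans (kernel_mass (adm_p0 KP) w1); apply: ge0_subset_integral => //.
    - by apply/measurable_EFinP; apply: measurable_funTS; exact: measurable_kern1.
    - by move=> z _; rewrite lee_fin kern_ge0.
    - by move=> z [].
  rewrite ge0_integralZl ?lee_fin //; last 2 first.
  - by [apply/measurable_EFinP; exact: measurable_funTS|move=> w _; rewrite lee_fin].
  - by [apply/measurable_EFinP; exact: measurable_funTS|move=> w _; rewrite lee_fin].
  by rewrite -[leRHS]mule1 lee_wpmul2l ?lee_fin //; exact: ch.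
rewrite integral_cst //.
apply: (@le_trans _ _ ((Y / l ^+ 2)%:E * (2 * l ^+ 2)%:E)%E).
  rewrite lee_wpmul2l ?lee_fin //; apply: le_trans (le_area_cball zeta (ltW l0)).
  apply: le_measure; rewrite ?inE //; first exact: measurable_cball.
  by move=> w [].
rewrite -EFinM lee_fin le_eqVlt; apply/orP; left; apply/eqP; field.
by rewrite gt_eqF.
Qed.

Lemma mobius_sqr a z : disc a -> disc z ->
  1 - normc (mobius a z) ^+ 2 = (1 - normc a ^+ 2) * (1 - normc z ^+ 2) / normc (1 - z * a^*%C) ^+ 2.
Proof.
move=> a1 z1; have k0 := kernel_gt0 z1 a1.
have kE : 1 - a^*%C * z = 1 - z * a^*%C by rewrite mulrC.
have nV : normc (mobius a z) = normc (a - z) / normc (1 - z * a^*%C).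
  rewrite /mobius; set u := _ / _; have : normc u * normc (1 - z * a^*%C) = normc (a - z).
    by rewrite -normcM /u -kE divfK // kE -normc_gt0.
  by move=> <-; rewrite mulfK // gt_eqF.
rewrite nV; have := kernel_identity z a; rewrite -normcBC => e.
have n0 : normc (1 - z * a^*%C) ^+ 2 != 0 by rewrite expf_neq0 // gt_eqF.
apply: (mulIf n0); rewrite divfK // mulrBl mul1r expr_div_n divfK // e; ring.
Qed.

Lemma mobius_bounds a z : disc a -> disc z -> 0 <= 1 - normc (mobius a z) ^+ 2 <= 1.
Proof.
move=> a1 z1; rewrite lerBlDr lerDl sqr_ge0 andbT mobius_sqr // divr_ge0 ?sqr_ge0 //.
by rewrite mulr_ge0 // subr_ge0 expr_le1 ?normc_ge0 // ltW.
Qed.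

Lemma measurable_mobius_weight a : disc a ->
  measurable_fun disc (fun w => K (1 - normc (mobius a w) ^+ 2)).
Proof.
move=> a1.
pose Kp t := K (Num.max 0 t).
have mK : measurable_fun setT Kp.
  apply: nondecreasing_measurable => // s t st; apply: (adm_mono KP).
    by rewrite le_max lexx.
  by rewrite ge_max le_max lexx /= le_max st orbT.
pose J w : R := (1 - normc a ^+ 2) * (1 - normc w ^+ 2) / normc (1 - w * a^*%C) ^+ 2.
have mJ : measurable_fun setT J.
  apply: measurable_funM.
    apply: measurable_funM; first exact: measurable_cst.
    apply: measurable_funB; first exact: measurable_cst.
    by apply: measurable_funX; apply: measurable_normc; exact: measurable_id.
  apply: measurable_funV_ge0 => [q|]; first by rewrite sqr_ge0.
  apply: measurable_funX; apply: measurable_normc; apply: measurable_funBC => //.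
  by apply: measurable_funMC; [exact: measurable_id|exact: measurable_cst].
apply: (eq_measurable_fun (Kp \o J)).
  move=> w; rewrite inE => w1; have /andP[b0 _] := mobius_bounds a1 w1.
  by rewrite /= /Kp /J -mobius_sqr // max_r.
by apply: measurable_funTS; exact: measurableT_comp.
Qed.

(* Annuli around the boundary point [a / |a|]. *)
Lemma carleson_mobius : exists2 CM : R, 0 <= CM & forall (u : C -> R) (A : R),
  measurable_fun disc u -> 0 <= A -> carleson u A -> forall a, disc a ->
  (\int[area]_(z in disc) (u z ^+ 2 * K (1 - normc (mobius a z) ^+ 2))%:E <= (CM * A)%:E)%E.
Proof.
have phi0 n : 0 <= phi n := phi_ge0 KP n.
have S0 : (0 <= \sum_(n <oo) (phi n)%:E)%E by apply: nneseries_ge0 => n _ _; rewrite lee_fin phi0.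
pose P := fine (\sum_(n <oo) (phi n)%:E)%E.
have PE : (\sum_(n <oo) (phi n)%:E = P%:E)%E by rewrite fineK // ge0_fin_numE // (adm_sum KP).
have P0 : 0 <= P by exact: fine_ge0.
have C0 := CK_ge0 KP; have C60 : 0 <= CK ^+ 6 by rewrite exprn_ge0.
exists (CK ^+ 6 * P); first by rewrite mulr_ge0.
move=> u A mu A0 cu a a1; have mD := @measurable_disc R.
(* The boundary point nearest to [a]; for [a = 0] any point of the circle is at the right distance
   1. *)
pose zeta : C := if a == 0 then 1 else a / (normc a)%:C%C.
have [zeta1 dz] : normc zeta = 1 /\ normc (a - zeta) = defect a.
  rewrite /zeta defectE //; case: eqVneq => [->|an0].
    by rewrite normc1 sub0r normcN normc1 normc0 subr0.
  have na : 0 < normc a by rewrite normc_gt0.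
  have nc : (normc a)%:C%C != 0 :> C by rewrite -normc_gt0 normcR normr_gt0 gt_eqF.
  have aE : a = (normc a)%:C%C * (a / (normc a)%:C%C) by rewrite mulrC divfK.
  have n1 : normc (a / (normc a)%:C%C) = 1.
    have e : normc (normc a)%:C%C = normc a by rewrite normcR ger0_norm ?normc_ge0.
    have := normcM (a / (normc a)%:C%C) (normc a)%:C%C; rewrite divfK // e => E.
    by apply: (mulIf (lt0r_neq0 na)); rewrite mul1r -E.
  split => //; rewrite {1}aE -{2}[a / _]mul1r -mulrBl -[1]/(1%:C%C) -rmorphB normr_line n1 mulr1.
  by rewrite ler0_norm ?opprB // subr_le0 ltW.
have da0 : 0 < defect a := defect_gt0 a1.
pose L n := 2 ^+ n * defect a.
have L0 n : 0 < L n by rewrite mulr_gt0 ?exprn_gt0.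
have mB n : measurable (cball zeta (L n)) by exact: measurable_cball.
have mu2 n : measurable_fun disc (fun w => u w ^+ 2 * wt (L n) w).
  apply: measurable_funM; first exact: measurable_funX.
  by apply: measurable_funTS; exact: measurable_wt.
have c0 n : 0 <= CK ^+ 6 * phi n by rewrite mulr_ge0.
have uw0 n w : 0 <= u w ^+ 2 * wt (L n) w := mulr_ge0 (sqr_ge0 _) (wt_ge0 _ (L0 n)).
have Km w : disc w -> 0 <= K (1 - normc (mobius a w) ^+ 2).
  by move=> w1; apply: (adm_ge0 KP); have /andP[] := mobius_bounds a1 w1.
have mKm := measurable_mobius_weight a1.
apply: (le_trans (@dyadic_cover R disc (fun w => (u w ^+ 2 * K (1 - normc (mobius a w) ^+ 2))%:E)
  (fun n => cball zeta (L n)) (fun n w => ((CK ^+ 6 * phi n)%:E * (u w ^+ 2 * wt (L n) w)%:E)%E) mD mB _ _ _ _ _)).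
- by apply/measurable_EFinP; apply: measurable_funM => //; exact: measurable_funX.
- by move=> n; apply: measurable_funeM; apply/measurable_EFinP.
- by move=> w w1; rewrite lee_fin mulr_ge0 ?sqr_ge0 ?Km.
- by move=> n w w1; apply: mule_ge0; rewrite lee_fin.
- move=> w w1; have [n [h1 h2]] := dyadic_scale da0 (normc_ge0 (w - zeta)).
  exists n; split => //; rewrite -EFinM lee_fin mulrCA; apply: ler_wpM2l; first exact: sqr_ge0.
  have kd := kernel_ge_dist w1 a1; have [_ kda] := kernel_ge_defect w1 a1.
  pose k := normc (1 - w * a^*%C); rewrite -/k in kd kda.
  have k0 : 0 < k := kernel_gt0 w1 a1.
  have Lk : L n <= 4 * k.
    have dw : normc (w - zeta) <= 2 * k.
      have -> : w - zeta = (w - a) + (a - zeta) by ring.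
      by apply: (le_trans (normcD _ _)); rewrite dz; lra.
    apply: (le_trans h2); rewrite ge_max; apply/andP; split; lra.
  pose s := defect w / L n.
  have s0 : 0 < s by rewrite divr_gt0 ?defect_gt0.
  have dwL : defect w < L n by exact: carleson_defect zeta1 w1 h1.
  have s1 : s <= 1 by rewrite /s ler_pdivrMr // mul1r ltW.
  have q0 : 0 < 2 ^- n * s by rewrite mulr_gt0 // invr_gt0 exprn_gt0.
  (* The numerator is at most four times the product of the defects and the denominator at least
     [(L n / 4) ^ 2], hence [4 * 16 = 2 ^ 6]. Six doublings remove this factor. *)
  have B : 1 - normc (mobius a w) ^+ 2 <= 2 ^+ 6 * (2 ^- n * s).
    rewrite mobius_sqr // -/k ler_pdivrMr ?exprn_gt0 //.
    have na0 := normc_ge0 a; have nw0 := normc_ge0 w.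
    have e1 : 1 - normc a ^+ 2 <= 2 * defect a by rewrite defectE //; have : normc a < 1 := a1; nra.
    have e2 : 1 - normc w ^+ 2 <= 2 * defect w by rewrite defectE //; have : normc w < 1 := w1; nra.
    have e3 : 0 <= 1 - normc w ^+ 2 by rewrite subr_ge0 expr_le1 // ltW.
    have e4 : 0 <= 1 - normc a ^+ 2 by rewrite subr_ge0 expr_le1 // ltW.
    apply: (le_trans (ler_pM e4 e3 e1 e2)).
    have k2 : L n ^+ 2 / 16 <= k ^+ 2.
      have -> : L n ^+ 2 / 16 = (L n / 4) ^+ 2 by field.
      by rewrite lerXn2r ?nnegrE ?divr_ge0 ?(ltW (L0 n)) ?(ltW k0) // ler_pdivrMr // mulrC.
    have E : 2 * defect a * (2 * defect w) = 2 ^+ 6 * (2 ^- n * s) * (L n ^+ 2 / 16).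
      rewrite /s /L; field; rewrite !gt_eqF ?exprn_gt0 //.
    by rewrite E; apply: ler_wpM2l => //; rewrite mulr_ge0 // ltW.
  apply: (le_trans (weight_le_iter (mobius_bounds a1 w1) (ltW q0) B)).
  rewrite -[leRHS]mulrA; apply: ler_wpM2l => //.
  by have := adm_phi KP n (_ : 0 < s <= 1); rewrite s0 s1 => /(_ isT).
apply: (@le_trans _ _ (\sum_(n <oo) ((CK ^+ 6 * A)%:E * (phi n)%:E)%E)%E).
  apply: lee_nneseries => [n _ _|n _].
    by apply: integral_ge0 => w [w1 _]; apply: mule_ge0; rewrite lee_fin.
  have mI : measurable (disc `&` cball zeta (L n)) by exact: measurableI.
  rewrite ge0_integralZl ?lee_fin //; last 2 first.
  - by apply/measurable_EFinP; apply: measurable_funS (mu2 n) => // w [].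
  - by move=> w [w1 _]; rewrite lee_fin.
  have -> : ((CK ^+ 6 * A)%:E * (phi n)%:E = (CK ^+ 6 * phi n)%:E * A%:E)%E.
    by rewrite -!EFinM mulrAC.
  apply: lee_wpmul2l; first by rewrite lee_fin.
  exact: cu.
rewrite nneseriesZl ?lee_fin ?mulr_ge0 //; last by move=> n _; rewrite lee_fin.
by rewrite PE -EFinM mulrAC.
Qed.

End weighted.
End kernel_estimates.

(** * Integration against a density *)

Section density.
Variable R : realType.
Local Notation C := R[i].
Local Notation Re := complex.Re.
Local Notation Im := complex.Im.
Local Notation area := (@area R).
Local Notation disc := (@disc R).
Import HBNNSimple.

Variable rho : C -> R.
Hypothesis mrho : measurable_fun disc rho.
Hypothesis rho0 : forall z, disc z -> 0 <= rho z.

Let r1 : C -> \bar R := (EFin \o rho) \_ disc.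

Let r1_ge0 z : (0 <= r1 z)%E.
Proof. by rewrite /r1 patchE; case: ifPn => //; rewrite inE => z1; rewrite lee_fin rho0. Qed.

Let mr1 : measurable_fun setT r1.
Proof.
have m : measurable_fun disc (EFin \o rho) by exact/measurable_EFinP.
exact: (measurable_restrictT (EFin \o rho) (@measurable_disc R)).1 m.
Qed.

Let densityE : density rho = fun A => (\int[area]_(z in A) r1 z)%E.
Proof. by apply/funext => A; rewrite /density integral_mkcondr. Qed.

(** [density rho] is a bare set function; its measure structure is built here from the integral of
    [rho] extended by 0, which opens the library of integrals for [mu_QK] and [dA_]. *)
Lemma density_measure : exists m : {measure set C -> \bar R}, density rho = m :> (set C -> \bar R).
Proof.
have d0 : density rho set0 = 0 by rewrite densityE integral_set0.
have dge0 A : (0 <= density rho A)%E by rewrite densityE; exact: integral_ge0.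
have dsa : semi_sigma_additive (density rho) by rewrite densityE; exact: (@semi_sigma_additive_nng_induced _ _ _ area r1 mr1 r1_ge0).
by exists (HB.pack_for {measure set C -> \bar R} (density rho) (isMeasure.Build _ _ _ (density rho) d0 dge0 dsa)).
Qed.

(** Monotone convergence on both sides reduces to simple functions, then to indicators, where the
    identity is the definition of [density]. *)
Lemma ge0_integral_density (D : set C) (f : C -> R) : measurable D -> measurable_fun D f ->
  (forall z, D z -> 0 <= f z) ->
  (\int[density rho]_(z in D) (f z)%:E = \int[area]_(z in D `&` disc) (f z * rho z)%:E)%E.
Proof.
have [m dm] := density_measure; rewrite dm => mD mf f0.
have mf' : measurable_fun D (EFin \o f) by exact/measurable_EFinP.
pose f_ := nnsfun_approx mD mf'.
have mDd : measurable (D `&` disc) by apply: measurableI => //; exact: measurable_disc.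
have mrhoD : measurable_fun (D `&` disc) rho.
  by apply: (measurable_funS (@measurable_disc R) _ mrho) => z [].
have mfr n : measurable_fun (D `&` disc) (fun z => (f_ n z * rho z)%:E).
  apply/measurable_EFinP; apply: measurable_funM; first exact: measurable_funTS.
  exact: mrhoD.
transitivity (limn (fun n => \int[m]_(z in D) (f_ n z)%:E))%E.
  rewrite -monotone_convergence //; last 3 first.
  - by move=> n; apply/measurable_EFinP; exact: measurable_funTS.
  - by move=> n z _; rewrite lee_fin.
  - by move=> z _ i j ij; rewrite lee_fin; exact/lefP/nd_nnsfun_approx.
  apply: eq_integral => z; rewrite inE => Dz; apply/esym/cvg_lim => //.
  by apply: (cvg_nnsfun_approx mD mf' _ Dz) => w Dw; rewrite lee_fin f0.
transitivity (limn (fun n => \int[area]_(z in D `&` disc) (f_ n z * rho z)%:E))%E; last first.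
  rewrite -monotone_convergence //; last 2 first.
  - by move=> n z [_ z1]; rewrite lee_fin mulr_ge0 // rho0.
  - move=> z [_ z1] i j ij; rewrite lee_fin ler_wpM2r ?rho0 //; exact/lefP/nd_nnsfun_approx.
  apply: eq_integral => z; rewrite inE => -[Dz z1]; apply/cvg_lim => //.
  rewrite EFinM; under eq_fun do rewrite EFinM.
  apply: cvgeZr => //.
  by apply: (cvg_nnsfun_approx mD mf' _ Dz) => w Dw; rewrite lee_fin f0.
congr (limn _); apply/funext => n.
have mk k : measurable (f_ n @^-1` [set k]) by exact: measurable_sfunP.
transitivity (\sum_(k \in range (f_ n)) \int[m]_(z in D) (k * \1_(f_ n @^-1` [set k]) z)%:E)%E.
  under eq_integral do rewrite fimfunE -fsumEFin//.
  rewrite ge0_integral_fsum//.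
  - by move=> y; apply/measurable_EFinP/measurable_funM => //; exact: measurable_funTS.
  - by move=> y x _; rewrite nnfun_muleindic_ge0.
transitivity (\sum_(k \in range (f_ n)) \int[area]_(z in D `&` disc) ((k * \1_(f_ n @^-1` [set k]) z)%:E * (rho z)%:E))%E.
  apply: eq_fsbigr => k; rewrite inE => -[y _ yk].
  have k0 : 0 <= k by rewrite -yk.
  under eq_integral do rewrite EFinM.
  have mi : measurable_fun setT (\1_(f_ n @^-1` [set k]) : C -> R) by exact: measurable_indic.
  rewrite ge0_integralZl ?lee_fin //; last first.
    by apply/measurable_EFinP; exact: measurable_funTS.
  rewrite integral_indic // -dm /density.
  under [RHS]eq_integral do rewrite -EFinM -mulrA EFinM.
  rewrite ge0_integralZl ?lee_fin //; last 2 first.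
  - by apply/measurable_EFinP; apply: measurable_funM mrhoD; exact: measurable_funTS.
  - by move=> z [_ z1]; rewrite lee_fin mulr_ge0 // rho0.
  congr (_ * _)%E; rewrite -setIA setIC integral_mkcondr; apply: eq_integral => z _.
  by rewrite patchE indicE; case: ifP => _; rewrite ?mul1r ?mul0r.
rewrite -ge0_integral_fsum//.
- apply: eq_integral => z; rewrite inE => -[_ z1].
  rewrite -ge0_mule_fsuml ?fsumEFin // -?fimfunE -?EFinM //.
  by move=> k; exact: nnfun_muleindic_ge0.
- move=> k; apply: emeasurable_funM; last by apply/measurable_EFinP; exact: mrhoD.
  by apply/measurable_EFinP; apply: measurable_funM => //; exact: measurable_funTS.
- by move=> k z [_ z1]; rewrite mule_ge0 ?nnfun_muleindic_ge0 // lee_fin rho0.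
Qed.

Lemma integral_density (D : set C) (f : C -> R) : measurable D -> measurable_fun D f ->
  (\int[density rho]_(z in D) (f z)%:E = \int[area]_(z in D `&` disc) (f z * rho z)%:E)%E.
Proof.
move=> mD mf; have [m dm] := density_measure; rewrite dm [LHS]integralE [RHS]integralE -dm.
have E (g : C -> R) : (forall z, 0 <= g z) -> measurable_fun D g ->
    (\int[density rho]_(z in D) (g z)%:E = \int[area]_(z in D `&` disc) (g z * rho z)%:E)%E.
  by move=> g0 mg; apply: ge0_integral_density.
have Ep : ((fun z => (f z)%:E)^\+ = fun z => (Num.max (f z) 0)%:E)%E.
  by apply/funext => z; rewrite funeposE EFin_max.
have En : ((fun z => (f z)%:E)^\- = fun z => (Num.max (- f z) 0)%:E)%E.
  by apply/funext => z; rewrite funenegE EFin_max EFinN.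
rewrite Ep En !E.
- congr (_ - _)%E; apply: eq_integral => z; rewrite inE => -[_ /rho0 r0].
    by rewrite funeposE -EFin_max maxr_pMl // mul0r.
  by rewrite funenegE -EFinN -EFin_max maxr_pMl // mul0r mulNr.
- by move=> z; rewrite le_max lexx orbT.
- by apply: measurable_maxr; [exact: measurable_funN|exact: measurable_cst].
- by move=> z; rewrite le_max lexx orbT.
- by apply: measurable_maxr => //; exact: measurable_cst.
Qed.

Lemma cintegral_density (D : set C) (h : C -> C) : measurable D -> measurable_fun D h ->
  cintegral (density rho) D h = cintegral area (D `&` disc) (fun z => h z * (rho z)%:C%C).
Proof.
move=> mD mh; rewrite /cintegral !integral_density //.
- congr (fine _ +i* fine _)%C; apply: eq_integral => z _; rewrite ?cReM ?cImM /=; congr EFin; ring.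
- exact: measurable_funIm.
- exact: measurable_funRe.
Qed.

End density.

(** * Cells and Carleson boxes *)

Section geometry.
Variable R : realType.
Local Notation C := R[i].
Local Notation Re := complex.Re.
Local Notation Im := complex.Im.
Local Notation area := (@area R).
Local Notation disc := (@disc R).
Implicit Types (z w a : C) (N : nat) (I : Defs.arc R).

Lemma cis0 : cis 0 = 1 :> C. Proof. by rewrite /cis cos0 sin0. Qed.

Lemma cis2pi : cis (2 * pi) = 1 :> C.
Proof. by rewrite /cis mulr_natl cos2pi sin2pi. Qed.

Lemma cisJ (t : R) : (cis t)^*%C = cis (- t).
Proof. by rewrite /cis cosN sinN. Qed.

Lemma cisVr (t : R) : cis t * cis (- t) = 1.
Proof. by rewrite -cisD subrr cis0. Qed.

Lemma chord_le (s t : R) : normc (cis s - cis t) <= 2 * `|s - t|.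
Proof.
have E (u : R) : cis u = cexp (u%:C%C * 'i%C).
  by rewrite /cexp !ReImE /= !(mulr0, mul0r, mulr1, add0r, subr0, oppr0, addr0, expR0, mul1r) //; apply: complexP.
have H := @cmean_value R (@cexp R) (@cexp R) (t%:C%C * 'i%C) ((s - t)%:C%C * 'i%C) 1.
have -> : normc (cis s - cis t) = normc (cexp (t%:C%C * 'i%C + (s - t)%:C%C * 'i%C) - cexp (t%:C%C * 'i%C)).
  by rewrite -mulrDl -rmorphD (addrC t) subrK !E.
have n1 : normc ((s - t)%:C%C * 'i%C) = `|s - t|.
  by rewrite normr_line (_ : normc 'i%C = 1) ?mulr1 //= expr0n expr1n add0r sqrtr1.
rewrite -n1 -[X in 2 * X]mul1r; apply: H => u _; first exact: has_cderiv_cexp.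
have -> : t%:C%C * 'i%C + u%:C%C * ((s - t)%:C%C * 'i%C) = (t + u * (s - t))%:C%C * 'i%C :> C.
  by apply: complexP; rewrite !ReImE /=; ring.
by rewrite -E normc_cis.
Qed.

(** The argument normalized to [[0, 2 pi[], as the cells require; [carg] has its jump on the
    negative axis. *)
Definition theta z : R :=
  if 0 <= Im z then acos (Re z / normc z) else 2 * pi - acos (Re z / normc z).

Lemma Re_ratio z : -1 <= Re z / normc z <= 1.
Proof.
have [->|z0] := eqVneq z 0; first by rewrite mul0r lerN10 ler01.
have nz : 0 < normc z by rewrite normc_gt0.
by rewrite -ler_norml normrM normfV (gtr0_norm nz) ler_pdivrMr // mul1r Re_le_normc.
Qed.

Lemma theta_bounds z : 0 <= theta z < 2 * pi.
Proof.
have h := Re_ratio z; have a0 := acos_ge0 h; have a1 := acos_lepi h; have p0 := @pi_gt0 R.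
rewrite /theta; case: ifPn => [_|]; first by rewrite a0 /=; lra.
rewrite -ltNge => im; apply/andP; split; first lra.
have : 0 < acos (Re z / normc z); last lra.
apply: acos_gt0; case/andP: h => -> /=.
have nz : 0 < normc z by rewrite normc_gt0; apply/eqP => z0; rewrite z0 ltxx in im.
rewrite ltr_pdivrMr // mul1r => _; rewrite lt_neqAle (le_trans (ler_norm _) (Re_le_normc _)) andbT.
apply/eqP => E; have := normc_sqr z; rewrite E => /eqP; rewrite eq_sym -subr_eq0 addrC addKr sqrf_eq0.
by move=> /eqP i0; rewrite i0 ltxx in im.
Qed.

Lemma polar z : z = (normc z)%:C%C * cis (theta z).
Proof.
have [->|z0] := eqVneq z 0; first by rewrite normc0 mul0r.
have h := Re_ratio z; have nz : 0 < normc z by rewrite normc_gt0.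
have c : cos (acos (Re z / normc z)) = Re z / normc z by have [] := acos_def h.
have s : sin (acos (Re z / normc z)) = `|Im z| / normc z.
  rewrite sin_acos // -(sqrtr_sqr (Im z)) -[in RHS](ger0_norm (ltW nz)) -(sqrtr_sqr (normc z)).
  rewrite -sqrtrV ?sqr_ge0 // -sqrtrM ?sqr_ge0 //; congr Num.sqrt.
  rewrite expr_div_n; have -> : Im z ^+ 2 = normc z ^+ 2 - Re z ^+ 2 by rewrite normc_sqr addrC addKr.
  field; exact: lt0r_neq0.
have ns : normc z != 0 by rewrite gt_eqF.
have cB (x : R) : cos (2 * pi - x) = cos x by rewrite cosB mulr_natl cos2pi sin2pi mul1r mul0r addr0.
have sB (x : R) : sin (2 * pi - x) = - sin x by rewrite sinB mulr_natl cos2pi sin2pi mul1r mul0r sub0r.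
apply: complexP; rewrite !ReImE /= !mul0r ?subr0 ?addr0 /theta; case: ifPn => im; rewrite ?cB ?sB ?c ?s.
- by rewrite mulrC divfK.
- by rewrite mulrC divfK.
- by rewrite ger0_norm // mulrC divfK.
- by rewrite -ltNge in im; rewrite ltr0_norm // mulNr opprK mulrC divfK.
Qed.

Lemma theta_cis (r t : R) : 0 < r -> 0 <= t < 2 * pi -> theta (r%:C%C * cis t) = t.
Proof.
move=> r0 /andP[t0 t1]; have p0 := @pi_gt0 R.
have n : normc (r%:C%C * cis t) = r by rewrite normr_line normc_cis mulr1 gtr0_norm.
rewrite /theta n !ReImE /= !mul0r subr0 addr0 [r * cos t]mulrC mulfK ?gt_eqF // pmulr_rge0 //.
have [tp|pt] := leP t pi.
  have -> : 0 <= sin t.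
    have [->|tn] := eqVneq t pi; first by rewrite sinpi.
    have [->|tn0] := eqVneq t 0; first by rewrite sin0.
    by rewrite ltW // sin_gt0_pi // lt_def tn0 t0 lt_neqAle tn tp.
  by rewrite cosK // in_itv /= t0.
pose s := 2 * pi - t; have sI : 0 < s < pi by rewrite /s; lra.
have tE : t = 2 * pi - s by rewrite /s; ring.
have cE : cos t = cos s by rewrite tE cosB mulr_natl cos2pi sin2pi mul1r mul0r addr0.
have sE : sin t = - sin s by rewrite tE sinB mulr_natl cos2pi sin2pi mul1r mul0r sub0r.
rewrite sE oppr_ge0 leNgt sin_gt0_pi //= cE cosK ?tE //.
by rewrite in_itv /=; case/andP: sI => /ltW -> /ltW ->.
Qed.

Lemma measurable_theta : measurable_fun setT theta.
Proof.
pose cl (x : R) := Num.max (-1) (Num.min 1 x).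
have m11 : -1 <= 1 :> R by lra.
have clI x : -1 <= cl x <= 1 by rewrite /cl le_max lexx /= ge_max m11 /= ge_min lexx.
have clE x : -1 <= x <= 1 -> cl x = x by move=> /andP[x0 x1]; rewrite /cl min_r // max_r.
have mac : measurable_fun setT (fun x => acos (cl x)).
  have : measurable_fun setT (fun x => - acos (cl x)).
    apply: nondecreasing_measurable => // x y xy; rewrite lerN2 leNgt; apply/negP => lt_acos.
    have cxy : cl x <= cl y.
      by rewrite /cl ge_max !le_max !le_min !ge_min !lexx xy /= !orbT.
    have [hx cx] := acos_def (clI x); have [hy cy] := acos_def (clI y).
    have : cos (acos (cl y)) < cos (acos (cl x)) by rewrite ltr_cos // in_itv.
    by rewrite cx cy ltNge cxy.
  by move=> /measurable_funN; apply: eq_measurable_fun => x _; rewrite /= opprK.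
pose q z := acos (cl (Re z / normc z)).
have mq : measurable_fun setT q.
  apply: (measurableT_comp mac); apply: measurable_funM; first exact: measurable_Re.
  apply: measurable_funV_ge0 => [z|]; first exact: normc_ge0.
  by apply: measurable_normc; exact: measurable_id.
have -> : theta = fun z => if 0 <= Im z then q z else 2 * pi - q z.
  by apply/funext => z; rewrite /theta /q clE // Re_ratio.
apply: measurable_fun_ifT => //.
  apply: (measurable_fun_bool true); rewrite setTI.
  have := @measurable_Im R measurableT [set` `[0, +oo[]; rewrite setTI => H.
  have := H (measurable_itv _); congr measurable; apply/seteqP; split => z /=; rewrite in_itv /= andbT //.
by apply: measurable_funB; [exact: measurable_cst|exact: mq].
Qed.

(** Rotating by [- tau] brings the point near the positive axis, where its argument is the
    arctangent of a ratio that is at most [2 d / rho]. *)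
Lemma sector (rho tau d : R) w : 0 < rho -> d <= rho / 2 -> normc (w - rho%:C%C * cis tau) < d ->
  exists t, `|t - tau| <= 2 * d / rho /\ w = (normc w)%:C%C * cis t.
Proof.
move=> r0 dr wd; pose u := w * cis (- tau).
have d0 : 0 < d by rewrite (le_lt_trans (normc_ge0 _) wd).
have ur : normc (u - rho%:C%C) < d.
  have -> : u - rho%:C%C = (w - rho%:C%C * cis tau) * cis (- tau).
    by rewrite mulrBl -mulrA cisVr mulr1.
  by rewrite normcM normc_cis mulr1.
have re : rho / 2 <= Re u.
  have := le_lt_trans (Re_le_normc _) ur; rewrite cReD cReN /= ltr_norml => /andP[h _]; lra.
have im : `|Im u| <= d.
  by have := le_lt_trans (Im_le_normc _) ur; rewrite cImD cImN /= oppr0 addr0 => /ltW.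
have u0 : 0 < Re u by rewrite (lt_le_trans _ re) // divr_gt0.
exists (tau + carg u); rewrite addrC addKr; split.
  rewrite carg_atan //; set x := Im u / Re u.
  have ax : `|atan x| <= `|x|.
    have := @MVT01 R (fun t => atan (t * x)) (fun t => x / (1 + (t * x) ^+ 2)) `|x|.
    rewrite mul1r mul0r atan0 subr0; apply => t t01.
      have D1 := @is_derive1_atan R (t * x).
      have D2 : is_derive t 1 (fun s : R => s * x) x by apply: is_derive_eq; rewrite /GRing.scale /=; ring.
      have := @is_derive1_comp R atan (fun s : R => s * x) t _ _ D1 D2.
      by rewrite [_^-1 * x]mulrC.
    rewrite normrM normfV ler_pdivrMr ?normr_gt0 ?gt_eqF ?ltr_pwDl ?sqr_ge0 //.
    by rewrite ler_peMr // ger0_norm ?addr_ge0 ?sqr_ge0 // lerDl sqr_ge0.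
  apply: (le_trans ax); rewrite /x normrM normfV (gtr0_norm u0) ler_pdivrMr //.
  apply: (le_trans im); have -> : 2 * d / rho * Re u = d * (2 * Re u / rho) by ring.
  by rewrite ler_peMr ?(ltW d0) // ler_pdivlMr // mul1r; lra.
have uE : u = (normc u)%:C%C * cis (carg u) by rewrite cis_carg.
have nu : normc u = normc w by rewrite normcM normc_cis mulr1.
by rewrite -nu cisD mulrCA -uE /u mulrCA cisVr mulr1.
Qed.

Lemma area_cball_gt0 (p : C) (r : R) : 0 < r -> (0 < area (cball p r))%E.
Proof.
move=> r0; pose a : R := r / 4.
pose Q : set (R * R) := [set` `[(Re p - a)%R : R, (Re p + a)%R : R]] `*` [set` `[(Im p - a)%R : R, (Im p + a)%R : R]].
have lQ : (0 < (@lebesgue_measure R \x @lebesgue_measure R)%E Q)%E.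
  rewrite product_measure1E; try exact: measurable_itv.
  have I (x : R) : (0 < @lebesgue_measure R [set` `[(x - a)%R : R, (x + a)%R : R]])%E.
    have xa : x - a < x + a by rewrite /a; lra.
    by rewrite lebesgue_measure_itv /= lte_fin xa lte_fin subr_gt0.
  by apply: mule_gt0; exact: I.
rewrite area_set; apply: mule_gt0; first by rewrite lte_fin invr_gt0 pi_gt0.
apply: (lt_le_trans lQ); apply: le_measure; rewrite ?inE //.
- by apply: measurableX; exact: measurable_itv.
- exact: (@measurable_cball R).
- move=> [x y] []; rewrite /preimage /complex_of_pair /cball /= !in_itv /= => hx hy.
  apply: (@le_lt_trans _ _ (`|x - Re p| + `|y - Im p|)).
    by have := normc_le_ReIm ((x +i* y)%C - p); rewrite !ReImE.
  have : `|x - Re p| <= a by rewrite ler_norml; lra.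
  have : `|y - Im p| <= a by rewrite ler_norml; lra.
  rewrite /a; lra.
Qed.

(** The origin belongs to every [cell] with first index 0, since its angle is free there. [cell_]
    fixes the angle to [theta], agrees with [cell] off the origin, and partitions the disc. *)
Definition cell_ N (Q : cell_index N) : set C :=
  [set w | Q.1%:R / 2 ^+ N <= normc w ^+ 2 < Q.1.+1%:R / 2 ^+ N /\
    2 * pi * Q.2%:R / 2 ^+ N <= theta w < 2 * pi * Q.2.+1%:R / 2 ^+ N].

Lemma cell_angle N (Q : cell_index N) (t : R) :
  2 * pi * Q.2%:R / 2 ^+ N <= t < 2 * pi * Q.2.+1%:R / 2 ^+ N -> 0 <= t < 2 * pi.
Proof.
move=> /andP[h1 h2]; have p0 := @pi_ge0 R; apply/andP; split.
  by apply: le_trans h1; rewrite divr_ge0 ?exprn_ge0 // !mulr_ge0.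
apply: (lt_le_trans h2); rewrite ler_pdivrMr ?exprn_gt0 // ler_wpM2l ?mulr_ge0 //.
by rewrite -natrX ler_nat ltn_ord.
Qed.

Lemma cellE N (Q : cell_index N) w : w != 0 -> cell Q w <-> cell_ Q w.
Proof.
move=> w0; split=> [[r [t [r0 wE hr ht]]]|[hr ht]]; last first.
  exists (normc w), (theta w); split => //; [exact: normc_ge0|exact: polar].
have nr : normc w = r by rewrite wE normr_line normc_cis mulr1 ger0_norm.
have rp : 0 < r by rewrite -nr normc_gt0.
by split; rewrite ?nr // wE theta_cis //; exact: cell_angle ht.
Qed.

Lemma cell_disc N (Q : cell_index N) w : cell_ Q w -> disc w.
Proof.
move=> [/andP[_ h] _]; rewrite /Defs.disc /mkset -(expr_lt1 (n := 2)) ?normc_ge0 //.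
apply: (lt_le_trans h); rewrite ler_pdivrMr ?exprn_gt0 // mul1r -natrX ler_nat; exact: ltn_ord.
Qed.

Lemma measurable_cell_ N (Q : cell_index N) : measurable (cell_ Q).
Proof.
have m1 : measurable_fun setT (fun w : C => normc w ^+ 2).
  by apply: measurable_funX; apply: measurable_normc; exact: measurable_id.
have H1 := m1 measurableT [set` `[(Q.1%:R / 2 ^+ N)%R : R, (Q.1.+1%:R / 2 ^+ N)%R : R[] (measurable_itv _).
have H2 := measurable_theta measurableT (Y := [set` `[(2 * pi * Q.2%:R / 2 ^+ N)%R : R, (2 * pi * Q.2.+1%:R / 2 ^+ N)%R : R[]) (measurable_itv _).
rewrite !setTI in H1 H2; by have := measurableI _ _ H1 H2; congr measurable.
Qed.

Lemma cell_exists N w : disc w -> exists Q : cell_index N, cell_ Q w.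
Proof.
have fl (x : R) : 0 <= x < 1 -> exists j : 'I_(2 ^ N), j%:R / 2 ^+ N <= x < j.+1%:R / 2 ^+ N.
  move=> /andP[x0 x1]; have p0 : 0 < 2 ^+ N :> R by rewrite exprn_gt0.
  have y0 : 0 <= x * 2 ^+ N by rewrite mulr_ge0 // ltW.
  have h : (Num.trunc (x * 2 ^+ N) < 2 ^ N)%N.
    by rewrite truncn_lt_nat // natrX -[ltRHS]mul1r ltr_pM2r.
  exists (Ordinal h) => /=; rewrite ler_pdivrMr // ltr_pdivlMr // truncnS_gt truncn_le y0 //.
move=> w1; have [j hj] : exists j : 'I_(2 ^ N), j%:R / 2 ^+ N <= normc w ^+ 2 < j.+1%:R / 2 ^+ N.
  by apply: fl; rewrite sqr_ge0 expr_lt1 ?normc_ge0.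
have p0 : 0 < 2 * pi :> R by rewrite mulr_gt0 ?pi_gt0.
have [k hk] : exists k : 'I_(2 ^ N), k%:R / 2 ^+ N <= theta w / (2 * pi) < k.+1%:R / 2 ^+ N.
  apply: fl; have /andP[h1 h2] := theta_bounds w.
  by rewrite divr_ge0 ?(ltW p0) //= ltr_pdivrMr // mul1r.
exists (j, k); split => //=; move: hk; rewrite ler_pdivlMr // ltr_pdivrMr // ![_ * (2 * pi)]mulrC !mulrA //.
Qed.

Lemma cell_unique N (Q Q' : cell_index N) w : cell_ Q w -> cell_ Q' w -> Q = Q'.
Proof.
have fl (x c : R) (j j' : 'I_(2 ^ N)) : 0 < c -> c * j%:R <= x < c * j.+1%:R -> c * j'%:R <= x < c * j'.+1%:R -> j = j'.
  move=> c0 /andP[a1 a2] /andP[b1 b2]; apply/val_inj => /=; apply/eqP; rewrite eqn_leq.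
  have h1 := le_lt_trans a1 b2; have h2 := le_lt_trans b1 a2.
  by rewrite !ltr_pM2l // !ltr_nat !ltnS in h1 h2; rewrite h1.
have p0 : 0 < 2 ^- N :> R by rewrite invr_gt0 exprn_gt0.
have q0 : 0 < 2 * pi * 2 ^- N :> R by rewrite !mulr_gt0 ?pi_gt0.
case: Q Q' => [j k] [j' k'] [/= h1 h2] [/= h3 h4]; congr (_, _).
  by apply: (fl (normc w ^+ 2) (2 ^- N)) => //; rewrite ![2 ^- N * _]mulrC.
by apply: (fl (theta w) (2 * pi * 2 ^- N)) => //; rewrite ![_ * 2 ^- N * _]mulrAC.
Qed.

Lemma cell_small z (d : R) : 0 < d -> exists N0, forall N (Q : cell_index N) w, (N0 <= N)%N ->
  cell_ Q z -> cell_ Q w -> normc (w - z) < d.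
Proof.
move=> d0; have p0 := @pi_gt0 R.
(* The first term makes the radial size small: cells split the squared modulus evenly, so moduli
   differ by less than a square root of [2 ^- N]. The second handles the angular size through
   [chord_le]. *)
pose M : R := 4 / d ^+ 2 + 8 * pi / d.
have [N0 HN0] : exists N0 : nat, M <= N0%:R.
  by exists (Num.trunc M).+1; rewrite ltW // truncnS_gt.
exists N0 => N Q w NN [/andP[a1 a2] /andP[a3 a4]] [/andP[b1 b2] /andP[b3 b4]].
pose e : R := 2 ^- N; have e0 : 0 < e by rewrite invr_gt0 exprn_gt0.
have eM : e * M < 1.
  rewrite /e mulrC ltr_pdivrMr ?exprn_gt0 // mul1r (le_lt_trans HN0) //.
  by rewrite -natrX ltr_nat (leq_ltn_trans NN) // ltn_expl.
have d20 : 0 < d ^+ 2 by rewrite exprn_gt0.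
have e1 : e * 4 < d ^+ 2.
  have : e * (4 / d ^+ 2) < 1.
    apply: le_lt_trans eM; rewrite ler_pM2l // lerDl divr_ge0 ?mulr_ge0 ?ltW //.
  by rewrite mulrA ltr_pdivrMr // mul1r.
have e2 : e * (8 * pi) < d.
  have : e * (8 * pi / d) < 1.
    apply: le_lt_trans eM; by rewrite ler_pM2l // lerDr divr_ge0 // ltW.
  by rewrite mulrA ltr_pdivrMr // mul1r.
have rE j : j.+1%:R / 2 ^+ N = j%:R / 2 ^+ N + e :> R by rewrite -addn1 natrD mulrDl mul1r.
have tE j : 2 * pi * j.+1%:R / 2 ^+ N = 2 * pi * j%:R / 2 ^+ N + 2 * pi * e :> R.
  by rewrite -(natr1 j) mulrDr mulr1 mulrDl.
rewrite rE in a2 b2; rewrite tE in a4 b4.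
have zle1 : normc z <= 1.
  by rewrite ltW //; apply: (@cell_disc N Q); split; rewrite ?rE ?tE ?a1 ?a3.
have n1 : `|normc w - normc z| < d / 2.
  rewrite -(ltr_pXn2r (n := 2)) ?nnegrE ?normr_ge0 ?divr_ge0 ?(ltW d0) // real_normK ?num_real //.
  have h : `|normc w ^+ 2 - normc z ^+ 2| < e.
    by move: a1 a2 b1 b2; clear; rewrite ltr_norml => *; apply/andP; split; lra.
  apply: (@le_lt_trans _ _ `|normc w ^+ 2 - normc z ^+ 2|).
    rewrite subr_sqr normrM -[leLHS]real_normK ?num_real // expr2 ler_wpM2l ?normr_ge0 //.
    move: (normc w) (normc z) (normc_ge0 w) (normc_ge0 z); clear => x y x0 y0.
    by rewrite [leRHS]ger0_norm ?addr_ge0 // ler_norml; apply/andP; split; lra.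
  apply: (lt_trans h); rewrite expr_div_n ltr_pdivlMr ?exprn_gt0 //; move: e1; clear => ?; lra.
have n2 : normc (cis (theta w) - cis (theta z)) <= d / 2.
  apply: (le_trans (chord_le _ _)).
  have : `|theta w - theta z| <= 2 * pi * e.
    by move: a3 a4 b3 b4; clear; rewrite ler_norml => *; apply/andP; split; lra.
  move: e2; clear => *; lra.
have -> : w - z =
  (normc w - normc z)%:C%C * cis (theta w) + (normc z)%:C%C * (cis (theta w) - cis (theta z)).
  by rewrite {1}(polar w) {1}(polar z) rmorphB; ring.
apply: (le_lt_trans (normcD _ _)); rewrite !normr_line normc_cis mulr1 (ger0_norm (normc_ge0 z)).
have : normc z * normc (cis (theta w) - cis (theta z)) <= normc (cis (theta w) - cis (theta z)).
  by rewrite ler_piMl ?normc_ge0.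
move: n1 n2; clear => *; lra.
Qed.

(** The centre has squared modulus and angle in the middle of their ranges. The ball is what gives
    each cell positive mass. *)
Lemma cell_ball N (Q : cell_index N) : exists (p : C) (r : R), 0 < r /\ cball p r `<=` cell Q.
Proof.
have p0 := @pi_gt0 R; pose e : R := 2 ^- N; have e0 : 0 < e by rewrite invr_gt0 exprn_gt0.
have e1 : e <= 1 by rewrite /e invf_le1 ?exprn_gt0 // exprn_ege1 // ler1n.
pose q : R := (Q.1%:R + 2^-1) * e.
have q0 : 0 < q by rewrite mulr_gt0 // ltr_wpDl.
have qE : Q.1%:R / 2 ^+ N = q - e / 2 /\ Q.1.+1%:R / 2 ^+ N = q + e / 2.
  by rewrite /q -/e -!(natr1 Q.1); split; field.
have q1 : q <= 1.
  have : Q.1.+1%:R / 2 ^+ N <= 1 :> R.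
    by rewrite ler_pdivrMr ?exprn_gt0 // mul1r -natrX ler_nat; exact: ltn_ord.
  rewrite qE.2; lra.
pose rho := Num.sqrt q; have rho0 : 0 < rho by rewrite sqrtr_gt0.
have rhoq : rho ^+ 2 = q by rewrite sqr_sqrtr // ltW.
have rho1 : rho <= 1 by rewrite -(expr_le1 (n := 2)) ?(ltW rho0) // rhoq.
pose tau : R := 2 * pi * Q.2%:R / 2 ^+ N + pi * e.
pose d := rho * e / 8; have d0 : 0 < d by rewrite divr_gt0 // mulr_gt0.
have d2 : d <= rho / 2 by rewrite /d; nra.
exists (rho%:C%C * cis tau), d; split => // w wd.
have [t [ht wE]] := sector rho0 d2 wd.
exists (normc w), t; split => //; first exact: normc_ge0.
  have h : `|normc w - rho| < d.
    have n : normc (rho%:C%C * cis tau) = rho by rewrite normr_line normc_cis mulr1 gtr0_norm.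
    rewrite ltr_norml; apply/andP; split.
      have := normc_sub_ge (rho%:C%C * cis tau) w; rewrite n normcBC /cball /= in wd *; lra.
    have := normc_sub_ge w (rho%:C%C * cis tau); rewrite n /cball /= in wd *; lra.
  have de : d * 3 < e / 2 by rewrite /d; nra.
  have : `|normc w ^+ 2 - q| < e / 2.
    rewrite -rhoq subr_sqr normrM (lt_trans _ de) //.
    have h3 : `|normc w + rho| <= 3.
      have := normc_ge0 w => w0; rewrite ger0_norm ?addr_ge0 // ?(ltW rho0) //.
      move: h; rewrite ltr_norml => /andP[_]; have : d <= 1 by rewrite /d; nra.
      lra.
    apply: (@le_lt_trans _ _ (`|normc w - rho| * 3)); first by rewrite ler_wpM2l.
    by rewrite ltr_pM2r.
  rewrite ltr_norml qE.1 qE.2; clear => /andP[h1 h2]; apply/andP; split; lra.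
have dE : 2 * d / rho = e / 4 by rewrite /d; field; rewrite gt_eqF.
rewrite dE ler_norml in ht.
have -> : 2 * pi * Q.2.+1%:R / 2 ^+ N = tau + pi * e :> R.
  by rewrite /tau /e -!(natr1 Q.2); field; rewrite expf_neq0.
have -> : 2 * pi * Q.2%:R / 2 ^+ N = tau - pi * e :> R by rewrite /tau; ring.
have pe : e / 4 < pi * e by rewrite [pi * e]mulrC ltr_pM2l //; have := pi_ge2 R; lra.
by case/andP: ht => h1 h2; apply/andP; split; lra.
Qed.

End geometry.

Section boxes.
Variable R : realType.
Local Notation C := R[i].
Local Notation Re := complex.Re.
Local Notation Im := complex.Im.
Local Notation area := (@area R).
Local Notation disc := (@disc R).
Implicit Types (z w a : C) (N : nat) (I : Defs.arc R).

(** Cells and boxes are images in polar coordinates and match their explicit descriptions only off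
    the origin; one point cannot spoil measurability. *)
Lemma measurable_off0 (X Y : set C) : measurable Y -> (forall w, w != 0 -> X w <-> Y w) -> measurable X.
Proof.
move=> mY XY; rewrite (_ : X = (Y `\` [set 0]) `|` (X `&` [set 0])).
  apply: measurableU; first by apply: measurableD => //; exact: measurable_set1C.
  have [X0|X0] := pselect (X 0).
    rewrite (_ : _ `&` _ = [set 0]); first exact: measurable_set1C.
    by apply/seteqP; split => w /=; [case|move=> ->].
  rewrite (_ : _ `&` _ = set0) //.
  by apply/seteqP; split => w //= [Xw w0]; apply: X0; rewrite -w0.
apply/seteqP; split => w /=.
  move=> Xw; have [e|w0] := eqVneq w 0; last by left; split; [exact/XY|exact/eqP].
  by right; rewrite -e.
by move=> [[Yw /eqP w0]|[]] //; apply/XY.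
Qed.

Lemma measurable_cell N (Q : cell_index N) : measurable (cell Q : set C).
Proof. by apply: (measurable_off0 (measurable_cell_ Q)) => w; exact: cellE. Qed.

(** The arc is rotated to start at angle 0. The last alternative is the full arc closed on the
    right, whose final endpoint [2 pi] is not a value of [theta]; it then covers every direction. *)
Definition box_ I : set C :=
  [set w | 1 - arc_len I <= normc w < 1 /\
    (theta (w * cis (- arc_start I)) \in
       Interval (BSide (arc_closed_left I) 0) (BSide (~~ arc_closed_right I) (2 * pi * arc_len I))
     \/ arc_len I = 1 /\ arc_closed_right I)].

Lemma boxE I w : w != 0 -> carleson_box I w <-> box_ I w.
Proof.
case: I => al l cl cr lb; have /andP[l0 l1] := lb; rewrite /carleson_box /box_ /arc_set /= => w0.
have p0 := @pi_gt0 R; have nw : 0 < normc w by rewrite normc_gt0.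
split=> [[r [t [wE [s sI cs] h1 h2]]]|[h alt]].
  have r0 : 0 <= r by rewrite (le_trans _ h1) // subr_ge0.
  have nr : normc w = r by rewrite wE normr_line normc_cis mulr1 ger0_norm.
  split; first by rewrite nr h1.
  have wE2 : w * cis (- al) = r%:C%C * cis (s - al) by rewrite wE -cs -mulrA -cisD.
  have [sl|sg] := ltP (s - al) (2 * pi).
    left; rewrite wE2 theta_cis -?nr //.
      by move: sI sl; clear; case: (cl); case: (cr); rewrite /= !in_itv /= => /andP[? ?] ?; apply/andP; split; lra.
    by rewrite sl andbT; move: sI {cs}; case: (cl); rewrite in_itv /= => /andP[? _]; lra.
  right; have pl : 2 * pi * l <= 2 * pi by rewrite ler_piMr // mulr_ge0 // ltW.
  have l1' : l = 1 \/ 2 * pi * l < 2 * pi.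
    by have [->|ln] := eqVneq l 1; [left|right; rewrite gtr_pMr ?mulr_gt0 // lt_neqAle ln].
  by case: l1' => [->|pl'] ; split => //; move: sI {cs}; case: (cr) => //; rewrite in_itv /= => /andP[? ?]; exfalso; lra.
have wE : w = (normc w)%:C%C * cis (theta (w * cis (- al)) + al).
  have E := polar (w * cis (- al)); rewrite normcM normc_cis mulr1 in E.
  by rewrite cisD mulrA -E -mulrA -cisD addNr cis0 mulr1.
have /andP[t0 t1] := theta_bounds (w * cis (- al)).
move: (theta _) wE alt t0 t1 => x wE alt x0 x1; case/andP: h => h1 h2.
exists (normc w), (x + al); split => //.
case: alt => [xI|[E ->]].
  exists (x + al) => //; move: xI; clear; case: (cl); case: (cr); rewrite /= !in_itv /= => /andP[? ?]; apply/andP; split; lra.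
have [xp|xn] := ltP 0 x.
  exists (x + al) => //; rewrite E; move: xp x1; clear; case: (cl); rewrite /= !in_itv /= => ? ?; apply/andP; split; lra.
exists (al + 2 * pi); last by rewrite cisD cis2pi mulr1 (_ : x + al = al) //; lra.
rewrite E; move: p0; clear; case: (cl); rewrite /= !in_itv /= => ?; apply/andP; split; lra.
Qed.

Lemma measurable_box I : measurable (carleson_box I).
Proof.
apply: (@measurable_off0 _ (box_ I)) => [|w]; last exact: boxE.
have m1 : measurable_fun setT (fun w : C => normc w) by apply: measurable_normc; exact: measurable_id.
have m2 : measurable_fun setT (fun w : C => theta (w * cis (- arc_start I))).
  by apply: (measurableT_comp (@measurable_theta R)); apply: measurable_funMC; [exact: measurable_id|exact: measurable_cst].
have H1 := m1 measurableT [set` `[(1 - arc_len I)%R : R, 1%R : R[] (measurable_itv _).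
have H2 := m2 measurableT [set` Interval (BSide (arc_closed_left I) 0) (BSide (~~ arc_closed_right I) (2 * pi * arc_len I))] (measurable_itv _).
rewrite !setTI in H1 H2; apply: measurableI => //.
have [h|h] := pselect (arc_len I = 1 /\ arc_closed_right I).
  rewrite (_ : (fun w => _) = setT) //; apply/seteqP; split => // w _; by right.
move: H2; congr measurable; apply/seteqP; split => w /=; first by left.
by case.
Qed.

Lemma box_disc I : carleson_box I `<=` disc.
Proof.
move=> w [r [t [-> _ h1 h2]]]; rewrite /Defs.disc /mkset normr_line normc_cis mulr1 ger0_norm //.
by rewrite (le_trans _ h1) // subr_ge0; case/andP: (arc_len_bounds I).
Qed.

Lemma full_arc_bounds : 0 < (1 : R) <= 1. Proof. by rewrite ltr01 lexx. Qed.

Definition full_arc : Defs.arc R := Arc 0 true true full_arc_bounds.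

Lemma full_box : carleson_box full_arc = disc.
Proof.
apply/seteqP; split; first exact: box_disc.
move=> w w1; exists (normc w), (theta w); split => //; first exact: polar; last first.
  by rewrite subrr normc_ge0.
have /andP[h1 h2] := theta_bounds w; exists (theta w) => //.
by rewrite /= in_itv /= h1 add0r mulr1 ltW.
Qed.

(** By [sector] points of the ball deviate by an angle of at most [2 l], and the arc of normalized
    length [l] centred at [zeta] has half-opening [pi l >= 2 l]. *)
Lemma ball_box (zeta : C) (l : R) : normc zeta = 1 -> 0 < l <= 2^-1 ->
  exists I, arc_len I = l /\ disc `&` cball zeta l `<=` carleson_box I.
Proof.
move=> z1 /andP[l0 l2]; have lb : 0 < l <= 1 by rewrite l0 /=; lra.
have p2 := @pi_ge2 R.
exists (Arc (theta zeta - pi * l) true true lb); split => // w [wd wl].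
have zE : zeta = 1%:C%C * cis (theta zeta) by rewrite -z1 -polar.
have := @sector R 1 (theta zeta) l w ltr01; rewrite -zE divr1 mul1r => /(_ l2 wl) [t [ht wE]].
exists (normc w), t; split => //=.
  exists t => //; rewrite /= in_itv /=.
  have := ler_wpM2r (ltW l0) p2; move: ht; rewrite ler_norml => /andP[? ?] ?; apply/andP; split; lra.
by have := normc_sub_ge zeta w; rewrite z1 normcBC; move: wl; rewrite /cball /=; lra.
Qed.

(** [a] sits above the midpoint of the arc at height [l], the length of the arc. Then
    [|1 - z conj a| <= 10 l] on the box, and [100 <= 2 ^ 7]. *)
Lemma box_mobius I : exists a, disc a /\ forall z, carleson_box I z ->
  (1 - normc z) / arc_len I <= 2 ^+ 7 * (1 - normc (mobius a z) ^+ 2).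
Proof.
case: I => al l cl cr lb; have /andP[l0 l1] := lb; rewrite /=; have p0 := @pi_gt0 R; have p4 : pi <= 4 :> R by have [/andP[_ h] _] := pihalf_02_cos_pihalf R; lra.
pose a : C := (1 - l)%:C%C * cis (al + pi * l).
have na : normc a = 1 - l by rewrite normr_line normc_cis mulr1 ger0_norm // subr_ge0.
have a1 : disc a by rewrite /Defs.disc /mkset na; lra.
exists a; split => // z zB; have z1 := box_disc zB.
have [r [t [zE [s sI cs] h1 h2]]] := zB; rewrite /= in sI h1.
have r0 : 0 <= r by rewrite (le_trans _ h1) // subr_ge0.
have nz : normc z = r by rewrite zE normr_line normc_cis mulr1 ger0_norm.
have sm : `|s - (al + pi * l)| <= pi * l.
  move: sI; clear; case: (cl); case: (cr); rewrite /= !in_itv /= ler_norml => /andP[? ?]; apply/andP; split; lra.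
have k0 := kernel_gt0 z1 a1.
have kl : normc (1 - z * a^*%C) <= 10 * l.
  have -> : 1 - z * a^*%C = (1 - r * (1 - l))%:C%C - (r * (1 - l))%:C%C * (cis (s - (al + pi * l)) - cis 0).
    rewrite zE -cs /a conjM conjR cisJ cisD cis0 rmorphB rmorph1 realcM; ring.
  apply: (le_trans (normcB _ _)); rewrite normr_line normcR.
  have rl : 0 <= r * (1 - l) <= 1.
    by rewrite mulr_ge0 ?subr_ge0 //= mulr_ile1 ?subr_ge0 ?(ltW h2) // lerBlDr lerDl ltW.
  case/andP: rl => rl0 rl1; rewrite !ger0_norm // ?subr_ge0 //.
  have cl1 := chord_le (s - (al + pi * l)) 0; rewrite subr0 in cl1.
  have pl : pi * l <= 4 * l by rewrite ler_pM2r.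
  have : r * (1 - l) * normc (cis (s - (al + pi * l)) - cis 0) <= normc (cis (s - (al + pi * l)) - cis 0).
    by rewrite ler_piMl ?normc_ge0.
  have : (1 - l) * (1 - l) <= r * (1 - l) by rewrite ler_wpM2r // subr_ge0.
  have : 0 <= l * l by rewrite mulr_ge0 // ltW.
  lra.
rewrite mobius_sqr // na nz ler_pdivrMr //; move: k0 kl; set k := normc _ => k0 kl.
have -> : 2 ^+ 7 * ((1 - (1 - l) ^+ 2) * (1 - r ^+ 2) / k ^+ 2) * l =
    2 ^+ 7 * ((1 - (1 - l) ^+ 2) * (1 - r ^+ 2) * l) / k ^+ 2 by ring.
rewrite ler_pdivlMr ?exprn_gt0 //.
have k2 : k ^+ 2 <= 100 * l ^+ 2.
  rewrite (_ : 100 * l ^+ 2 = (10 * l) ^+ 2); last by rewrite exprMn; congr (_ * _); ring.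
  by rewrite ler_pXn2r ?nnegrE ?(ltW k0) // mulr_ge0 // ltW.
apply: (@le_trans _ _ ((1 - r) * (100 * l ^+ 2))); first by rewrite ler_wpM2l // subr_ge0 ltW.
have -> : 2 ^+ 7 = 128 :> R by rewrite -natrX.
have -> : 1 - (1 - l) ^+ 2 = l * (2 - l) by ring.
have -> : 1 - r ^+ 2 = (1 - r) * (1 + r) by ring.
have X : 0 <= (1 - r) * l ^+ 2 by rewrite mulr_ge0 ?sqr_ge0 // subr_ge0 ltW.
have Y : 1 <= (2 - l) * (1 + r) by nra.
have := ler_wpM2l X Y; rewrite mulr1; nra.
Qed.

Lemma measurable_sumC d (T : measurableType d) (D : set T) (J : Type) (s : seq J) (f : J -> T -> C) :
  (forall j, measurable_fun D (f j)) -> measurable_fun D (fun x => \sum_(j <- s) f j x).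
Proof.
move=> mf; elim: s => [|j s IH].
  by rewrite (_ : (fun x => _) = cst 0); [exact: measurable_cst|apply/funext => x; rewrite big_nil].
rewrite (_ : (fun x => _) = fun x => f j x + \sum_(i <- s) f i x); first exact: measurable_funDC.
by apply/funext => x; rewrite big_cons.
Qed.

Lemma measurable_QK_density (K : R -> R) CK p phi a f : admissible K CK p phi -> analytic f -> disc a ->
  measurable_fun disc (QK_density K f a).
Proof.
move=> KP fa a1; apply: measurable_funM; last exact: (measurable_mobius_weight KP a1).
apply: measurable_funX; apply: measurable_normc; apply: analytic_measurable; exact: analytic_derive1.
Qed.

Section step.
Variable N : nat.
Implicit Type (c : cell_index N -> C) (Q : cell_index N).

Definition step c w : C := \sum_Q c Q * (\1_(cell_ Q) w)%:C%C.

Lemma stepE c Q w : cell_ Q w -> step c w = c Q.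
Proof.
move=> Qw; rewrite /step (bigD1 Q) //= indicE mem_set // mulr1 big1 ?addr0 // => Q' Q'Q.
rewrite indicE memNset ?mulr0 // => Q'w; by move/eqP: Q'Q; apply; exact: cell_unique Q'w Qw.
Qed.

Lemma measurable_step c : measurable_fun setT (step c).
Proof.
apply: measurable_sumC => Q; apply: measurable_funMC; first exact: measurable_cst.
apply: measurable_funR; apply: measurable_indic; exact: measurable_cell_.
Qed.

Lemma normc_step c w : disc w ->
  normc (step c w) ^+ 2 = \sum_Q normc (c Q) ^+ 2 * \1_(cell_ Q) w.
Proof.
move=> /(cell_exists N)[Q Qw]; rewrite (stepE c Qw) (bigD1 Q) //= indicE mem_set // mulr1 big1 ?addr0 // => Q' Q'Q.
rewrite indicE memNset ?mulr0 // => Q'w; by move/eqP: Q'Q; apply; exact: cell_unique Q'w Qw.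
Qed.

Section weighted.
Variables (K : R -> R) (CK : R) (p : nat) (phi : nat -> R).
Hypothesis KP : admissible K CK p phi.

Lemma box_wt_le I w : carleson_box I w -> wt K (arc_len I) w <= K 1.
Proof.
move=> wB; have wd := box_disc wB; have /andP[l0 _] := arc_len_bounds I.
have [r [t [wE _ h1 h2]]] := wB.
have r0 : 0 <= r by rewrite (le_trans _ h1) // subr_ge0; case/andP: (arc_len_bounds I).
have nw : normc w = r by rewrite wE normr_line normc_cis mulr1 ger0_norm.
apply: (adm_mono KP); first by rewrite divr_ge0 ?defect_ge0 // ltW.
rewrite ler_pdivrMr // mul1r defectE // nw; lra.
Qed.

(** [cell] is traded for the indicator of [cell_] at the cost of the origin, a null set. The bound
    by [K 1] gives the finiteness that undoes [fine]. *)
Lemma cell_massE I Q :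
  (cell_mass K I Q)%:E = (\int[area]_(w in carleson_box I) (\1_(cell_ Q) w * wt K (arc_len I) w)%:E)%E.
Proof.
have /andP[l0 _] := arc_len_bounds I; have mB := measurable_box I.
have mw := measurable_wt KP l0.
have mcB : measurable (cell Q `&` carleson_box I) by apply: measurableI => //; exact: measurable_cell.
have mcB' : measurable (cell_ Q `&` carleson_box I) by apply: measurableI => //; exact: measurable_cell_.
have mwE D : measurable_fun D (fun w => (wt K (arc_len I) w)%:E).
  by apply/measurable_EFinP; exact: measurable_funTS mw.
have E : (\int[area]_(z in cell Q `&` carleson_box I) (K ((1 - normc z) / arc_len I))%:E =
    \int[area]_(w in carleson_box I) (\1_(cell_ Q) w * wt K (arc_len I) w)%:E)%E.
  transitivity (\int[area]_(z in cell Q `&` carleson_box I) (wt K (arc_len I) z)%:E)%E.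
    apply: eq_integral => w; rewrite inE => -[_ wB]; rewrite /wt defectE //; exact: box_disc wB.
  rewrite (@ge0_negligible_integral _ _ _ area _ [set 0]) //; last first.
  - exact: area_set1.
  - by move=> w _; rewrite lee_fin; exact: (wt_ge0 KP).
  - exact: measurable_set1C.
  transitivity (\int[area]_(z in (cell_ Q `&` carleson_box I) `\` [set 0%R]) (wt K (arc_len I) z)%:E)%E.
    congr (integral _ _ _); apply/seteqP; split => w [[h1 h2] w0]; split => //; split => //.
      by apply/(cellE _ _) => //; exact/eqP.
    by apply/(cellE _ _) => //; exact/eqP.
  rewrite -(@ge0_negligible_integral _ _ _ area _ [set 0]) //; last 3 first.
  - exact: measurable_set1C.
  - by move=> w _; rewrite lee_fin; exact: (wt_ge0 KP).
  - exact: area_set1.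
  rewrite setIC integral_mkcondr; apply: eq_integral => w _; rewrite patchE indicE.
  by case: ifPn => h; rewrite ?(negbTE h) ?h ?mul1r ?mul0r.
rewrite /cell_mass E fineK // ge0_fin_numE; last first.
  by apply: integral_ge0 => w _; rewrite lee_fin mulr_ge0 // (wt_ge0 KP).
have : (\int[area]_(w in carleson_box I) (cst (K 1)%:E w) < +oo)%E.
  rewrite integral_cst //; apply: lte_mul_pinfty; rewrite ?lee_fin ?(adm_ge0 KP) //.
  by apply: le_lt_trans (@disc_lty R); apply: le_measure; rewrite ?inE //; [exact: (@measurable_disc R)|exact: box_disc].
apply: le_lt_trans; apply: ge0_le_integral => //.
- by move=> w _; rewrite lee_fin mulr_ge0 // (wt_ge0 KP).
- apply/measurable_EFinP; apply: measurable_funM; last exact: measurable_funTS mw.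
  by apply: measurable_indic; exact: measurable_cell_.
- move=> w wB; rewrite lee_fin; apply: le_trans (box_wt_le wB).
  by rewrite ler_piMl ?(wt_ge0 KP) // indicE; case: (_ \in _).
Qed.

Lemma sum_cell_mass I c : (\sum_Q normc (c Q) ^+ 2 * cell_mass K I Q)%:E =
  (\int[area]_(w in carleson_box I) (normc (step c w) ^+ 2 * wt K (arc_len I) w)%:E)%E.
Proof.
have /andP[l0 _] := arc_len_bounds I; have mB := measurable_box I.
have mw := measurable_wt KP l0.
have mi Q : measurable_fun (carleson_box I) (fun w => (\1_(cell_ Q) w * wt K (arc_len I) w)%:E).
  apply/measurable_EFinP; apply: measurable_funM; last exact: measurable_funTS mw.
  by apply: measurable_indic; exact: measurable_cell_.
have pi0 Q w : (0 <= (\1_(cell_ Q) w * wt K (arc_len I) w)%:E)%E.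
  by rewrite lee_fin mulr_ge0 // (wt_ge0 KP).
rewrite -sumEFin; transitivity (\sum_Q (\int[area]_(w in carleson_box I)
    ((normc (c Q) ^+ 2)%:E * (\1_(cell_ Q) w * wt K (arc_len I) w)%:E))%E).
  by apply: eq_bigr => Q _; rewrite EFinM cell_massE ge0_integralZl // lee_fin sqr_ge0.
rewrite -ge0_integral_sum //.
- apply: eq_integral => w; rewrite inE => wB; rewrite normc_step; last exact: box_disc wB.
  by rewrite sumEFin; rewrite mulr_suml; congr EFin; apply: eq_bigr => Q _; rewrite mulrA.
- by move=> Q; apply: emeasurable_funM => //; exact: measurable_cst.
- by move=> Q w _; rewrite mule_ge0 // lee_fin sqr_ge0.
Qed.

(** Small balls lie in a box of the same scale by [ball_box]. For [l > 1 / 2] the full arc is used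
    instead, and one doubling compares the weights at scales [l] and 1. *)
Lemma step_carleson c (A : R) :
  (forall I, \sum_Q normc (c Q) ^+ 2 * cell_mass K I Q <= A) ->
  carleson K (fun w => normc (step c w)) (CK * A).
Proof.
move=> H zeta l z1 l0; have mD := @measurable_disc R; have mb := @measurable_cball R zeta l.
have mst : measurable_fun setT (fun w => normc (step c w)) by apply: measurable_normc; exact: measurable_step.
have m k D : 0 < k -> measurable_fun D (fun w => (normc (step c w) ^+ 2 * wt K k w)%:E).
  move=> k0; apply/measurable_EFinP; apply: measurable_funM; last exact: measurable_funTS (measurable_wt KP k0).
  by apply: measurable_funX; exact: measurable_funTS mst.
have p0 k w : 0 < k -> (0 <= (normc (step c w) ^+ 2 * wt K k w)%:E)%E.
  by move=> k0; rewrite lee_fin mulr_ge0 ?sqr_ge0 // (wt_ge0 KP).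
have A0 : 0 <= A.
  rewrite -lee_fin; apply: (@le_trans _ _ (\sum_Q normc (c Q) ^+ 2 * cell_mass K full_arc Q)%:E).
    by rewrite sum_cell_mass; apply: integral_ge0 => w _; exact: p0.
  by rewrite lee_fin; exact: H.
have C1 := adm_C1 KP.
have [l2|l2] := leP l 2^-1.
  have l12 : 0 < l <= 2^-1 by rewrite l0.
  have [I [IE sub]] := ball_box z1 l12.
  apply: (@le_trans _ _ A%:E); last by rewrite lee_fin ler_peMl.
  apply: (@le_trans _ _ (\int[area]_(w in carleson_box I) (normc (step c w) ^+ 2 * wt K l w)%:E)%E).
    apply: ge0_subset_integral => //; [exact: measurableI|exact: measurable_box|exact: m|by move=> w _; exact: p0].
  by rewrite -IE -sum_cell_mass lee_fin.
apply: (@le_trans _ _ (\int[area]_(w in disc) (CK%:E * (normc (step c w) ^+ 2 * wt K 1 w)%:E))%E); last first.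
  rewrite ge0_integralZl //; [|exact: m|by move=> w _; exact: p0|by rewrite lee_fin (CK_ge0 KP)].
  rewrite EFinM lee_wpmul2l ?lee_fin ?(CK_ge0 KP) //.
  by have := sum_cell_mass full_arc c; rewrite full_box /= => <-; rewrite lee_fin.
apply: (@le_trans _ _ (\int[area]_(w in disc `&` cball zeta l) (CK%:E * (normc (step c w) ^+ 2 * wt K 1 w)%:E))%E).
  apply: ge0_le_integral => //; [exact: measurableI|by move=> w _; exact: p0|exact: m|..].
    by apply: emeasurable_funM; [exact: measurable_cst|exact: m].
  move=> w [wd wl]; rewrite -EFinM lee_fin mulrCA ler_wpM2l ?sqr_ge0 //.
  have dl := carleson_defect z1 wd wl; have d0 := defect_ge0 w.
  rewrite -[CK]expr1; apply: (weight_le_iter KP).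
  - by rewrite divr_ge0 ?(ltW l0) //= ler_pdivrMr // mul1r ltW.
  - by rewrite divr1.
  - rewrite divr1 expr1 ler_pdivrMr // mulrAC ler_peMl //; lra.
apply: ge0_subset_integral => //; [exact: measurableI|..].
  by apply: emeasurable_funM; [exact: measurable_cst|exact: m].
by move=> w _; rewrite mule_ge0 ?p0 // lee_fin (CK_ge0 KP).
Qed.

(** The exponent 7 counts the doublings in the factor [2 ^ 7] of [box_mobius]. *)
Lemma box_QK I f : analytic f -> exists a, disc a /\
  (\int[area]_(w in carleson_box I) (normc (derive1 f w) ^+ 2 * wt K (arc_len I) w)%:E <=
    (CK ^+ 7)%:E * \int[area]_(w in disc) (QK_density K f a w)%:E)%E.
Proof.
move=> fa; have [a [a1 H]] := box_mobius I; exists a; split => //.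
have /andP[l0 _] := arc_len_bounds I; have mB := measurable_box I.
have mf := analytic_measurable (analytic_derive1 fa); have mw := measurable_wt KP l0.
have C7 : 0 <= CK ^+ 7 by rewrite exprn_ge0 // (CK_ge0 KP).
have mq := measurable_QK_density KP fa a1.
have q0 w : disc w -> 0 <= QK_density K f a w.
  by move=> w1; rewrite mulr_ge0 ?sqr_ge0 // (adm_ge0 KP) //; case/andP: (mobius_bounds a1 w1).
rewrite -ge0_integralZl //; last 2 first.
- exact: (@measurable_disc R).
- exact/measurable_EFinP.
apply: (@le_trans _ _ (\int[area]_(w in carleson_box I) ((CK ^+ 7)%:E * (QK_density K f a w)%:E))%E).
  apply: ge0_le_integral => //.
  - by move=> w _; rewrite lee_fin mulr_ge0 ?sqr_ge0 // (wt_ge0 KP).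
  - apply/measurable_EFinP; apply: measurable_funM; last exact: measurable_funTS mw.
    apply: measurable_funX; apply: measurable_normc.
    by apply: measurable_funS mf; [exact: measurable_disc|exact: box_disc].
  - apply: emeasurable_funM; first exact: measurable_cst.
    by apply/measurable_EFinP; apply: measurable_funS mq; [exact: measurable_disc|exact: box_disc].
  - move=> w wB; have w1 := box_disc wB; rewrite -EFinM lee_fin mulrCA ler_wpM2l ?sqr_ge0 //.
    rewrite /wt defectE //; apply: (weight_le_iter KP); last exact: H.
      rewrite divr_ge0 ?subr_ge0 ?(ltW w1) ?(ltW l0) //= ler_pdivrMr // mul1r.
      have [r [t [wE _ h1 h2]]] := wB.
      have r0 : 0 <= r by rewrite (le_trans _ h1) // subr_ge0; case/andP: (arc_len_bounds I).
      by rewrite wE normr_line normc_cis mulr1 ger0_norm //; lra.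
    by case/andP: (mobius_bounds a1 w1).
apply: ge0_subset_integral => //; [exact: measurable_disc|..|exact: box_disc].
  by apply: emeasurable_funM; [exact: measurable_cst|exact/measurable_EFinP].
by move=> w w1; rewrite mule_ge0 ?lee_fin // q0.
Qed.

End weighted.
End step.
End boxes.

(** * The space [Q_K] *)

Section weight.
Variables (R : realType) (K : R -> R).
Hypothesis hK : weightWQ K.
Local Notation leb := (@lebesgue_measure R).
Local Notation RL := (g_sigma_algebraType R.-ocitv.-measurable).

Lemma dilation_ge0 (s : R) : 0 <= s -> (0 <= dilation K s)%E.
Proof.
move=> s0; apply: (@le_trans _ _ (K (s * 1) / K 1)%:E).
  by rewrite lee_fin divr_ge0 // (weight_ge0 hK) // mulr1.
by apply: ereal_sup_ubound; exists 1 => //; rewrite /= in_itv /= ltr01 lexx.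
Qed.

Lemma dilation_mono (s t : R) : 0 <= s -> s <= t -> (dilation K s <= dilation K t)%E.
Proof.
move=> s0 st; apply: ge_ereal_sup => x [u]; rewrite /= in_itv /= => /andP[u0 u1] <-.
apply: (@le_trans _ _ (K (t * u) / K u)%:E).
  rewrite lee_fin ler_wpM2r ?invr_ge0 ?(weight_ge0 hK) ?(ltW u0) //.
  by apply: (weight_nondecreasing hK); [rewrite mulr_ge0 // ltW|rewrite ler_pM2r].
by apply: ereal_sup_ubound; exists u => //; rewrite /= in_itv /= u0.
Qed.

Lemma dilation_le1 (s : R) : 0 <= s <= 1 -> (dilation K s <= 1)%E.
Proof.
move=> /andP[s0 s1]; apply: ge_ereal_sup => x [u]; rewrite /= in_itv /= => /andP[u0 u1] <-.
rewrite lee_fin ler_pdivrMr ?mul1r ?(weight_gt0 hK) //.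
by apply: (weight_nondecreasing hK); [rewrite mulr_ge0 // ltW|rewrite ler_piMl // ltW].
Qed.

Let dil (s : R) := fine (dilation K s).

Let dilE (s : R) : 0 <= s <= 1 -> dilation K s = (dil s)%:E.
Proof.
move=> s01; rewrite fineK // ge0_fin_numE; last by case/andP: s01 => s0 _; exact: dilation_ge0.
by apply: le_lt_trans (dilation_le1 s01) _; rewrite ltry.
Qed.

Let dil_ge0 (s : R) : 0 <= s -> 0 <= dil s.
Proof. by move=> s0; apply: fine_ge0; exact: dilation_ge0. Qed.

Let dil_mono (s t : R) : 0 <= s -> s <= t -> t <= 1 -> dil s <= dil t.
Proof.
move=> s0 st t1; rewrite -lee_fin -!dilE ?s0 ?(le_trans st) ?(le_trans s0) //; exact: dilation_mono.
Qed.

(** An uncountable supremum, measurable because it is monotone; clamping to [[0, 1]], where it is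
    finite, makes the function total. *)
Let measurable_dil : measurable_fun setT (fun s : R => dil (Num.min 1 (Num.max 0 s))).
Proof.
apply: nondecreasing_measurable => // s t st; apply: dil_mono.
- by rewrite le_min ler01 le_max lexx.
- by rewrite le_min !ge_min lexx /= ge_max !le_max lexx st !orbT.
- by rewrite ge_min lexx.
Qed.

Let mG (D : set R) : D `<=` `]0, 1[ -> measurable D -> measurable_fun D (fun s => dilation K s * (s^-1)%:E)%E.
Proof.
move=> D01 mD; apply: (eq_measurable_fun (fun s : R => (dil (Num.min 1 (Num.max 0 s)) * (Num.max 0 s)^-1)%:E)).
  move=> s; rewrite inE => /D01; rewrite /= in_itv /= => /andP[s0 s1].
  by rewrite [Num.max 0 s]max_r ?(ltW s0) // min_r ?(ltW s1) // EFinM dilE ?(ltW s0) ?(ltW s1).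
apply/measurable_EFinP; apply: measurable_funTS; apply: measurable_funM => //.
apply: measurable_funV_ge0 => [s|]; first by rewrite le_max lexx.
by apply: measurable_maxr; [exact: measurable_cst|exact: measurable_id].
Qed.

(** On [[2 ^- (n + 1), 2 ^- n[], of length [2 ^- (n + 1)], the Dini integrand is at least the
    dilation at the left end divided by [2 ^- n]. Each dyadic interval therefore pays for half a
    term of the series. *)
Lemma dilation_sum : (\sum_(n <oo) (fine (dilation K (2 ^- n)))%:E < +oo)%E.
Proof.
have e0 n : 0 < 2 ^- n :> R by rewrite invr_gt0 exprn_gt0.
have e1 n : 2 ^- n <= 1 :> R by rewrite invf_le1 ?exprn_gt0 // exprn_ege1 // ler1n.
apply: nneseries_shift => [n|]; first by apply: dil_ge0; exact: ltW.
have [sg _ [H _]] := weight_dilation hK.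
set J := (\int[_]_(s in _) _)%E in H.
pose I n : set R := [set` `[(2 ^- n)%R : R, 1%R : R[].
have sub n : I n `<=` `]0, 1[.
  by move=> s; rewrite /I /= !in_itv /= => /andP[h ->]; rewrite (lt_le_trans (e0 n)).
have mI n : measurable (I n : set RL) by exact: measurable_itv.
have G0 n s : I n s -> (0 <= dilation K s * (s^-1)%:E)%E.
  move=> /sub; rewrite /= in_itv /= => /andP[s0 s1]; rewrite mule_ge0 ?lee_fin ?invr_ge0 ?(ltW s0) //.
  by apply: dilation_ge0; exact: ltW.
have step n : ((\sum_(k < n) dil (2 ^- k.+1) / 2)%:E <= \int[leb]_(s in I n) (dilation K s * (s^-1)%:E))%E.
  elim: n => [|n IH].
    by rewrite big_ord0; apply: integral_ge0 => s; exact: G0.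
  pose B : set R := [set` `[(2 ^- n.+1)%R : R, (2 ^- n)%R : R[].
  have en : 2 ^- n = 2 * 2 ^- n.+1 :> R by rewrite exprS invfM mulrA mulfV ?mul1r.
  have IU : I n.+1 = I n `|` B.
    have := e0 n.+1 => ?; have := e1 n => ?.
    apply/seteqP; split => s; rewrite /I /B /= !in_itv /=.
      by move=> /andP[h1 h2]; have [h|h] := leP (2 ^- n) s; [left|right]; apply/andP.
    by case=> /andP[h1 h2]; apply/andP; split; lra.
  have mB : measurable (B : set RL) by exact: measurable_itv.
  rewrite IU ge0_integral_setU //; last 3 first.
  - rewrite -IU; exact: (@mG (I n.+1) (@sub _) (mI _)).
  - by move=> s; rewrite -IU; exact: G0.
  - apply/disj_setPS => s; rewrite /I /B /= !in_itv /= => -[/andP[h1 h2] /andP[h3 h4]]; by move: (le_lt_trans h1 h4); rewrite ltxx.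
  rewrite big_ord_recr /= EFinD; apply: leeD => //.
  have sB : B `<=` I n.+1 by rewrite IU; right.
  apply: (@le_trans _ _ (\int[leb]_(s in B) (cst (dil (2 ^- n.+1) / 2 ^- n)%:E s))%E).
    have lB : leb B = (2 ^- n - 2 ^- n.+1)%:E.
      by rewrite /B lebesgue_measure_itv /= lte_fin en ltr_pMl // ltr1n.
    rewrite integral_cst // [X in (_ * X)%E](_ : _ = (2 ^- n - 2 ^- n.+1)%:E) // en -EFinM lee_fin.
    have := e0 n.+1; set x := 2 ^- n.+1 => x0; rewrite le_eqVlt; apply/orP; left; apply/eqP.
    by field; exact: lt0r_neq0.
  apply: ge0_le_integral => //.
  - by move=> s _; rewrite lee_fin divr_ge0 ?dil_ge0 // ltW.
  - exact: (@mG B (subset_trans sB (@sub n.+1)) mB).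
  - move=> s sBs; have /sub := sB _ sBs; rewrite /= in_itv /= => /andP[s0 s1].
    move: sBs; rewrite /B /= in_itv /= => /andP[h1 h2].
    rewrite dilE ?(ltW s0) ?(ltW s1) // -EFinM lee_fin; apply: ler_pM.
    + by rewrite dil_ge0 // ltW.
    + by rewrite invr_ge0 ltW.
    + by apply: dil_mono => //; exact: ltW.
    + by rewrite lef_pV2 ?posrE // ltW.
have J0 : (0 <= J)%E.
  by apply: integral_ge0 => s; rewrite /= in_itv /= => /andP[s0 s1]; rewrite mule_ge0 ?dilation_ge0 ?lee_fin ?invr_ge0 // ltW.
have JE : J = (fine J)%:E by rewrite fineK // ge0_fin_numE.
apply: (@le_lt_trans _ _ (2 * fine J)%:E); last by rewrite ltry.
apply: lime_le; first by apply: is_cvg_nneseries => n _ _; rewrite lee_fin dil_ge0 // ltW.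
apply: nearW => n; rewrite big_mkord sumEFin lee_fin -ler_pdivrMl // mulrC mulr_suml.
rewrite -lee_fin -JE; apply: (le_trans (step n)).
apply: ge0_subset_integral => //; first exact: (@mG _ (@subset_refl _ _) (measurable_itv _)).
by move=> s; rewrite /= in_itv /= => /andP[s0 s1]; rewrite mule_ge0 ?dilation_ge0 ?lee_fin ?invr_ge0 // ltW.
Qed.

(** [phi n] is the dilation at [2 ^- n]. Adding 3 to the exponent keeps [CK <= 2 ^ p] and forces
    [p > 2], so that the one condition [p <= b] also gives the smoothness requirement [2 <= b]. *)
Lemma weight_admissible : exists CK p phi, (2 < p)%N /\ admissible K CK p phi.
Proof.
have [CK C1 dbl] := weight_doubling hK.
have [p pC] : exists p : nat, CK <= 2 ^+ p.
  exists (Num.trunc CK).+1; rewrite ltW // (lt_trans (truncnS_gt _)) // -natrX ltr_nat ltn_expl //.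
exists CK, (p + 3)%N, (fun n => fine (dilation K (2 ^- n))); split; first by rewrite addn3.
split => //.
- exact: weight_ge0.
- exact: weight_nondecreasing.
- exact: weight_gt0.
- by apply: (le_trans pC); rewrite ler_weXn2l ?ler1n // leq_addr.
- by rewrite addn3.
- move=> n t /andP[t0 t1]; rewrite -ler_pdivrMr ?(weight_gt0 hK) //.
  have e0 : 0 < 2 ^- n :> R by rewrite invr_gt0 exprn_gt0.
  have e1 : 2 ^- n <= 1 :> R by rewrite invf_le1 ?exprn_gt0 // exprn_ege1 // ler1n.
  rewrite -lee_fin -[leRHS]dilE ?(ltW e0) //; apply: ereal_sup_ubound; exists t => //.
  by rewrite /= in_itv /= t0.
- exact: dilation_sum.
Qed.

End weight.

Section seminorm.
Variables (R : realType) (K : R -> R).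
Local Notation C := R[i].
Local Notation area := (@area R).
Local Notation disc := (@disc R).
Implicit Types (f g : C -> C) (a z : C).

Lemma QK_seminorm_le f (s : R) : 0 <= s ->
  (forall a, disc a -> (\int[area]_(z in disc) (QK_density K f a z)%:E <= (s ^+ 2)%:E)%E) ->
  (QK_seminorm K f <= s%:E)%E.
Proof.
move=> s0 H; have -> : s%:E = sqrte (s%:E ^+ 2)%E by rewrite sqrte_sqr gee0_abs.
rewrite lee_sqrt ?sqre_ge0 // -EFin_expe; apply: ge_ereal_sup => x [a a1 <-]; exact: H.
Qed.

Lemma QK_seminorm_ge f (s : R) : (forall a z, disc a -> disc z -> 0 <= QK_density K f a z) ->
  (QK_seminorm K f <= s%:E)%E ->
  forall a, disc a -> (\int[area]_(z in disc) (QK_density K f a z)%:E <= (s ^+ 2)%:E)%E.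
Proof.
move=> q0; rewrite /QK_seminorm; set X := ereal_sup _ => H a a1.
have aX : (\int[area]_(z in disc) (QK_density K f a z)%:E <= X)%E by apply: ereal_sup_ubound; exists a.
have X0 : (0 <= X)%E.
  by apply: le_trans aX; apply: integral_ge0 => z z1; rewrite lee_fin q0.
apply: (le_trans aX); rewrite -[X]sqr_sqrte // EFin_expe.
have s0 : (0 <= s%:E)%E by apply: le_trans H; exact: sqrte_ge0.
by rewrite !expe2; apply: lee_pmul => //; exact: sqrte_ge0.
Qed.

Lemma in_QK_norm f : in_QK K f -> exists2 s : R, 0 <= s &
  QK_seminorm K f = s%:E /\ QK_norm K f = (normc (f 0) + s)%:E.
Proof.
move=> [_]; rewrite /QK_norm; have := sqrte_ge0 (ereal_sup
    [set (\int[area]_(z in disc) (QK_density K f a z)%:E)%E | a in disc]).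
rewrite -/(QK_seminorm K f); case: (QK_seminorm K f) => [s| |] //= s0 _.
by exists s.
Qed.

Lemma in_QKP f (s : R) : analytic f -> (QK_seminorm K f <= s%:E)%E -> in_QK K f.
Proof.
move=> fa H; split => //; rewrite /QK_norm.
by apply: (@le_lt_trans _ _ ((normc (f 0))%:E + s%:E)%E); [rewrite leeD2l|rewrite ltry].
Qed.

End seminorm.

Section QK.
Variable R : realType.
Local Notation C := R[i].
Local Notation Re := complex.Re.
Local Notation Im := complex.Im.
Local Notation area := (@area R).
Local Notation disc := (@disc R).
Variables (K : R -> R) (CK : R) (p : nat) (phi : nat -> R) (b : R).
Hypothesis KP : admissible K CK p phi.
Hypothesis b2 : 2 <= b.
Hypothesis pb : p%:R <= b.
Implicit Types (f g : C -> C) (a z w : C).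

Let b0 : 0 <= b. Proof. exact: le_trans b2. Qed.

Lemma QK_density_ge0 f a z : disc a -> disc z -> 0 <= QK_density K f a z.
Proof.
by move=> a1 z1; rewrite mulr_ge0 ?sqr_ge0 // (adm_ge0 KP) //; case/andP: (mobius_bounds a1 z1).
Qed.

Let rho w : R := 1 - normc w ^+ 2.

Let rho01 w : disc w -> 0 < rho w <= 1.
Proof. by move=> w1; rewrite subr_gt0 expr_lt1 ?normc_ge0 // w1 lerBlDr lerDl sqr_ge0. Qed.

Lemma measurable_rho_pow : measurable_fun disc (fun w => rho w `^ b).
Proof.
apply: (@measurableT_comp _ _ _ _ _ _ (fun x : R => x `^ b)); first exact: measurable_powR.
apply: measurable_funTS; apply: measurable_funB; first exact: measurable_cst.
by apply: measurable_funX; apply: measurable_normc; exact: measurable_id.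
Qed.

Lemma area_disc_le2 : (area disc <= 2%:E)%E.
Proof.
have := @le_area_cball R 0 1 ler01; rewrite (_ : cball 0 1 = @Defs.disc R) ?expr1n ?mulr1 //.
by apply/seteqP; split => w; rewrite /Defs.disc /cball /= subr0.
Qed.

(** At [a = 0] the density is [|f'| ^ 2 K(1 - |w| ^ 2)]. Use [|f'| <= |f'| ^ 2 + 1], then
    [rho ^ b <= rho ^ p], which [weight_power] bounds by a multiple of [K rho]; the summand 2 bounds
    the area of the disc. *)
Lemma weighted_L1_bound f (M : R) : analytic f ->
  (\int[area]_(z in disc) (QK_density K f 0 z)%:E <= M%:E)%E ->
  (\int[area]_(w in disc) (normc (derive1 f w) * rho w `^ b)%:E <= (CK / K 1 * M + 2)%:E)%E.
Proof.
move=> fa H; have k1 := adm_gt0 KP ltr01; have c0 := CK_ge0 KP; have mD := @measurable_disc R.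
have c1 : 0 <= CK / K 1 by rewrite divr_ge0 // ltW.
have d0 : disc 0 by rewrite /Defs.disc /mkset normc0.
have mq := measurable_QK_density KP fa d0.
have q0 z : disc z -> 0 <= QK_density K f 0 z by exact: QK_density_ge0.
have mf : measurable_fun disc (fun w => normc (derive1 f w)).
  by apply: measurable_normc; apply: analytic_measurable; exact: analytic_derive1.
apply: (@le_trans _ _ (\int[area]_(w in disc) ((CK / K 1)%:E * (QK_density K f 0 w)%:E + 1))%E).
  apply: ge0_le_integral => //.
  - by move=> w _; rewrite lee_fin mulr_ge0 ?normc_ge0 ?powR_ge0.
  - by apply/measurable_EFinP; apply: measurable_funM => //; exact: measurable_rho_pow.
  - by apply: emeasurable_funD => //; apply: measurable_funeM; exact/measurable_EFinP.
  move=> w w1; rewrite -EFinM -[1%E]/(1%R%:E) -EFinD lee_fin.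
  have /andP[r0 r1] := rho01 w1.
  have KE : K (1 - normc (mobius 0 w) ^+ 2) = K (rho w).
    by rewrite mobius_sqr // normc0 expr0n subr0 mul1r conjc0 mulr0 subr0 normc1 expr1n divr1.
  have kw : rho w `^ b <= CK / K 1 * K (rho w).
    apply: (@le_trans _ _ (rho w ^+ p)).
      by rewrite -powR_mulrn ?(ltW r0) //; apply: ger_powR => //; rewrite r0.
    have := weight_power KP r0 r1 (lexx 1); rewrite expr1n mulr1 mulrAC ler_pdivlMr //.
  have rb : rho w `^ b <= 1.
    have E1 : 1 `^ b = 1 :> R by rewrite powR1.
    by apply: (@le_trans _ _ (1 `^ b)); [apply: ge0_ler_powR; rewrite ?nnegrE // ltW|rewrite E1].
  rewrite /QK_density KE; set F := normc _; have F0 : 0 <= F by exact: normc_ge0.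
  have P0 : 0 <= rho w `^ b by exact: powR_ge0.
  have h1 : F * rho w `^ b <= F ^+ 2 * rho w `^ b + rho w `^ b.
    have -> : F ^+ 2 * rho w `^ b + rho w `^ b = (F ^+ 2 + 1) * rho w `^ b by ring.
    by apply: ler_wpM2r => //; nra.
  apply: (le_trans h1); apply: lerD => //.
  by rewrite mulrCA ler_wpM2l ?sqr_ge0.
rewrite ge0_integralD //; last 2 first.
- by move=> w w1; rewrite mule_ge0 ?lee_fin // q0.
- by apply: measurable_funeM; exact/measurable_EFinP.
rewrite EFinD; apply: leeD; last first.
  apply: le_trans area_disc_le2; rewrite -[X in (_ <= X)%E]mul1e -(integral_cst area mD 1%E) //.
apply: (@le_trans _ _ ((CK / K 1)%:E * M%:E)%E); last by rewrite -EFinM.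
rewrite ge0_integralZl //; last exact/measurable_EFinP.
by apply: lee_wpmul2l; rewrite ?lee_fin.
Qed.

Lemma weighted_L1 f (M : R) : analytic f ->
  (\int[area]_(z in disc) (QK_density K f 0 z)%:E <= M%:E)%E ->
  area.-integrable disc (fun w => (normc (derive1 f w) * rho w `^ b)%:E).
Proof.
move=> fa H; apply/integrableP; split.
  apply/measurable_EFinP; apply: measurable_funM; last exact: measurable_rho_pow.
  by apply: measurable_normc; apply: analytic_measurable; exact: analytic_derive1.
apply: le_lt_trans (ltry (CK / K 1 * M + 2)); apply: le_trans (weighted_L1_bound fa H).
apply: ge0_le_integral => //; first exact: (@measurable_disc R).
- apply/measurable_EFinP; apply: measurableT_comp => //; apply: measurable_funM; last exact: measurable_rho_pow.
  by apply: measurable_normc; apply: analytic_measurable; exact: analytic_derive1.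
- apply/measurable_EFinP; apply: measurable_funM; last exact: measurable_rho_pow.
  by apply: measurable_normc; apply: analytic_measurable; exact: analytic_derive1.
- by move=> w _; rewrite lee_fin ger0_norm // mulr_ge0 ?normc_ge0 ?powR_ge0.
Qed.

Lemma cintegrable_weighted f (M : R) : analytic f ->
  (\int[area]_(z in disc) (QK_density K f 0 z)%:E <= M%:E)%E ->
  cintegrable area disc (fun w => derive1 f w * cutoff 1 b w).
Proof.
move=> fa H; have d0 : disc 0 by rewrite /Defs.disc /mkset normc0.
exact: (reproducing b2 (analytic_derive1 fa) d0 (weighted_L1 fa H)).1.
Qed.

(** The potential representation with the pointwise bound on [Lkernel]. The estimate is affine in
    the squared seminorm instead of linear in the norm; geometric growth arguments do not see the
    difference. *)
Lemma point_evaluation z : disc z -> exists2 Cz : R, 0 <= Cz & forall f (M : R), analytic f ->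
  (\int[area]_(z in disc) (QK_density K f 0 z)%:E <= M%:E)%E ->
  normc (f z - f 0) <= Cz * (CK / K 1 * M + 2).
Proof.
move=> z1; have x0 : 0 < 1 - normc z by rewrite subr_gt0.
have mD := @measurable_disc R.
pose c : R := 2 * (2 * ((1 - normc z) `^ (b + 2))^-1).
have c0 : 0 <= c by rewrite !mulr_ge0 // invr_ge0 powR_ge0.
have m0 : 0 < normc (bergman_mass b : C) by rewrite normc_gt0 bergman_mass_neq0.
exists (c / normc (bergman_mass b : C)); first by rewrite divr_ge0 // ltW.
move=> f M fa H; have E := analytic_potential b2 fa z1 (weighted_L1 fa H).
have ci := cintegrable_weighted fa H.
have mL := measurable_Lkernel b0 z1.
have bd w : disc w -> normc (derive1 f w * cutoff 1 b w * Lkernel b z w) <=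
    2 * ((1 - normc z) `^ (b + 2))^-1 * (normc (derive1 f w) * rho w `^ b).
  move=> w1; rewrite !normcM mulrC cutoffE // normcR ger0_norm ?powR_ge0 //.
  rewrite ler_wpM2r ?mulr_ge0 ?normc_ge0 ?powR_ge0 //; exact: normc_Lkernel_le.
have mh : measurable_fun disc (fun w => derive1 f w * cutoff 1 b w * Lkernel b z w).
  by apply: measurable_funMC => //; exact: cintegrable_measurable ci.
have ig := weighted_L1 fa H.
have cL : cintegrable area disc (fun w => derive1 f w * cutoff 1 b w * Lkernel b z w).
  apply: (@cintegrableW _ _ _ _ _ _ (fun w => 2 * ((1 - normc z) `^ (b + 2))^-1 * (normc (derive1 f w) * rho w `^ b))) => //.
  exact: (integrableZl mD (2 * ((1 - normc z) `^ (b + 2))^-1) ig).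
rewrite mulrAC ler_pdivlMr // mulrC -normcM -E -lee_fin.
apply: (le_trans (cintegral_le mD cL)).
apply: (@le_trans _ _ (2%:E * ((2 * ((1 - normc z) `^ (b + 2))^-1)%:E * (CK / K 1 * M + 2)%:E))%E); last first.
  by rewrite -!EFinM lee_fin /c !mulrA.
apply: lee_wpmul2l => //.
apply: le_trans (lee_wpmul2l _ (weighted_L1_bound fa H)); last by rewrite lee_fin mulr_ge0 // invr_ge0 powR_ge0.
have mf : measurable_fun disc (fun w => normc (derive1 f w) * rho w `^ b).
  apply: measurable_funM; last exact: measurable_rho_pow.
  by apply: measurable_normc; apply: analytic_measurable; exact: analytic_derive1.
rewrite -ge0_integralZl //; last 3 first.
- exact/measurable_EFinP.
- by move=> w _; rewrite lee_fin mulr_ge0 ?normc_ge0 ?powR_ge0.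
- by rewrite lee_fin mulr_ge0 // invr_ge0 powR_ge0.
apply: ge0_le_integral => //.
- by move=> w _; rewrite lee_fin normc_ge0.
- by apply/measurable_EFinP; apply: measurable_normc.
- by apply: measurable_funeM; exact/measurable_EFinP.
Qed.

(** [1 - |w| ^ 2] is at most twice the defect, whence the power of 2; the defect over
    [|1 - z conj w|] is at most 1, so its exponent may drop from [b] to [p]. *)
Lemma kernel_weight_le z w : disc z -> disc w ->
  rho w `^ b / normc (1 - z * w^*%C) `^ (b + 2) <= 2 `^ b * kern p z w.
Proof.
move=> z1 w1; have k0 := kernel_gt0 z1 w1; have [_ dk] := kernel_ge_defect z1 w1.
have d0 := defect_gt0 w1; rewrite /kern; set k := normc _ in k0 dk *; set d := defect w in d0 dk *.
have rd : rho w <= 2 * d.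
  have E : d = 1 - normc w by rewrite /d defectE.
  have := normc_ge0 w; rewrite /rho E; have := ltW w1; rewrite -/(normc w); nra.
have /andP[r0 _] := rho01 w1.
rewrite powRD; last by rewrite (gt_eqF k0) implybT.
have kp : k `^ 2 = k ^+ 2 by rewrite powR_mulrn // ltW.
rewrite kp; have -> : rho w `^ b / (k `^ b * k ^+ 2) = rho w `^ b / k `^ b * (k ^+ 2)^-1 by rewrite invfM mulrA.
have -> : 2 `^ b * (d ^+ p / k ^+ (p + 2)) = 2 `^ b * (d ^+ p / k ^+ p) * (k ^+ 2)^-1.
  by rewrite exprD invfM !mulrA.
apply: ler_wpM2r; first by rewrite invr_ge0 exprn_ge0 // ltW.
apply: (@le_trans _ _ ((2 * d) `^ b / k `^ b)).
  by apply: ler_wpM2r; [rewrite invr_ge0 powR_ge0|rewrite ge0_ler_powR // nnegrE ?mulr_ge0 // ltW].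
rewrite powRM ?(ltW d0) // -!mulrA; apply: ler_wpM2l; first exact: powR_ge0.
have q0 : 0 < d / k by rewrite divr_gt0.
have -> : d `^ b / k `^ b = (d / k) `^ b.
  have E : (d / k) `^ b * k `^ b = d `^ b by rewrite -powRM ?(ltW q0) ?(ltW k0) // divfK // lt0r_neq0.
  by rewrite -E mulfK // lt0r_neq0 // powR_gt0.
rewrite -expr_div_n -powR_mulrn ?(ltW q0) //; apply: ger_powR => //.
by rewrite q0 /= ler_pdivrMr // mul1r.
Qed.

Section potential.
Variable h : C -> C.
Hypothesis mh : measurable_fun setT h.
Hypothesis ih : cintegrable area disc (fun w => h w * cutoff 1 b w).

Let F := bergman_potential b (fun w => h w * cutoff 1 b w).

Lemma potential_derive z : disc z ->
  has_cderiv F z (cintegral area disc (fun w => h w * cutoff 1 b w * bker (b + 2) z w)).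
Proof. by move=> z1; exact: has_cderiv_bergman_potential. Qed.

Lemma potential_analytic : analytic F.
Proof. by move=> z z1; exact: (has_cderiv_derivable (potential_derive z1)).1. Qed.

Lemma potential_derive_le z : disc z ->
  ((normc (derive1 F z))%:E <= (2 * 2 `^ b)%:E * \int[area]_(w in disc) (normc (h w) * kern p z w)%:E)%E.
Proof.
move=> z1; rewrite (has_cderiv_derivable (potential_derive z1)).2; have mD := @measurable_disc R.
have nb w : disc w -> normc (bker (b + 2) z w) = (normc (1 - z * w^*%C) `^ (b + 2))^-1.
  by move=> w1; rewrite normc_bker //; exact: normcMJ_lt1.
have mb := measurable_bker (b + 2) z1.
have x0 : 0 < 1 - normc z by rewrite subr_gt0.
have mi : measurable_fun disc (fun w => h w * cutoff 1 b w * bker (b + 2) z w).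
  by apply: measurable_funMC => //; exact: cintegrable_measurable ih.
have ci : cintegrable area disc (fun w => h w * cutoff 1 b w * bker (b + 2) z w).
  apply: (@cintegrableW _ _ _ _ _ _ (fun w => ((1 - normc z) `^ (b + 2))^-1 * normc (h w * cutoff 1 b w))) => //.
    move=> w w1; rewrite normcM mulrC ler_wpM2r ?normc_ge0 //; apply: normc_bker_le => //.
    by rewrite addr_ge0.
  exact: (integrableZl mD ((1 - normc z) `^ (b + 2))^-1 (cintegrable_normc mD ih)).
apply: (le_trans (cintegral_le mD ci)); rewrite EFinM -muleA; apply: lee_wpmul2l => //.
have mk : measurable_fun disc (fun w => normc (h w) * kern p z w).
  apply: measurable_funM; first by apply: measurable_normc; exact: measurable_funTS mh.
  exact: measurable_funTS (measurable_kern2 p z).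
rewrite -ge0_integralZl //; last 2 first.
- exact/measurable_EFinP.
- by move=> w _; rewrite lee_fin mulr_ge0 ?normc_ge0 ?kern_ge0.
apply: ge0_le_integral => //.
- by move=> w _; rewrite lee_fin normc_ge0.
- by apply/measurable_EFinP; apply: measurable_normc.
- by apply: measurable_funeM; exact/measurable_EFinP.
- move=> w w1; rewrite -EFinM lee_fin !normcM nb // cutoffE // normcR ger0_norm ?powR_ge0 //.
  by rewrite -mulrA [leRHS]mulrCA ler_wpM2l ?normc_ge0 // kernel_weight_le.
Qed.

End potential.

Lemma potential_QK : exists2 CP : R, 0 < CP & forall (h : C -> C) (A : R), measurable_fun setT h ->
  cintegrable area disc (fun w => h w * cutoff 1 b w) -> 0 < A ->
  carleson K (fun w => normc (h w)) A -> forall a, disc a ->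
  (\int[area]_(z in disc) (QK_density K (bergman_potential b (fun w => h w * cutoff 1 b w)) a z)%:E
     <= (CP * A)%:E)%E.
Proof.
have [CS CS0 HS] := carleson_kernel KP; have [CM CM0 HM] := carleson_mobius KP.
pose c : R := 2 * 2 `^ b; have c0 : 0 < c by rewrite mulr_gt0 // powR_gt0.
exists (c ^+ 2 * (CM * CS) + 1); first by rewrite ltr_wpDl // !mulr_ge0 ?sqr_ge0.
move=> h A mh ih A0 hA a a1; have mD := @measurable_disc R.
(* [carleson_kernel] is stated for Carleson constant 1, so [h] is divided by the square root of [A]
   and the result scaled back. *)
pose s := Num.sqrt A; have s0 : 0 < s by rewrite sqrtr_gt0.
have sA : s ^+ 2 = A by rewrite sqr_sqrtr // ltW.
pose h1 w := normc (h w) / s.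
have mh1 : measurable_fun setT h1.
  by apply: measurable_funM; [exact: measurable_normc|exact: measurable_cst].
have h10 w : 0 <= h1 w by rewrite divr_ge0 ?normc_ge0 // ltW.
have ch1 : carleson K h1 1.
  move=> zeta l z1 l0; have mB : measurable (disc `&` cball zeta l) by apply: measurableI => //; exact: measurable_cball.
  rewrite (eq_integral (fun w => (A^-1)%:E * (normc (h w) ^+ 2 * wt K l w)%:E)%E); last first.
    by move=> w _; rewrite -EFinM -sA /h1; congr EFin; field; exact: lt0r_neq0.
  rewrite ge0_integralZl //.
  - by rewrite -[1%E]/(1%R%:E) -(mulVf (lt0r_neq0 A0)) EFinM lee_wpmul2l ?lee_fin ?invr_ge0 ?(ltW A0) //; exact: hA.
  - apply/measurable_EFinP; apply: measurable_funM; last exact: measurable_funTS (measurable_wt KP l0).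
    by apply: measurable_funX; apply: measurable_normc; exact: measurable_funTS mh.
  - by move=> w _; rewrite lee_fin mulr_ge0 ?sqr_ge0 // (wt_ge0 KP).
  - by rewrite lee_fin invr_ge0 ltW.
pose F := bergman_potential b (fun w => h w * cutoff 1 b w).
have Fa : analytic F by exact: potential_analytic.
pose u z := normc (derive1 F z) / (c * s).
have cs0 : 0 < c * s by rewrite mulr_gt0.
have mu : measurable_fun disc u.
  apply: measurable_funM; last exact: measurable_cst.
  by apply: measurable_normc; apply: analytic_measurable; exact: analytic_derive1.
have u0 z : disc z -> 0 <= u z by move=> _; rewrite divr_ge0 ?normc_ge0 // ltW.
have uk z : disc z -> ((u z)%:E <= \int[area]_(w in disc) (h1 w * kern p z w)%:E)%E.
  move=> z1; rewrite (eq_integral (fun w => (s^-1)%:E * (normc (h w) * kern p z w)%:E)%E); last first.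
    by move=> w _; rewrite -EFinM /h1; congr EFin; rewrite mulrAC mulrC.
  rewrite ge0_integralZl //.
  - have := potential_derive_le mh ih z1; rewrite -/F -/c => H.
    rewrite /u invfM mulrA mulrC EFinM; apply: lee_wpmul2l; first by rewrite lee_fin invr_ge0 ltW.
    by rewrite mulrC EFinM -lee_pdivlMl // ?invrK // invr_gt0.
  - apply/measurable_EFinP; apply: measurable_funM; last exact: measurable_funTS (measurable_kern2 p z).
    by apply: measurable_normc; exact: measurable_funTS mh.
  - by move=> w _; rewrite lee_fin mulr_ge0 ?normc_ge0 ?kern_ge0.
  - by rewrite lee_fin invr_ge0 ltW.
have cu := HS h1 u mh1 h10 ch1 mu u0 uk.
have := HM u CS mu CS0 cu a a1 => H.
have mq := measurable_QK_density KP Fa a1.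
rewrite (eq_integral (fun z => ((c * s) ^+ 2)%:E * (u z ^+ 2 * K (1 - normc (mobius a z) ^+ 2))%:E)%E); last first.
  by move=> z _; rewrite -EFinM mulrA -exprMn /u [_ * (_ / _)]mulrC divfK ?lt0r_neq0.
rewrite ge0_integralZl //.
- apply: (@le_trans _ _ (((c * s) ^+ 2)%:E * (CM * CS)%:E)%E); first by rewrite lee_wpmul2l // lee_fin sqr_ge0.
  rewrite -EFinM lee_fin exprMn sA mulrAC ler_wpM2r ?(ltW A0) //; lra.
- apply/measurable_EFinP; apply: measurable_funM; last exact: (measurable_mobius_weight KP a1).
  exact: measurable_funX.
- move=> z z1; rewrite lee_fin mulr_ge0 ?sqr_ge0 // (adm_ge0 KP) //.
  by case/andP: (mobius_bounds a1 z1).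
- by rewrite lee_fin sqr_ge0.
Qed.

End QK.

(** * Packets and step functions *)

Section packets.
Variable R : realType.
Local Notation C := R[i].
Local Notation area := (@area R).
Local Notation disc := (@disc R).
Variable b : R.
Hypothesis b2 : 2 <= b.
Implicit Types (z w : C) (N : nat).

Let b0 : 0 <= b. Proof. exact: le_trans b2. Qed.

Lemma cintegral_off0 (D D' : set C) (h : C -> C) : measurable D -> measurable D' ->
  measurable_fun D h -> measurable_fun D' h -> (forall w, w != 0 -> D w <-> D' w) ->
  cintegral area D h = cintegral area D' h.
Proof.
move=> mD mD' mh mh' DD.
have H (f : C -> R) : measurable_fun D f -> measurable_fun D' f ->
    (\int[area]_(w in D) (f w)%:E = \int[area]_(w in D') (f w)%:E)%E.
  move=> mf mf'; rewrite integral_mkcond [RHS]integral_mkcond; apply: ae_eq_integral => //.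
  - by apply/(measurable_restrictT _ mD); exact/measurable_EFinP.
  - by apply/(measurable_restrictT _ mD'); exact/measurable_EFinP.
  exists [set 0]; split; [exact: measurable_set1C|exact: area_set1|].
  move=> w /= nH; apply: contrapT => /eqP w0; apply: nH => _.
  rewrite !patchE; have [wD|wD] := pselect (D w).
    by rewrite !mem_set //; apply/(DD _ w0).
  by rewrite !memNset // => wD'; apply: wD; exact/(DD _ w0).
rewrite /cintegral; congr Complex; congr fine; apply: H; try exact: measurable_funRe; exact: measurable_funIm.
Qed.

Lemma cell_sub_disc N (Q : cell_index N) : cell Q `<=` disc.
Proof.
move=> w wQ; have [->|w0] := eqVneq w 0; first by rewrite /Defs.disc /mkset normc0.
by apply: cell_disc; apply/(cellE Q w0).
Qed.

Lemma packetE N (Q : cell_index N) z : disc z -> packet b Q z =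
  cintegral area disc (fun w => (b + 1)%:C%C * (\1_(cell_ Q) w)%:C%C * cutoff 1 b w * Lkernel b z w).
Proof.
move=> z1; have mD := @measurable_disc R; have mL := measurable_Lkernel b0 z1.
have mr : measurable_fun disc (fun w : C => (b + 1) * (1 - normc w ^+ 2) `^ b).
  by apply: measurable_funM; [exact: measurable_cst|exact: measurable_rho_pow].
have b10 : 0 <= b + 1 by rewrite addr_ge0.
have r0 w : disc w -> 0 <= (b + 1) * (1 - normc w ^+ 2) `^ b by move=> _; rewrite mulr_ge0 ?powR_ge0.
have mc := measurable_cell Q; have mc' := measurable_cell_ Q.
have mh : measurable_fun disc (fun w => Lkernel b z w * ((b + 1) * (1 - normc w ^+ 2) `^ b)%:C%C).
  by apply: measurable_funMC => //; exact: measurable_funR.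
rewrite /packet /dA_ cintegral_density //; last exact: measurable_funS mD (@cell_sub_disc _ Q) mL.
rewrite (@cintegral_off0 _ (disc `&` cell_ Q)).
- rewrite cintegral_mkcond [RHS]cintegral_mkcond; apply: eq_cintegral => w _.
  have [wD|wD] := pselect (disc w); last first.
    by rewrite [in RHS]memNset // memNset // => -[].
  rewrite [in RHS]mem_set //; have [wQ|wQ] := pselect (cell_ Q w).
    rewrite mem_set // indicE mem_set // mulr1 cutoffE // rmorphM; ring.
  by rewrite memNset ?indicE ?memNset ?mulr0 ?mul0r // => -[].
- exact: measurableI.
- exact: measurableI.
- by apply: measurable_funS mh => // w [].
- by apply: measurable_funS mh => // w [].
- by move=> w w0; split => -[h1 h2]; split => //; apply/(cellE Q w0).
Qed.

Section step_functions.
Variables (N : nat) (c : cell_index N -> C).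

Lemma step_le w : disc w -> normc (step c w) <= \sum_Q normc (c Q).
Proof.
move=> /(cell_exists N)[Q Qw]; rewrite (stepE c Qw) (bigD1 Q) //= lerDl.
by apply: sumr_ge0 => Q' _; exact: normc_ge0.
Qed.

Lemma step_integrable : cintegrable area disc (fun w => (b + 1)%:C%C * step c w * cutoff 1 b w).
Proof.
have b10 : 0 <= b + 1 by rewrite addr_ge0.
apply: (@cintegrable_bounded _ _ _ ((b + 1) * \sum_Q normc (c Q))).
- exact: measurable_disc.
- exact: disc_lty.
- apply: measurable_funMC; last exact: cintegrable_measurable (cintegrable_cutoff b2).
  by apply: measurable_funMC; [exact: measurable_cst|exact: measurable_funTS (measurable_step c)].
- move=> w w1; rewrite !normcM normcR ger0_norm // -mulrA; apply: ler_wpM2l => //.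
  apply: (@le_trans _ _ (normc (step c w))); last exact: step_le.
  by rewrite ler_piMr ?normc_ge0 // cutoff_bounded.
Qed.

Lemma sum_packet z : disc z -> \sum_Q c Q * packet b Q z =
  bergman_potential b (fun w => (b + 1)%:C%C * step c w * cutoff 1 b w) z.
Proof.
move=> z1; have mD := @measurable_disc R; have mL := measurable_Lkernel b0 z1.
have b10 : 0 <= b + 1 by rewrite addr_ge0.
have x0 : 0 < 1 - normc z by rewrite subr_gt0.
have ci Q : cintegrable area disc
    (fun w => (b + 1)%:C%C * (\1_(cell_ Q) w)%:C%C * cutoff 1 b w * Lkernel b z w).
  apply: (@cintegrable_bounded _ _ _ ((b + 1) * (2 * ((1 - normc z) `^ (b + 2))^-1))) => //.
  - exact: disc_lty.
  - apply: measurable_funMC => //; apply: measurable_funMC; last exact: cintegrable_measurable (cintegrable_cutoff b2).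
    apply: measurable_funMC; first exact: measurable_cst.
    by apply: measurable_funR; apply: measurable_indic; exact: measurable_cell_.
  - move=> w w1; rewrite !normcM [normc (b + 1)%:C%C]normcR ger0_norm // -!mulrA; apply: ler_wpM2l => //.
    have i1 : normc (\1_(cell_ Q) w)%:C%C <= 1 :> R.
      by rewrite normcR indicE; case: (_ \in _); rewrite ?normr1 ?normr0.
    apply: (@le_trans _ _ (normc (Lkernel b z w))); last exact: normc_Lkernel_le.
    rewrite mulrA ler_piMl ?normc_ge0 // mulr_ile1 ?normc_ge0 //; exact: cutoff_bounded.
transitivity (\sum_Q cintegral area disc (fun w => c Q * ((b + 1)%:C%C * (\1_(cell_ Q) w)%:C%C * cutoff 1 b w * Lkernel b z w))).
  by apply: eq_bigr => Q _; rewrite packetE // cintegralZ.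
rewrite -cintegral_sum //; last by move=> Q; exact: cintegrableZ.
apply: eq_cintegral => w _; rewrite /step mulr_sumr !mulr_suml.
by apply: eq_bigr => Q _; ring.
Qed.

Variables (K : R -> R).

Lemma X_normP (s : R) : (forall I (Q : cell_index N), 0 <= cell_mass K I Q) -> 0 <= s ->
  (X_norm K c <= s%:E)%E <-> (forall I, \sum_Q normc (c Q) ^+ 2 * cell_mass K I Q <= s ^+ 2).
Proof.
move=> m0 s0; have S0 I : 0 <= \sum_Q normc (c Q) ^+ 2 * cell_mass K I Q.
  by apply: sumr_ge0 => Q _; rewrite mulr_ge0 ?sqr_ge0.
have sE : s%:E = sqrte (s%:E ^+ 2)%E by rewrite sqrte_sqr gee0_abs.
rewrite /X_norm [in X in (_ <= X)%E]sE lee_sqrt ?sqre_ge0 // -EFin_expe; split=> H.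
  by move=> I; rewrite -lee_fin; apply: le_trans H; apply: ereal_sup_ubound; exists I.
by apply: ge_ereal_sup => x [I _ <-]; rewrite lee_fin.
Qed.

End step_functions.
End packets.

(** * Multipliers and the capacity [C] *)

Section multipliers.
Variable R : realType.
Local Notation C := R[i].
Local Notation area := (@area R).
Local Notation disc := (@disc R).
Implicit Types (f g F : C -> C) (a z w : C).

Lemma normc_sqrD (x y : C) : normc (x + y) ^+ 2 <= 2 * normc x ^+ 2 + 2 * normc y ^+ 2.
Proof.
have h := normcD x y; have x0 := normc_ge0 x; have y0 := normc_ge0 y.
apply: (@le_trans _ _ ((normc x + normc y) ^+ 2)).
  by rewrite ler_pXn2r ?nnegrE ?normc_ge0 ?addr_ge0.
have := sqr_ge0 (normc x - normc y); nra.
Qed.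

Lemma analyticM f g : analytic f -> analytic g -> analytic (fun z => g z * f z).
Proof.
move=> fa ga z z1; exact: (has_cderiv_derivable (has_cderivM (analytic_has_cderiv ga z1) (analytic_has_cderiv fa z1))).1.
Qed.

Lemma derive1M f g z : analytic f -> analytic g -> disc z ->
  derive1 (fun z => g z * f z) z = derive1 g z * f z + g z * derive1 f z.
Proof.
move=> fa ga z1.
exact: (has_cderiv_derivable (has_cderivM (analytic_has_cderiv ga z1) (analytic_has_cderiv fa z1))).2.
Qed.

Lemma analytic_cst (k : C) : analytic (fun=> k).
Proof. by move=> z _; exact: (has_cderiv_derivable (has_cderiv_cst k z)).1. Qed.

(** If [x > y], Bernoulli makes [(x / y) ^ n] grow at least linearly, beyond any [D]. *)
Lemma le_of_geometric (x y D : R) : 0 < y -> (forall n, x ^+ n <= D * y ^+ n) -> x <= y.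
Proof.
move=> y0 H; rewrite leNgt; apply/negP => yx; pose d := x / y - 1.
have d0 : 0 < d by rewrite subr_gt0 ltr_pdivlMr // mul1r.
have bern n : 1 + n%:R * d <= (1 + d) ^+ n.
  elim: n => [|n IH]; first by rewrite mul0r addr0 expr0.
  rewrite exprS -natr1; have : (1 + d) * (1 + n%:R * d) <= (1 + d) * (1 + d) ^+ n.
    by rewrite ler_wpM2l // addr_ge0 // ltW.
  have : 0 <= n%:R * d ^+ 2 by rewrite mulr_ge0 // sqr_ge0.
  nra.
have HD n : 1 + n%:R * d <= D.
  apply: (le_trans (bern n)); rewrite /d addrC subrK expr_div_n ler_pdivrMr ?exprn_gt0 //.
pose n := (Num.trunc (D / d)).+1.
have := HD n; have : D / d < n%:R by exact: truncnS_gt.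
rewrite ltr_pdivrMr // => h1 h2; lra.
Qed.

Lemma lt_pinfty_bound (x : \bar R) : (x < +oo)%E -> exists2 B : R, 0 <= B & (x <= B%:E)%E.
Proof.
case: x => [r| |] // _; last by exists 0 => //; rewrite leNye.
by exists `|r| => //; rewrite lee_fin ler_norm.
Qed.

(* The value of [h] is used on a cell only where the oscillation of [h] is at
   most [eps], so that [step] stays below [normc h + eps] everywhere. *)
Lemma step_approx (h : C -> C) (eps : R) : 0 < eps -> (forall w, disc w -> ccont h w) ->
  exists c : forall N, cell_index N -> C,
    (forall N w, disc w -> normc (step (c N) w) <= normc (h w) + eps) /\
    (forall w, disc w -> forall e : R, 0 < e -> exists N0, forall N, (N0 <= N)%N ->
       normc (step (c N) w - h w) < e).
Proof.
move=> e0 hc.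
pose good N (Q : cell_index N) w0 := cell_ Q w0 /\ forall w, cell_ Q w -> normc (h w - h w0) <= eps.
have ch N (Q : cell_index N) : exists v : C, (exists w0, good N Q w0 /\ v = h w0) \/ ((forall w0, ~ good N Q w0) /\ v = 0).
  have [[w0 g]|ng] := pselect (exists w0, good N Q w0); first by exists (h w0); left; exists w0.
  by exists 0; right; split => // w0 g; apply: ng; exists w0.
pose c N Q := projT1 (cid (ch N Q)).
have cP N Q : (exists w0, good N Q w0 /\ c N Q = h w0) \/ ((forall w0, ~ good N Q w0) /\ c N Q = 0).
  exact: projT2 (cid (ch N Q)).
exists c; split=> [N w w1|w w1 e e_gt0].
  have [Q wQ] := cell_exists N w1; rewrite (stepE (c N) wQ).
  case: (cP N Q) => [[w0 [[w0Q g] ->]]|[_ ->]]; last by rewrite normc0 addr_ge0 ?normc_ge0 // ltW.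
  have -> : h w0 = h w - (h w - h w0) by ring.
  by apply: (le_trans (normcB _ _)); rewrite lerD2l; exact: g.
(* Oscillation below [eps] makes the small cell around [w] eligible, with [w] itself as witness;
   oscillation below [e] makes the value chosen on it close to [h w]. *)
pose m := Num.min (eps / 2) e; have m0 : 0 < m by rewrite lt_min e_gt0 divr_gt0.
have [d d0 hd] := hc w w1 m m0.
have [N0 HN] := cell_small w d0; exists N0 => N NN.
have [Q wQ] := cell_exists N w1; rewrite (stepE (c N) wQ).
have close v : cell_ Q v -> normc (h v - h w) < m.
  by move=> vQ; apply: hd; exact: HN NN wQ vQ.
have me : m <= eps / 2 by rewrite /m ge_min lexx.
have m_e : m <= e by rewrite /m ge_min lexx orbT.
case: (cP N Q) => [[w0 [[w0Q _] ->]]|[ng _]]; first by apply: lt_le_trans m_e; exact: close.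
exfalso; apply: (ng w); split => // v vQ.
by apply: ltW; apply: lt_le_trans (close _ vQ) _; apply: (le_trans me); lra.
Qed.

Section weighted.
Variables (K : R -> R) (CK : R) (p : nat) (phi : nat -> R) (b : R).
Hypothesis KP : admissible K CK p phi.
Hypothesis b2 : 2 <= b.
Hypothesis pb : p%:R <= b.

Let mD := @measurable_disc R.

Lemma cell_mass_ge0 N I (Q : cell_index N) : 0 <= cell_mass K I Q.
Proof.
rewrite -lee_fin (cell_massE KP); apply: integral_ge0 => w _.
have /andP[l0 _] := arc_len_bounds I.
by rewrite lee_fin mulr_ge0 // (wt_ge0 KP).
Qed.

Lemma QK_density_mul_le f g a z : analytic f -> analytic g -> disc a -> disc z ->
  normc (f z) ^+ 2 * QK_density K g a z <=
    2 * QK_density K (fun z => g z * f z) a z + 2 * (normc (g z) ^+ 2 * QK_density K f a z) /\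
  QK_density K (fun z => g z * f z) a z <=
    2 * (normc (f z) ^+ 2 * QK_density K g a z) + 2 * (normc (g z) ^+ 2 * QK_density K f a z).
Proof.
move=> fa ga a1 z1; rewrite /QK_density derive1M //.
have k0 : 0 <= K (1 - normc (mobius a z) ^+ 2).
  by apply: (adm_ge0 KP); case/andP: (mobius_bounds a1 z1).
move: (K _) k0 => k k0; set x := derive1 g z * f z; set y := g z * derive1 f z.
have -> : normc (f z) ^+ 2 * (normc (derive1 g z) ^+ 2 * k) = normc x ^+ 2 * k.
  by rewrite /x normcM exprMn; ring.
have -> : normc (g z) ^+ 2 * (normc (derive1 f z) ^+ 2 * k) = normc y ^+ 2 * k.
  by rewrite /y normcM exprMn; ring.
have F3 (u v : R) : 2 * (u * k) + 2 * (v * k) = (2 * u + 2 * v) * k by ring.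
rewrite !F3; split; apply: ler_wpM2r => //; last exact: normc_sqrD.
have -> : x = (x + y) + (- y) by ring.
apply: (le_trans (normc_sqrD _ _)).
by rewrite normcN addrK.
Qed.

Lemma measurable_normc_sqr f : analytic f -> measurable_fun disc (fun z => normc (f z) ^+ 2).
Proof. by move=> fa; apply: measurable_funX; apply: measurable_normc; exact: analytic_measurable. Qed.

Lemma integral_mu_QK g a F : analytic g -> analytic F -> disc a ->
  (\int[mu_QK K g a]_(z in disc) (normc (F z) ^+ 2)%:E =
   \int[area]_(z in disc) (normc (F z) ^+ 2 * QK_density K g a z)%:E)%E.
Proof.
move=> ga Fa a1; rewrite /mu_QK ge0_integral_density ?setIid //.
- exact: (measurable_QK_density KP).
- by move=> z z1; exact: (QK_density_ge0 KP).
- exact: measurable_normc_sqr.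
- by move=> z _; exact: sqr_ge0.
Qed.

(** From [f g' = (g f)' - g f'], squared with the factor 2 of [normc_sqrD]. *)
Lemma multiplier_integral g f (G s t : R) : analytic g -> analytic f -> 0 <= s ->
  (forall z, disc z -> normc (g z) <= G) ->
  (forall a, disc a -> (\int[area]_(z in disc) (QK_density K f a z)%:E <= (s ^+ 2)%:E)%E) ->
  (forall a, disc a -> (\int[area]_(z in disc) (QK_density K (fun z => g z * f z) a z)%:E <= (t ^+ 2)%:E)%E) ->
  forall a, disc a -> (\int[area]_(z in disc) (normc (f z) ^+ 2 * QK_density K g a z)%:E <=
    (2 * t ^+ 2 + 2 * (G ^+ 2 * s ^+ 2))%:E)%E.
Proof.
move=> ga fa s0 gG Hf Hgf a a1; have gfa := analyticM fa ga.
have mf := measurable_QK_density KP fa a1; have mgf := measurable_QK_density KP gfa a1.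
have mg := measurable_QK_density KP ga a1.
have q0 h z : disc z -> 0 <= QK_density K h a z := QK_density_ge0 KP h a1.
have G0 : 0 <= G by apply: le_trans (gG 0 _); rewrite ?normc_ge0 // /Defs.disc /mkset normc0.
have L z (z1 : disc z) := (QK_density_mul_le fa ga a1 z1).1.
move: L (Hf a a1) (Hgf a a1) mf mgf mg (q0 f) (q0 g) (q0 (fun z => g z * f z)) => {Hf Hgf q0}.
move: (QK_density K (fun z => g z * f z) a) (QK_density K f a) (QK_density K g a) => q1 q2 q3.
move=> L Hf Hgf mf mgf mg q20 q30 q10.
have m1 : measurable_fun disc (fun z => (q1 z)%:E) by exact/measurable_EFinP.
have m2 : measurable_fun disc (fun z => (q2 z)%:E) by exact/measurable_EFinP.
have n1 : measurable_fun disc (fun z => 2%:E * (q1 z)%:E)%E by exact: measurable_funeM.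
have n2 : measurable_fun disc (fun z => (2 * G ^+ 2)%:E * (q2 z)%:E)%E by exact: measurable_funeM.
have G2 : 0 <= 2 * G ^+ 2 by rewrite mulr_ge0 ?sqr_ge0.
have p1 z : disc z -> (0 <= 2%:E * (q1 z)%:E)%E by move=> z1; rewrite -EFinM lee_fin mulr_ge0 ?q10.
have p2 z : disc z -> (0 <= (2 * G ^+ 2)%:E * (q2 z)%:E)%E by move=> z1; rewrite -EFinM lee_fin mulr_ge0 ?q20.
apply: (@le_trans _ _ (\int[area]_(z in disc) (2%:E * (q1 z)%:E + (2 * G ^+ 2)%:E * (q2 z)%:E))%E).
  apply: ge0_le_integral => //.
  - by move=> z z1; rewrite lee_fin mulr_ge0 ?sqr_ge0 ?q30.
  - by apply/measurable_EFinP; apply: measurable_funM => //; exact: measurable_normc_sqr.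
  - exact: emeasurable_funD.
  move=> z z1; rewrite -!EFinM -EFinD lee_fin.
  apply: (le_trans (L z z1)); rewrite lerD2l -[leRHS]mulrA; apply: ler_wpM2l => //.
  by apply: ler_wpM2r; [exact: q20|rewrite ler_pXn2r ?nnegrE ?normc_ge0 // gG].
rewrite ge0_integralD // [X in (_ <= X)%E]EFinD; apply: leeD.
  rewrite ge0_integralZl //.
  by rewrite [X in (_ <= X)%E]EFinM; apply: lee_wpmul2l.
rewrite ge0_integralZl //.
rewrite mulrA [X in (_ <= X)%E]EFinM; apply: lee_wpmul2l => //; by rewrite lee_fin.
Qed.

Lemma QK_seminorm_cst (k : C) : QK_seminorm K (fun=> k) = 0%E.
Proof.
apply/eqP; rewrite eq_le sqrte_ge0 andbT; apply: QK_seminorm_le => // a a1.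
rewrite expr0n /= integral0_eq // => z _.
by rewrite /QK_density (has_cderiv_derivable (has_cderiv_cst k z)).2 normc0 expr0n mul0r.
Qed.

Lemma in_QK_cst (k : C) : in_QK K (fun=> k) /\ QK_norm K (fun=> k) = (normc k)%:E.
Proof.
rewrite /in_QK /QK_norm QK_seminorm_cst adde0; split => //; split; first exact: analytic_cst.
by rewrite ltry.
Qed.

Lemma multiplier_in_QK g : bounded_multiplier K g -> in_QK K g.
Proof.
move=> [M H]; have [+ _] := H _ (in_QK_cst 1).1.
by rewrite (_ : (fun z => g z * 1) = g) //; apply/funext => z; rewrite mulr1.
Qed.

(** Iterating on the constant 1 gives [g ^ n] of norm at most [M1 ^ n]. Point evaluation, quadratic
    in the norm, yields [|g z| ^ n <= D (M1 ^ 2) ^ n] for all [n], hence the bound [M1 ^ 2]. *)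
Lemma multiplier_Hinfty g : bounded_multiplier K g -> in_Hinfty g.
Proof.
move=> gm; have ga := (multiplier_in_QK gm).1; have [M H] := gm.
split => //; pose M1 := Num.max M 1; exists (M1 ^+ 2) => z z1.
have M11 : 1 <= M1 by rewrite le_max lexx orbT.
have M10 : 0 <= M1 by exact: le_trans M11.
have pw n : in_QK K (fun z => g z ^+ n) /\ (QK_norm K (fun z => (g z ^+ n)%R) <= (M1 ^+ n)%:E)%E.
  elim: n => [|n [IH1 IH2]].
    have [h1 h2] := in_QK_cst 1; rewrite (_ : (fun z => g z ^+ 0) = fun=> 1) //.
    by rewrite h2 normc1 expr0.
  rewrite (_ : (fun z => g z ^+ n.+1) = fun z => g z * g z ^+ n); last by apply/funext => u; rewrite exprS.
  have [h1 h2] := H _ IH1; split => //; apply: (le_trans h2); rewrite exprS EFinM.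
  have [s s0 [_ E]] := in_QK_norm IH1; rewrite E in IH2 *.
  apply: (@le_trans _ _ (M1%:E * (normc (g 0 ^+ n) + s)%:E)%E).
    by rewrite -!EFinM lee_fin ler_wpM2r ?addr_ge0 ?normc_ge0 // le_max lexx.
  by apply: lee_wpmul2l.
have [Cz Cz0 HC] := point_evaluation KP b2 pb z1.
have c1 : 0 <= CK / K 1 by rewrite divr_ge0 ?(CK_ge0 KP) // ltW // (adm_gt0 KP).
have d0 : disc 0 by rewrite /Defs.disc /mkset normc0.
apply: (@le_of_geometric _ _ (1 + Cz * (CK / K 1 + 2))); first by rewrite exprn_gt0 // (lt_le_trans ltr01).
move=> n; have [h1 h2] := pw n; have [s s0 [E1 E2]] := in_QK_norm h1.
rewrite E2 lee_fin in h2; have n0 := normc_ge0 (g 0 ^+ n).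
have sM : s <= M1 ^+ n by lra.
have gM : normc (g 0 ^+ n) <= M1 ^+ n by lra.
have Hs : (QK_seminorm K (fun z => (g z ^+ n)%R) <= s%:E)%E by rewrite E1.
have q0 a' z' : disc a' -> disc z' -> 0 <= QK_density K (fun z => g z ^+ n) a' z' by move=> ? ?; exact: (QK_density_ge0 KP).
have := HC (fun z => g z ^+ n) (s ^+ 2) h1.1 (QK_seminorm_ge q0 Hs d0) => /= hz.
have -> : normc (g z) ^+ n = normc (g z ^+ n).
  by elim: (n) => [|k IH]; rewrite ?expr0 ?normc1 // !exprS normcM IH.
have e1 : 1 <= M1 ^+ n by exact: exprn_ege1.
have s2 : s ^+ 2 <= (M1 ^+ n) ^+ 2 by rewrite ler_pXn2r ?nnegrE // exprn_ge0.
have e2 : M1 ^+ n <= (M1 ^+ n) ^+ 2 by rewrite expr2 ler_peMl // exprn_ge0.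
have -> : (M1 ^+ 2) ^+ n = (M1 ^+ n) ^+ 2 by rewrite -!exprM mulnC.
have -> : g z ^+ n = (g z ^+ n - g 0 ^+ n) + g 0 ^+ n by ring.
apply: (le_trans (normcD _ _)).
have h3 : Cz * (CK / K 1 * s ^+ 2 + 2) <= Cz * (CK / K 1 + 2) * (M1 ^+ n) ^+ 2.
  rewrite -[leRHS]mulrA; apply: ler_wpM2l => //; rewrite mulrDl; apply: lerD; first exact: ler_wpM2l.
  lra.
rewrite mulrDl mul1r addrC; apply: lerD; first exact: le_trans gM e2.
exact: le_trans hz h3.
Qed.

Lemma multiplier_bound g (G M : R) : 0 <= M ->
  (forall f, in_QK K f -> in_QK K (fun z => g z * f z) /\
     (QK_norm K (fun z => g z * f z)%R <= M%:E * QK_norm K f)%E) ->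
  analytic g -> (forall z, disc z -> normc (g z) <= G) ->
  forall f (s : R), analytic f -> f 0 = 0 -> 0 <= s ->
  (forall a, disc a -> (\int[area]_(z in disc) (QK_density K f a z)%:E <= (s ^+ 2)%:E)%E) ->
  forall a, disc a -> (\int[area]_(z in disc) (normc (f z) ^+ 2 * QK_density K g a z)%:E <=
    (2 * (M ^+ 2 + G ^+ 2) * s ^+ 2)%:E)%E.
Proof.
move=> M0 H ga gG f s fa f0 s0 Hf a a1.
have sf := QK_seminorm_le s0 Hf; have fQ := in_QKP fa sf.
have [gfQ gfN] := H f fQ.
have [t t0 [E1 E2]] := in_QK_norm gfQ.
have tM : t <= M * s.
  have nf : (QK_norm K f <= s%:E)%E by rewrite /QK_norm f0 normc0 add0e.
  have : (QK_norm K (fun z => g z * f z)%R <= M%:E * s%:E)%E.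
    by apply: (le_trans gfN); apply: lee_wpmul2l.
  by rewrite E2 -EFinM lee_fin; apply: le_trans; rewrite lerDr normc_ge0.
have q0 a' z' : disc a' -> disc z' -> 0 <= QK_density K (fun z => g z * f z) a' z'.
  by move=> ? ?; exact: (QK_density_ge0 KP).
have Hgf a' (a1' : disc a') : (\int[area]_(z in disc) (QK_density K (fun z => g z * f z) a' z)%:E <= (t ^+ 2)%:E)%E.
  by apply: (QK_seminorm_ge q0) => //; rewrite E1.
apply: (le_trans (multiplier_integral ga fa s0 gG Hf Hgf a1)); rewrite lee_fin.
have : t ^+ 2 <= (M * s) ^+ 2 by rewrite ler_pXn2r ?nnegrE // mulr_ge0.
rewrite exprMn => h; nra.
Qed.

Lemma packets_QK : exists2 CF : R, 0 < CF & forall N (c : cell_index N -> C) (A : R), 0 < A ->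
  (forall I, \sum_Q normc (c Q) ^+ 2 * cell_mass K I Q <= A) -> forall a, disc a ->
  (\int[area]_(z in disc) (QK_density K (bergman_potential b
      (fun w => (b + 1)%:C%C * step c w * cutoff 1 b w)) a z)%:E <= (CF * A)%:E)%E.
Proof.
have [CP CP0 HP] := potential_QK KP b2 pb.
have b10 : 0 < b + 1 by rewrite ltr_wpDl // (le_trans _ b2).
have CK0 : 0 < CK := lt_le_trans ltr01 (adm_C1 KP).
exists (CP * ((b + 1) ^+ 2 * CK)); first by rewrite !mulr_gt0 // exprn_gt0.
move=> N c A A0 H a a1.
have mh : measurable_fun setT (fun w => (b + 1)%:C%C * step c w).
  by apply: measurable_funMC; [exact: measurable_cst|exact: measurable_step].
have := HP _ ((b + 1) ^+ 2 * CK * A) mh (step_integrable b2 c) _ _ a a1.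
rewrite mulrA; apply; first by rewrite !mulr_gt0 // exprn_gt0.
move=> zeta l z1 l0; have := step_carleson KP H z1 l0 => Hc.
have mB : measurable (disc `&` cball zeta l) by apply: measurableI => //; exact: measurable_cball.
rewrite (eq_integral (fun w => ((b + 1) ^+ 2)%:E * (normc (step c w) ^+ 2 * wt K l w)%:E)%E); last first.
  by move=> w _; rewrite -EFinM normcM normcR (gtr0_norm b10) exprMn -mulrA.
rewrite ge0_integralZl //.
- by rewrite -mulrA [X in (_ <= X)%E]EFinM; apply: lee_wpmul2l => //; rewrite lee_fin sqr_ge0.
- apply/measurable_EFinP; apply: measurable_funM; last exact: measurable_funTS (measurable_wt KP l0).
  by apply: measurable_funX; apply: measurable_normc; exact: measurable_funTS (measurable_step c).
- by move=> w _; rewrite lee_fin mulr_ge0 ?sqr_ge0 // (wt_ge0 KP).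
- by rewrite lee_fin sqr_ge0.
Qed.

Lemma packet_sum_analytic N (c : cell_index N -> C) :
  analytic (bergman_potential b (fun w => (b + 1)%:C%C * step c w * cutoff 1 b w)).
Proof. exact: (potential_analytic b2 (step_integrable b2 c)). Qed.

Lemma integral_packet_sum g a N (c : cell_index N -> C) : analytic g -> disc a ->
  (\int[mu_QK K g a]_(z in disc) (normc (\sum_Q c Q * packet b Q z) ^+ 2)%:E =
   \int[area]_(z in disc) (normc (bergman_potential b
      (fun w => (b + 1)%:C%C * step c w * cutoff 1 b w) z) ^+ 2 * QK_density K g a z)%:E)%E.
Proof.
move=> ga a1; transitivity (\int[mu_QK K g a]_(z in disc) (normc (bergman_potential b
    (fun w => (b + 1)%:C%C * step c w * cutoff 1 b w) z) ^+ 2)%:E)%E; last first.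
  exact: (integral_mu_QK ga (@packet_sum_analytic N c) a1).
rewrite /mu_QK; have [m ->] := density_measure (measurable_QK_density KP ga a1) (fun z => QK_density_ge0 KP g a1 (z := z)).
by apply: eq_integral => z; rewrite inE => z1; rewrite -(sum_packet b2 c z1).
Qed.

Lemma C_capacity_le (mu : set C -> \bar R) (B : R) : (C_capacity K b mu <= B%:E)%E <->
  forall N (c : cell_index N -> C), (forall I, \sum_Q normc (c Q) ^+ 2 * cell_mass K I Q <= 1) ->
  (\int[mu]_(z in disc) (normc (\sum_Q c Q * packet b Q z) ^+ 2)%:E <= B%:E)%E.
Proof.
have X1 N (c : cell_index N -> C) : (X_norm K c <= 1)%E <->
    forall I, \sum_Q normc (c Q) ^+ 2 * cell_mass K I Q <= 1.
  have := @X_normP R N c K 1 (@cell_mass_ge0 N) ler01; rewrite expr1n; exact.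
split=> [H N c /X1 hc|H].
  apply: le_trans H; apply: (@le_trans _ _ (ereal_sup
    [set (\int[mu]_(z in disc) (normc (\sum_Q c Q * packet b Q z) ^+ 2)%:E)%E
      | c in [set c : cell_index N -> C | (X_norm K c <= 1)%E]])).
    by apply: ereal_sup_ubound; exists c.
  by apply: ereal_sup_ubound; exists N.
apply: ge_ereal_sup => x [N _ <-]; apply: ge_ereal_sup => y [c hc <-].
by apply: H; apply/X1.
Qed.

Lemma multiplier_capacity g : bounded_multiplier K g ->
  exists B : R, forall a, disc a -> (C_capacity K b (mu_QK K g a) <= B%:E)%E.
Proof.
move=> gm; have [ga [G gG]] := multiplier_Hinfty gm; have [M H] := gm.
have [CF CF0 HF] := packets_QK.
(* The constant in [bounded_multiplier] carries no sign, while squaring the norm bound needs one. *)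
pose M1 := Num.max M 0; have M10 : 0 <= M1 by rewrite le_max lexx orbT.
have H1 f : in_QK K f -> in_QK K (fun z => g z * f z) /\
     (QK_norm K (fun z => g z * f z)%R <= M1%:E * QK_norm K f)%E.
  move=> fQ; have [h1 h2] := H f fQ; split => //; apply: (le_trans h2).
  have [s s0 [_ ->]] := in_QK_norm fQ; rewrite -!EFinM lee_fin ler_wpM2r ?addr_ge0 ?normc_ge0 //.
  by rewrite le_max lexx.
exists (2 * (M1 ^+ 2 + G ^+ 2) * CF) => a a1; apply/C_capacity_le => N c hc.
rewrite integral_packet_sum //.
have := multiplier_bound M10 H1 ga gG (@packet_sum_analytic N c) (bergman_potential0 _ _) (sqrtr_ge0 CF) _ a1.
rewrite sqr_sqrtr ?(ltW CF0) //; apply => a' a1'.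
by have := HF N c 1 ltr01 hc a' a1'; rewrite mulr1.
Qed.

(** The square of [|f'| + eps] splits into [box_QK] for [f'] and a constant: [2 eps ^ 2 K 1] times
    an area of at most 2. *)
Lemma step_X_norm f (s eps : R) N (c : cell_index N -> C) : analytic f -> 0 <= eps ->
  (forall a, disc a -> (\int[area]_(z in disc) (QK_density K f a z)%:E <= (s ^+ 2)%:E)%E) ->
  (forall w, disc w -> normc (step c w) <= normc (derive1 f w) + eps) ->
  forall I, \sum_Q normc (c Q) ^+ 2 * cell_mass K I Q <= 2 * (CK ^+ 7 * s ^+ 2) + 4 * K 1 * eps ^+ 2.
Proof.
move=> fa e0 Hf Hc I; rewrite -lee_fin (sum_cell_mass KP).
have mB := measurable_box I; have /andP[l0 _] := arc_len_bounds I.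
have [a [a1 Hbox]] := box_QK KP I fa.
have w0 w := wt_ge0 KP w l0; have K1 : 0 <= K 1 by exact: (adm_ge0 KP).
have mw : measurable_fun (carleson_box I) (wt K (arc_len I)) by exact: measurable_funTS (measurable_wt KP l0).
have mf : measurable_fun (carleson_box I) (fun w => normc (derive1 f w) ^+ 2 * wt K (arc_len I) w).
  apply: measurable_funM => //; apply: measurable_funS (@box_disc R I) (measurable_normc_sqr (analytic_derive1 fa)).
  exact: measurable_disc.
have ms : measurable_fun (carleson_box I) (fun w => normc (step c w) ^+ 2 * wt K (arc_len I) w).
  apply: measurable_funM => //; apply: measurable_funX; apply: measurable_normc.
  exact: measurable_funTS (measurable_step c).
pose k : R := 2 * eps ^+ 2 * K 1; have k0 : 0 <= k by rewrite !mulr_ge0 ?sqr_ge0.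
apply: (@le_trans _ _ (\int[area]_(w in carleson_box I)
    (2%:E * (normc (derive1 f w) ^+ 2 * wt K (arc_len I) w)%:E + cst k%:E w))%E).
  apply: ge0_le_integral => //.
  - by move=> w _; rewrite lee_fin mulr_ge0 ?sqr_ge0.
  - exact/measurable_EFinP.
  - apply: emeasurable_funD; last exact: measurable_cst.
    by apply: measurable_funeM; exact/measurable_EFinP.
  move=> w wB; rewrite /cst -EFinM -EFinD lee_fin.
  have d1 := box_disc wB; have h := Hc w d1; have n0 := normc_ge0 (step c w).
  have F0 := normc_ge0 (derive1 f w); have wK := box_wt_le KP wB; have wg := w0 w.
  apply: (@le_trans _ _ ((normc (derive1 f w) + eps) ^+ 2 * wt K (arc_len I) w)).
    by rewrite ler_wpM2r // ler_pXn2r ?nnegrE // addr_ge0.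
  apply: (@le_trans _ _ ((2 * normc (derive1 f w) ^+ 2 + 2 * eps ^+ 2) * wt K (arc_len I) w)).
    by rewrite ler_wpM2r //; have := sqr_ge0 (normc (derive1 f w) - eps); nra.
  rewrite mulrDl -mulrA lerD2l; apply: ler_wpM2l => //; by rewrite mulr_ge0 ?sqr_ge0.
rewrite ge0_integralD //; last 2 first.
- by move=> w _; rewrite -EFinM lee_fin; apply: mulr_ge0 => //; apply: mulr_ge0 => //; exact: sqr_ge0.
- by apply: measurable_funeM; exact/measurable_EFinP.
rewrite ge0_integralZl //; [|exact/measurable_EFinP|by move=> w _; rewrite lee_fin mulr_ge0 ?sqr_ge0].
rewrite [X in (_ <= X)%E]EFinD; apply: leeD.
  rewrite [X in (_ <= X)%E]EFinM; apply: lee_wpmul2l => //; apply: (le_trans Hbox).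
  by rewrite [X in (_ <= X)%E]EFinM; apply: lee_wpmul2l; [rewrite lee_fin exprn_ge0 // (CK_ge0 KP)|exact: Hf].
rewrite integral_cst //; apply: (@le_trans _ _ (k%:E * 2%:E)%E).
  apply: lee_wpmul2l; rewrite ?lee_fin //; apply: le_trans (area_disc_le2 R).
  by apply: le_measure; rewrite ?inE //; exact: box_disc.
by rewrite -EFinM lee_fin /k; lra.
Qed.

(** Dominated convergence at fixed [z]: the steps are dominated by [|f'| + eps], integrable against
    the weight, and [Lkernel b z] is bounded. *)
Lemma step_potential_cvg f (s eps : R) (c : forall N, cell_index N -> C) z : analytic f -> 0 <= eps ->
  (forall a, disc a -> (\int[area]_(z in disc) (QK_density K f a z)%:E <= (s ^+ 2)%:E)%E) ->
  (forall N w, disc w -> normc (step (c N) w) <= normc (derive1 f w) + eps) ->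
  (forall w, disc w -> forall e : R, 0 < e -> exists N0, forall N, (N0 <= N)%N ->
     normc (step (c N) w - derive1 f w) < e) -> disc z ->
  forall e : R, 0 < e -> exists N0, forall N, (N0 <= N)%N ->
    normc (bergman_potential b (fun w => (b + 1)%:C%C * step (c N) w * cutoff 1 b w) z -
           (b + 1)%:C%C * (bergman_mass b * (f z - f 0))) < e.
Proof.
move=> fa e0 Hf Hc Hcv z1; have b0 : 0 <= b by exact: le_trans b2.
have b10 : 0 <= b + 1 by rewrite addr_ge0.
have d0 : disc 0 by rewrite /Defs.disc /mkset normc0.
have x0 : 0 < 1 - normc z by rewrite subr_gt0.
have ci := cintegrable_weighted KP b2 pb fa (Hf 0 d0).
have mL := measurable_Lkernel b0 z1; have mcut := cintegrable_measurable (cintegrable_cutoff b2).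
have E := analytic_potential b2 fa z1 (weighted_L1 KP b2 pb fa (Hf 0 d0)).
pose k : R := (b + 1) * (2 * ((1 - normc z) `^ (b + 2))^-1).
have k0 : 0 <= k by rewrite !mulr_ge0 // invr_ge0 powR_ge0.
pose D w := k * (normc (derive1 f w * cutoff 1 b w) + eps * normc (cutoff 1 b w)).
have iD : area.-integrable disc (EFin \o D).
  have i1 := cintegrable_normc mD ci; have i2 := cintegrable_normc mD (cintegrable_cutoff b2).
  exact: (integrableZl mD k (integrableD mD i1 (integrableZl mD eps i2))).
have kL w : disc w -> (b + 1) * normc (Lkernel b z w) <= k.
  by move=> w1; apply: ler_wpM2l => //; exact: normc_Lkernel_le.
pose f1 w := (b + 1)%:C%C * (derive1 f w * cutoff 1 b w * Lkernel b z w).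
have f1D w : disc w -> normc (f1 w) <= D w.
  move=> w1; rewrite /f1 normcM normcR ger0_norm // normcM mulrCA mulrC.
  apply: ler_pM; rewrite ?normc_ge0 ?mulr_ge0 ?normc_ge0 //; first exact: kL.
  by rewrite lerDl mulr_ge0 ?normc_ge0.
have mf1 : measurable_fun disc f1.
  apply: measurable_funMC; first exact: measurable_cst.
  by apply: measurable_funMC => //; exact: cintegrable_measurable ci.
have -> : (b + 1)%:C%C * (bergman_mass b * (f z - f 0)) = cintegral area disc f1.
  rewrite -E /bergman_potential /f1 cintegralZ //.
  apply: (@cintegrableW _ _ _ _ _ _ (fun w => 2 * ((1 - normc z) `^ (b + 2))^-1 * normc (derive1 f w * cutoff 1 b w))) => //.
  - by apply: measurable_funMC => //; exact: cintegrable_measurable ci.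
  - by move=> w w1; rewrite normcM mulrC ler_wpM2r ?normc_ge0 //; exact: normc_Lkernel_le.
  - exact: (integrableZl mD (2 * ((1 - normc z) `^ (b + 2))^-1) (cintegrable_normc mD ci)).
apply: (@cintegral_dct _ _ _ _ disc (fun N w => (b + 1)%:C%C * step (c N) w * cutoff 1 b w * Lkernel b z w) f1 D) => //.
- by move=> N; apply: measurable_funMC => //; exact: cintegrable_measurable (step_integrable b2 (c N)).
- move=> w w1 e e_gt0; have l0 : 0 < k + 1 by rewrite ltr_wpDl.
  have [N0 HN] := Hcv w w1 (e / (k + 1)) (divr_gt0 e_gt0 l0); exists N0 => N NN.
  have -> : (b + 1)%:C%C * step (c N) w * cutoff 1 b w * Lkernel b z w - f1 w =
    (b + 1)%:C%C * Lkernel b z w * cutoff 1 b w * (step (c N) w - derive1 f w) by rewrite /f1; ring.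
  rewrite !normcM normcR ger0_norm //; have := HN N NN; set X := normc (_ - _) => hX.
  have X0 : 0 <= X by exact: normc_ge0.
  apply: (@le_lt_trans _ _ ((k + 1) * X)); last by rewrite mulrC -ltr_pdivlMr.
  apply: ler_wpM2r => //; have h1 := kL w w1; have h2 := cutoff_bounded w b2.
  apply: (@le_trans _ _ ((b + 1) * normc (Lkernel b z w))); last lra.
  by rewrite ler_piMr // mulr_ge0 ?normc_ge0.
- move=> N w w1; rewrite !normcM normcR ger0_norm //.
  have -> : (b + 1) * normc (step (c N) w) * normc (cutoff 1 b w) * normc (Lkernel b z w) =
    (b + 1) * normc (Lkernel b z w) * (normc (step (c N) w) * normc (cutoff 1 b w)) by ring.
  apply: ler_pM; rewrite ?mulr_ge0 ?normc_ge0 //; first exact: kL.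
  by rewrite normcM -mulrDl ler_wpM2r ?normc_ge0 //; exact: Hc.
Qed.

(** The capacity bounds the integrals of the step potentials, and an upper bound passes to the
    pointwise limit by Fatou. *)
Lemma capacity_potential g (B : R) a f (s eps : R) : analytic g -> disc a ->
  (C_capacity K b (mu_QK K g a) <= B%:E)%E -> analytic f ->
  (forall a', disc a' -> (\int[area]_(z in disc) (QK_density K f a' z)%:E <= (s ^+ 2)%:E)%E) -> 0 < eps ->
  (\int[area]_(z in disc) (normc ((b + 1)%:C%C * (bergman_mass b * (f z - f 0))) ^+ 2 *
     QK_density K g a z)%:E <= (B * (2 * (CK ^+ 7 * s ^+ 2) + 4 * K 1 * eps ^+ 2))%:E)%E.
Proof.
move=> ga a1 HC fa Hf eps0.
have fc w : disc w -> ccont (derive1 f) w by move=> w1; exact: analytic_ccont (analytic_derive1 fa) w1.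
have [c [Hc Hcv]] := step_approx eps0 fc.
set A := 2 * (CK ^+ 7 * s ^+ 2) + 4 * K 1 * eps ^+ 2.
have K1 := adm_gt0 KP ltr01; have C7 : 0 <= CK ^+ 7 by rewrite exprn_ge0 // (CK_ge0 KP).
have A0 : 0 < A.
  have h1 : 0 <= 2 * (CK ^+ 7 * s ^+ 2) by apply: mulr_ge0 => //; apply: mulr_ge0 => //; exact: sqr_ge0.
  have h2 : 0 < 4 * K 1 * eps ^+ 2 by apply: mulr_gt0; [exact: mulr_gt0|exact: exprn_gt0].
  by rewrite /A ltr_wpDl.
have HX N := step_X_norm fa (ltW eps0) Hf (Hc N).
have mq := measurable_QK_density KP ga a1; have q0 z := QK_density_ge0 KP g a1 (z := z).
pose F N := bergman_potential b (fun w => (b + 1)%:C%C * step (c N) w * cutoff 1 b w).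
have Fa N : analytic (F N) by exact: (@packet_sum_analytic N (c N)).
have mn N : measurable_fun disc (fun z => (normc (F N z) ^+ 2 * QK_density K g a z)%:E).
  have m := measurable_normc_sqr (Fa N); move: (QK_density K g a) mq => q mq'.
  by apply/measurable_EFinP; exact: measurable_funM m mq'.
have HN N : (\int[area]_(z in disc) (normc (F N z) ^+ 2 * QK_density K g a z)%:E <= (B * A)%:E)%E.
  (* Capacity tests coefficients of norm at most 1; the form is quadratic, so scaling by [k] costs
     exactly [A]. *)
  pose k : R := (Num.sqrt A)^-1; have k0 : 0 < k by rewrite invr_gt0 sqrtr_gt0.
  have kA : k ^+ 2 * A = 1 by rewrite /k exprVn sqr_sqrtr ?(ltW A0) // mulVf // lt0r_neq0.
  pose c1 Q := k%:C%C * c N Q.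
  have hc1 I : \sum_Q normc (c1 Q) ^+ 2 * cell_mass K I Q <= 1.
    have -> : \sum_Q normc (c1 Q) ^+ 2 * cell_mass K I Q = k ^+ 2 * \sum_Q normc (c N Q) ^+ 2 * cell_mass K I Q.
      by rewrite mulr_sumr; apply: eq_bigr => Q _; rewrite normcM normcR (gtr0_norm k0) exprMn -mulrA.
    by rewrite -kA ler_wpM2l ?sqr_ge0.
  have := (C_capacity_le _ B).1 HC N c1 hc1; rewrite integral_packet_sum //.
  rewrite (eq_integral (fun z => (k ^+ 2)%:E * (normc (F N z) ^+ 2 * QK_density K g a z)%:E)%E); last first.
    move=> z; rewrite inE => z1; rewrite -EFinM; congr EFin; move: (QK_density K g a z) => q; rewrite mulrA; congr (_ * q).
    rewrite -(sum_packet b2) // /F -(sum_packet b2) // -(gtr0_norm k0) -normcR -exprMn -normcM; congr (normc _ ^+ _).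
    by rewrite mulr_sumr; apply: eq_bigr => Q _; rewrite mulrA.
  rewrite ge0_integralZl //; last 2 first.
  - by move=> z z1; rewrite lee_fin mulr_ge0 ?sqr_ge0 ?q0.
  - by rewrite lee_fin sqr_ge0.
  move=> h; have k2 : 0 < k ^+ 2 by rewrite exprn_gt0.
  have -> : (B * A)%:E = ((k ^+ 2)^-1%:E * B%:E)%E.
    by rewrite -EFinM; congr EFin; apply: (mulfI (lt0r_neq0 k2)); rewrite [in LHS]mulrCA kA mulr1 mulrA mulfV ?lt0r_neq0 // mul1r.
  by rewrite lee_pdivlMl.
pose Fl z := (b + 1)%:C%C * (bergman_mass b * (f z - f 0)).
pose u N z := (normc (F N z) ^+ 2 * QK_density K g a z)%:E.
have cv z : disc z -> u N z @[N --> \oo] --> (normc (Fl z) ^+ 2 * QK_density K g a z)%:E.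
  move=> z1; apply/cvg_EFin; first by apply: nearW.
  have cvn : normc (F N z) @[N --> \oo] --> normc (Fl z).
    apply/cvgrPdist_lt => e e_gt0.
    have [N0 HN0] := step_potential_cvg fa (ltW eps0) Hf Hc Hcv z1 e_gt0.
    exists N0 => // n nN; have h : normc (F n z - Fl z) < e := HN0 n nN.
    change (`|normc (Fl z) - normc (F n z)| < e); apply: le_lt_trans h; rewrite ler_norml.
    have h1 := normc_sub_ge (F n z) (Fl z); have := normc_sub_ge (Fl z) (F n z); rewrite normcBC => h2.
    by apply/andP; split; lra.
  exact: (cvgM (cvgM cvn cvn) (cvg_cst _)).
rewrite (eq_integral (fun z => limn_einf (u^~ z))); last first.
  by move=> z; rewrite inE => z1; rewrite (cvg_limn_einf_sup (cv z z1)).1.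
apply: le_trans (fatou _ mD _ _) _.
- exact: mn.
- by move=> N z z1; rewrite lee_fin mulr_ge0 ?sqr_ge0 ?q0.
rewrite limn_einf_lim; apply: lime_le; first exact: is_cvg_einfs.
by apply: nearW => n; apply: le_trans (HN n); apply: ereal_inf_lbound; exists n => /=.
Qed.

(** In [(g f)' = g' f + g f'] the last term is bounded by [G]. In the first, [f - f 0] is controlled
    by the capacity and the constant [f 0] by the membership of [g] in [Q_K]. *)
Lemma capacity_multiplier g (G B : R) : in_QK K g -> (forall z, disc z -> normc (g z) <= G) -> 0 <= B ->
  (forall a, disc a -> (C_capacity K b (mu_QK K g a) <= B%:E)%E) -> bounded_multiplier K g.
Proof.
move=> gQ gG B0 HC; have ga := gQ.1.
have d0 : disc 0 by rewrite /Defs.disc /mkset normc0.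
have G0 : 0 <= G by apply: le_trans (gG 0 d0); exact: normc_ge0.
have [sg sg0 [Esg _]] := in_QK_norm gQ.
have q0 h a z : disc a -> disc z -> 0 <= QK_density K h a z by move=> a1; exact: (QK_density_ge0 KP).
have Hg : forall a, disc a -> (\int[area]_(z in disc) (QK_density K g a z)%:E <= (sg ^+ 2)%:E)%E.
  by apply: (QK_seminorm_ge (q0 g)); rewrite Esg.
pose k := normc ((b + 1)%:C%C * bergman_mass b : C).
have b10 : 0 < b + 1 by rewrite ltr_wpDl // (le_trans _ b2).
have k0 : 0 < k.
  by rewrite normc_gt0 mulf_neq0 ?bergman_mass_neq0 // -normc_gt0 normcR normr_gt0 lt0r_neq0.
have K1 := adm_gt0 KP ltr01; have C7 : 0 <= CK ^+ 7 by rewrite exprn_ge0 // (CK_ge0 KP).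
pose D := B * (2 * CK ^+ 7) / k ^+ 2; have D0 : 0 <= D by apply: divr_ge0; [apply: mulr_ge0 => //; exact: mulr_ge0|exact: sqr_ge0].
have osc f (s : R) : analytic f ->
    (forall a', disc a' -> (\int[area]_(z in disc) (QK_density K f a' z)%:E <= (s ^+ 2)%:E)%E) ->
    forall a, disc a -> (\int[area]_(z in disc) (normc (f z - f 0) ^+ 2 * QK_density K g a z)%:E <= (D * s ^+ 2)%:E)%E.
  move=> fa Hf a a1; have mq := measurable_QK_density KP ga a1.
  have fa0 : analytic (fun z => f z - f 0).
    by move=> z z1; exact: (has_cderiv_derivable (has_cderivB (analytic_has_cderiv fa z1) (has_cderiv_cst (f 0) z))).1.
  have E : (\int[area]_(z in disc) (normc ((b + 1)%:C%C * (bergman_mass b * (f z - f 0))) ^+ 2 * QK_density K g a z)%:E =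
      (k ^+ 2)%:E * \int[area]_(z in disc) (normc (f z - f 0) ^+ 2 * QK_density K g a z)%:E)%E.
    rewrite -ge0_integralZl //.
    - by apply: eq_integral => z _; rewrite -EFinM; move: (QK_density K g a z) => q; rewrite [in LHS]mulrA normcM -/k exprMn -mulrA.
    - have m := measurable_normc_sqr fa0; move: (QK_density K g a) mq => q mq'.
      by apply/measurable_EFinP; exact: measurable_funM m mq'.
    - by move=> z z1; rewrite lee_fin mulr_ge0 ?sqr_ge0 ?q0.
    - by rewrite lee_fin sqr_ge0.
  have k2 : 0 < k ^+ 2 by rewrite exprn_gt0.
  have -> : (D * s ^+ 2)%:E = ((k ^+ 2)^-1%:E * (B * (2 * (CK ^+ 7 * s ^+ 2)))%:E)%E.
    by rewrite -EFinM; congr EFin; rewrite /D; ring.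
  rewrite lee_pdivlMl // -E; apply/lee_addgt0Pr => e e0.
  (* The truncation error is [B * 4 K 1 eps ^ 2]; this choice of [eps] brings it below [e], so it
     disappears from the final constant. *)
  pose den := B * (4 * K 1) + 1; have den0 : 0 < den by rewrite ltr_wpDl // !mulr_ge0 // ltW.
  pose eps := Num.sqrt (e / den); have eps0 : 0 < eps by rewrite sqrtr_gt0 divr_gt0.
  apply: (le_trans (capacity_potential ga a1 (HC a a1) fa Hf eps0)).
  rewrite -EFinD lee_fin mulrDr lerD2l /eps sqr_sqrtr ?divr_ge0 ?(ltW e0) ?(ltW den0) //.
  by rewrite mulrA mulrCA ler_piMr ?(ltW e0) // ler_pdivrMr // mul1r /den; lra.
(* Collects the three contributions [4 D s ^ 2], [4 F0 ^ 2 sg ^ 2] and [2 G ^ 2 s ^ 2] against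
   [(F0 + s) ^ 2]. The value of [g f] at 0 adds [G] to the operator bound. *)
pose T2 := 4 * D + 4 * sg ^+ 2 + 2 * G ^+ 2.
have T20 : 0 <= T2 by apply: addr_ge0; [apply: addr_ge0|]; apply: mulr_ge0 => //; exact: sqr_ge0.
pose T := Num.sqrt T2; have T0 : 0 <= T by exact: sqrtr_ge0.
exists (G + T) => f fQ; have fa := fQ.1; have gfa := analyticM fa ga.
have [s s0 [Es En]] := in_QK_norm fQ.
have Hf : forall a, disc a -> (\int[area]_(z in disc) (QK_density K f a z)%:E <= (s ^+ 2)%:E)%E.
  by apply: (QK_seminorm_ge (q0 f)); rewrite Es.
set F0 := normc (f 0) in En; have F00 : 0 <= F0 by exact: normc_ge0.
have sn : (QK_seminorm K (fun z => g z * f z)%R <= (T * (F0 + s))%:E)%E.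
  apply: QK_seminorm_le; first by rewrite mulr_ge0 ?addr_ge0.
  move=> a a1; have Hosc := osc f s fa Hf a a1.
  have mq := measurable_QK_density KP ga a1; have mqf := measurable_QK_density KP fa a1.
  have mqg := measurable_QK_density KP gfa a1.
  have fa0 : analytic (fun z => f z - f 0).
    by move=> z z1; exact: (has_cderiv_derivable (has_cderivB (analytic_has_cderiv fa z1) (has_cderiv_cst (f 0) z))).1.
  have L z (z1 : disc z) := (QK_density_mul_le fa ga a1 z1).2.
  have mo : measurable_fun disc (fun z => normc (f z - f 0) ^+ 2) by exact: (measurable_normc_sqr fa0).
  move: L (Hf a a1) (Hg a a1) Hosc mq mqf mqg (q0 f a) (q0 g a) (q0 (fun z => g z * f z) a) => {Hf Hg q0 osc}.
  move: (QK_density K (fun z => g z * f z) a) (QK_density K f a) (QK_density K g a) => q1 q2 q3.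
  move=> L Hf Hg Hosc m3 m2 m1 q20 q30 q10.
  have m2' : measurable_fun disc (fun z => (q2 z)%:E) by exact/measurable_EFinP.
  have m3' : measurable_fun disc (fun z => (q3 z)%:E) by exact/measurable_EFinP.
  have n2' z (z1 : disc z) : (0 <= (q2 z)%:E)%E by rewrite lee_fin q20.
  have n3' z (z1 : disc z) : (0 <= (q3 z)%:E)%E by rewrite lee_fin q30.
  have n4' z (z1 : disc z) : (0 <= (normc (f z - f 0) ^+ 2 * q3 z)%:E)%E by rewrite lee_fin mulr_ge0 ?sqr_ge0 ?q30.
  have e2 : measurable_fun disc (fun z => (2 * G ^+ 2)%:E * (q2 z)%:E)%E.
    by apply: measurable_funeM; exact/measurable_EFinP.
  have e3 : measurable_fun disc (fun z => (4 * F0 ^+ 2)%:E * (q3 z)%:E)%E.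
    by apply: measurable_funeM; exact/measurable_EFinP.
  have e1' : measurable_fun disc (fun z => (normc (f z - f 0) ^+ 2 * q3 z)%:E).
    by apply/measurable_EFinP; exact: measurable_funM mo m3.
  have e1 : measurable_fun disc (fun z => 4%:E * (normc (f z - f 0) ^+ 2 * q3 z)%:E)%E.
    exact: measurable_funeM.
  have G2 : 0 <= 2 * G ^+ 2 by rewrite mulr_ge0 ?sqr_ge0.
  have F2 : 0 <= 4 * F0 ^+ 2 by rewrite mulr_ge0 ?sqr_ge0.
  have p1 z : disc z -> (0 <= 4%:E * (normc (f z - f 0) ^+ 2 * q3 z)%:E)%E.
    by move=> z1; rewrite -EFinM lee_fin mulr_ge0 // mulr_ge0 ?sqr_ge0 ?q30.
  have p2 z : disc z -> (0 <= (2 * G ^+ 2)%:E * (q2 z)%:E)%E by move=> z1; rewrite -EFinM lee_fin mulr_ge0 ?q20.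
  have p3 z : disc z -> (0 <= (4 * F0 ^+ 2)%:E * (q3 z)%:E)%E by move=> z1; rewrite -EFinM lee_fin mulr_ge0 ?q30.
  apply: (@le_trans _ _ (\int[area]_(z in disc) (4%:E * (normc (f z - f 0) ^+ 2 * q3 z)%:E +
      ((4 * F0 ^+ 2)%:E * (q3 z)%:E + (2 * G ^+ 2)%:E * (q2 z)%:E)))%E).
    apply: ge0_le_integral => //.
    - by move=> z z1; rewrite lee_fin q10.
    - exact/measurable_EFinP.
    - by apply: emeasurable_funD => //; exact: emeasurable_funD.
    move=> z z1; rewrite -!EFinM -!EFinD lee_fin; apply: (le_trans (L z z1)).
    have h1 : normc (f z) ^+ 2 <= 2 * normc (f z - f 0) ^+ 2 + 2 * F0 ^+ 2.
      by have := normc_sqrD (f z - f 0) (f 0); rewrite subrK.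
    have h2 : normc (g z) ^+ 2 <= G ^+ 2 by rewrite ler_pXn2r ?nnegrE ?normc_ge0 // gG.
    have h3 := ler_wpM2r (q30 z a1 z1) h1; have h4 := ler_wpM2r (q20 z a1 z1) h2.
    lra.
  rewrite ge0_integralD //; last 2 first.
  - by move=> z z1; rewrite adde_ge0 ?p2 ?p3.
  - exact: emeasurable_funD.
  rewrite ge0_integralD // !ge0_integralZl //.
  apply: (@le_trans _ _ (4%:E * (D * s ^+ 2)%:E + ((4 * F0 ^+ 2)%:E * (sg ^+ 2)%:E + (2 * G ^+ 2)%:E * (s ^+ 2)%:E))%E).
    by apply: leeD; [|apply: leeD]; apply: lee_wpmul2l; rewrite ?lee_fin.
  rewrite -!EFinM -!EFinD lee_fin exprMn sqr_sqrtr // /T2.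
  have := mulr_ge0 F00 s0; have := sqr_ge0 F0; have := sqr_ge0 s; have := sqr_ge0 sg; have := sqr_ge0 G.
  move: (sg ^+ 2) (G ^+ 2) => x y y0 x0' s2 f2 fs.
  have -> : (F0 + s) ^+ 2 = F0 ^+ 2 + s ^+ 2 + 2 * (F0 * s) by ring.
  move: (F0 ^+ 2) (s ^+ 2) (F0 * s) s2 f2 fs => u v t v0 u0 t0.
  have := mulr_ge0 D0 u0; have := mulr_ge0 D0 t0; have := mulr_ge0 x0' v0; have := mulr_ge0 x0' t0.
  have := mulr_ge0 y0 u0; have := mulr_ge0 y0 t0; clear => *; nra.
split; first exact: in_QKP gfa sn.
rewrite {1}/QK_norm En -EFinM; apply: (@le_trans _ _ ((G * F0)%:E + (T * (F0 + s))%:E)%E).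
  by apply: leeD => //; rewrite lee_fin normcM ler_wpM2r // gG.
by rewrite -EFinD lee_fin mulrDl; have := mulr_ge0 G0 s0; lra.
Qed.

End weighted.
End multipliers.

(** * The capacity [D] *)

Section grothendieck.
Variables (R : realType) (n : nat).
Local Notation C := R[i].
Local Notation V := 'cV[C]_n.
Implicit Types (v x y : V) (s : seq V) (i : 'I_n).

(* The [2 ^ size s] sums [sum_v (+- v)]. *)
Fixpoint sign_sums s : seq V :=
  if s is v :: s' then [seq x + v | x <- sign_sums s'] ++ [seq x - v | x <- sign_sums s']
  else [:: 0].

Lemma size_sign_sums s : size (sign_sums s) = (2 ^ size s)%N.
Proof. by elim: s => //= v s IH; rewrite size_cat !size_map IH addnn expnS mul2n. Qed.

Lemma sum_sign_sums (f : V -> R) v s :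
  \sum_(x <- sign_sums (v :: s)) f x = \sum_(x <- sign_sums s) (f (x + v) + f (x - v)).
Proof. by rewrite /= big_cat /= !big_map big_split. Qed.

Lemma sum_sign_sums_cst (a : R) s : \sum_(x <- sign_sums s) a = 2 ^+ size s * a.
Proof. by rewrite big_const_seq count_predT iter_addr_0 size_sign_sums -[LHS]mulr_natl natrX. Qed.

(** Random signs are orthogonal: cross terms cancel between [x + v] and [x - v], so the average of a
    quadratic form over the sign sums is its sum over the vectors. *)
Lemma sign_sums_parallelogram (q : V -> R) s :
  (forall x y, q (x + y) + q (x - y) = 2 * q x + 2 * q y) ->
  \sum_(x <- sign_sums s) q x = 2 ^+ size s * \sum_(v <- s) q v.
Proof.
move=> hq; have q0 : q 0 = 0 by have := hq 0 0; rewrite addr0 subr0; lra.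
elim: s => [|v s IH]; first by rewrite /= big_seq1 big_nil mulr0.
rewrite sum_sign_sums big_cons (eq_bigr (fun x => 2 * q x + 2 * q v)); last by move=> x _; exact: hq.
by rewrite big_split /= sum_sign_sums_cst -mulr_sumr IH exprS; ring.
Qed.

Lemma normc_parallelogram (x y : C) :
  normc (x + y) ^+ 2 + normc (x - y) ^+ 2 = 2 * normc x ^+ 2 + 2 * normc y ^+ 2.
Proof. by rewrite !normc_sqr; case: x => a b; case: y => c d /=; ring. Qed.

(** An equality for real numbers; for complex ones the gap is eight times the square of the
    imaginary part of [conj x * y]. *)
Lemma normc_fourth (x y : C) : normc (x + y) ^+ 4 + normc (x - y) ^+ 4 <=
  2 * (normc x ^+ 4 + 6 * (normc x ^+ 2 * normc y ^+ 2) + normc y ^+ 4).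
Proof.
have E (t : R) : t ^+ 4 = (t ^+ 2) ^+ 2 by rewrite -exprM.
rewrite !E !normc_sqr; case: x => a b; case: y => c d /=.
rewrite -subr_ge0 (_ : _ - _ = 8 * (a * d - b * c) ^+ 2); last by ring.
by rewrite mulr_ge0 // sqr_ge0.
Qed.

(** Khintchine's inequality for exponent 4 with constant 3: the induction turns [12 a S] and
    [2 a ^ 2] into parts of [6 (a + S) ^ 2]. *)
Lemma sign_sums_fourth s i :
  \sum_(x <- sign_sums s) normc (x i 0) ^+ 4 <= 3 * 2 ^+ size s * (\sum_(v <- s) normc (v i 0) ^+ 2) ^+ 2.
Proof.
elim: s => [|v s IH]; first by rewrite /= big_seq1 mxE normc0 expr0n big_nil expr0n /= mulr0.
rewrite sum_sign_sums big_cons.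
apply: (@le_trans _ _ (\sum_(x <- sign_sums s)
    (2 * normc (x i 0) ^+ 4 + 12 * normc (v i 0) ^+ 2 * normc (x i 0) ^+ 2 + 2 * normc (v i 0) ^+ 4))).
  apply: ler_sum => x _; rewrite !mxE; apply: (le_trans (normc_fourth _ _)); lra.
rewrite !big_split /= sum_sign_sums_cst -2!mulr_sumr.
rewrite (sign_sums_parallelogram (q := fun x => normc (x i 0) ^+ 2)); last first.
  by move=> x y; rewrite !mxE normc_parallelogram.
rewrite [2 ^+ _.+1]exprS.
move: IH; set T := \sum_(x <- _) _; set S := \sum_(w <- s) _; set P := 2 ^+ size s.
have P0 : 0 <= P by rewrite exprn_ge0.
have -> : normc (v i 0) ^+ 4 = (normc (v i 0) ^+ 2) ^+ 2 by rewrite -exprM.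
move: (normc (v i 0) ^+ 2) => a h.
have := mulr_ge0 P0 (sqr_ge0 a); nra.
Qed.

Section form.
Variables (q : V -> R) (J : Type) (m : J -> 'I_n -> R) (A B0 : R).
Hypothesis q_ge0 : forall x, 0 <= q x.
Hypothesis q_par : forall x y, q (x + y) + q (x - y) = 2 * q x + 2 * q y.
Hypothesis qZ : forall (a : R) x, q (a%:C%C *: x) = a ^+ 2 * q x.
Hypothesis q_le : forall x, q x <= B0 * \sum_i normc (x i 0) ^+ 2.
Hypothesis B00 : 0 <= B0.
Hypothesis A0 : 0 <= A.
Hypothesis q_cap : forall x, (forall j, \sum_i normc (x i 0) ^+ 2 * m j i <= 1) -> q x <= A.

Lemma form_sqrD x y : q (x + y) <= 2 * q x + 2 * q y.
Proof. by rewrite -q_par lerDl. Qed.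

(* Little Grothendieck inequality. Truncating the random sums [sum_v (+- v)] at
   the level [sqrt 12 * t] leaves a vector controlled by [q_cap] and, by the
   fourth moment bound, a remainder that is again an admissible family, of half
   the size; hence the best constant [S] satisfies [S <= 24 A + S / 2]. *)
Lemma little_grothendieck s :
  (forall j, \sum_i (\sum_(v <- s) normc (v i 0) ^+ 2) * m j i <= 1) ->
  (forall j i, 0 <= m j i) -> \sum_(v <- s) q v <= 48 * A.
Proof.
move=> hs m0; pose t2 i := \sum_(v <- s) normc (v i 0) ^+ 2.
have t20 i : 0 <= t2 i by apply: sumr_ge0 => v _; exact: sqr_ge0.
(* Admissibility is relaxed to a bound by the fixed profile [t2], coordinate by coordinate, so that
   the family of remainders can be compared with the same supremum. *)
pose adm (s' : seq V) := forall i, \sum_(v <- s') normc (v i 0) ^+ 2 <= t2 i.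
pose E := [set x : R | exists s', adm s' /\ x = \sum_(v <- s') q v].
have E0 : E !=set0 by exists 0; exists [::]; split; [move=> i; rewrite big_nil|rewrite big_nil].
(* Absorbing [S / 2] requires a finite supremum; the crude bound [q_le] is there only for this. *)
have Eub : ubound E (B0 * \sum_i t2 i).
  move=> x [s' [hs' ->]]; apply: (@le_trans _ _ (\sum_(v <- s') B0 * \sum_i normc (v i 0) ^+ 2)).
    by apply: ler_sum => v _; exact: q_le.
  rewrite -mulr_sumr exchange_big /=; apply: ler_wpM2l => //; apply: ler_sum => i _; exact: hs'.
have hE : has_sup E by split => //; exists (B0 * \sum_i t2 i).
pose S := sup E.
have leS s' : adm s' -> \sum_(v <- s') q v <= S.
  by move=> hs'; apply: ub_le_sup; [exact: hE.2|exists s'].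
suff H s' : adm s' -> \sum_(v <- s') q v <= 24 * A + S / 2.
  have : S <= 24 * A + S / 2 by apply: ge_sup => // x [s' [hs' ->]]; exact: H.
  have := leS s (fun i => lexx (t2 i)); lra.
move=> hs'; set P : R := 2 ^+ size s'; have P0 : 0 < P by rewrite exprn_gt0.
pose y x : V := \col_i (if normc (x i 0) ^+ 2 <= 12 * t2 i then x i 0 else 0).
pose z x : V := x - y x.
have yq x : q (y x) <= 12 * A.
  pose k : R := (Num.sqrt 12)^-1; have k2 : k ^+ 2 = 12^-1 by rewrite exprVn sqr_sqrtr.
  have := q_cap (x := k%:C%C *: y x); rewrite qZ k2 => h.
  rewrite -ler_pdivrMl //; apply: h => j; apply: le_trans (hs j); apply: ler_sum => i _.
  apply: ler_wpM2r => //; rewrite !mxE normcM normcR exprMn real_normK ?num_real // k2.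
  case: ifP => h12; first by rewrite ler_pdivrMl.
  by rewrite normc0 expr0n mulr0; exact: t20.
(* Beyond the level [12 t2] the fourth moment gives [12 t2 * sum |z| ^ 2 <= 3 P t2 ^ 2], so the
   remainders have mean square at most [t2 / 4]. Scaled by [c] they are admissible, and the mean of
   [q (z x)] is at most [S / 4]. *)
pose c : R := 2 * (Num.sqrt P)^-1; have c2 : c ^+ 2 = 4 / P by rewrite exprMn exprVn sqr_sqrtr ?(ltW P0) //; ring.
have zadm : adm [seq c%:C%C *: z x | x <- sign_sums s'].
  move=> i; rewrite big_map.
  have -> : \sum_(x <- sign_sums s') normc ((c%:C%C *: z x) i 0) ^+ 2 =
      4 / P * \sum_(x <- sign_sums s') normc (z x i 0) ^+ 2.
    rewrite mulr_sumr; apply: eq_bigr => x _.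
    by rewrite mxE normcM normcR exprMn real_normK ?num_real // c2.
  rewrite mulrAC ler_pdivrMr //.
  have zE x : normc (z x i 0) ^+ 2 = if normc (x i 0) ^+ 2 <= 12 * t2 i then 0 else normc (x i 0) ^+ 2.
    by rewrite !mxE; case: ifP; rewrite ?subrr ?normc0 ?expr0n // subr0.
  (* On a coordinate where the profile vanishes one cannot divide by it, but all sign sums vanish
     there. *)
  have [t0|tn] := eqVneq (t2 i) 0.
    have x0 : \sum_(x <- sign_sums s') normc (x i 0) ^+ 2 <= 0.
      rewrite (sign_sums_parallelogram (q := fun x => normc (x i 0) ^+ 2)).
        have h0 : \sum_(v <- s') normc (v i 0) ^+ 2 <= 0 by apply: le_trans (hs' i) _; rewrite t0.
        by rewrite -/P mulr_ge0_le0 // ltW.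
      by move=> x w; rewrite !mxE normc_parallelogram.
    rewrite t0 mul0r mulrC; have : \sum_(x <- sign_sums s') normc (z x i 0) ^+ 2 <= 0; last lra.
    apply: le_trans x0; apply: ler_sum => x _; rewrite zE; case: ifP => // _; exact: sqr_ge0.
  have tp : 0 < t2 i by rewrite lt_def tn t20.
  have h4 := sign_sums_fourth s' i.
  have hz : 12 * t2 i * \sum_(x <- sign_sums s') normc (z x i 0) ^+ 2 <=
      \sum_(x <- sign_sums s') normc (x i 0) ^+ 4.
    rewrite mulr_sumr; apply: ler_sum => x _; rewrite zE.
    have -> : normc (x i 0) ^+ 4 = normc (x i 0) ^+ 2 * normc (x i 0) ^+ 2 by rewrite -exprD.
    case: ifPn => h; first by rewrite mulr0 mulr_ge0 ?sqr_ge0.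
    by apply: ler_wpM2r; [exact: sqr_ge0|rewrite ltW // ltNge].
  have hs2 : (\sum_(v <- s') normc (v i 0) ^+ 2) ^+ 2 <= t2 i ^+ 2.
    by rewrite ler_pXn2r ?nnegrE //; apply: sumr_ge0 => v _; exact: sqr_ge0.
  have P30 : 0 <= 3 * P by rewrite mulr_ge0 // ltW.
  have h5 := ler_wpM2l P30 hs2.
  rewrite -(ler_pM2l tp); rewrite -/P in h4; lra.
have hx : P * \sum_(v <- s') q v <= P * (24 * A) + 2 * \sum_(x <- sign_sums s') q (z x).
  rewrite -(sign_sums_parallelogram s' q_par).
  apply: (@le_trans _ _ (\sum_(x <- sign_sums s') (24 * A + 2 * q (z x)))).
    apply: ler_sum => x _; have -> : x = y x + z x by rewrite addrC subrK.
    by apply: (le_trans (form_sqrD _ _)); have := yq (y x + z x); have -> : y x + z x = x; [rewrite addrC subrK|have := yq x; lra].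
  by rewrite big_split /= sum_sign_sums_cst -mulr_sumr.
have hz := leS _ zadm; rewrite big_map in hz.
have hz2 : 4 / P * \sum_(x <- sign_sums s') q (z x) <= S.
  by apply: le_trans hz; rewrite mulr_sumr; apply: ler_sum => x _; rewrite qZ c2.
rewrite mulrAC ler_pdivrMr // in hz2.
rewrite -(ler_pM2l P0); lra.
Qed.

End form.
End grothendieck.

(** * Separation from a cone of diagonal matrices *)

Section separation.
Variables (R : realType) (n : nat).
Local Notation C := R[i].
Local Notation Re := complex.Re.
Implicit Types (x y w : 'M[C]_n) (v u : 'cV[C]_n) (s : seq 'cV[C]_n) (a : R).

(** The real Frobenius inner product, the real part of the trace of [x] times the adjoint of [y];
    [ip x (rank1 v)] is the quadratic form of a Hermitian [x] at [v]. *)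
Definition ip x y : R := \sum_i \sum_j Re (x i j * (y i j)^*%C).

Definition rank1 v : 'M[C]_n := \matrix_(i, j) (v i 0 * (v j 0)^*%C).

(** Positive semidefinite matrices are handled as finite sums of rank-one ones, so that separation
    directly yields a finite family of vectors. *)
Definition psum s : 'M[C]_n := \sum_(v <- s) rank1 v.

Definition herm x := forall i j, x i j = (x j i)^*%C.

Lemma conjc_sum (I : Type) (r : seq I) (f : I -> C) : (\sum_(i <- r) f i)^*%C = \sum_(i <- r) (f i)^*%C.
Proof.
elim: r => [|i r IH]; first by rewrite !big_nil conjc0.
by rewrite !big_cons -IH; case: (f i) (\sum_(k <- r) f k) => a b [c d] /=; rewrite opprD.
Qed.

Lemma Re_sum (I : Type) (r : seq I) (f : I -> C) : Re (\sum_(i <- r) f i) = \sum_(i <- r) Re (f i).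
Proof. by elim: r => [|i r IH]; rewrite ?big_nil // !big_cons cReD IH. Qed.

Lemma realc_sum (I : Type) (r : seq I) (f : I -> R) : (\sum_(i <- r) f i)%:C%C = \sum_(i <- r) (f i)%:C%C :> C.
Proof.
elim: r => [|i r IH]; first by rewrite !big_nil.
by rewrite !big_cons -IH; apply: complexP; rewrite /= ?addr0.
Qed.

Lemma ipD x y w : ip (x + y) w = ip x w + ip y w.
Proof.
rewrite /ip -big_split; apply: eq_bigr => i _; rewrite -big_split; apply: eq_bigr => j _.
by rewrite mxE mulrDl cReD.
Qed.

Lemma ipZ a x w : ip (a%:C%C *: x) w = a * ip x w.
Proof.
rewrite /ip mulr_sumr; apply: eq_bigr => i _; rewrite mulr_sumr; apply: eq_bigr => j _.
by rewrite mxE -mulrA; case: (x i j * _) => c d /=; rewrite mul0r subr0.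
Qed.

Lemma ipC x w : ip x w = ip w x.
Proof.
rewrite /ip; apply: eq_bigr => i _; apply: eq_bigr => j _.
by case: (x i j) => c d; case: (w i j) => e f /=; ring.
Qed.

Lemma ip0 w : ip 0 w = 0.
Proof. by have := ipZ 0 0 w; rewrite scaler0 mul0r. Qed.

Lemma ipN x w : ip (- x) w = - ip x w.
Proof. by apply/eqP; rewrite -subr_eq0 opprK -ipD addNr ip0. Qed.

Lemma ipB x y w : ip (x - y) w = ip x w - ip y w.
Proof. by rewrite ipD ipN. Qed.

Lemma ipDr x y w : ip w (x + y) = ip w x + ip w y.
Proof. by rewrite !(ipC w) ipD. Qed.

Lemma ipZr a x w : ip w (a%:C%C *: x) = a * ip w x.
Proof. by rewrite !(ipC w) ipZ. Qed.

Lemma ip_ge0 x : 0 <= ip x x.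
Proof.
apply: sumr_ge0 => i _; apply: sumr_ge0 => j _.
by case: (x i j) => c d /=; rewrite mulrN opprK addr_ge0 // -expr2 sqr_ge0.
Qed.

Lemma ip_sqrD x y a : ip (x + a%:C%C *: y) (x + a%:C%C *: y) = ip x x + 2 * a * ip x y + a ^+ 2 * ip y y.
Proof. by rewrite !(ipD, ipDr, ipZ, ipZr) (ipC y x); ring. Qed.

Lemma ip_sqrD_le x y : ip (x + y) (x + y) <= 2 * ip x x + 2 * ip y y.
Proof.
have := ip_ge0 (x - y); rewrite ipB !(ipC _ (x - y)) !ipB ipD !(ipC _ (x + y)) !ipD (ipC y x); lra.
Qed.

Lemma ip_psum x s : ip x (psum s) = \sum_(v <- s) ip x (rank1 v).
Proof.
rewrite /psum; elim: s => [|v s IH]; first by rewrite !big_nil ipC ip0.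
by rewrite !big_cons ipDr IH.
Qed.

Lemma psum_cons v s : psum (v :: s) = rank1 v + psum s.
Proof. by rewrite /psum big_cons. Qed.

Lemma rank1Z a v : rank1 (a%:C%C *: v) = (a ^+ 2)%:C%C *: rank1 v.
Proof. by apply/matrixP => i j; rewrite !mxE conjM conjR expr2 realcM; ring. Qed.

Lemma psumZ a s : psum [seq a%:C%C *: v | v <- s] = (a ^+ 2)%:C%C *: psum s.
Proof. by rewrite /psum big_map scaler_sumr; apply: eq_bigr => v _; exact: rank1Z. Qed.

Lemma ip_rank1 v u : ip (rank1 v) (rank1 u) = normc (\sum_i v i 0 * (u i 0)^*%C) ^+ 2.
Proof.
set S := \sum_i _; have -> : normc S ^+ 2 = Re (S * S^*%C).
  by rewrite normc_sqr; case: (S) => c d /=; ring.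
have -> : S^*%C = \sum_j (v j 0)^*%C * u j 0.
  by rewrite /S conjc_sum; apply: eq_bigr => j _; rewrite conjM conjK.
rewrite /ip mulr_suml Re_sum; apply: eq_bigr => i _.
rewrite mulr_sumr Re_sum; apply: eq_bigr => j _.
by rewrite !mxE conjM conjK; congr Re; ring.
Qed.

Lemma ip_rank1_self v : ip (rank1 v) (rank1 v) = (\sum_i normc (v i 0) ^+ 2) ^+ 2.
Proof.
rewrite ip_rank1; have -> : \sum_i v i 0 * (v i 0)^*%C = (\sum_i normc (v i 0) ^+ 2)%:C%C.
  by rewrite realc_sum; apply: eq_bigr => i _; rewrite sqr_normcE.
by rewrite normcR real_normK ?num_real.
Qed.

(** Cauchy-Schwarz, the Frobenius norm of [rank1 v] being the squared length of [v]; it is read off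
    from one well-chosen nonnegative square, with [v = 0] apart. *)
Lemma ip_rank1_ge x v (e : R) : 0 < e -> ip x x <= e ^+ 2 -> - (e * \sum_i normc (v i 0) ^+ 2) <= ip x (rank1 v).
Proof.
move=> e0 h; set N := \sum_i _; have N0 : 0 <= N by apply: sumr_ge0 => i _; exact: sqr_ge0.
have E := ip_rank1_self v; rewrite -/N in E.
have [NZ|NN] := eqVneq N 0.
  have := ip_ge0 (rank1 v + (- ip x (rank1 v) / (ip x x + 1))%:C%C *: x).
  rewrite NZ mulr0 oppr0 ip_sqrD E NZ expr0n /= (ipC (rank1 v) x); set t := ip x (rank1 v).
  have p0 := ip_ge0 x; set P := ip x x in p0 *; have P1 : 0 < P + 1 by rewrite ltr_wpDl.
  have -> : 0 + 2 * (- t / (P + 1)) * t + (- t / (P + 1)) ^+ 2 * P = - (t ^+ 2 * (P + 2)) / (P + 1) ^+ 2.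
    by field; exact: lt0r_neq0.
  rewrite ler_pdivlMr ?exprn_gt0 // mul0r oppr_ge0 => h2.
  have t20 : t ^+ 2 <= 0.
    have P2 : 0 < P + 2 by rewrite ltr_wpDl.
    by rewrite -(pmulr_lle0 _ P2).
  have : t ^+ 2 = 0 by apply/eqP; rewrite eq_le t20 sqr_ge0.
  by move/eqP; rewrite sqrf_eq0 => /eqP ->.
have Np : 0 < N by rewrite lt_def NN N0.
have := ip_ge0 (x + (e / N)%:C%C *: rank1 v); rewrite ip_sqrD E => h2.
have h3 : 0 <= e ^+ 2 + 2 * (e / N) * ip x (rank1 v) + e ^+ 2.
  have E2 : (e / N) ^+ 2 * N ^+ 2 = e ^+ 2 by rewrite -exprMn divfK.
  rewrite E2 in h2; lra.
have h4 : 0 <= e * (e + ip x (rank1 v) / N).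
  have -> : e * (e + ip x (rank1 v) / N) = (e ^+ 2 + 2 * (e / N) * ip x (rank1 v) + e ^+ 2) / 2.
    by field; rewrite NN.
  by rewrite divr_ge0.
rewrite pmulr_rge0 // in h4; rewrite -mulNr -ler_pdivlMr //; lra.
Qed.

Lemma herm_hermsymmx x : herm x -> x \is hermsymmx.
Proof.
move=> h; apply/is_hermitianmxP; rewrite expr0 scale1r; apply/matrixP => i j.
by rewrite !mxE h.
Qed.

Lemma hermD x y : herm x -> herm y -> herm (x + y).
Proof. by move=> hx hy i j; rewrite !mxE hx hy; apply: complexP; rewrite /=; case: (x j i) (y j i) => a b [c d] /=; ring. Qed.

Lemma hermN x : herm x -> herm (- x).
Proof. by move=> hx i j; rewrite !mxE hx; case: (x j i). Qed.

Lemma herm_psum s : herm (psum s).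
Proof.
rewrite /psum; elim: s => [|v s IH]; first by rewrite big_nil => i j; rewrite !mxE conjc0.
by rewrite big_cons; apply: hermD => // i j; rewrite !mxE conjM conjK mulrC.
Qed.

(** Spectral theorem: the hypothesis on eigenvectors says that the eigenvalues are at least [- a],
    and the vectors are eigenvectors scaled by the square roots of the shifted eigenvalues. *)
Lemma herm_psumP x (a : R) : herm x -> 0 <= a ->
  (forall v, - (a * \sum_i normc (v i 0) ^+ 2) <= ip x (rank1 v)) ->
  exists s, x + a%:C%C%:M = psum s.
Proof.
move=> hx a0 H; have hh := herm_hermsymmx hx.
have := orthomx_spectralP (hermitian_normalmx hh); set U := spectralmx x; set sp := spectral_diag x => /= xE.
have Uu : U \is unitarymx := spectral_unitarymx x.
have UU : U *m (U ^t*)%sesqui = 1%:M := unitarymxP Uu.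
have iU : invmx U = (U ^t*)%sesqui by exact: invmx_unitary.
have UU2 : (U ^t*)%sesqui *m U = 1%:M by exact: mulmx1C UU.
have spr k : sp 0 k = (Re (sp 0 k))%:C%C.
  by rewrite RRe_real //; have /mxOverP := hermitian_spectral_diag_real hh; exact.
pose v k : 'cV[C]_n := \col_i (U k i)^*%C.
have oneE : 1%:M = \sum_k rank1 (v k) :> 'M[C]_n.
  rewrite -UU2; apply/matrixP => i j; rewrite summxE mxE; apply: eq_bigr => k _.
  by rewrite !mxE conjK.
have xs : x = \sum_k sp 0 k *: rank1 (v k).
  rewrite xE iU; apply/matrixP => i j; rewrite summxE mxE; apply: eq_bigr => k _.
  by rewrite mul_mx_diag !mxE conjK; ring.
have nv k : \sum_i normc (v k i 0) ^+ 2 = 1.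
  have E := congr1 (fun A : 'M[C]_n => A k k) UU; rewrite /= !mxE eqxx in E.
  have : (\sum_i normc (v k i 0) ^+ 2)%:C%C = 1%:C%C :> C.
    rewrite -[1%:C%C]/(1%:R : C) -E realc_sum; apply: eq_bigr => i _.
    by rewrite !mxE normcJ sqr_normcE.
  by move=> /(congr1 (@complex.Re R)).
have fv k : ip x (rank1 (v k)) = Re (sp 0 k).
  have D : U *m x *m (U ^t*)%sesqui = diag_mx sp.
    by rewrite xE iU !mulmxA UU mul1mx -mulmxA UU mulmx1.
  have E := congr1 (fun A : 'M[C]_n => A k k) D; rewrite /= !mxE eqxx mulr1n in E; rewrite -E.
  rewrite /ip Re_sum exchange_big /=; apply: eq_bigr => j _.
  rewrite mxE mulr_suml Re_sum; apply: eq_bigr => i _.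
  by rewrite !mxE conjM !conjK; congr Re; ring.
have pos k : 0 <= Re (sp 0 k) + a by have := H (v k); rewrite nv mulr1 fv; lra.
exists [seq (Num.sqrt (Re (sp 0 k) + a))%:C%C *: v k | k <- index_enum 'I_n].
rewrite /psum big_map {1}xs -scalemx1 oneE scaler_sumr -big_split /=; apply: eq_bigr => k _.
have E : sp 0 k + a%:C%C = (Re (sp 0 k) + a)%:C%C.
  by rewrite {1}(spr k); apply: complexP; rewrite /= ?addr0.
by rewrite rank1Z sqr_sqrtr // -E scalerDl.
Qed.

Variables (G : 'M[C]_n) (J : Type) (m : J -> 'I_n -> R) (j0 : J) (mu0 mu1 D : R).
Hypothesis Gherm : herm G.
Hypothesis m_ge0 : forall j i, 0 <= m j i.
Hypothesis m_le : forall j i, m j i <= mu1.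
Hypothesis mu0_gt0 : 0 < mu0.
Hypothesis m_ge : forall i, mu0 <= m j0 i.
Hypothesis D_ge0 : 0 <= D.
Hypothesis G_tr : 0 <= ip G 1%:M.
Hypothesis G_le : forall s, (forall j, \sum_i (\sum_(v <- s) normc (v i 0) ^+ 2) * m j i <= 1) ->
  \sum_(v <- s) ip G (rank1 v) <= D.
Implicit Type l : seq (R * J).

(** A combination of the diagonal matrices [m j] is coded by the list of its weights and indices;
    [aw] gives its diagonal entries and [amx] the matrix. *)
Definition aw l i : R := \sum_(k <- l) k.1 * m k.2 i.

Definition amx l : 'M[C]_n := diag_mx (\row_i (aw l i)%:C%C).

Let ok l := all (fun k : R * J => 0 <= k.1) l /\ \sum_(k <- l) k.1 <= D.

Lemma ip_amx l x : ip (amx l) x = \sum_i aw l i * Re (x i i).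
Proof.
rewrite /ip; apply: eq_bigr => i _; rewrite (bigD1 i) //= big1 ?addr0 => [|j ji].
  by rewrite !mxE eqxx mulr1n; case: (x i i) => c d /=; rewrite mul0r subr0.
by rewrite !mxE eq_sym (negbTE ji) mulr0n mul0r.
Qed.

Lemma ip_amx_rank1 l v : ip (amx l) (rank1 v) = \sum_i aw l i * normc (v i 0) ^+ 2.
Proof.
rewrite ip_amx; apply: eq_bigr => i _; rewrite mxE normc_sqr.
by case: (v i 0) => c d /=; congr (_ * _); ring.
Qed.

Lemma aw_cons k l i : aw (k :: l) i = k.1 * m k.2 i + aw l i.
Proof. by rewrite /aw big_cons. Qed.

Lemma aw_ge0 l i : all (fun k : R * J => 0 <= k.1) l -> 0 <= aw l i.
Proof.
elim: l => [|k l IH] /=; first by rewrite /aw big_nil.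
by case/andP=> k0 hl; rewrite aw_cons addr_ge0 ?IH // mulr_ge0.
Qed.

Lemma aw_le l i : all (fun k : R * J => 0 <= k.1) l -> aw l i <= (\sum_(k <- l) k.1) * mu1.
Proof.
elim: l => [|k l IH] /=; first by rewrite /aw !big_nil mul0r.
by case/andP=> k0 hl; rewrite aw_cons big_cons mulrDl lerD ?IH // ler_wpM2l.
Qed.

Let scl (a : R) l := [seq (a * k.1, k.2) | k <- l].

Lemma aw_scale a l i : aw (scl a l) i = a * aw l i.
Proof. by rewrite /aw big_map mulr_sumr; apply: eq_bigr => u _; rewrite mulrA. Qed.

Lemma amx_mix (a b : R) l j : amx ((b, j) :: scl a l) = a%:C%C *: amx l + b%:C%C *: amx [:: (1, j)].
Proof.
apply/matrixP => i k; rewrite !mxE aw_cons aw_scale aw_cons /= /aw big_nil addr0 mul1r.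
case: (i == k); rewrite ?mulr0n ?mulr0 ?addr0 // !mulr1n; apply: complexP; rewrite /=; ring.
Qed.

Lemma herm_amx l : herm (amx l).
Proof.
move=> i j; rewrite !mxE eq_sym; case: eqVneq => [->|_]; rewrite ?mulr1n ?mulr0n ?conjc0 //.
by rewrite conjc_real.
Qed.

(** Residuals of [G] after subtracting a combination of total weight at most [D] and adding a
    positive semidefinite matrix. The aim is to show that this convex set comes arbitrarily close to
    0. *)
Let F y := exists l s, ok l /\ y = G - amx l + psum s.

Let F_herm y : F y -> herm y.
Proof.
move=> [l [s [_ ->]]]; apply: hermD; last exact: herm_psum.
by apply: hermD => //; apply: hermN; exact: herm_amx.
Qed.

(** Bounds the squared distance of two admissible diagonals, hence the length of directions along
    them, independently of the step. *)
Let ca : R := n%:R * (D * mu1) ^+ 2.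

Let ca_ge0 : 0 <= ca. Proof. by rewrite mulr_ge0 // sqr_ge0. Qed.

Let mu1_ge0 (i : 'I_n) : 0 <= mu1. Proof. exact: le_trans (m_ge0 j0 i) (m_le j0 i). Qed.

Let ip_amx_diff l l' : ok l -> ok l' -> ip (amx l - amx l') (amx l - amx l') <= ca.
Proof.
move=> [l0 lD] [l0' lD'].
have -> : amx l - amx l' = diag_mx (\row_i (aw l i - aw l' i)%:C%C).
  apply/matrixP => i k; rewrite !mxE; case: (i == k); rewrite ?mulr0n ?subr0 // !mulr1n rmorphB //.
rewrite /ip /ca -[n in n%:R]card_ord -sum1_card natr_sum mulr_suml; apply: ler_sum => i _.
rewrite mul1r (bigD1 i) //= big1 ?addr0 => [|j ji]; last first.
  by rewrite !mxE eq_sym (negbTE ji) mulr0n mul0r.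
rewrite !mxE eqxx mulr1n /= mul0r subr0 -expr2; move: (mu1_ge0 i) => u0.
have b l1 (h0 : all (fun k : R * J => 0 <= k.1) l1) (hD : \sum_(k <- l1) k.1 <= D) : 0 <= aw l1 i <= D * mu1.
  by rewrite aw_ge0 //= (le_trans (aw_le _ _)) // ler_wpM2r.
have /andP[x0 x1] := b l l0 lD; have /andP[y0 y1] := b l' l0' lD'.
rewrite -[leLHS]real_normK ?num_real // ler_pXn2r ?nnegrE ?normr_ge0 ?mulr_ge0 //.
by rewrite ler_norml; apply/andP; split; lra.
Qed.

Let ok_nil : ok [::]. Proof. by split => //; rewrite big_nil. Qed.

Let ok_mix (t : R) l j : 0 <= t <= 1 -> ok l -> ok ((t * D, j) :: scl (1 - t) l).
Proof.
move=> /andP[t0 t1] [l0 lD]; split.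
  rewrite /= mulr_ge0 //= /scl all_map; apply: sub_all l0 => u u0 /=.
  by rewrite mulr_ge0 // subr_ge0.
rewrite big_cons /= /scl big_map -mulr_sumr /=.
have : (1 - t) * (\sum_(k <- l) k.1) <= (1 - t) * D by rewrite ler_wpM2l // subr_ge0.
lra.
Qed.

(** Bounds the squared norm of the positive part of a near minimizer, written as [y + amx l - G]
    with [|y| ^ 2 <= |G| ^ 2 + 1]. *)
Let cp : R := 2 * (2 * (ip G G + 1) + 2 * ca) + 2 * ip G G.

Let amx_nil : amx [::] = 0.
Proof. by apply/matrixP => i k; rewrite !mxE /aw big_nil; case: (_ == _); rewrite ?mulr0n ?mulr1n. Qed.

Let psum_nil : psum [::] = 0. Proof. by rewrite /psum big_nil. Qed.

(* First-order optimality at an almost minimal [y], along the three kinds of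
   admissible directions. *)
Let near_min (t : R) : 0 < t -> t <= 1 -> exists l s, let y := G - amx l + psum s in
  [/\ ok l, forall v, - (t * \sum_i normc (v i 0) ^+ 2) <= ip y (rank1 v),
      ip y (psum s) <= t * (1 + cp) / 2 &
      forall j, D * ip y (amx [:: (1, j)]) <= ip y (amx l) + t * (1 + ca) / 2].
Proof.
move=> t0 t1; pose E := [set r : R | exists2 y, F y & r = ip y y].
have FG : F G by exists [::], [::]; rewrite amx_nil psum_nil subr0 addr0.
have hE : has_inf E.
  by split; [exists (ip G G); exists G|exists 0 => r [y _ ->]; exact: ip_ge0].
(* Tolerance [t ^ 2] for steps of length [t]: the defect of minimality is then of the same order as
   the quadratic term in [dir]. *)
have t20 : 0 < t ^+ 2 by rewrite exprn_gt0.
have [r [y Fy rE] rlt] := inf_adherent t20 hE.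
have opt y' : F y' -> ip y y <= ip y' y' + t ^+ 2.
  move=> Fy'; have : inf E <= ip y' y' by apply: ge_inf; [exact: hE.2|exists y'].
  rewrite rE in rlt; lra.
have dir w : F (y + t%:C%C *: w) -> - (t * (1 + ip w w) / 2) <= ip y w.
  move=> /opt; rewrite ip_sqrD => h.
  have : 0 <= t * (2 * ip y w + t * (1 + ip w w)) by nra.
  by rewrite pmulr_rge0 //; lra.
have [l [s [okl yE]]] := Fy; have [l0 lD] := okl.
exists l, s; rewrite -yE /=; split => //.
- move=> v; set Nv := \sum_i _; have N0 : 0 <= Nv by apply: sumr_ge0 => i _; exact: sqr_ge0.
  have [NZ|NN] := eqVneq Nv 0.
    rewrite NZ mulr0 oppr0.
    have h (e : R) : 0 < e -> 0 <= ip y (rank1 v) + e.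
      move=> e0; pose a := Num.sqrt (ip y y + 1); have a0 : 0 < a by rewrite sqrtr_gt0 ltr_wpDl // ip_ge0.
      have ha : ip y y <= a ^+ 2 by rewrite /a sqr_sqrtr ?addr_ge0 ?ip_ge0 // lerDl.
      have := ip_rank1_ge v a0 ha; rewrite -/Nv NZ mulr0 oppr0; lra.
    by rewrite leNgt; apply/negP => hneg; have := h (- ip y (rank1 v) / 2); lra.
  have Np : 0 < Nv by rewrite lt_def NN N0.
  (* First direction: adding a rank-one matrix, normalized to have norm 1. *)
  pose k := (Num.sqrt Nv)^-1; have k2 : k ^+ 2 = Nv^-1 by rewrite exprVn sqr_sqrtr.
  have st : Num.sqrt t ^+ 2 = t by rewrite sqr_sqrtr // ltW.
  have : F (y + t%:C%C *: rank1 (k%:C%C *: v)).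
    exists l, ((Num.sqrt t)%:C%C *: (k%:C%C *: v) :: s); split => //.
    by rewrite psum_cons (rank1Z (Num.sqrt t)) st yE; rewrite -!addrA; congr (_ + (_ + _)); rewrite addrC.
  move=> /dir; rewrite rank1Z k2 !(ipZ, ipZr) ip_rank1_self -/Nv.
  have -> : Nv^-1 * (Nv^-1 * Nv ^+ 2) = 1 by field.
  rewrite (mulrC Nv^-1) ler_pdivlMr //; lra.
(* Second direction: shrinking the positive part, which stays a sum of rank-one matrices because
   [t <= 1]. *)
- have Fp : F (y + t%:C%C *: (- psum s)).
    exists l, [seq (Num.sqrt (1 - t))%:C%C *: v | v <- s]; split => //.
    rewrite psumZ sqr_sqrtr ?subr_ge0 // yE rmorphB rmorph1 scalerBl scale1r scalerN -!addrA //.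
  have := dir _ Fp; rewrite ipC ipN ipN (ipC (psum s) (- psum s)) ipN opprK (ipC (psum s) y) => h.
  have hp : ip (psum s) (psum s) <= cp.
    have -> : psum s = (y + amx l) + (- G) by rewrite yE (_ : G - amx l + psum s + amx l = G + psum s) addrAC ?subrK // subrr add0r.
    apply: (le_trans (ip_sqrD_le _ _)); rewrite ipN (ipC G (- G)) ipN opprK.
    have h1 := ip_sqrD_le y (amx l).
    have h2 : ip (amx l) (amx l) <= ca by have := ip_amx_diff okl ok_nil; rewrite amx_nil subr0.
    have h3 : ip y y <= ip G G + 1.
      by apply: (le_trans (opt G FG)); rewrite lerD2l exprn_ile1 // ltW.
    rewrite /cp; lra.
  have := ler_wpM2l (ltW t0) hp; lra.
- move=> j; set Aj := amx [:: (1, j)].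
  have okj : ok [:: (D, j)] by split; rewrite /= ?andbT // big_seq1.
  have ajE : amx [:: (D, j)] = D%:C%C *: Aj.
    by have := amx_mix 0 D [::] j; rewrite scale0r add0r /scl /=.
  (* Third direction: moving the combination towards the whole budget [D] on the single index [j];
     the total weight stays at most [D]. *)
  have Fa : F (y + t%:C%C *: (amx l - D%:C%C *: Aj)).
    exists ((t * D, j) :: scl (1 - t) l), s; split; first by apply: ok_mix => //; rewrite (ltW t0).
    have sc (x : 'M[C]_n) : (1 - t)%:C%C *: x = x - t%:C%C *: x.
      by apply/matrixP => i k; rewrite !mxE; case: (x i k) => c d; apply: complexP; rewrite /=; ring.
    rewrite amx_mix yE sc realcM -scalerA -/Aj; move: (amx l) (psum s) (D%:C%C *: Aj) => x1 x2 x3.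
    by apply/matrixP => i k; rewrite !mxE; ring.
  have hd : ip (amx l - D%:C%C *: Aj) (amx l - D%:C%C *: Aj) <= ca by rewrite -ajE; exact: ip_amx_diff.
  have e1 : ip y (amx l - D%:C%C *: Aj) = ip y (amx l) - D * ip y Aj by rewrite ipC ipB ipZ !(ipC _ y).
  have h := dir _ Fa; rewrite e1 in h.
  have := ler_wpM2l (ltW t0) hd; lra.
Qed.

(** The near minimizer [y] is positive up to [t], so [y + t] is a family [s'] that [G_le] can test
    after division by its worst mass [X]; thus [ip G y] is at most about [D X]. Optimality makes
    [ip y (amx l)] at least about [D X] and [ip y (psum s)] about 0, so [ip y y] is small. *)
Theorem separation (eps : R) : 0 < eps -> exists l, all (fun k : R * J => 0 <= k.1) l /\
  \sum_(k <- l) k.1 <= D + eps /\ forall v, 0 <= ip (amx l - G) (rank1 v).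
Proof.
move=> eps0; pose e := eps * mu0; have e0 : 0 < e by rewrite mulr_gt0.
have ig := ip_ge0 G.
have cp0 : 0 <= cp by rewrite /cp; have := ca_ge0; lra.
pose M : R := D * \sum_(i < n) mu1.
have M0 : 0 <= M by apply: mulr_ge0 => //; apply: sumr_ge0 => i _; exact: mu1_ge0 i.
pose c : R := 2 * D + (1 + ca) / 2 + M + (1 + cp) / 2 + 1.
have c0 : 0 < c.
  by rewrite /c; move: D_ge0 ca_ge0 M0 cp0; move: (ca) (M) (cp) => x1 x2 x3 *; lra.
(* [c] collects all error terms of the estimate of [ip y y], each being proportional to [t]. *)
pose t := Num.min 1 (e ^+ 2 / c).
have t0 : 0 < t by rewrite lt_min ltr01 divr_gt0 // exprn_gt0.
have t1 : t <= 1 by rewrite ge_min lexx.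
have tc : t * c <= e ^+ 2 by rewrite -ler_pdivlMr // ge_min lexx orbT.
have [l [s]] := near_min t0 t1; set y := G - amx l + psum s => -[[l0 lD] h3 h1 h2].
have hy : herm y by apply: F_herm; exists l, s.
have [s' s'E] := herm_psumP hy (ltW t0) h3.
pose T i := \sum_(v <- s') normc (v i 0) ^+ 2.
have T0 i : 0 <= T i by apply: sumr_ge0 => v _; exact: sqr_ge0.
pose al j := \sum_i T i * m j i.
have al0 j : 0 <= al j by apply: sumr_ge0 => i _; rewrite mulr_ge0.
pose E := [set r : R | exists j, r = al j].
have hE : has_sup E.
  split; first by exists (al j0); exists j0.
  exists (\sum_i T i * mu1) => r [j ->]; apply: ler_sum => i _; exact: ler_wpM2l.
pose X := sup E; have alX j : al j <= X by apply: ub_le_sup; [exact: hE.2|exists j].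
have X0 : 0 <= X := le_trans (al0 j0) (alX j0).
(* The index set is infinite and the supremum may not be attained; an index within [t] of it
   suffices. *)
have [r [j ->] jX] := sup_adherent t0 hE.
have Xt : 0 < X + t by rewrite ltr_wpDl.
pose k := (Num.sqrt (X + t))^-1; have k2 : k ^+ 2 = (X + t)^-1 by rewrite exprVn sqr_sqrtr // ltW.
have GX : ip G (psum s') <= D * (X + t).
  have := @G_le [seq k%:C%C *: v | v <- s'] _; rewrite -ip_psum psumZ k2 ipZr.
  rewrite ler_pdivrMl // [_ * D]mulrC; apply => j'.
  rewrite (eq_bigr (fun i => (X + t)^-1 * (T i * m j' i))); last first.
    move=> i _; rewrite big_map mulrA; congr (_ * _); rewrite /T mulr_sumr; apply: eq_bigr => v _.
    by rewrite mxE normcM normcR exprMn real_normK ?num_real // k2.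
  by rewrite -mulr_sumr ler_pdivrMl // mulr1 (le_trans (alX j')) // lerDl ltW.
have Gy : ip G y <= ip G (psum s').
  by rewrite -s'E -scalemx1 ipDr ipZr lerDl mulr_ge0 // ltW.
have Ay : al j = ip (amx [:: (1, j)]) y + t * ip (amx [:: (1, j)]) 1%:M.
  rewrite -ipZr scalemx1 -ipDr s'E ip_amx; apply: eq_bigr => i _.
  rewrite aw_cons /aw big_nil addr0 mul1r mulrC; congr (_ * _).
  rewrite /psum summxE Re_sum; apply: eq_bigr => v _.
  by rewrite mxE normc_sqr; case: (v i 0) => a b /=; ring.
have A1 : D * ip (amx [:: (1, j)]) 1%:M <= M.
  apply: ler_wpM2l => //; rewrite ip_amx; apply: ler_sum => i _.
  by rewrite aw_cons /aw big_nil addr0 mul1r mxE eqxx /= mulr1.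
have yy : ip y y <= e ^+ 2.
  apply: le_trans tc.
  have -> : ip y y = ip G y - ip y (amx l) + ip y (psum s).
    have e1 x : ip x (G - amx l + psum s) = ip G x - ip x (amx l) + ip x (psum s).
      by rewrite !ipDr (ipC x (- amx l)) ipN (ipC (amx l)) (ipC x G).
    exact: e1.
  have hj := h2 j; rewrite (ipC y) in hj.
  have : D * X <= D * (al j + t) by apply: ler_wpM2l => //; rewrite -/X in jX; lra.
  rewrite Ay; have := ler_wpM2l (ltW t0) A1; rewrite /c; nra.
(* The remaining error [y] is at most [e = eps * mu0] as a form, which [eps] times the diagonal of
   index [j0] dominates, its entries being at least [mu0]. *)
exists ((eps, j0) :: l); split; first by rewrite /= ltW.
split; first by rewrite big_cons /= addrC lerD2r.
move=> v; set Nv := \sum_i normc (v i 0) ^+ 2.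
have am : amx ((eps, j0) :: l) - G = (eps%:C%C *: amx [:: (1, j0)]) + (psum s - y).
  have := amx_mix 1 eps l j0; rewrite scale1r (_ : scl 1 l = l); last first.
    by rewrite /scl -[RHS]map_id; apply: eq_map => -[a b]; rewrite /= mul1r.
  have py : psum s - y = amx l - G by rewrite /y opprD addrCA subrr addr0 opprB.
  by move=> ->; rewrite py addrA (addrC (amx l)).
rewrite am ipD ipZ ipB.
have p1 : mu0 * Nv <= ip (amx [:: (1, j0)]) (rank1 v).
  rewrite ip_amx_rank1 mulr_sumr; apply: ler_sum => i _.
  by rewrite aw_cons /aw big_nil addr0 mul1r ler_wpM2r ?sqr_ge0.
have p2 : 0 <= ip (psum s) (rank1 v).
  by rewrite ipC ip_psum; apply: sumr_ge0 => u _; rewrite ip_rank1 sqr_ge0.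
have p3 : ip y (rank1 v) <= e * Nv.
  have := @ip_rank1_ge (- y) v e e0; rewrite ipN (ipC y) ipN opprK => /(_ yy).
  by rewrite ipN lerNl opprK.
have := ler_wpM2l (ltW eps0) p1; rewrite /e in p3; lra.
Qed.

End separation.

(** * A uniform bound for packets *)

Section packet_bound.
Variable R : realType.
Local Notation C := R[i].
Local Notation area := (@area R).
Local Notation disc := (@disc R).
Variable b : R.
Hypothesis b2 : 2 <= b.
Implicit Types (z w : C) (N : nat).

Let b0 : 0 <= b. Proof. exact: le_trans b2. Qed.
Let mD := @measurable_disc R.

(** The closed form of the primitive, available up to the factor [conj w]: [Lkernel] has one power
    of singularity less than its derivative. *)
Lemma LkernelM z w : disc z -> disc w -> (b + 1)%:C%C * w^*%C * Lkernel b z w = bker (b + 1) z w - 1.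
Proof.
move=> z1 w1; have d0 : disc 0 by rewrite /Defs.disc /mkset normc0.
pose F v := (b + 1)%:C%C * w^*%C * Lkernel b v w - bker (b + 1) v w.
have dF v : disc v -> has_cderiv F v 0.
  move=> v1; have h1 := has_cderivZ ((b + 1)%:C%C * w^*%C) (has_cderiv_Lkernel b0 v1 w1).
  have h2 := has_cderiv_bker (b + 1) (normcMJ_lt1 v1 w1).
  have := has_cderivB h1 h2; rewrite (_ : b + 1 + 1 = b + 2); last by ring.
  by rewrite subrr.
have := cderiv0_cst dF z1; rewrite /F Lkernel0 mulr0 sub0r.
have -> : bker (b + 1) 0 w = 1.
  by rewrite /bker mul0r subr0 (_ : 1 = 1%:C%C) // cpow_real ?powR1 ?invr1.
by move=> h; rewrite -h; ring.
Qed.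

(** Where the integrand is of size [2 ^ n], the point [w] is within [8 * 2 ^- n] of [z]; the pieces
    contribute multiples of [2 ^- n]. *)
Lemma integral_inv_kernel_le z : disc z ->
  (\int[area]_(w in disc) (normc (1 - z * w^*%C))^-1%:E <= 256%:E)%E.
Proof.
move=> z1; pose B n := cball z (8 * 2 ^- n : R).
have e0 n : 0 < 2 ^- n :> R by rewrite invr_gt0 exprn_gt0.
have mB n : measurable (B n) by exact: measurable_cball.
have mG : measurable_fun disc (fun w => (normc (1 - z * w^*%C))^-1%:E).
  apply/measurable_EFinP; apply: measurable_funTS; apply: measurable_funV_ge0 => [w|]; first exact: normc_ge0.
  apply: measurable_normc; apply: measurable_funBC; first exact: measurable_cst.
  by apply: measurable_funMC; [exact: measurable_cst|apply: measurable_funJ; exact: measurable_id].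
apply: (le_trans (@dyadic_cover R disc (fun w => (normc (1 - z * w^*%C))^-1%:E) B (fun n w => (2 ^+ n)%:E) mD
  mB mG _ _ _ _)).
- by move=> n; exact: measurable_cst.
- by move=> w _; rewrite lee_fin invr_ge0 normc_ge0.
- by move=> n w _; rewrite lee_fin exprn_ge0.
- move=> w w1; have k0 := kernel_gt0 z1 w1; have kd := kernel_ge_dist z1 w1.
  have k2 : normc (1 - z * w^*%C) <= 2.
    apply: (le_trans (normcB _ _)); have := normcMJ_lt1 z1 w1; rewrite normc1; lra.
  move: (normc (1 - z * w^*%C)) k0 kd k2 => k k0 kd k2.
  have h2 : 0 < 2^-1 :> R by rewrite invr_gt0.
  have ki : 0 <= k^-1 by rewrite invr_ge0 ltW.
  have [n [n1 n2]] := @dyadic_scale R k^-1 2^-1 h2 ki.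
  have p0 : 0 < 2 ^+ n :> R by rewrite exprn_gt0.
  exists n; split; last by rewrite lee_fin ltW // (lt_le_trans n1) // ler_piMr ?(ltW p0) // invf_le1 // ler1n.
  rewrite /B /cball /mkset normcBC (le_lt_trans kd) // ltr_pdivlMr //.
  have m : 2 ^+ n / 2 * k <= Num.max 2^-1 (2 * k^-1) * k by rewrite ler_wpM2r // ltW.
  have : Num.max 2^-1 (2 * k^-1) * k <= 2.
    by rewrite maxr_pMl ?(ltW k0) // ge_max -mulrA mulVf ?lt0r_neq0 // mulr1 lexx andbT; lra.
  lra.
apply: (@le_trans _ _ (\sum_(n <oo) (128 * 2 ^- n)%:E)%E).
  apply: lee_nneseries => [n _ _|n _]; first by apply: integral_ge0 => w _; rewrite lee_fin exprn_ge0.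
  have mDB : measurable (disc `&` B n) by exact: measurableI.
  rewrite (integral_cst area mDB (2 ^+ n)%:E).
  apply: (@le_trans _ _ ((2 ^+ n)%:E * (2 * (8 * 2 ^- n) ^+ 2)%:E)%E).
    apply: lee_wpmul2l; first by rewrite lee_fin exprn_ge0.
    apply: (@le_trans _ _ (area (B n))); first by apply: le_measure; rewrite ?inE // => w [].
    by apply: le_area_cball; rewrite mulr_ge0 // ltW.
  rewrite -EFinM lee_fin le_eqVlt; apply/orP; left; apply/eqP.
  have p0 : 2 ^+ n != 0 :> R by rewrite expf_neq0.
  by move: (2 ^+ n : R) p0 => x x0; field.
apply: (le_trans (@sum_half_le R 128 (fun n => 128 * 2 ^- n) _ _)) => [n|n|].
- by rewrite mulr_ge0 // ltW.
- by [].
- by rewrite lee_fin -natrM.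
Qed.

(** After the weight has cancelled [b] powers of the singularity, only [1 / |1 - z conj w|] remains,
    whose integral is bounded uniformly in [z]. Boundedness makes products of packets integrable for
    every finite measure. *)
Lemma packet_bounded : exists2 B : R, 0 <= B & forall N (Q : cell_index N) z, disc z -> normc (packet b Q z) <= B.
Proof.
pose c1 : R := (b + 1) * (2 * 2 `^ (b + 2)) + 2; pose c2 : R := 2 * 2 `^ b.
have b10 : 0 <= b + 1 by rewrite addr_ge0.
have P0 (x : R) : 0 <= 2 `^ x by exact: powR_ge0.
have c10 : 0 <= c1 by rewrite addr_ge0 // mulr_ge0 // mulr_ge0.
have c20 : 0 <= c2 by rewrite mulr_ge0.
pose c3 : R := 256; have c30 : 0 <= c3 by exact: ler0n.
exists (2 * (c1 * 2 + c2 * c3)).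
  by apply: mulr_ge0 => //; apply: addr_ge0; exact: mulr_ge0.
move=> N Q z z1; rewrite (packetE b2 Q z1).
have mL := measurable_Lkernel b0 z1; have x0 : 0 < 1 - normc z by rewrite subr_gt0.
have mcut := cintegrable_measurable (cintegrable_cutoff b2).
have mI : measurable_fun disc (fun w => (b + 1)%:C%C * (\1_(cell_ Q) w)%:C%C * cutoff 1 b w * Lkernel b z w).
  apply: measurable_funMC => //; apply: measurable_funMC => //.
  apply: measurable_funMC; first exact: measurable_cst.
  by apply: measurable_funR; apply: measurable_indic; exact: measurable_cell_.
have bd w : disc w -> normc ((b + 1)%:C%C * (\1_(cell_ Q) w)%:C%C * cutoff 1 b w * Lkernel b z w) <=
    c1 + c2 * (normc (1 - z * w^*%C))^-1.
  move=> w1; rewrite !normcM [normc (b + 1)%:C%C]normcR ger0_norm //.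
  have i1 : normc (\1_(cell_ Q) w)%:C%C <= 1 :> R.
    by rewrite normcR indicE; case: (_ \in _); rewrite ?normr1 ?normr0.
  have u1 := cutoff_bounded w b2; have L0 := normc_ge0 (Lkernel b z w).
  have k0 := kernel_gt0 z1 w1; have ki : 0 <= (normc (1 - z * w^*%C))^-1 by rewrite invr_ge0 ltW.
  apply: (@le_trans _ _ ((b + 1) * (normc (cutoff 1 b w) * normc (Lkernel b z w)))).
    rewrite -!mulrA; apply: ler_wpM2l => //; rewrite ler_piMl // mulr_ge0 ?normc_ge0 //.
  (* [LkernelM] loses control near [w = 0], but there the kernel has no singularity and the mean
     value inequality suffices. *)
  have [wh|wh] := leP (normc w) 2^-1.
    have Lb : normc (Lkernel b z w) <= 2 * 2 `^ (b + 2).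
      have kb (t : R) : 0 <= t <= 1 -> disc (0 + t%:C%C * z).
        move=> /andP[t0 t1]; rewrite add0r /Defs.disc /mkset normr_line ger0_norm //.
        by apply: le_lt_trans z1; rewrite ler_piMl ?normc_ge0.
      have := @cmean_value R (Lkernel b ^~ w) (fun v => bker (b + 2) v w) 0 z (2 `^ (b + 2)).
      rewrite add0r Lkernel0 subr0 => H.
      have := H (fun t t01 => has_cderiv_Lkernel b0 (kb t t01) w1); move=> {}H.
      apply: (le_trans (H _)) => [t t01|].
        have v1 := kb t t01; rewrite normc_bker; last exact: normcMJ_lt1.
        have g : 2^-1 <= normc (1 - (0 + t%:C%C * z) * w^*%C).
          by rewrite kernel_sym; apply: le_trans (normc_ker_ge w v1); lra.
        have g0 : 0 < normc (1 - (0 + t%:C%C * z) * w^*%C) by exact: kernel_gt0.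
        have E : 2 `^ (b + 2) = ((2^-1) `^ (b + 2))^-1 :> R.
          by rewrite -powRN -powR_inv1 // -powRrM mulN1r opprK.
        rewrite E lef_pV2 ?posrE ?powR_gt0 ?invr_gt0 //.
        by apply: ge0_ler_powR; rewrite ?nnegrE ?invr_ge0 ?addr_ge0 // ltW.
      have : 2 `^ (b + 2) * normc z <= 2 `^ (b + 2) by rewrite ler_piMr // ltW.
      lra.
    apply: (@le_trans _ _ ((b + 1) * (2 * 2 `^ (b + 2)))).
      apply: ler_wpM2l => //; apply: le_trans Lb; rewrite ler_piMl //.
    rewrite /c1; have := mulr_ge0 c20 ki; lra.
  have n := congr1 (@normc R) (LkernelM z1 w1); rewrite !normcM normcJ normcR ger0_norm // in n.
  have h1 : (b + 1) * normc w * normc (Lkernel b z w) <= normc (bker (b + 1) z w) + 1.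
    by rewrite n -[X in _ <= _ + X](@normc1 R); exact: normcB.
  rewrite normc_bker in h1; last exact: normcMJ_lt1.
  set k := normc (1 - z * w^*%C) in h1 k0 ki *.
  have [_ dk] := kernel_ge_defect z1 w1; rewrite -/k (defectE w1) in dk.
  have cE : normc (cutoff 1 b w) = (1 - normc w ^+ 2) `^ b.
    by rewrite cutoffE // normcR ger0_norm // powR_ge0.
  have h2 : normc (cutoff 1 b w) * (k `^ (b + 1))^-1 <= 2 `^ b * k^-1.
    rewrite cE powRD; last by rewrite (gt_eqF k0) implybT.
    rewrite powRr1 ?(ltW k0) // invfM mulrA; apply: ler_wpM2r => //.
    have kb0 : 0 < k `^ b by exact: powR_gt0.
    rewrite ler_pdivrMr // -powRM ?(ltW k0) //.
    have r0 : 0 <= 1 - normc w ^+ 2 by rewrite subr_ge0 expr_le1 ?normc_ge0 // ltW.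
    apply: ge0_ler_powR; rewrite ?nnegrE ?mulr_ge0 ?(ltW k0) //.
    have := normc_ge0 w; have := ltW w1; rewrite -/(normc w) => w1' w0'; nra.
  have cu0 : 0 <= normc (cutoff 1 b w) by exact: normc_ge0.
  have h3 : (b + 1) * normc (Lkernel b z w) <= 2 * ((k `^ (b + 1))^-1 + 1).
    have := mulr_ge0 b10 L0; set y := (b + 1) * _ => y0.
    have : y * normc w <= (k `^ (b + 1))^-1 + 1 by rewrite /y mulrAC.
    have : y * 2^-1 <= y * normc w by rewrite ler_wpM2l // ltW.
    lra.
  rewrite mulrCA; apply: (le_trans (ler_wpM2l cu0 h3)).
  have c4' : 0 <= (b + 1) * (2 * 2 `^ (b + 2)) by rewrite mulr_ge0 // mulr_ge0.
  rewrite /c1 /c2; lra.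
have mB : measurable_fun disc (fun w => (normc (1 - z * w^*%C))^-1%:E).
  apply/measurable_EFinP; apply: measurable_funTS; apply: measurable_funV_ge0 => [w|]; first exact: normc_ge0.
  apply: measurable_normc; apply: measurable_funBC; first exact: measurable_cst.
  by apply: measurable_funMC; [exact: measurable_cst|apply: measurable_funJ; exact: measurable_id].
have ci : cintegrable area disc (fun w => (b + 1)%:C%C * (\1_(cell_ Q) w)%:C%C * cutoff 1 b w * Lkernel b z w).
  apply: (@cintegrable_bounded _ _ _ (c1 + c2 * (1 - normc z)^-1)) => //; first exact: disc_lty.
  move=> w w1; apply: (le_trans (bd w w1)); rewrite lerD2l; apply: ler_wpM2l => //.
  by rewrite lef_pV2 ?posrE ?(kernel_gt0 z1 w1) //; exact: normc_ker_ge.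
rewrite -lee_fin; apply: (le_trans (cintegral_le mD ci)).
rewrite [X in (_ <= X)%E]EFinM; apply: lee_wpmul2l => //.
apply: (@le_trans _ _ (\int[area]_(w in disc) (cst c1%:E w + c2%:E * (normc (1 - z * w^*%C))^-1%:E))%E).
  apply: ge0_le_integral => //.
  - by move=> w _; rewrite lee_fin normc_ge0.
  - by apply/measurable_EFinP; apply: measurable_normc.
  - by apply: emeasurable_funD; [exact: measurable_cst|exact: measurable_funeM].
have i0 w : (0 <= (normc (1 - z * w^*%C))^-1%:E)%E by rewrite lee_fin invr_ge0 normc_ge0.
rewrite ge0_integralD //; last 2 first.
- by move=> w _; apply: mule_ge0; [rewrite lee_fin|exact: i0].
- exact: measurable_funeM.
rewrite ge0_integralZl // [X in (_ <= X)%E]EFinD; apply: leeD.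
  rewrite integral_cst // [X in (_ <= X)%E]EFinM; apply: lee_wpmul2l; rewrite ?lee_fin //.
  exact: area_disc_le2.
rewrite [X in (_ <= X)%E]EFinM; apply: lee_wpmul2l; rewrite ?lee_fin //.
exact: integral_inv_kernel_le.
Qed.

End packet_bound.

Section capacities.
Variable R : realType.
Local Notation C := R[i].
Local Notation Re := complex.Re.
Local Notation area := (@area R).
Local Notation disc := (@disc R).
Variables (K : R -> R) (CK : R) (p : nat) (phi : nat -> R) (b : R).
Hypothesis KP : admissible K CK p phi.
Hypothesis b2 : 2 <= b.
Hypothesis pb : p%:R <= b.

Let mD := @measurable_disc R.

Lemma cell_mass_le N I (Q : cell_index N) : cell_mass K I Q <= K 1 * 2.
Proof.
have /andP[l0 _] := arc_len_bounds I; have mB := measurable_box I.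
have K1 : 0 <= K 1 by exact: (adm_ge0 KP).
rewrite -lee_fin (cell_massE KP).
apply: (@le_trans _ _ (\int[area]_(w in carleson_box I) cst (K 1)%:E w)%E); last first.
  rewrite integral_cst // EFinM; apply: lee_wpmul2l; rewrite ?lee_fin //.
  apply: le_trans (area_disc_le2 R); apply: le_measure; rewrite ?inE //; exact: box_disc.
apply: ge0_le_integral => //.
- by move=> w _; rewrite lee_fin mulr_ge0 // (wt_ge0 KP).
- apply/measurable_EFinP; apply: measurable_funM; last exact: measurable_funTS (measurable_wt KP l0).
  by apply: measurable_indic; exact: measurable_cell_.
- move=> w wB; rewrite lee_fin; apply: le_trans (box_wt_le KP wB).
  by rewrite ler_piMl ?(wt_ge0 KP) // indicE; case: (_ \in _).
Qed.

(** A ball inside the cell, shrunk to keep away from the circle, sees a weight bounded below. This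
    positivity is the slack that [separation] consumes. *)
Lemma cell_mass_full_gt0 N (Q : cell_index N) : 0 < cell_mass K (full_arc R) Q.
Proof.
have [c [r [r0 sub]]] := cell_ball R Q.
have c1 : disc c by apply: (@cell_sub_disc R N Q); apply: sub; rewrite /cball /mkset subrr normc0.
pose d := (1 - normc c) / 2; have d0 : 0 < d by rewrite divr_gt0 // subr_gt0.
pose s := Num.min r d; have s0 : 0 < s by rewrite lt_min r0.
pose B := cball c s `\` [set 0].
have mb := @measurable_cball R c s.
have mB : measurable B by apply: measurableD => //; exact: measurable_set1C.
have aB : (0 < area B)%E.
  apply: (lt_le_trans (area_cball_gt0 c s0)); rewrite -[X in (_ <= X)%E]adde0 -(@area_set1 R 0).
  apply: (@le_trans _ _ (area (B `|` [set 0]))).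
    apply: le_measure; rewrite ?inE //; first by apply: measurableU => //; exact: measurable_set1C.
    by move=> w wc; have [->|/eqP w0] := eqVneq w 0; [right|left].
  by apply: measureU2 => //; exact: measurable_set1C.
have Kd := adm_gt0 KP d0.
rewrite -lte_fin (cell_massE KP) full_box /=.
have mw := measurable_wt KP ltr01.
have mi : measurable_fun disc (fun w => (\1_(cell_ Q) w * wt K 1 w)%:E).
  apply/measurable_EFinP; apply: measurable_funM; last exact: measurable_funTS mw.
  by apply: measurable_indic; exact: measurable_cell_.
have p0 w : (0 <= (\1_(cell_ Q) w * wt K 1 w)%:E)%E by rewrite lee_fin mulr_ge0 // (wt_ge0 KP).
have wB w : B w -> cell_ Q w /\ d <= 1 - normc w.
  move=> [wc /eqP w0]; split.
    by apply/(cellE Q w0); apply: sub; apply: lt_le_trans wc _; rewrite ge_min lexx.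
  have : normc (w - c) < d by apply: lt_le_trans wc _; rewrite ge_min lexx orbT.
  have := normc_sub_ge w c; rewrite /d; lra.
have Bd : B `<=` disc by move=> w /wB[_ h]; rewrite /Defs.disc /mkset; lra.
apply: (@lt_le_trans _ _ (\int[area]_(w in B) cst (K d)%:E w)%E).
  by rewrite integral_cst //; apply: mule_gt0; rewrite ?lte_fin.
apply: (@le_trans _ _ (\int[area]_(w in B) (\1_(cell_ Q) w * wt K 1 w)%:E)%E).
  apply: ge0_le_integral => //; first by move=> w _; rewrite lee_fin ltW.
    exact: measurable_funS mi.
  move=> w wB1; have [h1 h2] := wB w wB1; rewrite lee_fin indicE mem_set // mul1r /wt divr1 defectE; last exact: Bd.
  by apply: (adm_mono KP) => //; exact: ltW.
by apply: ge0_subset_integral.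
Qed.

Lemma psdmx_ip n (M : 'M[C]_n) (v : 'cV[C]_n) : psdmx M -> 0 <= ip M (rank1 v).
Proof.
move=> [_ /(_ v)]; rewrite lecE => /andP[_]; rewrite /= (_ : complex.Re _ = ip M (rank1 v)) //.
rewrite mxE Re_sum /ip exchange_big; apply: eq_bigr => j _.
rewrite mxE mulr_suml Re_sum; apply: eq_bigr => i _.
by rewrite !mxE conjM conjK; congr Re; ring.
Qed.

(** Nonnegativity in the order of [R[i]] includes being real; this is where hermiticity enters. *)
Lemma ip_psdmx n (M : 'M[C]_n) : herm M -> (forall v, 0 <= ip M (rank1 v)) -> psdmx M.
Proof.
move=> hM H; split; first exact: herm_hermsymmx.
move=> v; set X := (_ *m _ *m _) 0 0.
have XE : X = \sum_i \sum_j (v i 0)^*%C * M i j * v j 0.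
  rewrite /X mxE exchange_big; apply: eq_bigr => j _; rewrite mxE mulr_suml; apply: eq_bigr => i _.
  by rewrite !mxE.
have XJ : X^*%C = X.
  rewrite XE conjc_sum exchange_big; apply: eq_bigr => i _; rewrite conjc_sum; apply: eq_bigr => j _.
  by rewrite !conjM conjK -hM; ring.
have ReX : Re X = ip M (rank1 v).
  rewrite XE Re_sum /ip; apply: eq_bigr => i _; rewrite Re_sum; apply: eq_bigr => j _.
  by rewrite mxE conjM conjK; congr Re; ring.
have := H v; rewrite -ReX; move: XJ; case: (X) => x y [] /= yE x0; rewrite lecE /= x0 andbT.
by apply/eqP; lra.
Qed.

Lemma diag_matrix_amx N (l : seq (R * Defs.arc R)) :
  \sum_(k <- l) (k.1%:C)%C *: diag_matrix K k.2 N = amx (fun I i => cell_mass K I (enum_val i)) l.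
Proof.
elim: l => [|k l IH].
  by rewrite big_nil; apply/matrixP => i j; rewrite !mxE /aw big_nil; case: (_ == _); rewrite ?mulr0n ?mulr1n.
rewrite big_cons IH; apply/matrixP => i j; rewrite !mxE aw_cons.
by case: (_ == _); rewrite ?mulr0n ?mulr0 ?addr0 // !mulr1n; apply: complexP; rewrite /=; ring.
Qed.

Lemma normc_sum (I : Type) (r : seq I) (f : I -> C) : normc (\sum_(i <- r) f i) <= \sum_(i <- r) normc (f i).
Proof.
elim: r => [|i r IH]; first by rewrite !big_nil normc0.
by rewrite !big_cons; apply: (le_trans (normcD _ _)); rewrite lerD2l.
Qed.

Lemma bounded_cintegrable (m : {measure set C -> \bar R}) (h : C -> C) (M : R) : (m disc < +oo)%E ->
  measurable_fun disc h -> (forall z, disc z -> normc (h z) <= M) -> cintegrable m disc h.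
Proof.
move=> mfin mh hM; apply: (@cintegrableW _ _ _ _ _ _ (fun=> M)) => //.
apply/integrableP; split; first exact: measurable_cst.
rewrite (_ : (fun x => _) = cst `|M%:E|%E) // integral_cst //.
by rewrite lte_mul_pinfty // ?abse_ge0 // abse_fin_num.
Qed.

Section measure.
Variables (g : C -> C) (a : C).
Hypothesis gQ : in_QK K g.
Hypothesis a1 : disc a.
Variable N : nat.

Let T := cell_index N.

Let mu_measure : exists2 m : {measure set C -> \bar R}, mu_QK K g a = m & (m disc < +oo)%E.
Proof.
have ga := gQ.1; have mq := measurable_QK_density KP ga a1.
have q0 z : disc z -> 0 <= QK_density K g a z := @QK_density_ge0 R K CK p phi KP g a z a1.
have [m dm] := density_measure mq q0; exists m; first exact: dm.
have [s s0 [Es _]] := in_QK_norm gQ.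
rewrite -dm /density setIid; apply: le_lt_trans (ltry (s ^+ 2)).
apply: QK_seminorm_ge => //; last by rewrite Es.
by move=> a' z a1'; exact: (@QK_density_ge0 R K CK p phi KP g a' z a1').
Qed.

(** One packet is a packet sum with Kronecker coefficients, hence analytic on the disc. *)
Let mpk (Q : T) : measurable_fun disc (packet b Q).
Proof.
pose c (Q' : T) : C := (Q' == Q)%:R.
have H := analytic_measurable (@packet_sum_analytic R b b2 N c).
apply: eq_measurable_fun H => z; rewrite inE => z1.
rewrite -(sum_packet b2) // (bigD1 Q) //= /c eqxx mul1r big1 ?addr0 // => Q' /negbTE ->.
by rewrite mul0r.
Qed.

(** Expanding the square and integrating term by term is legitimate because packets are bounded and
    the measure is finite. The coefficients come out conjugated, since [psdmx] conjugates the left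
    vector. *)
Lemma packet_form (v : 'cV[C]_#|T|) :
  (ip (packet_matrix b (mu_QK K g a) N) (rank1 v))%:E =
  (\int[mu_QK K g a]_(z in disc) (normc (\sum_i (v i 0)^*%C * packet b (enum_val i) z) ^+ 2)%:E)%E.
Proof.
have [m mE mfin] := mu_measure; rewrite mE.
have [B B0 HB] := packet_bounded b2.
have bdi (h : C -> C) (M : R) := @bounded_cintegrable m h M mfin.
have iP (i j : 'I_#|T|) : cintegrable m disc (fun z => packet b (enum_val i) z * (packet b (enum_val j) z)^*%C).
  apply: (bdi _ (B * B)).
    by apply: measurable_funMC; [exact: mpk|apply: measurable_funJ; exact: mpk].
  by move=> z z1; rewrite normcM normcJ; apply: ler_pM; rewrite ?normc_ge0 ?HB.
pose S z := \sum_i (v i 0)^*%C * packet b (enum_val i) z.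
have mS : measurable_fun disc S.
  by apply: measurable_sumC => i; apply: measurable_funMC; [exact: measurable_cst|exact: mpk].
have ES : ip (packet_matrix b m N) (rank1 v) = Re (cintegral m disc (fun z => (normc (S z) ^+ 2)%:C%C)).
  transitivity (Re (\sum_i \sum_j cintegral m disc (fun z =>
     (v i 0)^*%C * v j 0 * (packet b (enum_val i) z * (packet b (enum_val j) z)^*%C)))).
    rewrite Re_sum /ip; apply: eq_bigr => i _; rewrite Re_sum; apply: eq_bigr => j _.
    by rewrite cintegralZ // !mxE conjM conjK; congr Re; rewrite mulrC.
  rewrite (eq_bigr (fun i => cintegral m disc (fun z => \sum_j
     (v i 0)^*%C * v j 0 * (packet b (enum_val i) z * (packet b (enum_val j) z)^*%C)))); last first.
    by move=> i _; rewrite cintegral_sum // => j; exact: cintegrableZ.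
  rewrite -cintegral_sum //; last first.
    by move=> i; apply: cintegrable_sum => // j; exact: cintegrableZ.
  congr Re; apply: eq_cintegral => z _; rewrite sqr_normcE /S conjc_sum mulr_suml; apply: eq_bigr => i _.
  by rewrite mulr_sumr; apply: eq_bigr => j _; rewrite conjM conjK; ring.
pose W := \sum_i normc (v i 0) * B.
have W0 : 0 <= W by apply: sumr_ge0 => i _; rewrite mulr_ge0 ?normc_ge0.
have SW z : disc z -> normc (S z) <= W.
  move=> z1; apply: (le_trans (normc_sum _ _)); apply: ler_sum => i _.
  by rewrite normcM normcJ; apply: ler_wpM2l; rewrite ?normc_ge0 ?HB.
have mS2 : measurable_fun disc (fun z => normc (S z) ^+ 2).
  by apply: measurable_funX; exact: measurable_normc.
have cS : cintegrable m disc (fun z => (normc (S z) ^+ 2)%:C%C).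
  apply: (bdi _ (W ^+ 2)); first exact: measurable_funR.
  move=> z z1; rewrite normcR ger0_norm ?sqr_ge0 //.
  by rewrite ler_pXn2r // ?nnegrE ?normc_ge0 ?SW.
have [i1 _] := cS; have fn := integral_fune_fin_num mD i1.
by rewrite ES; exact: fineK fn.
Qed.

Lemma packet_form_ge0 (v : 'cV[C]_#|T|) : 0 <= ip (packet_matrix b (mu_QK K g a) N) (rank1 v).
Proof.
rewrite -lee_fin packet_form; have [m -> _] := mu_measure.
by apply: integral_ge0 => z _; rewrite lee_fin sqr_ge0.
Qed.

Lemma packet_matrix_herm : herm (packet_matrix b (mu_QK K g a) N).
Proof.
have [m mE mfin] := mu_measure; rewrite mE.
have [B B0 HB] := packet_bounded b2.
move=> i j; rewrite !mxE -cintegralJ //.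
  by apply: eq_cintegral => z _; rewrite conjM conjK mulrC.
apply: (bounded_cintegrable mfin (M := B * B)).
  by apply: measurable_funMC; [exact: mpk|apply: measurable_funJ; exact: mpk].
by move=> z z1; rewrite normcM normcJ; apply: ler_pM; rewrite ?normc_ge0 ?HB.
Qed.

End measure.

Lemma sum_enum_val (V : nmodType) (T : finType) (f : T -> V) :
  \sum_(i < #|T|) f (enum_val i) = \sum_Q f Q.
Proof. rewrite [RHS](reindex (fun i : 'I_#|T| => enum_val i)) //; apply: onW_bij.
by exists enum_rank; [exact: enum_valK|exact: enum_rankK]. Qed.

End capacities.

Section capacities.
Variable R : realType.
Local Notation C := R[i].
Local Notation Re := complex.Re.
Local Notation area := (@area R).
Local Notation disc := (@disc R).
Variables (K : R -> R) (CK : R) (p : nat) (phi : nat -> R) (b : R).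
Hypothesis KP : admissible K CK p phi.
Hypothesis b2 : 2 <= b.
Hypothesis pb : p%:R <= b.

Let mD := @measurable_disc R.

(** A majorant of [Gamma] is tested on the conjugate of [c], where each diagonal form is at most 1.
    The infimum may not be attained, hence the margin [e]. *)
Lemma D_capacity_C g a (D : R) : in_QK K g -> disc a ->
  (D_capacity K b (mu_QK K g a) <= D%:E)%E -> (C_capacity K b (mu_QK K g a) <= D%:E)%E.
Proof.
move=> gQ a1 H; apply/(C_capacity_le b KP) => N c hc; apply/lee_addgt0Pr => e e0.
have hN := le_trans (ereal_sup_ubound (ex_intro2 _ _ N I erefl)) H.
have /(le_lt_trans hN) : (D%:E < (D + e)%:E)%E by rewrite lte_fin ltrDl.
move=> /ereal_inf_lt[_ [M [la [J [-> la0 ll]]]]]; rewrite lte_fin => xl.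
pose v : 'cV[C]_#|cell_index N| := \col_i (c (enum_val i))^*%C.
have ES : (fun z => (normc (\sum_Q c Q * packet b Q z) ^+ 2)%:E) =
    (fun z => (normc (\sum_i (v i 0)^*%C * packet b (enum_val i) z) ^+ 2)%:E).
  apply/funext => z; rewrite -(sum_enum_val (fun Q => c Q * packet b Q z)).
  by congr ((normc _ ^+ 2)%:E); apply: eq_bigr => i _; rewrite mxE conjK.
rewrite ES -(packet_form KP b2 gQ a1) -EFinD lee_fin.
pose l := [seq (la m, J m) | m <- index_enum 'I_M].
have EM : \sum_m ((la m)%:C)%C *: diag_matrix K (J m) N = amx (fun I i => cell_mass K I (enum_val i)) l.
  by rewrite -diag_matrix_amx big_map.
have := psdmx_ip v ll; rewrite EM ipB subr_ge0 => h; apply: (le_trans h).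
apply: le_trans (ltW xl); rewrite ip_amx_rank1.
apply: (@le_trans _ _ (\sum_m la m * (\sum_Q normc (c Q) ^+ 2 * cell_mass K (J m) Q))); last first.
  by apply: ler_sum => m _; rewrite ler_piMr.
rewrite le_eqVlt; apply/orP; left; apply/eqP.
under eq_bigr do rewrite /aw big_map mulr_suml.
rewrite exchange_big; apply: eq_bigr => m _.
rewrite -(sum_enum_val (fun Q => normc (c Q) ^+ 2 * cell_mass K (J m) Q)) mulr_sumr.
by apply: eq_bigr => i _; rewrite mxE normcJ /=; ring.
Qed.

Lemma rank1_parallelogram n (x y : 'cV[C]_n) :
  rank1 (x + y) + rank1 (x - y) = 2%:C%C *: rank1 x + 2%:C%C *: rank1 y.
Proof.
apply/matrixP => i j; rewrite !mxE.
by case: (x i 0) (y i 0) (x j 0) (y j 0) => [? ?] [? ?] [? ?] [? ?]; apply: complexP; rewrite /=; ring.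
Qed.

Lemma psum_delta n : psum [seq delta_mx i 0 | i <- index_enum 'I_n] = 1%:M :> 'M[C]_n.
Proof.
rewrite /psum big_map; apply/matrixP => j k; rewrite summxE (bigD1 j) //= big1 => [|i ij]; rewrite !mxE.
  rewrite !eqxx /= andbT mul1r addr0 eq_sym; case: (_ == _); rewrite ?conjc0 //.
  by apply: complexP; rewrite /= ?oppr0.
by rewrite eq_sym (negbTE ij) mul0r.
Qed.

(** The factor 48 comes from [little_grothendieck], and the 1 is the margin given to
    [separation]. *)
Lemma C_capacity_D g a (B : R) : in_QK K g -> disc a -> 0 <= B ->
  (C_capacity K b (mu_QK K g a) <= B%:E)%E -> (D_capacity K b (mu_QK K g a) <= (48 * B + 1)%:E)%E.
Proof.
move=> gQ a1 B0 /(C_capacity_le b KP) H; apply: ge_ereal_sup => _ [N _ <-].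
set G := packet_matrix b (mu_QK K g a) N.
pose mm (I : Defs.arc R) (i : 'I_#|cell_index N|) : R := cell_mass K I (enum_val i).
have q0 (v : 'cV[C]_#|cell_index N|) : 0 <= ip G (rank1 v) by exact: (packet_form_ge0 KP b2 gQ a1).
have mm0 I i : 0 <= mm I i by exact: (cell_mass_ge0 KP).
have mf Q := cell_mass_full_gt0 KP Q.
(* [(1 + s0)^-1] is a positive lower bound for the finitely many cell masses in the full box. *)
pose s0 := \sum_Q (cell_mass K (full_arc R) (Q : cell_index N))^-1.
have s00 : 0 <= s0 by apply: sumr_ge0 => Q _; rewrite invr_ge0 ltW.
have mu00 : 0 < (1 + s0)^-1 by rewrite invr_gt0 ltr_pwDl.
have mge i : (1 + s0)^-1 <= mm (full_arc R) i.
  rewrite -[X in _ <= X]invrK lef_pV2 ?posrE ?invr_gt0 ?ltr_pwDl //; last exact: mf.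
  rewrite /s0 (bigD1 (enum_val i)) //= addrCA lerDl addr_ge0 // sumr_ge0 // => Q _.
  by rewrite invr_ge0 ltW.
have D0 : 0 <= 48 * B by rewrite mulr_ge0.
have tr0 : 0 <= ip G 1%:M by rewrite -psum_delta ip_psum; apply: sumr_ge0 => v _; exact: q0.
(* Exceeds the Frobenius norm of [G], which provides the crude bound [q_le] of the Grothendieck
   argument. *)
pose e := Num.sqrt (ip G G + 1).
have e20 : 0 < ip G G + 1 by rewrite ltr_wpDl ?ip_ge0.
have e0 : 0 < e by rewrite sqrtr_gt0.
have Gl (s : seq 'cV[C]_#|cell_index N|) : (forall j, \sum_i (\sum_(v <- s) normc (v i 0) ^+ 2) * mm j i <= 1) ->
    \sum_(v <- s) ip G (rank1 v) <= 48 * B.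
  move=> hs; apply: (@little_grothendieck R _ (fun v => ip G (rank1 v)) _ mm B e) => //.
  - by move=> x y; rewrite -ipDr rank1_parallelogram ipDr !ipZr.
  - by move=> k x; rewrite rank1Z ipZr.
  - move=> x; have := @ip_rank1_ge _ _ (- G) x e e0; rewrite ipN (ipC G) ipN opprK ipN lerN2; apply.
    by rewrite sqr_sqrtr ?(ltW e20) // lerDl.
  - exact: ltW.
  - move=> x hx; rewrite -lee_fin (packet_form KP b2 gQ a1).
    pose c Q := (x (enum_rank Q) 0)^*%C.
    have ES : (fun z => (normc (\sum_i (x i 0)^*%C * packet b (enum_val i) z) ^+ 2)%:E) =
        (fun z => (normc (\sum_Q c Q * packet b Q z) ^+ 2)%:E).
      apply/funext => z; rewrite -(sum_enum_val (fun Q => c Q * packet b Q z)).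
      by congr ((normc _ ^+ 2)%:E); apply: eq_bigr => i _; rewrite /c enum_valK.
    rewrite ES; apply: H => I; apply: le_trans (hx I).
    rewrite -(sum_enum_val (fun Q => normc (c Q) ^+ 2 * cell_mass K I Q)).
    by apply: ler_sum => i _; rewrite /c enum_valK normcJ.
have Gh := @packet_matrix_herm R K CK p phi b KP b2 g a gQ a1 N.
have [l [l0 [ls lp]]] := @separation R _ G _ mm (full_arc R) _ (K 1 * 2) _ Gh mm0
  (fun I i => cell_mass_le KP I (enum_val i)) mu00 mge D0 tr0 Gl 1 ltr01.
apply: (@le_trans _ _ (\sum_(k <- l) k.1)%:E); last by rewrite lee_fin.
apply: ereal_inf_lbound.
exists (size l), (fun m => (tnth (in_tuple l) m).1), (fun m => (tnth (in_tuple l) m).2); split.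
- by rewrite big_tnth.
- by move=> m; have /all_tnthP := (l0 : all _ (in_tuple l)); exact.
- rewrite (_ : \sum_m _ = amx mm l); last by rewrite -diag_matrix_amx [RHS]big_tnth.
  by apply: ip_psdmx lp; apply: hermD; [exact: herm_amx|exact: hermN].
Qed.

End capacities.

Theorem theorem7p3 (R : realType) (K : R -> R) (hK : weightWQ K) :
  exists b0 : R, forall (b : R) (hb : b0 <= b) (g : R[i] -> R[i])
      (hg : analytic g),
    (bounded_multiplier K g <->
      [/\ in_Hinfty g, in_QK K g &
          (ereal_sup [set D_capacity K b (mu_QK K g a) | a in disc (R:=R)]
             < +oo)%E]) /\
    (bounded_multiplier K g <->
      [/\ in_Hinfty g, in_QK K g &
          (ereal_sup [set C_capacity K b (mu_QK K g a) | a in disc (R:=R)]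
             < +oo)%E]).
Proof.
have [CK [p [phi [p2 KP]]]] := weight_admissible hK.
(* [p > 2], so [b >= p] also yields [2 <= b]. *)
exists p%:R => b pb g hg.
have b2 : 2 <= b by apply: le_trans pb; rewrite ler_nat ltnW.
have [[H1 H2] H3] := (@multiplier_in_QK R K g, @multiplier_Hinfty R K CK p phi b KP b2 pb g,
  @multiplier_capacity R K CK p phi b KP b2 pb g).
have sup_lt (F : R[i] -> \bar R) (B : R) : (forall a, disc a -> (F a <= B%:E)%E) ->
    (ereal_sup [set F a | a in disc (R:=R)] < +oo)%E.
  by move=> FB; apply: le_lt_trans (ltry B); apply: ge_ereal_sup => _ [a a1 <-]; exact: FB.
(* Both converses at once: any quantity that bounds [C] from above may play the role of [F], in
   particular [D] and [C]. *)
have back (F : R[i] -> \bar R) : (forall a (B : R), disc a -> in_QK K g -> (F a <= B%:E)%E ->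
      (C_capacity K b (mu_QK K g a) <= B%:E)%E) ->
    in_Hinfty g -> in_QK K g -> (ereal_sup [set F a | a in disc (R:=R)] < +oo)%E -> bounded_multiplier K g.
  move=> FC [_ [G hG]] gQ /lt_pinfty_bound[B B0 HB].
  apply: (capacity_multiplier KP b2 pb gQ hG B0) => a a1; apply: FC => //.
  by apply: le_trans HB; apply: ereal_sup_ubound; exists a.
split; split.
- move=> gm; have gQ := H1 gm; split => //; first exact: H2.
  have [B HB] := H3 gm; apply: (@sup_lt _ (48 * Num.max B 0 + 1)) => a a1.
  apply: (C_capacity_D KP b2 gQ a1); first by rewrite le_max lexx orbT.
  by apply: le_trans (HB a a1) _; rewrite lee_fin le_max lexx.
- by move=> [gi gQ]; apply: back gi gQ => a B a1 gQ; exact: (D_capacity_C KP b2 gQ a1).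
- move=> gm; split; [exact: H2|exact: H1|].
  by have [B HB] := H3 gm; exact: sup_lt HB.
- by move=> [gi gQ]; apply: back gi gQ.
Qed.
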